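(* For any $A,B\in\mathcal{PO}$ there is a $d_R$-geodesic in $\mathcal{PO}$ from $A$ to $B$.
   Context: Setting. $G=G_1*\dots*G_p*F_k$, where $(G_i)_{i=1}^p$ is a finite family of groups and $F_k$ is the free group of rank $0\le k<\infty$. A simplicial metric tree is a simplicial tree (not necessarily locally compact) with a complete path metric such that edges are isometric to closed intervals of $\mathbb R$; all branch points are vertices. A $G$-tree is a simplicial metric tree on which $G$ acts simplicially by isometries. A vertex $v$ is redundant if it has degree two and every $g\in G$ fixing $v$ also fixes the edges adjacent to $v$. $\mathcal O=\mathcal O(G,(G_i)_{i=1}^p,F_k)$ is the set of $G$-trees $T$, up to $G$-equivariant isometry, such that: (C0) $T$ has no redundant vertices; (C1) the action is minimal (no proper invariant subtree), with trivial edge stabilizers; (C2) for each $i=1,\dots,p$ there is exactly one orbit of vertices with stabilizer conjugate to $G_i$; (C3) all other vertices have trivial stabilizer. $l_T(g)=\inf_{x\in T}d_T(x,gx)$; $g$ is hyperbolic if it fixes no point of $T$ (independent of $T\in\mathcal O$), and $\operatorname{Hyp}(\mathcal O)$ is the set of hyperbolic elements. $\mathcal O$ carries the topology induced by $T\mapsto (l_T(g))_{g\in G}\in\mathbb R^G$. $\mathcal{PO}$ is the quotient of $\mathcal O$ by rescaling the metric by positive numbers, identified with the subset of $\mathcal O$ of $G$-trees of co-volume one (the sum of the lengths of the edges of $G\backslash T$ equals $1$). For $A,B\in\mathcal O$, $\Lambda_R(A,B)=\sup_{g\in\operatorname{Hyp}(\mathcal O)}\frac{l_B(g)}{l_A(g)}$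 and $d_R(A,B)=\log\Lambda_R(A,B)$; restricted to co-volume one trees, $d_R$ is an asymmetric distance. A $d_R$-geodesic is meant as an unparametrized oriented geodesic: a continuous path $\gamma:[0,1]\to\mathcal{PO}$ such that $d_R(\gamma(r),\gamma(t))=d_R(\gamma(r),\gamma(s))+d_R(\gamma(s),\gamma(t))$ for all $r\le s\le t$.
   Formalization: The groups G_i are assumed nontrivial; with a trivial factor (C2) allows exactly one orbit of vertices with trivial stabilizer and the claim fails, e.g. for G={1}*F_2 the space PO consists of roses only and is disconnected. *)

(* Defs.v *)
From HB Require Import structures.
From mathcomp Require Import all_boot all_order all_algebra.
From mathcomp Require Import all_classical all_reals all_analysis.

Set Implicit Arguments.
Unset Strict Implicit.
Unset Printing Implicit Defensive.

Import Order.TTheory GRing.Theory Num.Theory.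
Import numFieldNormedType.Exports.
Local Open Scope classical_set_scope.
Local Open Scope ring_scope.

(* G is the free product of the images of the G_i and of the free group on the
   x_j, by the universal property. *)
Definition is_free_product (p k : nat) (Gi : 'I_p -> groupType) (G : groupType)
    (iota : forall i, {multiplicative Gi i -> G}) (x : 'I_k -> G) : Prop :=
  forall (H : groupType) (f : forall i, {multiplicative Gi i -> H})
    (y : 'I_k -> H),
  (exists phi : {multiplicative G -> H},
     (forall i a, phi (iota i a) = f i a) /\ (forall j, phi (x j) = y j)) /\
  (forall phi psi : {multiplicative G -> H},
     (forall i a, phi (iota i a) = psi (iota i a)) ->
     (forall j, phi (x j) = psi (x j)) -> phi =1 psi).

Section SimplicialMetricTree.
Variables (R : realType) (X : metricType R).
Variables (V : set X) (E : set (set X)).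

(* An edge contains its endpoints, and its endpoints are its only vertices. *)
Definition is_metric_edge (e : set X) : Prop :=
  exists (l : R) (sigma : R -> X),
    [/\ 0 < l, e = sigma @` `[0, l],
        (forall s t, 0 <= s <= l -> 0 <= t <= l ->
           mdist (sigma s) (sigma t) = `|s - t|) &
        e `&` V = [set sigma 0; sigma l]].

Definition adjacent : rel X :=
  fun u v => `[< u <> v /\ exists2 e, E e & e `&` V = [set u; v] >].

Definition on_common_edge : rel X :=
  fun a b => `[< exists2 e, E e & e a /\ e b >].

(* Lengths of the piecewise linear paths from a to b: consecutive points of
   a :: s lie on a common edge. *)
Definition string_lengths (a b : X) : set R :=
  [set l | exists s : seq X,
     [/\ path on_common_edge a s, last a s = b &
         l = \sum_(d <- pairmap (@mdist R X) a s) d]].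

Definition is_simplicial_tree : Prop :=
  [/\ V !=set0,
      (forall e e', E e -> E e' -> e `&` V = e' `&` V -> e = e'),
      (forall e e', E e -> E e' -> e <> e' -> e `&` e' `<=` V),
      (forall a, V a \/ exists2 e, E e & e a) &
      (forall u v, V u -> V v -> exists! s : seq X,
         [/\ path adjacent u s, last u s = v & uniq (u :: s)])].

Definition is_complete_path_metric : Prop :=
  (forall a b : X, mdist a b = inf (string_lengths a b)) /\
  (forall F : set_system X, ProperFilter F -> cauchy F -> exists a : X, F --> a).

End SimplicialMetricTree.

Record simplicial_metric_tree (R : realType) := SimplicialMetricTree {
  point :> metricType R ;
  vertices : set point ;
  edges : set (set point) ;
  smt_edges : forall e, edges e -> is_metric_edge vertices e ;
  smt_tree : is_simplicial_tree vertices edges ;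
  smt_metric : is_complete_path_metric edges
}.

Record gtree (R : realType) (G : groupType) := GTree {
  tree :> simplicial_metric_tree R ;
  act : G -> tree -> tree ;
  act1 : forall x, act 1%g x = x ;
  actM : forall g h x, act (g * h)%g x = act g (act h x) ;
  act_isometry : forall g x y, mdist (act g x) (act g y) = mdist x y ;
  act_vertices : forall g v, vertices v -> vertices (act g v) ;
  act_edges : forall g e, edges e -> edges (act g @` e)
}.

Section GTreeNotions.
Variables (R : realType) (G : groupType) (T : gtree R G).

Definition stab (v : T) : set G := [set g | act g v = v].

Definition degree_two (v : T) : Prop :=
  exists e e', e <> e' /\ [set a | edges a /\ a v] = [set e; e'].

Definition redundant (v : T) : Prop :=
  [/\ vertices v, degree_two v &
      forall g, stab v g -> forall e, edges e -> e v -> act g @` e = e].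

(* In a tree, the subtrees are the nonempty connected subsets. *)
Definition minimal : Prop :=
  forall S : set T, S !=set0 -> connected S ->
    (forall g x, S x -> S (act g x)) -> S = setT.

Definition trivial_edge_stabilizers : Prop :=
  forall e, @edges R T e -> forall g : G, act g @` e = e -> g = 1%g.

Definition translation_length (g : G) : R :=
  inf [set mdist x (act g x) | x in [set: T]].

Definition fixes_no_point (g : G) : Prop := forall x : T, act g x <> x.

Definition edge_length (e : set T) : R :=
  sup [set mdist z.1 z.2 | z in e `*` e].

Definition edge_orbits : set (set (set T)) :=
  [set [set act g @` e | g in [set: G]] | e in @edges R T].

(* All the edges in an orbit have the same length, so the sup below is that
   length. *)
Definition covolume : \bar R :=
  \esum_(o in edge_orbits) (sup (edge_length @` o))%:E.

End GTreeNotions.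

Section OuterSpace.
Variables (R : realType) (p : nat) (Gi : 'I_p -> groupType) (G : groupType).
Variable iota : forall i, {multiplicative Gi i -> G}.

Definition conjugate_to_factor (i : 'I_p) (S : set G) : Prop :=
  exists h : G, S = [set (iota i a ^ h)%g | a in [set: Gi i]].

Definition in_outer (T : gtree R G) : Prop :=
  [/\ forall v : T, ~ redundant v,
      minimal T /\ trivial_edge_stabilizers T,
      forall i, exists v : T,
        [/\ vertices v, conjugate_to_factor i (stab v) &
            forall w : T, vertices w -> conjugate_to_factor i (stab w) ->
              exists g, w = act g v] &
      forall v : T, vertices v ->
        (forall i, ~ conjugate_to_factor i (stab v)) -> stab v = [set 1%g]].

Definition equiv_isometric (A B : gtree R G) : Prop :=
  exists f : A -> B,
    [/\ forall x y, mdist (f x) (f y) = mdist x y,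
        forall y, exists x, f x = y &
        forall g x, f (act g x) = act g (f x)].

(* The points of outer space are classes of trees up to equivariant isometry.
   The universe of G-trees is too large for a choiceType, hence for
   {eq_quot _} and for the topological structures of the library, so classes
   are predicates on G-trees and the representative is picked by cid. *)
Record outer_space := OuterSpace {
  iso_class : gtree R G -> Prop ;
  iso_classP : exists T, in_outer T /\ iso_class = equiv_isometric T
}.

Definition rep (A : outer_space) : gtree R G := projT1 (cid (iso_classP A)).

Definition outer_length (A : outer_space) : {ptws G -> R} :=
  translation_length (rep A).

(* Being hyperbolic does not depend on the tree. *)
Definition Hyp : set G :=
  [set g | forall T : gtree R G, in_outer T -> fixes_no_point T g].

Definition in_projective_outer_space (A : outer_space) : Prop := covolume (rep A) = 1%E.

Definition Lambda_R (A B : outer_space) : \bar R :=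
  ereal_sup [set (outer_length B g / outer_length A g)%:E | g in Hyp].

Definition d_R (A B : outer_space) : \bar R := lne (Lambda_R A B).

(* Continuity for the topology on outer space induced by outer_length: a map
   into an initial topology is continuous iff its composite is. *)
Definition continuous_on_unit_interval (gamma : R -> outer_space) : Prop :=
  {within `[0, 1], continuous (outer_length \o gamma)}.

Definition is_d_R_geodesic (gamma : R -> outer_space) : Prop :=
  [/\ continuous_on_unit_interval gamma,
      (forall t, 0 <= t <= 1 -> in_projective_outer_space (gamma t)) &
      (forall r s t, 0 <= r -> r <= s -> s <= t -> t <= 1 ->
         d_R (gamma r) (gamma t) =
         (d_R (gamma r) (gamma s) + d_R (gamma s) (gamma t))%E)].

End OuterSpace.

Arguments outer_space R {p Gi G} iota.

(* Main.v *)
(* Trees are encoded by their walls: a G-invariant family of nested half-spaces on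
   a G-set W, with weights, is dual to a G-tree whose translation lengths are the asymptotic
   wall-counting distances.

   By a Helly argument there is an equivariant Lambda_R(A,B)-Lipschitz map f : A -> B. After
   subdivision it maps each edge of A to a point or onto an edge of B.  Starting from the tree
   A scaled by Lambda_R(A,B), first shrink the edges until f is an isometry on each of them,
   then fold: pulling half-spaces of B back along f splits each of them into a finite family
   of half-spaces of A, and two opposed members of such a family with nothing between them
   are replaced by their union, until a single half-space is left.  In each step the old and
   new walls together are still nested, so the weights can be interpolated linearly, and all
   translation lengths are non-increasing along the way.  They decrease from
   Lambda_R(A,B) l_A to l_B, and the supremum of the quotient of these two is 1; hence so is
   that of the quotient of any two intermediate ones, and after rescaling to covolume one d_R is
   the difference of the logarithms of the covolumes. *)
Require Import Defs.
From HB Require Import structures.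
From mathcomp Require Import all_boot all_order all_algebra.
From mathcomp Require Import finmap.
From mathcomp Require Import all_classical all_reals all_analysis.
From mathcomp Require Import ring lra zify.
Set Implicit Arguments.
Unset Strict Implicit.
Unset Printing Implicit Defensive.
Import Order.TTheory GRing.Theory Num.Theory.
Import numFieldNormedType.Exports.
Local Open Scope classical_set_scope.
Local Open Scope ring_scope.

(** * Zero-hyperbolic metrics *)

(** Hence a wall system is not realized on its own ground set but on the nontrivial elements of G: a
    wall is recorded only by which elements have their fixed point or attracting end on which side.
    Walls with all elements on one side disappear, parallel walls become one wall with added
    weights, and the dual tree is minimal without redundant vertices; translation lengths are
    unchanged. Conditions (C2) and (C3) are not checked directly along the path: stabilizers are
    determined by the set of elliptic elements, which stays constant because every intermediate
    length function lies between those of B and of A scaled by the stretching factor, and these two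
    vanish on the same elements. Folding terminates because the number of active half-spaces drops
    at each step. Points of the path are controlled through length functions and covolumes only,
    except at its ends, which are set equal to A and B by definition. *)

Section FourPoint.
Variables (R : realType) (X : Type) (D : X -> X -> R).

(** The four-point condition that characterizes subsets of real trees, with the maximum split into a
    disjunction so that linear arithmetic applies. Separation is left out: wall-counting distances
    are only pseudometrics. *)
Record zero_hyperbolic : Prop := ZeroHyperbolic {
  zh0 : forall x, D x x = 0;
  zhC : forall x y, D x y = D y x;
  zh4 : forall x y z t,
    D x y + D z t <= D x z + D y t \/ D x y + D z t <= D x t + D y z }.

Definition btw (x y z : X) : Prop := D x z = D x y + D y z.

Definition geodesic : Prop := forall x y r, 0 <= r <= D x y ->
  exists z, D x z = r /\ D z y = D x y - r.

Hypothesis H : zero_hyperbolic.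

Lemma zh_tri y x z : D x z <= D x y + D y z.
Proof.
have := zh4 H x z y y; rewrite (zh0 H) (zhC H z y).
by case; lra.
Qed.

Lemma zh_ge0 x y : 0 <= D x y.
Proof. by have := zh_tri y x x; rewrite (zh0 H) (zhC H y x); lra. Qed.

Lemma btwC x y z : btw x y z -> btw z y x.
Proof. by rewrite /btw (zhC H z x) (zhC H z y) (zhC H y x); lra. Qed.

(** Two geodesics that overlap in a segment of positive length concatenate to a geodesic. This
    local-to-global principle is specific to trees and underlies the axis arguments below. *)
Lemma btw_chain x y z t : btw x y z -> btw y z t -> 0 < D y z ->
  btw x z t /\ btw x y t.
Proof.
rewrite /btw => h1 h2 h3.
have := zh4 H x z y t; rewrite (zhC H z y) => h4.
have := zh_tri z x t; have := zh_tri y x t.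
by split; case: h4; lra.
Qed.

Lemma btw_seq (c : nat -> X) :
  (forall n, btw (c n) (c n.+1) (c n.+2)) -> (forall n, 0 < D (c n) (c n.+1)) ->
  forall n, btw (c 0%N) (c n) (c n.+1).
Proof.
move=> h1 h2; elim=> [|n ih]; first by rewrite /btw (zh0 H) add0r.
by case: (btw_chain ih (h1 n) (h2 n)).
Qed.

(** The geodesics from [p] to [x] and from [p] to [y] together cover [x,y], so one of them passes
    through [m]. *)
Lemma max_btw x y m p : btw x m y ->
  D m p <= D x p - D x m \/ D m p <= D y p - D m y.
Proof.
rewrite /btw => h; have := zh4 H m p x y.
rewrite (zhC H m x) (zhC H p x) (zhC H p y); case; lra.
Qed.

(** Gromov's inequality: the product of [x] and [z] at [b] is at least the smaller of the other two.
    All products are doubled. *)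
Lemma gp_min b x y z :
  D b x + D b z - D x z >= D b x + D b y - D x y \/
  D b x + D b z - D x z >= D b y + D b z - D y z.
Proof.
by have := zh4 H x z b y; rewrite (zhC H x b) (zhC H z y) (zhC H z b); case; lra.
Qed.

Lemma btw_between x y a b : btw x a y -> btw x b y -> D x a <= D x b -> btw x a b.
Proof.
rewrite /btw => ha hb hab; have := zh4 H x y a b.
have := zh_tri a x b; rewrite (zhC H y b) (zhC H y a).
by move=> ? [|]; lra.
Qed.

Lemma btw_eq x y a b : btw x a y -> btw x b y -> D x a = D x b -> D a b = 0.
Proof.
move=> ha hb e; have : D x a <= D x b by rewrite e.
by move/(btw_between ha hb); rewrite /btw; lra.
Qed.

Lemma btw_trans x y z t : btw x y z -> btw x z t -> btw x y t /\ btw y z t.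
Proof.
by rewrite /btw => h1 h2; have := zh_tri y x t; have := zh_tri z y t; split; lra.
Qed.

End FourPoint.

Section Isometry.
Variables (R : realType) (G : groupType) (X : Type) (D : X -> X -> R).
Variable a : G -> X -> X.

Record isom_action : Prop := IsomAction {
  ia1 : forall x, a 1%g x = x;
  iaM : forall g h x, a (g * h)%g x = a g (a h x);
  iaD : forall g x y, D (a g x) (a g y) = D x y }.

(** Asymptotic translation length with a bounded error instead of a limit. In a tree d(x, g^n x)
    differs from n l(g) by at most twice the distance from x to the axis or fixed set; in this form
    the notion is independent of the base point and additive in the metric. *)
Definition asym (x : X) (g : G) (l : R) : Prop :=
  exists C, forall n, `|D x (a (g ^+ n)%g x) - n%:R * l| <= C.

Hypothesis (H : zero_hyperbolic D) (A : isom_action).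

Lemma iaVl g x : a g^-1%g (a g x) = x.
Proof. by rewrite -(iaM A) mulVg (ia1 A). Qed.

Lemma iaVr g x : a g (a g^-1%g x) = x.
Proof. by rewrite -(iaM A) mulgV (ia1 A). Qed.

Lemma iaDV g x y : D (a g^-1%g x) y = D x (a g y).
Proof. by rewrite -(iaD A g) iaVr. Qed.

Lemma btw_act g x y z : btw D x y z -> btw D (a g x) (a g y) (a g z).
Proof. by rewrite /btw !(iaD A). Qed.

Lemma bounded_slope (u v C : R) : (forall n : nat, n%:R * u <= n%:R * v + C) -> u <= v.
Proof.
move=> h; rewrite leNgt; apply/negP => uv.
have [n] : exists n : nat, C / (u - v) < n%:R.
  exists (Num.bound `|C / (u - v)|).
  by apply: le_lt_trans (ler_norm _) (archi_boundP _); rewrite normr_ge0.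
rewrite ltr_pdivrMr; last by lra.
by move=> h2; have := h n; nra.
Qed.

Lemma asym_le x g l (y : X) : asym x g l -> l <= D y (a g y).
Proof.
move=> [C hC]; apply: (@bounded_slope _ _ (C + 2 * D x y)) => n.
have dn : D y (a (g ^+ n)%g y) <= n%:R * D y (a g y).
  elim: n => [|n ih]; first by rewrite expg0 (ia1 A) (zh0 H) mul0r.
  have := zh_tri H (a (g ^+ n)%g y) y (a (g ^+ n.+1)%g y).
  by rewrite expgSr (iaM A) (iaD A) -natr1 mulrDl mul1r; lra.
have := hC n; rewrite ler_norml => /andP[h1 _].
have := zh_tri H y x (a (g ^+ n)%g x).
have := zh_tri H (a (g ^+ n)%g y) y (a (g ^+ n)%g x).
by rewrite (iaD A) (zhC H y x); lra.
Qed.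

Lemma asym_uniq x g l l' : asym x g l -> asym x g l' -> l = l'.
Proof.
move=> [C hC] [C' hC'].
apply/eqP; rewrite eq_le; apply/andP; split; apply: (@bounded_slope _ _ (C + C')) => n;
  by have := hC n; have := hC' n; rewrite !ler_norml; lra.
Qed.

Lemma asym_base x y g l : asym x g l -> asym y g l.
Proof.
move=> [C hC]; exists (C + 2 * D x y) => n; have := hC n.
have := zh_tri H (a (g ^+ n)%g y) y (a (g ^+ n)%g x).
have := zh_tri H (a (g ^+ n)%g x) x (a (g ^+ n)%g y).
have := zh_tri H y x (a (g ^+ n)%g x).
have := zh_tri H x y (a (g ^+ n)%g y).
have := zh_tri H y x (a (g ^+ n)%g y).
have := zh_tri H x y (a (g ^+ n)%g x).
rewrite !(iaD A) (zhC H y x) !ler_norml; lra.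
Qed.

Lemma axis_asym m g : btw D m (a g m) (a g (a g m)) -> 0 < D m (a g m) ->
  forall n, D m (a (g ^+ n)%g m) = n%:R * D m (a g m).
Proof.
move=> h1 h2.
have e n : a (g ^+ n.+1)%g m = a (g ^+ n)%g (a g m) by rewrite expgSr (iaM A).
have := @btw_seq _ _ _ H (fun n => a (g ^+ n)%g m).
have k1 n : btw D (a (g ^+ n)%g m) (a (g ^+ n.+1)%g m) (a (g ^+ n.+2)%g m).
  by rewrite (e n.+1) (expgSr g n) !(iaM A); apply: btw_act.
have k2 n : 0 < D (a (g ^+ n)%g m) (a (g ^+ n.+1)%g m) by rewrite e (iaD A).
move=> /(_ k1 k2) h; elim=> [|n ih]; first by rewrite expg0 (ia1 A) (zh0 H) mul0r.
have := h n; rewrite /btw expg0 (ia1 A) => ->.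
by rewrite ih e (iaD A) -natr1 mulrDl mul1r.
Qed.

Hypothesis Geo : geodesic D.

(** The midpoint of [x] and [g x] is fixed by [g] if the segments from [g x] to [x] and to [g^2 x]
    share at least half of their length, and lies on an axis of [g] otherwise. So one formula covers
    elliptic and hyperbolic elements. *)
Lemma translation_axis (x : X) g : exists m, forall n,
  D m (a (g ^+ n)%g m) = n%:R * D m (a g m).
Proof.
pose y := a g x; pose z := a g y.
have Lx : D x y = D y z by rewrite /y /z (iaD A).
have [|m [h1 h2]] := Geo (x := x) (y := y) (r := D x y / 2).
  by have := zh_ge0 H x y; lra.
have h3 : D y (a g m) = D x y / 2 by rewrite /y (iaD A).
have h4 : D (a g m) z = D x y / 2 by rewrite /z (iaD A) h2; lra.
have hm : D m y = D x y / 2 by lra.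
exists m.
(* [c = (x|z)_y]; [m] and [g m] are at distance [D x y / 2] from [y] on [y,x] and [y,z] *)
have [c|c] := leP (D x y) (2 * D x y - D x z).
  have m0 : D m (a g m) = 0.
    have := zh_ge0 H m (a g m).
    have bm : btw D y m x by rewrite /btw (zhC H y x) (zhC H y m) (zhC H m x); lra.
    have bgm : btw D y (a g m) z by rewrite /btw; lra.
    have := max_btw H (a g m) bm; have := max_btw H x bgm.
    have := (zhC H (a g m) x, zhC H z x, zhC H y m, zhC H y x, zhC H m x).
    by move=> [[[[s1 s2] s3] s4] s5]; case=> ?; case=> ?; lra.
  move=> n; rewrite m0 mulr0; elim: n => [|n ih]; first by rewrite expg0 (ia1 A) (zh0 H).
  have := zh_tri H (a (g ^+ n)%g m) m (a (g ^+ n.+1)%g m).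
  have := zh_ge0 H m (a (g ^+ n.+1)%g m).
  by rewrite expgSr (iaM A) (iaD A); lra.
have bm : btw D x m y by rewrite /btw; lra.
have bgm : btw D y (a g m) z by rewrite /btw; lra.
have q0 := zh_tri H z x (a g m).
have xgm : D x (a g m) = D x z - D x y / 2.
  have := zh_tri H (a g m) x z; have := max_btw H x bgm.
  by rewrite (zhC H (a g m) x) (zhC H y x) (zhC H z x); case; lra.
have mz : D m z = D x z - D x y / 2.
  have := zh_tri H m x z; have := max_btw H z bm; by case; lra.
have mgm : D m (a g m) = D x z - D x y.
  have := max_btw H (a g m) bm; have := zh_tri H m x (a g m); case; lra.
have ggm : a g (a g m) = a g (a g m) by [].
have ygg : D y (a g (a g m)) = D x z - D x y / 2 by rewrite /y (iaD A).
apply: axis_asym; last by lra.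
rewrite /btw (iaD A) mgm.
have b1 : btw D m (a g m) z by rewrite /btw; lra.
have b3 : btw D y (a g m) (a g (a g m)) by rewrite /btw ygg (iaD A) mgm; lra.
have := max_btw H (a g (a g m)) b1.
have := zh_tri H (a g m) m (a g (a g m)); rewrite (iaD A) mgm.
have zgg : D z (a g (a g m)) = D x y / 2 by rewrite /z (iaD A) -h3 (iaD A).
have := zh4 H m (a g (a g m)) (a g m) y.
rewrite (zhC H (a g m) y) h3 hm mgm (zhC H (a g (a g m)) y) ygg.
rewrite (zhC H (a g (a g m)) (a g m)) (iaD A) mgm.
have := zh4 H m z (a g m) (a g (a g m)); rewrite (iaD A) mgm mz zgg (zhC H z (a g m)) h4.
case; case; case; lra.
Qed.

End Isometry.

(** * The metric of a simplicial tree *)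

Section Lcp.
Variable X : eqType.

(** A vertex is encoded below by the sequence of vertices on its path from a root; the common prefix
    of two such paths leads to the vertex where they part. *)
Fixpoint lcp (s t : seq X) : seq X :=
  match s, t with
  | a :: s', b :: t' => if a == b then a :: lcp s' t' else [::]
  | _, _ => [::]
  end.

Lemma lcp_prefixl s t : prefix (lcp s t) s.
Proof. by elim: s t => [|a s ih] [|b t] //=; case: eqP => //= _; rewrite eqxx ih. Qed.

Lemma lcpC s t : lcp s t = lcp t s.
Proof.
elim: s t => [|a s ih] [|b t] //=; rewrite (eq_sym b).
by case: eqP => //= ->; rewrite ih.
Qed.

Lemma lcp_prefixr s t : prefix (lcp s t) t.
Proof. by rewrite lcpC lcp_prefixl. Qed.

Lemma lcp_max s t u : prefix u s -> prefix u t -> prefix u (lcp s t).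
Proof.
elim: u s t => [|c u ih] [|a s] [|b t] //=; first by rewrite prefix0s.
move=> /andP[/eqP<- us] /andP[/eqP<- ut]; rewrite eqxx /= eqxx /=.
exact: ih.
Qed.

Lemma lcp_id s : lcp s s = s.
Proof. by elim: s => //= a s ->; rewrite eqxx. Qed.

Lemma lcp_catl s t : lcp s (s ++ t) = s.
Proof. by elim: s => [|a s ih] //=; rewrite eqxx ih. Qed.

Lemma lcp_ultra s t u :
  prefix (lcp s t) (lcp s u) \/ prefix (lcp t u) (lcp s u).
Proof.
elim: s t u => [|a s ih] [|b t] [|c u] //=; rewrite ?prefix0s; try (by left); try by right.
- case: (eqVneq a b) => [<-|ab]; last by left; rewrite prefix0s.
  case: (eqVneq a c) => [_|ac]; last by right; rewrite prefix0s.
  by rewrite /= eqxx /=; apply: ih.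
Qed.

End Lcp.

Section SimplicialTree.
Variables (R : realType) (T : simplicial_metric_tree R).
Local Notation d := (@mdist R T).
Local Notation V := (@vertices R T).
Local Notation E := (@edges R T).
Local Notation adj := (Defs.adjacent V E).

Definition edge_ends (e : set T) (u v : T) : Prop :=
  [/\ E e, u <> v & e `&` V = [set u; v]].

Lemma edge_endsC e u v : edge_ends e u v -> edge_ends e v u.
Proof.
case=> He uv eV; split=> //; first by move=> vu; apply: uv.
by rewrite eV setUC.
Qed.

Lemma adjP u v : reflect (exists e, edge_ends e u v) (adj u v).
Proof.
apply: (iffP (asboolP _)) => [[uv [e He eV]]|[e [He uv eV]]].
  by exists e; split.
by split=> //; exists e.
Qed.

Lemma edge_endsV e u v : edge_ends e u v -> [/\ e u, e v, V u & V v].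
Proof.
case=> _ _ eV; have : [set u; v] u by left.
rewrite -eV => -[? ?]; have : [set u; v] v by right.
by rewrite -eV => -[? ?].
Qed.

Lemma edge_coord e u v : edge_ends e u v ->
  (forall x, e x -> d u x + d x v = d u v) /\
  (forall x y, e x -> e y -> d x y = `|d u x - d u y|).
Proof.
move=> [He uv eV].
have [l [s [l0 es h eV']]] := smt_edges He.
have c0 : 0 <= (0 : R) <= l by rewrite lexx ltW.
have c1 : 0 <= l <= l by rewrite lexx ltW.
have main : (u = s 0 /\ v = s l) \/ (u = s l /\ v = s 0).
  have : [set s 0; s l] u by rewrite -eV' eV; left.
  have : [set s 0; s l] v by rewrite -eV' eV; right.
  case=> ev [] eu; first by case: uv; rewrite eu ev.
  - by right.
  - by left.
  - by case: uv; rewrite eu ev.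
have hx x : e x -> exists2 t, 0 <= t <= l & x = s t.
  by rewrite es => -[t]; rewrite /= in_itv /= => tl <-; exists t.
case: main => -[-> ->]; split.
- move=> x /hx[t tl ->]; rewrite !h //; move: tl => /andP[t0 tl].
  by rewrite !sub0r !normrN (ger0_norm t0) (ger0_norm (ltW l0)) ler0_norm; lra.
- move=> x y /hx[t tl ->] /hx[t' tl' ->]; rewrite !h // !sub0r !normrN.
  by move: tl tl' => /andP[t0 tl] /andP[t0' tl']; rewrite (ger0_norm t0) (ger0_norm t0').
- move=> x /hx[t tl ->]; rewrite !h //; move: tl => /andP[t0 tl].
  by rewrite !subr0 (ger0_norm t0) (ger0_norm (ltW l0)) ger0_norm; lra.
- move=> x y /hx[t tl ->] /hx[t' tl' ->]; rewrite !h //.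
  move: tl tl' => /andP[t0 tl] /andP[t0' tl'].
  rewrite [in X in _ = X](ger0_norm (x := l - t)); last by lra.
  rewrite [in X in _ = X](ger0_norm (x := l - t')); last by lra.
  by rewrite -(normrN (t - t')); congr `|_|; lra.
Qed.

(** * Heights and branching points seen from a root *)

Section Rooted.
Variables (r : T) (Vr : V r).

Definition root_path (v : T) (s : seq T) : Prop :=
  [/\ path adj r s, last r s = v & uniq (r :: s)].

Lemma root_path_ex v : exists s, V v -> root_path v s.
Proof.
case: (pselect (V v)) => [Vv|]; last by exists [::].
have [_ _ _ _ h] := smt_tree T.
by have [s [? _]] := h r v Vr Vv; exists s.
Qed.

Definition pth v := sval (cid (root_path_ex v)).

Lemma pthP v : V v -> root_path v (pth v).
Proof. exact: svalP (cid (root_path_ex v)). Qed.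

Lemma root_path_uniq v s : V v -> root_path v s -> pth v = s.
Proof.
move=> Vv plen; have [_ _ _ _ h] := smt_tree T.
have [t [_ ht]] := h r v Vr Vv.
by rewrite -(ht _ plen) -(ht _ (pthP Vv)).
Qed.

Lemma adjV u v : adj u v -> V u /\ V v.
Proof. by move=> /adjP[e /edge_endsV[]]. Qed.

Lemma adjC u v : adj u v -> adj v u.
Proof. by move=> /adjP[e /edge_endsC h]; apply/adjP; exists e. Qed.

Lemma path_adjV u s : V u -> path adj u s -> forall v, v \in u :: s -> V v.
Proof.
elim: s u => [|w s ih] u Vu /=.
  by move=> _ v; rewrite inE => /eqP->.
move=> /andP[/adjV[_ Vw] pw] v; rewrite inE => /orP[/eqP->//|].
exact: ih.
Qed.

Lemma root_path_prefix v s t : root_path v (s ++ t) -> root_path (last r s) s.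
Proof.
case; rewrite cat_path => /andP[p _] _.
by rewrite -cat_cons cat_uniq => /andP[u _]; split.
Qed.

Lemma V_last v s t : root_path v (s ++ t) -> V (last r s).
Proof.
move=> /root_path_prefix[p _ _]; apply: (path_adjV Vr p).
exact: mem_last.
Qed.

Lemma pth_prefix v s t : V v -> pth v = s ++ t -> pth (last r s) = s.
Proof.
move=> Vv e; have := pthP Vv; rewrite e => h.
by apply: root_path_uniq (root_path_prefix h); apply: V_last h.
Qed.

Lemma pth_inj u v : V u -> V v -> pth u = pth v -> u = v.
Proof.
by move=> /pthP[_ hu _] /pthP[_ hv _] e; rewrite -hu -hv e.
Qed.

Lemma pth_parent u v : adj u v ->
  pth v = rcons (pth u) v \/ pth u = rcons (pth v) u.
Proof.
move=> uv; have [Vu Vv] := adjV uv.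
have [pu lu qu] := pthP Vu; have [pv lv qv] := pthP Vv.
have [vin|vnin] := boolP (v \in r :: pth u); last first.
  left; apply: root_path_uniq => //; split.
  - by rewrite rcons_path pu lu.
  - by rewrite last_rcons.
  - by rewrite -rcons_cons rcons_uniq vnin.
right; have [s [t [e ls]]] : exists s t, pth u = s ++ t /\ last r s = v.
  by case/splitPl: vin => s t ls; exists s, t.
have ev : pth v = s by rewrite -ls; apply: pth_prefix Vu e.
apply: root_path_uniq => //; split.
- by rewrite rcons_path pv lv; apply: adjC.
- by rewrite last_rcons.
- rewrite -rcons_cons rcons_uniq qv andbT ev.
  have tn : t != [::].
    apply/eqP => t0; move: e; rewrite t0 cats0 => e.
    by move: uv => /adjP[? [_ + _]]; apply; rewrite -lu e ls.
  have uin : u \in t.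
    by rewrite -lu e last_cat; case: (t) tn => //= a t' _; rewrite mem_last.
  move: qu; rewrite e -cat_cons cat_uniq => /and3P[_ /hasPn h _].
  exact: h.
Qed.

Definition plen (s : seq T) : R := \sum_(x <- pairmap d r s) x.

Lemma plen_cat s t : plen (s ++ t) = plen s + \sum_(x <- pairmap d (last r s) t) x.
Proof. by rewrite /plen pairmap_cat big_cat. Qed.

Lemma pairmap_ge0 (a : T) s : 0 <= \sum_(x <- pairmap d a s) x.
Proof.
elim: s a => [|b s ih] a /=; first by rewrite big_nil.
by rewrite big_cons addr_ge0 ?mdist_ge0.
Qed.

Lemma plen_prefix s t : prefix s t -> plen s <= plen t.
Proof. by move=> /prefixP[u ->]; rewrite plen_cat lerDl pairmap_ge0. Qed.

Lemma mdist_pairmap (a : T) s : d a (last a s) <= \sum_(x <- pairmap d a s) x.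
Proof.
elim: s a => [|b s ih] a /=; first by rewrite big_nil mdistxx.
by rewrite big_cons; apply: le_trans (metric_triangle _ b _) _; rewrite lerD2l.
Qed.

(** For a point inside an edge, [c] is the endpoint farther from the root, so that the geodesic from
    the root to [c] runs through [x]. *)
Definition anchored (x c : T) : Prop :=
  (V x /\ c = x) \/
  [/\ ~ V x & exists e u, [/\ edge_ends e u c, e x & pth c = rcons (pth u) c]].

Lemma anchor_ex x : exists c, anchored x c.
Proof.
case: (pselect (V x)) => [Vx|nVx]; first by exists x; left.
have [_ _ _ h _] := smt_tree T.
case: (h x) => [//|[e He ex]].
have [l [s [l0 e1 h1 eV]]] := smt_edges He.
have c0 : 0 <= (0 : R) <= l by rewrite lexx ltW.
have c1 : 0 <= l <= l by rewrite lexx ltW.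
have ne : s 0 <> s l.
  move=> e2; have := h1 _ _ c0 c1.
  by rewrite -e2 mdistxx sub0r normrN ger0_norm ?ltW //; lra.
have ee : edge_ends e (s 0) (s l) by split.
have : adj (s 0) (s l) by apply/adjP; exists e.
move=> /pth_parent[p1|p1].
  by exists (s l); right; split=> //; exists e, (s 0).
exists (s 0); right; split=> //; exists e, (s l); split=> //.
exact: edge_endsC.
Qed.

Definition anch x := sval (cid (anchor_ex x)).

Lemma anchP x : anchored x (anch x).
Proof. exact: svalP (cid (anchor_ex x)). Qed.

Lemma anchV x : V (anch x).
Proof. by case: (anchP x) => [[Vx ->]|[_ [e [u [/edge_endsV[]]]]]]. Qed.

Lemma anch_id x : V x -> anch x = x.
Proof. by move=> Vx; case: (anchP x) => [[_ ->]|[]]. Qed.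

(** The distance from the root, as a correction to the path length of the anchor. *)
Definition ht x := plen (pth (anch x)) - d x (anch x).

Lemma ht_vertex v : V v -> ht v = plen (pth v).
Proof. by move=> Vv; rewrite /ht anch_id // mdistxx subr0. Qed.

Lemma plen_child u v : V u -> V v -> pth v = rcons (pth u) v ->
  plen (pth v) = plen (pth u) + d u v.
Proof.
move=> Vu Vv ->; rewrite -cats1 plen_cat; have [_ -> _] := pthP Vu.
by rewrite /= big_cons big_nil addr0.
Qed.

Lemma edge_anch e u v : edge_ends e u v -> pth v = rcons (pth u) v ->
  forall x, e x -> (x = u \/ anch x = v) /\ ht x = plen (pth u) + d u x.
Proof.
move=> ee pv x ex; have [eu ev Vu Vv] := edge_endsV ee.
have [He uv eV] := ee.
have [ec1 ec2] := edge_coord ee.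
case: (pselect (V x)) => [Vx|nVx].
  rewrite (anch_id Vx) (ht_vertex Vx).
  have : [set u; v] x by rewrite -eV.
  case=> ->; first by rewrite mdistxx addr0; split=> //; left.
  by rewrite -plen_child //; split=> //; right.
have av : anch x = v.
  case: (anchP x) => [[//]|[_ [e' [u' [ee' e'x pc]]]]].
  have ee'E : e = e'.
    apply: contrapT => ne; have [_ _ h _ _] := smt_tree T.
    by have [He' _ _] := ee'; apply: nVx; apply: (h e e').
  have [_ u'c eV'] := ee'.
  have h1 : [set u; v] (anch x) by rewrite -eV ee'E eV'; right.
  have h2 : [set u; v] u' by rewrite -eV ee'E eV'; left.
  case: h1 => // acu; case: h2 => h2; first by case: u'c; rewrite h2 acu.
  move: pc; rewrite acu h2 => pc.
  by move: (congr1 size pv) (congr1 size pc); rewrite !size_rcons; lia.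
split; first by right.
by rewrite /ht av (plen_child Vu Vv pv) -(ec1 x ex); lra.
Qed.

Lemma ht_ge0 x : 0 <= ht x.
Proof.
case: (anchP x) => [[Vx e]|[_ [e [u [ee ex pc]]]]].
  by rewrite (ht_vertex Vx) pairmap_ge0.
have [_ ->] := edge_anch ee pc ex.
by rewrite addr_ge0 ?mdist_ge0 ?pairmap_ge0.
Qed.

Lemma ht_anch x : ht x <= plen (pth (anch x)).
Proof. by rewrite /ht lerBlDr lerDl mdist_ge0. Qed.

(** Height of the last common point of the geodesics from the root to [x] and [y], that is, their
    Gromov product at the root. The two heights enter the minimum because [x] and [y] may stop short
    of their anchors. *)
Definition meet x y := Num.min (plen (lcp (pth (anch x)) (pth (anch y))))
  (Num.min (ht x) (ht y)).

Lemma meetC x y : meet x y = meet y x.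
Proof. by rewrite /meet lcpC (minC (ht x)). Qed.

Lemma meet_le x y : meet x y <= ht x /\ meet x y <= ht y.
Proof. by rewrite /meet !ge_min !lexx !orbT. Qed.

Lemma meet_ultra x y z : Num.min (meet x y) (meet y z) <= meet x z.
Proof.
rewrite /meet.
set a := pth (anch x); set b := pth (anch y); set c := pth (anch z).
by case: (lcp_ultra a b c) => /plen_prefix h; rewrite !le_min !ge_min h !lexx ?orbT.
Qed.

Definition delta x y := ht x + ht y - 2 * meet x y.

Lemma delta_edge e x y : E e -> e x -> e y -> delta x y = d x y.
Proof.
move=> He ex ey.
have [l [s [l0 e1 h1 eV]]] := smt_edges He.
have c0 : 0 <= (0 : R) <= l by rewrite lexx ltW.
have c1 : 0 <= l <= l by rewrite lexx ltW.
have ne : s 0 <> s l.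
  move=> e2; have := h1 _ _ c0 c1.
  by rewrite -e2 mdistxx sub0r normrN ger0_norm ?ltW //; lra.
have ee : edge_ends e (s 0) (s l) by split.
have : exists u v, edge_ends e u v /\ pth v = rcons (pth u) v.
  have : adj (s 0) (s l) by apply/adjP; exists e.
  move=> /pth_parent[p1|p1]; first by exists (s 0), (s l).
  by exists (s l), (s 0); split=> //; apply: edge_endsC.
move: s e1 h1 eV ne ee => _ _ _ _ _ _ [u [v [ee pv]]].
have [_ ec] := edge_coord ee.
have [eu ev Vu Vv] := edge_endsV ee.
have [cx hx] := edge_anch ee pv ex; have [cy hy] := edge_anch ee pv ey.
rewrite (ec x y ex ey).
have hu : plen (pth u) <= plen (pth v) by rewrite (plen_child Vu Vv pv) lerDl mdist_ge0.
have := mdist_ge0 u x; have := mdist_ge0 u y => dy dx.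
have := ht_anch x; have := ht_anch y => ay ax.
have lu : lcp (pth u) (pth v) = pth u by rewrite pv -cats1 lcp_catl.
rewrite /delta /meet; case: cx => cx; case: cy => cy.
- by rewrite cx cy mdistxx subr0 normr0 lcp_id -[X in X - _]mulr2n minxx ht_vertex //
   anch_id // minxx mulr2n; lra.
- rewrite cx (anch_id Vu) cy lu ht_vertex // hy mdistxx sub0r normrN ger0_norm //.
  by rewrite !min_l; lra.
- rewrite cy (anch_id Vu) cx lcpC lu (ht_vertex Vu) hx mdistxx subr0 ger0_norm //.
  rewrite (min_r (x := _ + _)) ?minxx; lra.
- rewrite cx cy lcp_id.
  rewrite cx in ax; rewrite cy in ay.
  have [xy|/ltW xy] := leP (ht x) (ht y); rewrite min_r //.
    rewrite distrC ger0_norm; lra.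
  rewrite ger0_norm; lra.
Qed.

Lemma delta0 x : delta x x = 0.
Proof.
rewrite /delta /meet lcp_id minxx min_r ?ht_anch //; lra.
Qed.

Lemma delta_tri x y z : delta x z <= delta x y + delta y z.
Proof.
have := meet_ultra x y z; rewrite ge_min => h.
have [? ?] := meet_le x y; have [? ?] := meet_le y z.
by rewrite /delta; case/orP: h; lra.
Qed.

(** On a single edge [delta] is the metric, and it satisfies the triangle inequality; so it is at
    most the length of every string, hence at most their infimum. *)
Lemma delta_le x y : delta x y <= d x y.
Proof.
have [h _] := smt_metric T.
rewrite h; apply: lb_le_inf.
  (* If there were no string, the infimum of the empty set would be 0 by convention, so [x] and [y]
     would coincide; but then the empty sequence is a string. *)
  apply: contrapT => h2.
  have := h x y; rewrite (_ : string_lengths _ _ _ = set0) ?inf0; last first.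
    by rewrite -subset0 => l hl; apply: h2; exists l.
  move=> /mdist_positivity xy; apply: h2; exists 0.
  by exists [::]; split=> //=; rewrite big_nil.
move=> _ [s [ps <- ->]].
elim: s x ps => [|z s ih] x /=; first by rewrite big_nil delta0.
move=> /andP[/asboolP[e He [ex ez]] ps]; rewrite big_cons.
apply: le_trans (delta_tri _ z _) _; apply: lerD; last exact: ih.
by rewrite (delta_edge He).
Qed.

Lemma ancestor_dist s x : prefix s (pth (anch x)) -> s != pth (anch x) ->
  plen s <= ht x /\ d (last r s) x <= ht x - plen s.
Proof.
have vert v t : V v -> prefix t (pth v) -> d (last r t) v <= plen (pth v) - plen t.
  move=> Vv /prefixP[w e]; rewrite e plen_cat.
  have <- : last (last r t) w = v.
    by rewrite -last_cat -e; have [_ -> _] := pthP Vv.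
  by have := mdist_pairmap (last r t) w; lra.
move=> ps ns; case: (anchP x) => [[Vx e]|[_ [e [u [ee ex pc]]]]].
  rewrite (ht_vertex Vx); rewrite e in ps; split; first exact: plen_prefix.
  exact: vert.
have [_ ->] := edge_anch ee pc ex; have [_ _ Vu _] := edge_endsV ee.
have pu : prefix s (pth u).
  move: ps ns; rewrite pc => /prefixP[w]; case: (lastP w) => [|w' z].
    by rewrite cats0 => ->; rewrite eqxx.
  rewrite -rcons_cat => /rcons_inj[-> _] _.
  by apply/prefixP; exists w'.
have := plen_prefix pu; have := vert u s Vu pu.
have := metric_triangle (last r s) u x; have := mdist_ge0 u x.
by split; lra.
Qed.

(** The triangle inequality through the last common vertex [last r s] of the root paths gives the
    bound when neither anchor is that vertex. If one is, its point sits on the edge ending there or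
    at that vertex; if both are, the two points share an edge or coincide. *)
Lemma le_delta x y : d x y <= delta x y.
Proof.
pose s := lcp (pth (anch x)) (pth (anch y)).
have px : prefix s (pth (anch x)) by apply: lcp_prefixl.
have py : prefix s (pth (anch y)) by apply: lcp_prefixr.
have dl z : prefix s (pth (anch z)) -> s = pth (anch z) -> last r s = anch z.
  by move=> _ ->; have [_ -> _] := pthP (anchV z).
rewrite /delta /meet -/s.
have [ex|nx] := eqVneq s (pth (anch x)); have [ey|ny] := eqVneq s (pth (anch y)).
- have exy : anch x = anch y by rewrite -(dl x px ex) (dl y py ey).
  suff : (exists e, [/\ E e, e x & e y]) \/ x = y.
    case=> [[e [He e1 e2]]|xy]; last first.
      by have := delta0 y; rewrite /delta /meet /s xy mdistxx => ->.
    by rewrite -(delta_edge He e1 e2) /delta /meet.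
  case: (anchP x) => [[Vx e1]|[nVx [e [u [ee e1 pc]]]]];
    case: (anchP y) => [[Vy e2]|[nVy [e' [u' [ee' e2 pc']]]]].
  + by right; rewrite -e1 exy.
  + left; exists e'; have [? ? _] := ee'; split=> //.
    by have [_ + _ _] := edge_endsV ee'; rewrite -exy e1.
  + left; exists e; have [? ? _] := ee; split=> //.
    by have [_ + _ _] := edge_endsV ee; rewrite exy e2.
  + left; exists e; have [? ? eV] := ee; split=> //.
    have uu : u = u'.
      have [_ _ Vu Vc] := edge_endsV ee; have [_ _ Vu' Vc'] := edge_endsV ee'.
      apply: pth_inj => //; move: pc; rewrite exy pc' => /rcons_inj[->] //.
    have [He' _ eV'] := ee'.
    have [_ h _ _ _] := smt_tree T.
    by rewrite (h e e') // eV eV' uu exy.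
- have [h1 h2] := ancestor_dist py ny.
  have hx := ht_anch x; rewrite -ex in hx.
  have := metric_triangle x (anch x) y; rewrite -{2}(dl x px ex) => h3.
  have : d x (anch x) = plen s - ht x by rewrite /ht ex; lra.
  by move=> h4; rewrite (min_l (x := ht x)) ?min_r //; lra.
- have [h1 h2] := ancestor_dist px nx.
  have hy := ht_anch y; rewrite -ey in hy.
  have := metric_triangle x (anch y) y; rewrite -{1}(dl y py ey) => h3.
  have h4 : d y (anch y) = plen s - ht y by rewrite /ht ey; lra.
  have e1 := metric_sym x (last r s); have e2 := metric_sym (anch y) y.
  rewrite (min_r (x := ht x)); last by lra.
  by rewrite min_r //; lra.
- have [h1 h2] := ancestor_dist px nx; have [h3 h4] := ancestor_dist py ny.
  have := metric_triangle x (last r s) y; rewrite (metric_sym x (last r s)) => h5.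
  by rewrite min_l; [lra|rewrite le_min h1 h3].
Qed.

Lemma mdist_delta x y : d x y = ht x + ht y - 2 * meet x y.
Proof. by apply/eqP; rewrite eq_le le_delta delta_le. Qed.

Lemma mdist_hyperbolic : zero_hyperbolic d.
Proof.
split=> [x|x y|x y z t]; [exact: mdistxx|exact: metric_sym|].
rewrite !mdist_delta.
have := meet_ultra x z y; have := meet_ultra x t y.
have := meet_ultra z x t; have := meet_ultra z y t.
rewrite (meetC z x) (meetC z y) (meetC t y).
move: (meet x y) (meet x z) (meet x t) (meet y z) (meet y t) (meet z t)
  => a b c e f g.
rewrite !ge_min => /orP h1 /orP h2 /orP h3 /orP h4.
have [h|h] := leP (b + f) (a + g); [by left; lra|right].
by case: h1 => ?; case: h2 => ?; case: h3 => ?; case: h4 => ?; lra.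
Qed.

Lemma edge_point e u v t : edge_ends e u v -> 0 <= t <= d u v ->
  exists z, e z /\ d u z = t.
Proof.
move=> ee ht; have [eu ev Vu Vv] := edge_endsV ee.
have [He uv eV] := ee; have [_ ec] := edge_coord ee.
have [l [s [l0 es h eV']]] := smt_edges He.
have c0 : 0 <= (0 : R) <= l by rewrite lexx ltW.
have c1 : 0 <= l <= l by rewrite lexx ltW.
have e0l : d (s 0) (s l) = l by rewrite h // sub0r normrN gtr0_norm.
have hin x : 0 <= x <= l -> e (s x) by move=> hx; rewrite es; exists x; rewrite //= in_itv.
have : [set s 0; s l] u by rewrite -eV'.
have : [set s 0; s l] v by rewrite -eV'.
case=> ev' [] eu'; first by case: uv; rewrite eu' ev'.
- exists (s (l - t)); move: ht; rewrite eu' ev' metric_sym e0l => ht.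
  by split; [apply: hin; lra|rewrite h; [rewrite ger0_norm; lra| |]; lra].
- exists (s t); move: ht; rewrite eu' ev' e0l => ht.
  by split; [apply: hin; lra|rewrite h; [rewrite ler0_norm; lra| |]; lra].
- by case: uv; rewrite eu' ev'.
Qed.

Lemma parent_edge x : x = r \/ exists e p c,
  [/\ edge_ends e p c, pth c = rcons (pth p) c, e x & anch x = c].
Proof.
case: (anchP x) => [[Vx _]|[_ [e [u [ee ex pc]]]]]; last first.
  by right; exists e, u, (anch x).
have [px lx ux] := pthP Vx.
have [e|[s [z e]]] : pth x = [::] \/ exists s z, pth x = rcons s z.
  by case: (lastP (pth x)) => [|s z]; [left|right; exists s, z].
  by left; rewrite -lx e.
move: lx px; rewrite e last_rcons rcons_path => ez /andP[_ az]; right.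
move: e az; rewrite ez -cats1 => e; have := pth_prefix Vx e.
set p := last r s => ep /adjP[f ff].
exists f, p, x; split=> //; first by rewrite ep e cats1.
  by have [] := edge_endsV ff.
exact: anch_id.
Qed.

Lemma root_ht : ht r = 0.
Proof.
have e : pth r = [::] by apply: root_path_uniq.
by rewrite (ht_vertex Vr) e /plen /= big_nil.
Qed.

Lemma ht_lip x y : ht x - ht y <= d x y.
Proof. by rewrite mdist_delta; have [] := meet_le x y; lra. Qed.

Lemma ancestor x t : 0 <= t <= ht x -> exists z, ht z = t /\ d z x = ht x - t.
Proof.
have [n] := ubnP (size (pth (anch x))); elim: n => // n ih in x t *.
move=> hn htx; case: (parent_edge x) => [xr|[e [p [c [ee pc ex ac]]]]].
  move: htx; rewrite xr root_ht => htx; exists r; rewrite mdistxx root_ht; split; lra.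
have [ep ev Vp Vc] := edge_endsV ee.
have [ec1 ec2] := edge_coord ee.
have [_ hx] := edge_anch ee pc ex.
have hp := ht_vertex Vp.
have [tp|/ltW tp] := leP t (ht p).
  have [||z [h1 h2]] := ih p t _ _.
  - by rewrite (anch_id Vp); move: hn; rewrite ac pc size_rcons.
  - by case/andP: htx => -> _.
  exists z; split=> //; have := ht_lip x z; have := metric_triangle z p x.
  by rewrite (metric_sym x); lra.
have dp : d p x <= d p c by have := ec1 _ ex; have := mdist_ge0 x c; lra.
have [|z [ez dz]] := edge_point (t := t - ht p) ee; first by lra.
have [_ hz] := edge_anch ee pc ez.
exists z; split; first by rewrite hz dz; lra.
rewrite ec2 // dz distrC ger0_norm; lra.
Qed.

(** From [x] one descends towards the root as far as the meet and then ascends to [y]; [side] treats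
    the descent, and the ascent is the descent from [y] read backwards. *)
Lemma mdist_geodesic_ : geodesic d.
Proof.
have side x y t : 0 <= t <= ht x - meet x y ->
    exists z, d x z = t /\ d z y = d x y - t.
  move=> h; have := ht_ge0 x; have := meet_le x y; have := ht_ge0 y => hy0 [m1 m2] hx0.
  have m0 : 0 <= meet x y by rewrite !le_min hx0 hy0 pairmap_ge0.
  have [|z [hz dz]] := ancestor (x := x) (t := ht x - t); first by lra.
  exists z; rewrite metric_sym dz; split; first by lra.
  have := mdist_delta z x; have := meet_ultra z x y; rewrite ge_min => /orP mu dzx.
  have := metric_triangle x z y; rewrite (metric_sym x z).
  have := mdist_delta z y; have := mdist_delta x y.
  by case: mu; lra.
move=> x y t h; have [tx|tx] := leP t (ht x - meet x y).
  by apply: side; lra.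
have := mdist_delta x y => dxy.
have [|z [h1 h2]] := side y x (d x y - t); first by rewrite meetC; lra.
exists z; rewrite metric_sym h2 metric_sym (metric_sym z) h1; split; lra.
Qed.

(* Points not below [x] share a germ at [x], and so do points below [x] unless
   [x] is a vertex. *)
Lemma branch_vertex_ x a b c : 0 < d x a -> 0 < d x b -> 0 < d x c ->
  btw d a x b -> btw d b x c -> btw d a x c -> V x.
Proof.
move=> xa xb xc ab bc ac; apply: contrapT => nVx.
have below u v : meet x u < ht x -> meet x v < ht x -> d u v < d u x + d x v.
  move=> hu hv; rewrite (metric_sym u x) !mdist_delta.
  by have := meet_ultra u x v; rewrite (meetC u x) ge_min => /orP[]; lra.
have hxc : ht x < plen (pth (anch x)).
  rewrite /ht ltrBlDr ltrDl mdist_gt0; apply/eqP => e.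
  by apply: nVx; rewrite e; apply: anchV.
have above u v : ~ meet x u < ht x -> ~ meet x v < ht x -> 0 < d x u -> 0 < d x v ->
    d u v < d u x + d x v.
  have ab1 w : ~ meet x w < ht x -> 0 < d x w ->
      [/\ ht x < ht w, prefix (pth (anch x)) (pth (anch w)) & meet x w = ht x].
    move=> hw; have [m1 m2] := meet_le x w.
    have m : meet x w = ht x by apply/eqP; rewrite eq_le m1 leNgt; apply/negP.
    have hxl : ht x <= plen (lcp (pth (anch x)) (pth (anch w))).
      by rewrite -{1}m /meet ge_min lexx.
    split=> //; first by move: H; rewrite mdist_delta m; lra.
    apply: contrapT => np.
    have pl := lcp_prefixl (pth (anch x)) (pth (anch w)).
    have [e|ne] := eqVneq (lcp (pth (anch x)) (pth (anch w))) (pth (anch x)).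
      by apply: np; rewrite -e lcp_prefixr.
    have [h1 h2] := ancestor_dist pl ne.
    have dz : d (last r (lcp (pth (anch x)) (pth (anch w)))) x = 0.
      by have := mdist_ge0 (last r (lcp (pth (anch x)) (pth (anch w)))) x; lra.
    apply: nVx; move/mdist_positivity: dz => <-.
    have [s e] := prefixP pl; have := pthP (anchV x); rewrite {1}e.
    exact: V_last.
  move=> hu hv du dv; have [u1 u2 u3] := ab1 u hu du; have [v1 v2 v3] := ab1 v hv dv.
  rewrite (metric_sym u x) !mdist_delta u3 v3.
  suff : ht x < meet u v by lra.
  rewrite /meet !lt_min u1 v1 andbT.
  by rewrite andbT; apply: lt_le_trans hxc _; apply: plen_prefix; apply: lcp_max.
have h u v : 0 < d x u -> 0 < d x v -> btw d u x v ->
    ~ (meet x u < ht x <-> meet x v < ht x).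
  rewrite /btw => du dv e iff1.
  have [h1|h1] := pselect (meet x u < ht x).
    by have := below u v h1 (iff1.1 h1); lra.
  have h2 : ~ meet x v < ht x by move=> /iff1.
  by have := above u v h1 h2 du dv; lra.
have := h a b xa xb ab; have := h b c xb xc bc; have := h a c xa xc ac; tauto.
Qed.

(** A vertex between [x] and [y] is an ancestor of one of the two, hence it is the root or occurs in
    the root path of an anchor. *)
Lemma finite_vertices_btw_ x y : finite_set [set v | V v /\ btw d x v y].
Proof.
apply: (@sub_finite_set _ _ [set` r :: (pth (anch x) ++ pth (anch y))]); last first.
  exact: finite_seq.
move=> v [Vv]; rewrite /btw /= (metric_sym x v) !mdist_delta => bt.
have lem z : ht v <= meet v z -> v \in r :: pth (anch z).
  rewrite /meet le_min => /andP[h _]; move: h; rewrite (ht_vertex Vv) (anch_id Vv) => h.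
  have pl := lcp_prefixl (pth v) (pth (anch z)).
  suff <- : last r (lcp (pth v) (pth (anch z))) = v.
    have [s e] := prefixP (lcp_prefixr (pth v) (pth (anch z))).
    by rewrite [X in _ \in r :: X]e -cat_cons mem_cat mem_last.
  have [->|ne] := eqVneq (lcp (pth v) (pth (anch z))) (pth v).
    by have [_ -> _] := pthP Vv.
  rewrite -(anch_id Vv) in pl ne; rewrite (anch_id Vv) in ne.
  have [|h1 h2] := ancestor_dist pl; first by rewrite (anch_id Vv).
  apply: mdist_positivity; move: h2 h1; rewrite (anch_id Vv) (ht_vertex Vv) => h2 h1.
  by have := mdist_ge0 (last r (lcp (pth v) (pth (anch z)))) v; lra.
have := meet_ultra x v y; have [m1 m2] := meet_le v x; have [m3 m4] := meet_le v y.
rewrite (meetC x v) ge_min => /orP[h|h].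
  have : v \in r :: pth (anch y) by apply: lem; lra.
  by rewrite !inE mem_cat => /orP[->//|->]; rewrite !orbT.
have : v \in r :: pth (anch x) by apply: lem; lra.
by rewrite !inE mem_cat => /orP[->//|->]; rewrite !orbT.
Qed.

Lemma first_step v : V v -> v <> r -> exists w, [/\ adj r w & btw d r w v].
Proof.
move=> Vv vr; have [pv lv uv] := pthP Vv.
case e : (pth v) pv lv => [|w s] /=; first by move=> _ /esym.
move=> /andP[rw _] _; exists w; split=> //.
have [_ Vw] := adjV rw.
have ew : pth w = [:: w] by apply: (@pth_prefix v [:: w] s Vv); rewrite e.
have pw : prefix (pth w) (pth v) by rewrite ew e /= eqxx prefix0s.
have hw : plen (pth w) <= plen (pth v) by apply: plen_prefix.
have mw : meet w v = ht w.
  rewrite /meet (anch_id Vw) (anch_id Vv) !ht_vertex //.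
  have [s' ->] := prefixP pw; rewrite lcp_catl.
  rewrite min_l // le_min lexx /= plen_cat lerDl; exact: pairmap_ge0.
have m0 z : meet r z = 0.
  apply/eqP; rewrite eq_le; have [+ _] := meet_le r z; rewrite root_ht => ->.
  by rewrite !le_min root_ht lexx ht_ge0 pairmap_ge0.
rewrite /btw !mdist_delta !m0 root_ht mw; lra.
Qed.

End Rooted.

Lemma mdist_zh : zero_hyperbolic d.
Proof. by have [[r Vr] _ _ _ _] := smt_tree T; apply: (mdist_hyperbolic Vr). Qed.

Lemma mdist_geodesic : geodesic d.
Proof. by have [[r Vr] _ _ _ _] := smt_tree T; apply: (mdist_geodesic_ Vr). Qed.

Lemma branch_vertex x a b c : 0 < d x a -> 0 < d x b -> 0 < d x c ->
  btw d a x b -> btw d b x c -> btw d a x c -> V x.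
Proof. by have [[r Vr] _ _ _ _] := smt_tree T; apply: (branch_vertex_ Vr). Qed.

Lemma finite_vertices_btw x y : finite_set [set v | V v /\ btw d x v y].
Proof. by have [[r Vr] _ _ _ _] := smt_tree T; apply: (finite_vertices_btw_ Vr). Qed.

Lemma edge_segment e u v : edge_ends e u v -> e = [set y | btw d u y v].
Proof.
move=> ee; have [ec1 ec2] := edge_coord ee; have [eu ev Vu Vv] := edge_endsV ee.
apply/seteqP; split=> y /=; first by move=> /ec1; rewrite /btw; lra.
move=> by_; have [|z [ez dz]] := edge_point (t := d u y) ee.
  by move: by_; rewrite /btw; have := mdist_ge0 u y; have := mdist_ge0 y v; lra.
suff -> : y = z by [].
apply: mdist_positivity; apply: (btw_eq mdist_zh (x := u) (y := v)) => //.
by rewrite /btw ec1.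
Qed.

Lemma edge_btw_vertex e u v w : edge_ends e u v -> V w -> btw d u w v ->
  w = u \/ w = v.
Proof.
move=> ee Vw bw; have [_ _ eV] := ee.
have : [set u; v] w; last by [].
by rewrite -eV; split=> //; rewrite (edge_segment ee).
Qed.

Lemma adj_btw u v : V u -> V v ->
  adj u v <-> u <> v /\ forall w, V w -> btw d u w v -> w = u \/ w = v.
Proof.
move=> Vu Vv; split.
  move=> /adjP[e ee]; have [_ uv _] := ee; split=> // w; exact: edge_btw_vertex ee.
move=> [uv h]; have vu : v <> u by move=> /esym.
have [w [uw bw]] := first_step Vu Vv vu; have [_ Vw] := adjV uw.
case: (h w Vw bw) => [wu|<-//].
by move: uw => /adjP[e [_ + _]]; rewrite wu.
Qed.

End SimplicialTree.

(** * Convex sets and connectedness *)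

Definition convex_in (R : realType) (X : Type) (D : X -> X -> R) (S : set X) : Prop :=
  forall x y z, S x -> S y -> btw D x z y -> S z.

Lemma half_convex (R : realType) (X : Type) (D : X -> X -> R) (p q : X) :
  zero_hyperbolic D -> convex_in D [set z | btw D p q z].
Proof.
move=> H y y' w /= h1 h2 h3; have := max_btw H q h3.
move: h1 h2 h3; rewrite /btw; have := zh_tri H q p w; have := zh_tri H w p y; have := zh_tri H w p y'.
have := zhC H w q; have := zhC H y q; have := zhC H y' q; have := zhC H w y; have := zhC H w y'; lra.
Qed.

Lemma clamp_lip (R : realType) (c a b : R) : 0 <= c -> a <= b ->
  Num.max 0 (Num.min a c) <= Num.max 0 (Num.min b c) /\
  Num.max 0 (Num.min b c) - Num.max 0 (Num.min a c) <= b - a.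
Proof.
move=> c0 ab; have [a1|a1] := leP a c; have [b1|b1] := leP b c;
  rewrite ?(max_r c0) /Num.max; try (case: ltP => ?); try (case: ltP => ?); split; lra.
Qed.

Section TreeTopology.
Variables (R : realType) (T : simplicial_metric_tree R).
Local Notation d := (@mdist R T).

Lemma geodesic_path (x y : T) : exists s : R -> T,
  (forall a b, d (s a) (s b) <= `|a - b|) /\
  s @` `[0, d x y] = [set z | btw d x z y].
Proof.
pose cl (t : R) := Num.max 0 (Num.min t (d x y)).
have d0 : 0 <= d x y by apply: mdist_ge0.
have hcl t : 0 <= cl t <= d x y.
  by rewrite /cl ge_max le_max lexx d0 ge_min lexx orbT.
have ex t : exists z, d x z = cl t /\ d z y = d x y - cl t.
  exact: mdist_geodesic.
pose s t := sval (cid (ex t)).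
have hs t : d x (s t) = cl t /\ d (s t) y = d x y - cl t := svalP (cid (ex t)).
have bs t : btw d x (s t) y by rewrite /btw; have [-> ->] := hs t; lra.
have clE t : 0 <= t <= d x y -> cl t = t.
  by move=> /andP[t0 t1]; rewrite /cl min_l // max_r.
exists s; split.
  move=> a b; wlog ab : a b / a <= b.
    move=> h; have [/h//|/ltW/h] := leP a b.
    by rewrite metric_sym distrC.
  have clab : cl a <= cl b /\ cl b - cl a <= b - a.
    exact: clamp_lip.
  rewrite ler0_norm; last lra.
  have [ha _] := hs a; have [hb _] := hs b.
  have : btw d x (s a) (s b).
    by apply: (btw_between (mdist_zh T) (bs a) (bs b)); rewrite ha hb; case: clab.
  by rewrite /btw ha hb; lra.
apply/seteqP; split=> [_ [t _ <-]|z bz]; first exact: bs.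
have zd : 0 <= d x z <= d x y.
  by rewrite mdist_ge0 /=; move: bz; rewrite /= /btw => ->; rewrite lerDl mdist_ge0.
exists (d x z); first by rewrite /= in_itv.
apply: mdist_positivity; apply: (btw_eq (mdist_zh T) (bs _) bz).
by have [-> _] := hs (d x z); rewrite clE.
Qed.

Lemma lipschitz_continuous (s : R -> T) :
  (forall a b, d (s a) (s b) <= `|a - b|) -> continuous s.
Proof.
move=> h t; apply/metricType_numDomainType.cvgrPdist_lt => e e0.
near=> u; apply: le_lt_trans (h t u) _.
by near: u; apply: (@nbhsx_ballx _ R^o t e e0).
Unshelve. all: by end_near. Qed.

Lemma segment_connected_tree (x y : T) : connected [set z | btw d x z y].
Proof.
have [s [h <-]] := geodesic_path x y.
apply: connected_continuous_connected; first exact: segment_connected.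
by apply: continuous_subspaceT; apply: lipschitz_continuous.
Qed.

(** Minimality is stated with connected subsets, while later arguments use convexity; this lemma and
    [connected_convex] identify the two notions in a tree. *)
Lemma convex_connected (S : set T) : convex_in d S -> connected S.
Proof.
move=> cS; case: (pselect (S !=set0)) => [[x Sx]|/set0P/negP/negPn/eqP->]; last first.
  exact: connected0.
have -> : S = \bigcup_(y in S) [set z | btw d x z y].
  apply/seteqP; split=> [y Sy|z [y Sy]]; last exact: cS.
  by exists y => //=; rewrite /btw mdistxx addr0.
apply: bigcup_connected; last by move=> y _; apply: segment_connected_tree.
by exists x => y _ /=; rewrite /btw mdistxx add0r.
Qed.

(** The component of the complement of [z] that contains [x]: the geodesic from [u] to [x] misses
    [z]. *)
Let germ (z x u : T) := d u x < d u z + d z x.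

Lemma germ_near (z x u v : T) : d u v < d u z -> germ z x u -> germ z x v.
Proof.
rewrite /germ => h1 h2; have := zh4 (mdist_zh T) v x u z.
have e := (metric_sym u v, metric_sym z u, metric_sym z v, metric_sym x u, metric_sym x z, metric_sym x v).
have := metric_triangle u v z.
by case: e => [[[[[e1 e2] e3] e4] e5] e6] ? [|]; lra.
Qed.

Lemma germ_near' (z x u v : T) : d u v < d u z -> ~ germ z x u -> ~ germ z x v.
Proof.
rewrite /germ => h1 h2 h3; apply: h2; have := zh4 (mdist_zh T) u x v z.
have e := (metric_sym v u, metric_sym z u, metric_sym z v, metric_sym x u, metric_sym x z, metric_sym x v).
have := metric_triangle u v z.
by case: e => [[[[[e1 e2] e3] e4] e5] e6] ? [|]; lra.
Qed.

Lemma open_mdist (U : set T) :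
  (forall u, U u -> exists2 e, 0 < e & forall v, d u v < e -> U v) -> open U.
Proof.
move=> h; rewrite openE => u /h[e e0 he]; apply/nbhs_ballP; exists e => //= v.
by rewrite ballEmdist; apply: he.
Qed.

(** If [S] misses a point [z] between two of its points, the component of [x] in the complement of
    [z] cuts out a subset of [S] that is open and closed in [S], contains [x] and does not contain
    [y]. *)
Lemma connected_convex (S : set T) : connected S -> convex_in d S.
Proof.
move=> cS x y z Sx Sy bz; apply: contrapT => nSz.
have zx : d x z != 0 by apply/eqP => /mdist_positivity xz; apply: nSz; rewrite -xz.
have zx0 : 0 < d x z by rewrite lt_neqAle eq_sym zx mdist_ge0.
have pos u : S u -> 0 < d u z.
  by move=> Su; rewrite mdist_gt0; apply/eqP => uz; apply: nSz; rewrite -uz.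
suff h : S `&` germ z x = S.
  have : (S `&` germ z x) y by rewrite h.
  case=> _; rewrite /germ; move: bz; rewrite /btw.
  by rewrite (metric_sym y x) (metric_sym y z) (metric_sym z x); lra.
apply: cS.
- by exists x; split=> //; rewrite /germ mdistxx (metric_sym z); lra.
- exists (germ z x) => //; apply: open_mdist => u gu; exists (d u z).
    have := mdist_ge0 u z; rewrite le_eqVlt => /orP[/eqP uz|//].
    move: gu; rewrite /germ -uz; move/esym/mdist_positivity: uz => ->.
    by rewrite add0r ltxx.
  by move=> v uv; apply: germ_near gu.
- exists (germ z x `|` [set z]).
    rewrite -[X in closed X]setCK; apply: open_closedC; apply: open_mdist => u.
    move=> /not_orP[ngu nuz]; exists (d u z).
      by rewrite mdist_gt0; apply/eqP.
    move=> v uv; apply/not_orP; split; first exact: germ_near' ngu.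
    by move=> vz; move: uv; rewrite vz ltxx.
  apply/seteqP; split=> u [Su]; first by split=> //; left.
  by case=> // uz; exfalso; apply: nSz; rewrite -uz.
Qed.

End TreeTopology.

(** * Discrete sets and half-spaces *)

Section FiniteCount.
Variable I : choiceType.

(** On an infinite set the value is the default 0, which explains the finiteness hypotheses of the
    comparison lemmas. *)
Definition fcount (P : pred I) : nat := #|` fset_set [set i | P i]|%fset.

Lemma fcountE (S : {fset I}) (P : pred I) : (forall i, P i -> i \in S) ->
  fcount P = (\sum_(i <- S) P i)%N.
Proof.
move=> h; rewrite /fcount.
have -> : fset_set [set i | P i] = [fset i in S | P i]%fset.
  apply/fsetP => i; rewrite in_fset_set; last first.
    apply: (sub_finite_set (B := [set` S])); last exact: finite_fset.
    by move=> j /h.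
  rewrite !inE /=; apply/idP/idP => [|/andP[_ pi]]; last by rewrite inE.
  by rewrite inE /= => Pi; rewrite Pi andbT; apply: h.
rewrite card_fset_sum1 big_fset /= big_mkcond /=; apply: eq_bigr => i _.
by case: (P i).
Qed.

(** Sums of two counts are compared because the four-point condition compares sums of two
    distances. *)
Lemma fcount_leD (P Q P' Q' : pred I) :
  finite_set [set i | P' i] -> finite_set [set i | Q' i] ->
  (forall i, (P i + Q i <= P' i + Q' i)%N) ->
  (fcount P + fcount Q <= fcount P' + fcount Q')%N.
Proof.
move=> fP fQ h; pose S := (fset_set [set i | P' i] `|` fset_set [set i | Q' i])%fset.
have hP i : P' i -> i \in S by move=> Pi; rewrite inE in_fset_set // mem_set.
have hQ i : Q' i -> i \in S by move=> Pi; rewrite inE !in_fset_set // orbC mem_set.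
have hS i : P i || Q i -> i \in S.
  move=> hi; have := h i.
  case E1 : (P' i); first by rewrite hP.
  case E2 : (Q' i); first by rewrite hQ.
  by case: (P i) (Q i) hi => [] [].
rewrite !(@fcountE S) //; try by move=> i hi; apply: hS; rewrite hi ?orbT.
by rewrite -!big_split /=; apply: leq_sum.
Qed.

Lemma fcount0 : fcount (fun=> false) = 0%N.
Proof. by rewrite (@fcountE fset0) // big_seq_fset0. Qed.

Lemma fcount_le (P Q : pred I) : finite_set [set i | Q i] ->
  (forall i, P i -> Q i) -> (fcount P <= fcount Q)%N.
Proof.
move=> fQ h; have := @fcount_leD P (fun=> false) Q (fun=> false) fQ.
rewrite fcount0 !addn0; apply.
  by apply: (sub_finite_set (B := set0)) => // i.
by move=> i; have := h i; case: (P i) => //; case: (Q i) => // /(_ isT).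
Qed.

Lemma fcountD (P Q P' : pred I) : finite_set [set i | P i] -> finite_set [set i | Q i] ->
  (forall i, (P i + Q i = P' i)%N) -> (fcount P + fcount Q = fcount P')%N.
Proof.
move=> fP fQ h; apply/eqP; rewrite eqn_leq.
have f0 : finite_set [set i : I | false].
  by apply: (sub_finite_set (B := set0)) => // i.
have fP' : finite_set [set i | P' i].
  apply: (sub_finite_set (B := [set i | P i] `|` [set i | Q i])).
    by move=> i /=; have := h i; case: (P i) => /=; case: (Q i) => //=; case: (P' i) => //; tauto.
  by rewrite finite_setU.
rewrite -[fcount P']addn0 -fcount0; apply/andP; split; apply: fcount_leD => // i;
  by rewrite h addn0.
Qed.

Lemma fcount1 (P : pred I) i0 : P i0 -> (forall i, P i -> i = i0) -> fcount P = 1%N.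
Proof.
move=> h1 h2; rewrite (@fcountE [fset i0]%fset) ?big_seq_fset1 ?h1 //.
by move=> i /h2 ->; rewrite inE.
Qed.

Lemma eq_fcount (P Q : pred I) : P =1 Q -> fcount P = fcount Q.
Proof. by move=> h; congr (#|` fset_set _|)%fset; apply/seteqP; split=> i /=; rewrite h. Qed.

Lemma fcount_ge (P : pred I) (n : nat) (f : nat -> I) : finite_set [set i | P i] ->
  (forall m, (m < n)%N -> P (f m)) ->
  (forall m m', (m < n)%N -> (m' < n)%N -> f m = f m' -> m = m') -> (n <= fcount P)%N.
Proof.
move=> fP h1 h2; pose A := [set i | P i].
have u : uniq [seq f m | m <- iota 0 n].
  rewrite map_inj_in_uniq ?iota_uniq // => m m'; rewrite !mem_iota /= add0n.
  exact: h2.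
have : ([fset i in [seq f m | m <- iota 0 n]] `<=` fset_set A)%fset.
  apply/fsubsetP => i; rewrite !inE /= => /mapP[m]; rewrite mem_iota add0n => mn ->.
  by rewrite in_fset_set // mem_set //; apply: h1.
move=> /fsubset_leq_card; rewrite card_fseq undup_id //.
by rewrite size_map size_iota.
Qed.

Lemma fcount_eq0 (P : pred I) : finite_set [set i | P i] -> fcount P = 0%N ->
  forall i, ~~ P i.
Proof.
move=> fP h i; apply/negP => Pi; have := @fcount_ge P 1 (fun=> i) fP.
rewrite h => /(_ (fun _ _ => Pi)) hh; have // : (0 < 0)%N.
by apply: hh => m m' ? ? _; lia.
Qed.

End FiniteCount.

Lemma fcount_bij (I J : choiceType) (P : pred J) (f : I -> J) (g : J -> I) :
  cancel f g -> cancel g f -> finite_set [set j | P j] ->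
  fcount (fun i => P (f i)) = fcount P.
Proof.
move=> fK gK fP; rewrite (@fcountE _ (fset_set [set j | P j])); last first.
  by move=> j Pj; rewrite in_fset_set // mem_set.
rewrite (@fcountE _ (g @` fset_set [set j | P j])%fset); last first.
  move=> i Pi; apply/imfsetP; exists (f i); last by rewrite fK.
  by rewrite /= in_fset_set // mem_set.
rewrite big_imfset /=; last by move=> x y _ _; apply: (can_inj gK).
by apply: eq_bigr => j _; rewrite gK.
Qed.

Lemma finite_argmin (R : realType) (X : choiceType) (A : set X) (f : X -> R) :
  finite_set A -> A !=set0 -> exists2 a, A a & forall b, A b -> f a <= f b.
Proof.
move=> /finite_seqP[s ->]; elim: s => [[x]//|a s ih] _.
have [/ih[c /= cs hc]|e] := pselect ([set` s] !=set0); last first.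
  exists a => [|b]; first by rewrite /= mem_head.
  rewrite /= inE => /orP[/eqP->//|bs].
  by exfalso; apply: e; exists b.
have [ac|/ltW ca] := leP (f a) (f c).
  exists a => [|b]; first by rewrite /= mem_head.
  by rewrite /= inE => /orP[/eqP->//|/hc]; apply: le_trans.
exists c => [|b]; first by rewrite /= inE cs orbT.
by rewrite /= inE => /orP[/eqP->//|/hc].
Qed.

Section Discrete.
Variables (R : realType) (X : choiceType) (D : X -> X -> R).
Hypothesis (H : zero_hyperbolic D) (Geo : geodesic D).
Hypothesis Sep : forall x y, D x y = 0 -> x = y.
Variable Q : set X.

(** The possible vertex sets of a subdivision: they contain all branch points and are finite on
    every segment. *)
Record discrete : Prop := Discrete {
  disc_branch : forall x a b c, 0 < D x a -> 0 < D x b -> 0 < D x c ->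
    btw D a x b -> btw D b x c -> btw D a x c -> Q x;
  disc_finite : forall x y, finite_set [set z | Q z /\ btw D x z y] }.

Hypothesis QD : discrete.

Definition adjq (p q : X) : Prop :=
  [/\ Q p, Q q, p <> q & forall w, Q w -> btw D p w q -> w = p \/ w = q].

(** The side of the edge pq that contains [q]. Points in the interior of the edge lie on neither
    side, so the dichotomies below are stated for points of [Q]. *)
Definition half (p q : X) : set X := [set z | btw D p q z].

Lemma D_gt0 x y : x <> y -> 0 < D x y.
Proof.
by move=> xy; rewrite lt_neqAle eq_sym zh_ge0 // andbT; apply/eqP => /Sep.
Qed.

Lemma btw_xx x y : btw D x x y. Proof. by rewrite /btw (zh0 H) add0r. Qed.
Lemma btw_yy x y : btw D x y y. Proof. by rewrite /btw (zh0 H) addr0. Qed.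

Lemma adjqC p q : adjq p q -> adjq q p.
Proof.
case=> Qp Qq pq h; split=> //; first by move=> e; apply: pq.
by move=> w Qw /(btwC H) /(h w Qw) []; [right|left].
Qed.

Lemma adjq_gt0 p q : adjq p q -> 0 < D p q.
Proof. by case=> _ _ /D_gt0. Qed.

(** Unless the projection [m] of [z] to [p,q] is an endpoint, it would be a point of [Q] inside the
    edge, either as a branch point or as [z] itself. *)
Lemma half_or p q z : adjq p q -> Q z -> half p q z \/ half q p z.
Proof.
move=> [Qp Qq pq h] Qz; rewrite /half /=.
(* Distance from [p] to the projection, that is, the Gromov product of [z] and [q] at [p]. *)
pose t := (D p z + D p q - D q z) / 2.
have t0 : 0 <= t by rewrite /t; have := zh_tri H p q z; rewrite (zhC H q p); lra.
have t1 : t <= D p q by rewrite /t; have := zh_tri H q p z; lra.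
have [m [m1 m2]] : exists m, D p m = t /\ D m q = D p q - t by apply: Geo; lra.
have bm : btw D p m q by rewrite /btw; lra.
have mz : D m z = D p z - t.
  have := zh_tri H m p z; have := max_btw H z bm; rewrite /t in m1 m2 *; case; lra.
have [e|/eqP mp] := eqVneq m p.
  by right; rewrite /btw (zhC H q p); move: m1; rewrite e (zh0 H) /t; lra.
have [e|/eqP mq] := eqVneq m q.
  by left; rewrite /btw; move: m2; rewrite e (zh0 H) /t; lra.
exfalso; have Qm : Q m.
  have [<-//|/eqP mz'] := eqVneq z m.
  apply: (disc_branch QD (a := p) (b := q) (c := z)) => //.
  - exact: D_gt0.
  - exact: D_gt0.
  - by apply: D_gt0 => e; apply: mz'.
  - by rewrite /btw (zhC H q m) m2 mz; rewrite /t; lra.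
  - by rewrite /btw mz m1; lra.
by case: (h m Qm bm).
Qed.

Lemma half_not p q z : adjq p q -> half p q z -> ~ half q p z.
Proof.
by move=> /adjq_gt0; rewrite /half /= /btw (zhC H q p); lra.
Qed.

Lemma half_r p q : half p q q. Proof. exact: btw_yy. Qed.

Lemma half_cross p q u v : adjq p q -> adjq u v -> half p q u -> half q p v ->
  u = q /\ v = p.
Proof.
move=> pq [Qu Qv uv h] /(btwC H) h1 h2.
have [Qp Qq npq _] := pq.
have g := adjq_gt0 (adjqC pq).
have [b1 b2] := btw_chain H h1 h2 g.
move: h1; rewrite /btw (zhC H q p) => h1.
case: (h p Qp b1) => a; case: (h q Qq b2) => b; subst => //; rewrite ?(zh0 H) in h1 g *.
by exfalso; have := zhC H v u; lra.
Qed.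

Lemma half_disjoint p q u v : adjq p q -> adjq u v -> p <> u ->
  half q p u -> half v u p -> forall z, half p q z -> ~ half u v z.
Proof.
move=> pq uv npu h1 h2 z h3 h4.
have g1 := adjq_gt0 pq; have g2 := adjq_gt0 uv.
have pu := D_gt0 npu.
move: h1 h2 h3 h4; rewrite /half /= => h1 h2 h3 h4.
have h1' := btwC H h1; have h3' := btwC H h3.
have [h5 h6] := btw_chain H h1' h3 g1.
have [h7 h8] := btw_chain H (btwC H h2) h4 g2.
by move: h6 h8; rewrite /btw (zhC H u p); lra.
Qed.

Lemma half_disjoint_adj p q v : adjq p q -> adjq p v -> q <> v ->
  forall z, half p q z -> ~ half p v z.
Proof.
move=> pq pv nqv z h1 h2; apply: nqv.
have [Qp Qq npq hq] := pq; have [_ Qv npv hv] := pv.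
have [le|/ltW le] := leP (D p q) (D p v).
  case: (hv q Qq (btw_between H h1 h2 le)) => // e.
  by case: npq.
case: (hq v Qv (btw_between H h2 h1 le)) => // e.
by case: npv.
Qed.

(** By [half_cross], of two distinct edges each lies on one side of the other; the two sides that
    face away from each other are disjoint. *)
Lemma half_nested p q u v : adjq p q -> adjq u v ->
  [\/ forall z, half p q z -> ~ half u v z,
      forall z, half p q z -> ~ half v u z,
      forall z, half q p z -> ~ half u v z |
      forall z, half q p z -> ~ half v u z].
Proof.
move=> pq uv.
have [Qp Qq npq _] := pq; have [Qu Qv _ _] := uv.
have vu := adjqC uv; have qp := adjqC pq.
have main p' q' u' v' : adjq p' q' -> adjq u' v' -> half q' p' u' ->
    half q' p' v' -> half v' u' p' -> forall z, half p' q' z -> ~ half u' v' z.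
  move=> a1 a2 h1 h2 h3; have [e|/eqP n] := eqVneq p' u'; last exact: half_disjoint.
  subst; apply: half_disjoint_adj => // e; subst.
  by apply: (half_not (adjqC a1) h2); apply: half_r.
have [e|ne] := pselect ((u = p /\ v = q) \/ (u = q /\ v = p)).
  case: e => -[-> ->]; [constructor 2 => z | constructor 1 => z]; exact: half_not.
have side p' q' u' v' : adjq p' q' -> adjq u' v' ->
    ~ ((u' = p' /\ v' = q') \/ (u' = q' /\ v' = p')) ->
    (half p' q' u' /\ half p' q' v') \/ (half q' p' u' /\ half q' p' v').
  move=> a1 a2 n; have [_ _ _ _] := a1; have [Qu' Qv' _ _] := a2.
  have [h1|h1] := half_or a1 Qu'; have [h2|h2] := half_or a1 Qv'; [by left| | |by right].
    by have [? ?] := half_cross a1 a2 h1 h2; case: n; right.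
  by have [? ?] := half_cross (adjqC a1) a2 h1 h2; case: n; left.
have ne' : ~ ((p = u /\ q = v) \/ (p = v /\ q = u)).
  by move=> h; apply: ne; case: h => -[-> ->]; [left|right].
case: (side _ _ _ _ pq uv ne) => -[s1 s2]; case: (side _ _ _ _ uv pq ne') => -[s3 s4].
- by constructor 4; apply: main.
- by constructor 3; apply: main.
- by constructor 2; apply: main.
- by constructor 1; apply: main.
Qed.

Lemma first_stepq x y : Q x -> Q y -> x <> y -> exists q, adjq x q /\ btw D x q y.
Proof.
move=> Qx Qy xy.
have [||q [[Qq bq] qx] hq] :=
    @finite_argmin R _ [set z | (Q z /\ btw D x z y) /\ z <> x] (D x).
- by apply: sub_finite_set (disc_finite QD x y) => z [].
- by exists y; split; [split=> //; apply: btw_yy|move=> e; apply: xy].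
exists q; split=> //; split=> //; first by move=> e; apply: qx.
move=> w Qw bw; have [->|/eqP wx] := eqVneq w x; [by left|right].
have [b1 _] := btw_trans H bw bq.
have : D x q <= D x w by apply: hq.
move: bw; rewrite /btw => -> h; apply: Sep; have := zh_ge0 H w q; lra.
Qed.

(** Induction along the edge path from [x] to [y], on the number of points of [Q] between them. *)
Lemma chain_indq x (P : X -> Prop) : Q x -> P x ->
  (forall q q', P q -> adjq q q' -> btw D x q q' -> P q') -> forall y, Q y -> P y.
Proof.
move=> Qx Px step y; pose B y := fun z => `[< Q z /\ btw D x z y >].
have fB z : finite_set [set w | B z w].
  by apply: sub_finite_set (disc_finite QD x z) => w /asboolP.
have [n] := ubnP (fcount (B y)); elim: n y => // n ih y hn Qy.
have [->//|/eqP yx] := eqVneq y x.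
have [q [yq bq]] := first_stepq Qy Qx yx.
have [_ Qq nyq _] := yq.
apply: (step q); [apply: ih => // | exact: adjqC | exact: btwC].
suff : (fcount (B q) + fcount (pred1 y) <= fcount (B y) + @fcount X (fun=> false))%N.
  have -> : fcount (pred1 y) = 1%N.
    by apply: (@fcount1 _ _ y) => [|i /eqP//] /=; rewrite eqxx.
  by rewrite fcount0; lia.
apply: fcount_leD => //.
  by apply: (sub_finite_set (B := set0)) => // i.
move=> z /=; rewrite addn0; have bxy := btwC H bq.
case E1 : (B q z) => /=; last first.
  case: eqVneq => //= ->; rewrite (_ : B y y) //.
  by apply/asboolP; split=> //; apply: btw_yy.
move/asboolP: E1 => [Qz bz].
have -> : B y z by apply/asboolP; split=> //; have [] := btw_trans H bz bxy.
case: eqVneq => // zy; exfalso; move: bz bxy; rewrite zy /btw.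
have := D_gt0 nyq; rewrite (zhC H q y); lra.
Qed.

Definition sepq (p q x y : X) : bool := `[< half p q x >] (+) `[< half p q y >].

Lemma sepq_adj p q u v : adjq p q -> adjq u v ->
  sepq p q u v <-> (u = p /\ v = q) \/ (u = q /\ v = p).
Proof.
move=> pq uv; have [Qu Qv nuv _] := uv; rewrite /sepq; split; last first.
  have np : ~ half p q p by move=> h; apply: (half_not pq h); apply: half_r.
  by case=> -[-> ->]; rewrite (asboolT (half_r p q)) (asboolF np).
case: asboolP => hu; case: asboolP => hv //= _; [right|left].
  by case: (half_or pq Qv) => // h; apply: half_cross.
case: (half_or pq Qu) => // h; by apply: (half_cross (adjqC pq) uv h hv).
Qed.

Lemma sepq_step p q x u v : adjq p q -> adjq u v -> Q x -> btw D x u v ->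
  (sepq p q x u + sepq p q u v)%N = sepq p q x v.
Proof.
move=> pq uv Qx bx; have g := adjq_gt0 pq.
case E : (sepq p q u v); last first.
  by move: E; rewrite /sepq; do 3! case: `[< _ >].
suff : sepq p q x u = false.
  by move: E; rewrite /sepq; do 3! case: `[< _ >].
apply/negP => E2.
have np : ~ half p q p by move=> h; apply: (half_not pq h); apply: half_r.
move/(sepq_adj pq uv): E => [[eu ev]|[eu ev]]; subst; move: E2; rewrite /sepq.
  rewrite (asboolF np) addbF => /asboolP; move: bx; rewrite /half /= /btw.
  by rewrite (zhC H x q) (zhC H x p); lra.
rewrite (asboolT (half_r p q)) addbT; case: asboolP => // nh _.
case: (half_or pq Qx) => //; move: bx; rewrite /half /= /btw.
by rewrite (zhC H x p) (zhC H x q); rewrite (zhC H q p); lra.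
Qed.

Section Reps.
Variables (G : groupType) (a : G -> X -> X).
Hypothesis A : isom_action D a.
Hypothesis Qinv : forall g z, Q z -> Q (a g z).
Hypothesis free : forall g p q, adjq p q ->
  (a g p = p /\ a g q = q) \/ (a g p = q /\ a g q = p) -> g = 1%g.

Lemma a_inj g : injective (a g).
Proof. by move=> x y e; rewrite -(iaVl A g x) e (iaVl A). Qed.

Lemma adjq_act g p q : adjq p q -> adjq (a g p) (a g q).
Proof.
case=> Qp Qq pq h; split; [exact: Qinv|exact: Qinv|by move/a_inj|].
move=> w Qw bw; have bw' : btw D p (a g^-1%g w) q.
  by rewrite -(iaVl A g p) -(iaVl A g q); apply: btw_act.
by case: (h (a g^-1%g w) (Qinv _ Qw) bw') => <-; [left|right]; rewrite (iaVr A).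
Qed.

Lemma half_act g p q z : half (a g p) (a g q) z <-> half p q (a g^-1%g z).
Proof.
rewrite /half /= /btw -{1 2}(iaVr A g z) !(iaD A) //.
Qed.

(** One oriented representative for each orbit of unoriented edges. As no element but 1 stabilizes
    or inverts an edge, an index and a group element then name an edge uniquely, together with an
    orientation. *)
Record edge_reps n (r : 'I_n -> X * X) : Prop := EdgeReps {
  er_adj : forall i, adjq (r i).1 (r i).2;
  er_cover : forall p q, adjq p q -> exists i g,
    (p = a g (r i).1 /\ q = a g (r i).2) \/ (p = a g (r i).2 /\ q = a g (r i).1);
  er_uniq : forall i j g,
    (a g (r i).1 = (r j).1 /\ a g (r i).2 = (r j).2) \/
    (a g (r i).1 = (r j).2 /\ a g (r i).2 = (r j).1) -> i = j }.

Variables (n : nat) (r : 'I_n -> X * X).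
Hypothesis RP : edge_reps r.

Lemma er_inj i j g h :
  (a g (r i).1 = a h (r j).1 /\ a g (r i).2 = a h (r j).2) \/
  (a g (r i).1 = a h (r j).2 /\ a g (r i).2 = a h (r j).1) -> i = j /\ g = h.
Proof.
move=> e; have e' : (a (h^-1 * g)%g (r i).1 = (r j).1 /\ a (h^-1 * g)%g (r i).2 = (r j).2) \/
    (a (h^-1 * g)%g (r i).1 = (r j).2 /\ a (h^-1 * g)%g (r i).2 = (r j).1).
  by rewrite !(iaM A); case: e => -[-> ->]; rewrite !(iaVl A); [left|right].
have ij := er_uniq RP e'; split=> //; subst j.
have := free (er_adj RP i) e' => /(congr1 (fun x => h * x)%g).
by rewrite mulgA mulgV mul1g mulg1.
Qed.

Definition sepr i x y g : bool := sepq (a g (r i).1) (a g (r i).2) x y.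

(** Each step of an edge path crosses exactly one translate of one representative, and a geodesic
    crosses no edge twice. This turns the metric into a weighted count of walls. *)
Lemma dist_count x y : Q x -> Q y ->
  (forall i, finite_set [set g | sepr i x y g]) /\
  D x y = \sum_(i < n) D (r i).1 (r i).2 * (fcount (sepr i x y))%:R.
Proof.
move=> Qx; move: y; apply: (chain_indq Qx).
  have e i : sepr i x x =1 (fun=> false) by move=> g; rewrite /sepr /sepq addbb.
  split=> [i|]; first by apply: (sub_finite_set (B := set0)) => // g /=; rewrite e.
  by rewrite (zh0 H) big1 // => i _; rewrite (eq_fcount (e i)) fcount0 mulr0.
move=> q q' [fq dq] qq' bq.
have [i0 [g0 h0]] := er_cover RP qq'.
have one i g : sepr i q q' g = (i == i0) && (g == g0).
  apply/idP/idP.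
    move=> /(sepq_adj (adjq_act g (er_adj RP i)) qq') h.
    suff [-> ->] : i = i0 /\ g = g0 by rewrite !eqxx.
    by apply: er_inj; case: h => -[<- <-]; case: h0 => -[<- <-]; [left|right|right|left].
  move=> /andP[/eqP-> /eqP->]; apply/(sepq_adj (adjq_act g0 (er_adj RP i0)) qq').
  by case: h0 => -[<- <-]; [left|right].
have stp i g : (sepr i x q g + sepr i q q' g)%N = sepr i x q' g.
  exact: (sepq_step (adjq_act g (er_adj RP i)) qq').
have f1 i : finite_set [set g | sepr i q q' g].
  apply: (sub_finite_set (B := [set g0])) => // g /=.
  by rewrite one => /andP[_ /eqP].
split=> [i|].
  apply: (sub_finite_set (B := [set g | sepr i x q g] `|` [set g | sepr i q q' g])).
    by move=> g /=; have := stp i g; case: (sepr i x q g); case: (sepr i q q' g);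
      case: (sepr i x q' g) => //; tauto.
  by rewrite finite_setU.
rewrite bq dq.
have e i : fcount (sepr i x q') = (fcount (sepr i x q) + (i == i0))%N.
  rewrite -(fcountD (fq i) (f1 i) (stp i)); congr addn.
  case: (eqVneq i i0) => [->|ne].
    apply: (@fcount1 _ _ g0) => [|g]; first by rewrite one !eqxx.
    by rewrite one => /andP[_ /eqP].
  by rewrite /= -[RHS](@fcount0 G); apply: eq_fcount => g; rewrite one (negbTE ne).
under [RHS]eq_bigr do rewrite e natrD mulrDr.
rewrite big_split /=; congr +%R; rewrite (bigD1 i0) //= eqxx mulr1 big1 ?addr0.
  by case: h0 => -[-> ->]; rewrite (iaD A) // (zhC H).
by move=> i /negbTE ->; rewrite mulr0.
Qed.

End Reps.

End Discrete.

(** * Edge orbits *)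

Lemma reps_seq (T : eqType) (E : T -> T -> Prop) (s : seq T) :
  (forall x, E x x) -> (forall x y, E x y -> E y x) ->
  (forall x y z, E x y -> E y z -> E x z) ->
  exists r : seq T, [/\ {subset r <= s}, forall x, x \in s -> exists2 y, y \in r & E x y &
    forall x0 i j, (i < size r)%N -> (j < size r)%N -> E (nth x0 r i) (nth x0 r j) -> i = j].
Proof.
move=> Er Es Et; elim: s => [|a s [r [h1 h2 h3]]]; first by exists [::].
have [[y yr Ea]|na] := pselect (exists2 y, y \in r & E a y).
  exists r; split=> // [z /h1 zs|z]; first by rewrite inE zs orbT.
  by rewrite inE => /orP[/eqP->|/h2//]; exists y.
exists (a :: r); split.
- by move=> z; rewrite !inE => /orP[->//|/h1 ->]; rewrite orbT.
- move=> z; rewrite inE => /orP[/eqP->|/h2[y yr Ezy]]; first by exists a; rewrite ?mem_head.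
  by exists y => //; rewrite inE yr orbT.
- move=> x0 [|i] [|j] //= hi hj e.
  + by case: na; exists (nth x0 r j) => //; rewrite mem_nth.
  + by case: na; exists (nth x0 r i); [rewrite mem_nth|apply: Es].
  + by congr _.+1; apply: h3 e.
Qed.

(** * Generation of the free product by its factors and free generators *)

Section Generation.
Variables (p k : nat) (Gi : 'I_p -> groupType) (G : groupType)
  (iota : forall i, {multiplicative Gi i -> G}) (x : 'I_k -> G).

Section Subgroup.
Variable P : set G.
Hypotheses (P1 : P 1%g) (PM : forall g h, P g -> P h -> P (g * h)%g)
  (PV : forall g, P g -> P g^-1%g).

Definition subg_of : Type := {g : G | `[< P g >]}.
HB.instance Definition _ := Choice.on subg_of.
Let e1 : subg_of := exist _ 1%g (asboolT P1).
Let m (a b : subg_of) : subg_of :=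
  exist _ (sval a * sval b)%g (asboolT (PM (asboolW (svalP a)) (asboolW (svalP b)))).
Let v (a : subg_of) : subg_of := exist _ (sval a)^-1%g (asboolT (PV (asboolW (svalP a)))).
Let mA : associative m.
Proof. by move=> a b c; apply: val_inj; rewrite /= mulgA. Qed.
Let m1l : left_id e1 m.
Proof. by move=> a; apply: val_inj; rewrite /= mul1g. Qed.
Let m1r : right_id e1 m.
Proof. by move=> a; apply: val_inj; rewrite /= mulg1. Qed.
Let mV : left_inverse e1 v m.
Proof. by move=> a; apply: val_inj; rewrite /= mulVg. Qed.
Let mVr : right_inverse e1 v m.
Proof. by move=> a; apply: val_inj; rewrite /= mulgV. Qed.
HB.instance Definition _ := isGroup.Build subg_of mA m1l m1r mV mVr.

Let incl (a : subg_of) : G := sval a.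
Let inclM : {morph incl : a b / (a * b)%g}. Proof. by []. Qed.
HB.instance Definition _ := isMultiplicative.Build subg_of G incl inclM.

(** The universal property gives a homomorphism to the subgroup [P]; followed by the inclusion it
    agrees with the identity on the generators, so by uniqueness every element lies in [P]. *)
Lemma free_product_generated : is_free_product iota x ->
  (forall i a, P (iota i a)) -> (forall j, P (x j)) -> forall g, P g.
Proof.
move=> hG Pi Px g.
pose f i (a : Gi i) : subg_of := exist _ (iota i a) (asboolT (Pi i a)).
have fM i : {morph (f i) : a b / (a * b)%g}.
  by move=> a b; apply: val_inj; rewrite /= gmulfM.
pose F i : {multiplicative Gi i -> subg_of} :=
  HB.pack (f i) (isMultiplicative.Build (Gi i) subg_of (f i) (fM i)).
have [[phi [h1 h2]] _] := hG subg_of F (fun j => exist _ (x j) (asboolT (Px j))).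
have [_ /(_ (incl \o phi) idfun) h] := hG G iota x.
have <- : incl (phi g) = g.
  by apply: h => [i a|j] /=; rewrite ?h1 ?h2.
exact: asboolW (svalP (phi g)).
Qed.
End Subgroup.
End Generation.

Section Convex.
Variables (R : realType) (X : Type) (D : X -> X -> R).
Hypothesis H : zero_hyperbolic D.

(** Triangles are tripods: one side is covered by the other two. *)
Lemma btw_split x y z c : btw D x z y -> btw D x z c \/ btw D c z y.
Proof.
have := zh4 H x y z c; rewrite /btw (zhC H y c) (zhC H c z) (zhC H y z).
have := zh_tri H z x c; have := zh_tri H z c y; rewrite (zhC H c z).
by move=> ? ? [] ? ?; [right|left]; lra.
Qed.

Lemma convexU (A B : set X) c : convex_in D A -> convex_in D B -> A c -> B c ->
  convex_in D (A `|` B).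
Proof.
move=> cA cB Ac Bc x y z [Ax|Bx] [Ay|By] b.
- by left; apply: cA b.
- case: (btw_split c b) => h; [left|right]; [exact: cA h|exact: cB h].
- case: (btw_split c b) => h; [right|left]; [exact: cB h|exact: cA h].
- by right; apply: cB b.
Qed.

Lemma segment_convex u v : convex_in D [set z | btw D u z v].
Proof.
move=> x y z /= hx hy bz.
have [h|h] := leP (D u x) (D u y).
  have b1 := btw_between H hx hy h.
  case: (btw_split u bz) => h2.
    have h3 := btwC H h2; have [b2 _] := btw_trans H h3 b1.
    by have [] := btw_trans H b2 hy.
  by have [] := btw_trans H h2 hy.
have b1 := btw_between H hy hx (ltW h).
case: (btw_split u bz) => h2.
  by have h3 := btwC H h2; have [] := btw_trans H h3 hx.
by have [] := btw_trans H h2 hy.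
Qed.

End Convex.

Section OuterTree.
Variables (R : realType) (p k : nat) (Gi : 'I_p -> groupType) (G : groupType)
  (iota : forall i, {multiplicative Gi i -> G}) (x : 'I_k -> G).
Hypothesis hG : is_free_product iota x.
Hypothesis hGi : forall i : 'I_p, exists a : Gi i, a <> 1%g.

(** The homomorphism that is the identity on the factor [i] and trivial on the other factors and on
    the free part is a retraction. The case distinction on [j = i] transports the identity along an
    equality of indices. *)
Lemma factor_injective i : injective (iota i).
Proof.
pose c j : Gi j -> Gi i := fun=> 1%g.
have cM j : {morph (c j) : a b / (a * b)%g} by move=> a b; rewrite /c mulg1.
pose f j : {multiplicative Gi j -> Gi i} :=
  match pselect (j = i) with
  | left e => match e in _ = y return {multiplicative Gi j -> Gi y} with
      erefl => idfun end
  | right _ => HB.pack (c j) (isMultiplicative.Build (Gi j) (Gi i) (c j) (cM j))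
  end.
have fi a : f i a = a.
  by rewrite /f; case: pselect => // e; rewrite (eq_irrelevance e erefl).
have [[phi [h _]] _] := hG f (fun=> 1%g).
by move=> a b e; rewrite -(fi a) -(fi b) -!h e.
Qed.

Lemma factor_nontrivial i : exists a : Gi i, iota i a <> 1%g.
Proof.
have [a ha] := hGi i; exists a => e; apply: ha; apply: (@factor_injective i).
rewrite e; apply: (mulgI (iota i 1%g)).
by rewrite -gmulfM !mulg1.
Qed.

(** * Elliptic and hyperbolic elements when edge stabilizers are trivial *)

Section OneTree.
Variable T : gtree R G.
Local Notation d := (@mdist R T).
Local Notation V := (@vertices R T).
Let H := mdist_zh T.
Let Geo := mdist_geodesic (T := T).

Lemma act_isom : isom_action d (@act R G T).
Proof. by split; [exact: act1|exact: actM|exact: act_isometry]. Qed.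
Let A := act_isom.

Lemma mdist_sep (u v : T) : d u v = 0 -> u = v.
Proof. exact: mdist_positivity. Qed.

Lemma vertices_discrete : discrete d V.
Proof. split; [exact: branch_vertex|exact: finite_vertices_btw]. Qed.

Lemma adjq_edge u v : adjq d V u v <-> exists e, edge_ends e u v.
Proof.
split=> [[Vu Vv uv h]|[e ee]].
  by apply/adjP/adj_btw.
have [_ _ Vu Vv] := edge_endsV ee; have [_ uv _] := ee.
by split=> // w; apply: edge_btw_vertex ee.
Qed.

Lemma adjq_segment u v : adjq d V u v -> edge_ends [set y | btw d u y v] u v.
Proof. by move=> /adjq_edge[e ee]; rewrite -(edge_segment ee). Qed.

Lemma edge_exists_ends e : edges e -> exists u v : T, edge_ends e u v.
Proof.
move=> He; have [l [s [l0 e1 h1 eV]]] := smt_edges He.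
exists (s 0), (s l); split=> // e2.
have := h1 0 l; rewrite -e2 mdistxx sub0r normrN gtr0_norm // !lexx ltW //=.
by move=> /(_ isT isT); lra.
Qed.

Lemma act_bij_segment g u v : act g @` [set y : T | btw d u y v] =
  [set y | btw d (act g u) y (act g v)].
Proof.
apply/seteqP; split=> [_ [y /= b <-]|y /= b]; first exact: btw_act.
exists (act g^-1%g y); last by rewrite (iaVr A).
by rewrite /= -(iaVl A g u) -(iaVl A g v); apply: btw_act.
Qed.

Hypothesis free : trivial_edge_stabilizers T.

Lemma fix_nonvertex g (z : T) : ~ V z -> act g z = z -> g = 1%g.
Proof.
move=> nVz gz; have [_ _ h1 h2 _] := smt_tree T.
case: (h2 z) => [//|[e He ez]]; apply: (free He).
apply: contrapT => ne; apply: nVz.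
apply: (h1 _ _ (act_edges g He) He ne); split=> //.
by exists z.
Qed.

Lemma midpoint_fixed g u v m : btw d u m v -> d u m = d m v ->
  (act g u = u /\ act g v = v) \/ (act g u = v /\ act g v = u) -> act g m = m.
Proof.
move=> b e h; apply: mdist_sep.
have b' := btw_act A g b.
have e' : d (act g u) (act g m) = d (act g m) (act g v) by rewrite !(iaD A).
case: h => -[e1 e2]; rewrite e1 e2 in b' e'.
  apply: (btw_eq H b' b); move: b b'; rewrite /btw; lra.
apply: (btw_eq H (btwC H b') b); move: b b'; rewrite /btw.
have := (zhC H u (act g m), zhC H v u, zhC H v (act g m)) => -[[]]; lra.
Qed.

Lemma midpoint_ex u v : exists m, btw d u m v /\ d u m = d m v.
Proof.
have [|m [h1 h2]] := @Geo u v (d u v / 2).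
  by have := mdist_ge0 u v; lra.
by exists m; rewrite /btw; split; lra.
Qed.

(** The infimum is attained at the point found by [translation_axis], so the length defined as an
    infimum is also the asymptotic one. *)
Lemma translation_lengthP g : exists m : T,
  translation_length T g = d m (act g m) /\
  forall n, d m (act (g ^+ n)%g m) = n%:R * translation_length T g.
Proof.
have [[v _] _ _ _ _] := smt_tree T.
have [m hm] := translation_axis H A Geo v g; exists m.
suff e : translation_length T g = d m (act g m) by rewrite e.
have am : asym d (@act R G T) m g (d m (act g m)).
  by exists 0 => n; rewrite hm subrr normr0.
apply/eqP; rewrite eq_le; apply/andP; split.
  apply: ge_inf; last by exists m.
  by exists 0 => _ [y _ <-]; apply: mdist_ge0.
apply: lb_le_inf; first by exists (d m (act g m)), m.
by move=> _ [y _ <-]; apply: (asym_le H A y am).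
Qed.

Lemma translation_length_asym g (y : T) :
  asym d (@act R G T) y g (translation_length T g).
Proof.
have [m [e hm]] := translation_lengthP g; apply: (asym_base H A (x := m)).
by exists 0 => n; rewrite hm subrr normr0.
Qed.

Lemma translation_length_ge0 g : 0 <= translation_length T g.
Proof. by have [m [-> _]] := translation_lengthP g; apply: mdist_ge0. Qed.

Lemma translation_length0 g : translation_length T g = 0 <-> exists y : T, act g y = y.
Proof.
split=> [e|[y gy]].
  have [m [e' _]] := translation_lengthP g; exists m; apply/esym/mdist_sep.
  by rewrite -e' e.
apply/eqP; rewrite eq_le translation_length_ge0 andbT.
apply: le_trans (asym_le H A y (translation_length_asym g y)) _.
by rewrite gy mdistxx.
Qed.

Section Invariant.
Variable Q : set T.
Hypotheses (QD : discrete d Q) (VQ : V `<=` Q).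

Lemma adjq_free g u v : adjq d Q u v ->
  (act g u = u /\ act g v = v) \/ (act g u = v /\ act g v = u) -> g = 1%g.
Proof.
move=> [Qu Qv uv h] e; have [m [b1 b2]] := midpoint_ex u v.
apply: (fix_nonvertex (z := m)); last exact: midpoint_fixed e.
move=> /VQ Qm; case: (h m Qm b1) => em; subst m; apply: uv.
  by apply/esym/mdist_sep; rewrite metric_sym -b2 mdistxx.
by apply: mdist_sep; rewrite b2 mdistxx.
Qed.
End Invariant.

Lemma fix_unique g (y z : T) : act g y = y -> act g z = z -> y <> z -> g = 1%g.
Proof.
move=> gy gz yz.
have [Vy|] := pselect (V y); last by move=> h; apply: fix_nonvertex gy.
have [Vz|] := pselect (V z); last by move=> h; apply: fix_nonvertex gz.
have [q [yq bq]] := first_stepq H mdist_sep vertices_discrete Vy Vz yz.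
have gq : act g q = q.
  apply: mdist_sep; have := btw_act A g bq; rewrite gy gz => b.
  by apply: (btw_eq H b bq); rewrite -{1}gy (iaD A).
by apply: (adjq_free (Q := V) _ yq) => //; left.
Qed.

(** If the segments from [u] to [v] and to [g v] had a common initial part, [g] would fix its other
    end too, and an element fixing two points is trivial. *)
Lemma rotation_turn g (u v : T) : act g u = u -> g <> 1%g -> btw d v u (act g v).
Proof.
move=> gu g1; apply: contrapT; rewrite /btw => nb.
have e : d u (act g v) = d u v by rewrite -{1}gu (iaD A).
have lt : d v (act g v) < d v u + d u (act g v).
  by rewrite lt_neqAle metric_triangle andbT; apply/eqP.
(* Length of the common initial part of the segments from [u] to [v] and to [g v]. *)
pose c := d u v - d v (act g v) / 2.
have [|z [z1 z2]] := @Geo u v c.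
  have := mdist_ge0 v (act g v); move: lt; rewrite /c e (zhC H v u); lra.
have bz : btw d u z v by rewrite /btw; lra.
have zg : d z (act g v) = d u v - c.
  have := zh_tri H z u (act g v).
  have := max_btw H (act g v) bz; rewrite e z1 z2 /c; case; lra.
have bz' : btw d u z (act g v) by rewrite /btw z1 zg e; lra.
have bz2 : btw d u (act g z) (act g v) by rewrite -{1}gu; apply: btw_act.
have gz : act g z = z.
  by apply: mdist_sep; apply: (btw_eq H bz2 bz'); rewrite -{1}gu (iaD A).
apply: g1; apply: (fix_unique gu gz) => uz; move: z1; rewrite -uz mdistxx.
by move: lt; rewrite /c e (zhC H v u); lra.
Qed.

(** By [rotation_turn] the points v, u, gv = ghv, ghu and their further translates lie on a line
    along which gh translates. So two elliptic elements with different fixed points have a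
    hyperbolic product. *)
Lemma elliptic_product g h (u v : T) : act g u = u -> act h v = v ->
  g <> 1%g -> h <> 1%g -> u <> v -> 0 < translation_length T (g * h)%g.
Proof.
move=> gu hv g1 h1 uv.
have duv : 0 < d v u by rewrite mdist_gt0; apply/eqP => e; apply: uv.
have ghv : act (g * h)%g v = act g v by rewrite actM hv.
have t1 := rotation_turn v gu g1.
have t2 : btw d u (act g v) (act (g * h)%g u).
  by rewrite actM -{1}gu; apply: btw_act => //; apply: rotation_turn.
have t3 : btw d (act g v) (act (g * h)%g u) (act (g * h)%g (act g v)).
  by rewrite -{1}ghv; apply: btw_act.
have du : d u (act g v) = d v u by rewrite -{1}gu (iaD A) (zhC H).
have [|b1 _] := btw_chain H t1 t2; first by rewrite du.
have [|_ b2] := btw_chain H b1 t3.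
  by rewrite -ghv (iaD A).
have e0 : d v (act (g * h)%g v) = d v u + d v u by rewrite ghv t1 du.
have pos : 0 < d v (act (g * h)%g v) by rewrite e0; lra.
have := axis_asym H A (m := v) (g := (g * h)%g); rewrite ghv => /(_ b2).
rewrite -ghv => /(_ pos) ax.
suff -> : translation_length T (g * h)%g = d v (act (g * h)%g v) by [].
apply: (asym_uniq (translation_length_asym (g * h)%g v)).
by exists 0 => n; rewrite ax subrr normr0.
Qed.

Lemma discrete_reps (Q : set T) (s : seq T) : discrete d Q -> V `<=` Q ->
  (forall g z, Q z -> Q (act g z)) ->
  (forall u v, adjq d Q u v -> exists g a b,
    [/\ a \in s, b \in s, btw d a (act g u) b & btw d a (act g v) b]) ->
  exists n (r : 'I_n -> T * T), edge_reps d Q (@act R G T) r.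
Proof.
move=> QD VQ Qi hs.
pose F := \bigcup_(a in [set` s]) \bigcup_(b in [set` s]) [set z | Q z /\ btw d a z b].
have : finite_set F.
  apply: bigcup_finite; first exact: finite_seq.
  move=> a _; apply: bigcup_finite; first exact: finite_seq.
  by move=> b _; apply: disc_finite.
move=> /finite_seqP[t Ft].
pose E (e f : T * T) := exists g, (act g e.1 = f.1 /\ act g e.2 = f.2) \/
  (act g e.1 = f.2 /\ act g e.2 = f.1).
have Er e : E e e by exists 1%g; left; rewrite !act1.
have Es e f : E e f -> E f e.
  case=> g h; exists g^-1%g.
  by case: h => -[<- <-]; rewrite !(iaVl A); [left|right].
have Et e f h : E e f -> E f h -> E e h.
  case=> g h1 [g' h2]; exists (g' * g)%g; rewrite !actM.
  by case: h1 => -[-> ->]; case: h2 => -[-> ->]; [left|right|right|left].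
pose l := [seq e <- allpairs pair t t | `[< adjq d Q e.1 e.2 >]].
have [r [r1 r2 r3]] := reps_seq l Er Es Et.
exists (size r), (fun i => tnth (in_tuple r) i); split.
- move=> i; have := r1 _ (mem_tnth i (in_tuple r)).
  by rewrite mem_filter => /andP[/asboolP].
- move=> u v uv; have [g [a [b [sa sb ba bb]]]] := hs u v uv.
  have uv' := adjq_act A Qi g uv.
  have [Qu Qv _ _] := uv'.
  have Fu : F (act g u) by exists a => //; exists b.
  have Fv : F (act g v) by exists a => //; exists b.
  rewrite Ft in Fu Fv.
  have : (act g u, act g v) \in l.
    rewrite mem_filter; apply/andP; split; first exact/asboolP.
    by apply/allpairsP; exists (act g u, act g v).
  move=> /r2[f fr /Es[h hf]].
  have [i ei] : exists i : 'I_(size r), f = tnth (in_tuple r) i by apply/tnthP.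
  exists i, (g^-1 * h)%g; rewrite -ei !actM.
  by case: hf => -[-> ->]; rewrite !(iaVl A); [left|right].
- move=> i j g h; pose e0 := tnth (in_tuple r) i.
  have hi : nth e0 r i = tnth (in_tuple r) i by rewrite (tnth_nth e0).
  have hj : nth e0 r j = tnth (in_tuple r) j by rewrite (tnth_nth e0).
  apply/val_inj/(r3 e0); rewrite ?ltn_ord //; exists g; rewrite hi hj; exact: h.
Qed.

End OneTree.

Section InOuter.
Variable T : gtree R G.
Hypothesis HT : in_outer iota T.
Let Geo := mdist_geodesic (T := T).
Local Notation d := (@mdist R T).
Local Notation V := (@vertices R T).
Let H := mdist_zh T.
Let A := act_isom T.

Lemma outer_free : trivial_edge_stabilizers T.
Proof. by have [_ [_ ?] _ _] := HT. Qed.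

Lemma invariant_convex_full (S : set T) : S !=set0 -> convex_in d S ->
  (forall g z, S z -> S (act g z)) -> S = setT.
Proof.
have [_ [m _] _ _] := HT => S0 cS Si; apply: m => //.
exact: convex_connected.
Qed.

Lemma factor_fixed i : exists v : T, V v /\ forall a, act (iota i a) v = v.
Proof.
have [_ _ /(_ i)[v [Vv [h e] _]] _] := HT; exists (act h v).
split=> [|a]; first exact: act_vertices.
have : stab v (iota i a ^ h)%g by rewrite e; exists a.
rewrite /stab /= conjgE !actM => /(congr1 (act h)).
by rewrite (iaVr A).
Qed.

(** Cocompactness. The set [S] covered by the translates of finitely many segments from [v], to the
    points x_j v and to one fixed point per factor, is invariant. Since the x_j and the factors
    generate G, any two of its points are joined inside it, so by minimality it is the whole
    tree. *)
Lemma finite_hull : exists v (s : seq T), (forall b, b \in v :: s -> V b) /\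
  forall z : T, exists g b, b \in s /\ btw d v (act g z) b.
Proof.
have [[v Vv] _ _ _ _] := smt_tree T.
have [w hw] := choice factor_fixed.
pose s := v :: [seq act (x j) v | j <- enum 'I_k] ++ [seq w i | i <- enum 'I_p].
exists v, s; split.
  move=> b; rewrite inE => /orP[/eqP->//|].
  rewrite inE => /orP[/eqP->//|]; rewrite mem_cat => /orP[] /mapP[c _ ->].
    exact: act_vertices.
  by have [] := hw c.
pose S := [set z : T | exists g b, b \in s /\ btw d v (act g z) b].
have Si g z : S z -> S (act g z).
  move=> [h [b [sb bb]]]; exists (h * g^-1)%g, b; split=> //.
  by rewrite actM (iaVl A).
have Sv : S v.
  by exists 1%g, v; rewrite act1 mem_head /btw !mdistxx addr0.
(* Two points are linked when some convex subset of [S] contains both; this is transitive because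
   the union of two convex sets with a common point is convex. *)
pose linked (u z : T) := exists Y, [/\ convex_in d Y, Y `<=` S, Y u & Y z].
have lt u y z : linked u y -> linked y z -> linked u z.
  move=> [Y [c1 s1 y1 y2]] [Z [c2 s2 z1 z2]]; exists (Y `|` Z); split.
  - exact: convexU c1 c2 y2 z1.
  - by move=> t [/s1|/s2].
  - by left.
  - by right.
have lS u z : linked u z -> linked z u by move=> [Y [? ? ? ?]]; exists Y.
have lG g u z : linked u z -> linked (act g u) (act g z).
  move=> [Y [c1 s1 y1 y2]]; exists [set t | Y (act g^-1%g t)]; split.
  - by move=> a b c /= Ya Yb /(btw_act A g^-1%g); apply: c1.
  - by move=> t /= /s1 /(Si g); rewrite (iaVr A).
  - by rewrite /= (iaVl A).
  - by rewrite /= (iaVl A).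
have lseg b z : b \in s -> btw d v z b -> linked v z.
  move=> sb bz; exists [set t | btw d v t b]; split=> //.
  - exact: segment_convex.
  - by move=> t /= bt; exists 1%g, b; rewrite act1.
  - by rewrite /= /btw mdistxx add0r.
have lend b : b \in s -> linked v b.
  by move=> sb; apply: lseg sb _; rewrite /btw mdistxx addr0.
have N : forall g, linked v (act g v).
  apply: (free_product_generated (P := [set g | linked v (act g v)])) hG _ _.
  - by rewrite /= act1; apply: lend; rewrite mem_head.
  - by move=> g h /= hg /(lG g) hh; rewrite actM; apply: lt hg hh.
  - by move=> g /= /(lG g^-1%g); rewrite (iaVl A); apply: lS.
  - move=> i a /=; have li : linked v (w i).
      by apply: lend; rewrite inE mem_cat map_f ?mem_enum ?orbT.
    by apply: (lt _ _ _ li); apply: lS; have := lG (iota i a) _ _ li; rewrite (hw i).2.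
  - by move=> j /=; apply: lend; rewrite inE mem_cat (map_f (fun j => act (x j) v)) ?mem_enum ?orbT.
have lz z : S z -> linked v z.
  move=> [g [b [sb bb]]]; have := lG g^-1%g _ _ (lseg _ _ sb bb).
  by rewrite (iaVl A); apply: lt (N _).
have full : S = setT.
  apply: invariant_convex_full => //; first by exists v.
  move=> a b c Sa Sb bc; have [Y [cY YS Ya Yb]] := lt _ _ _ (lS _ _ (lz a Sa)) (lz b Sb).
  by apply: YS; apply: cY bc.
by move=> z; have : S z by rewrite full.
Qed.

(** A translate of the midpoint of an edge lies in one of the finitely many segments of the hull,
    whose ends are in [Q]. Then that translate of the edge lies in the segment, which contains
    finitely many points of [Q]. *)
Lemma outer_reps (Q : set T) : discrete d Q -> V `<=` Q ->
  (forall g z, Q z -> Q (act g z)) ->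
  exists n (r : 'I_n -> T * T), edge_reps d Q (@act R G T) r.
Proof.
move=> QD VQ Qi; have [v [s [vs hs]]] := finite_hull.
apply: (@discrete_reps T Q (v :: s)) => //.
move=> q q' qq'; have [m [bm em]] := midpoint_ex q q'.
have [g [b [sb bb]]] := hs m.
have [Qq Qq' nq _] := qq'.
have gqq := adjq_act A Qi g qq'.
have vv : v \in v :: s by rewrite mem_head.
have vb : b \in v :: s by rewrite inE sb orbT.
have sp := @mdist_sep T.
have D0 := adjq_gt0 H sp gqq.
have bm' := btw_act A g bm.
have em' : d (act g q) (act g m) = d (act g m) (act g q') by rewrite !(iaD A).
have Qv := VQ _ (vs v vv); have Qb := VQ _ (vs b vb).
exists g, v, b.
have main u u' : adjq d Q u u' -> btw d u (act g m) u' -> half d u' u v ->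
    half d u u' b -> btw d v u b /\ btw d v u' b.
  move=> uu bu h1 h2; have u0 := adjq_gt0 H sp uu.
  by have [] := btw_chain H (btwC H h1) h2 u0.
have bad u u' : adjq d Q u u' -> btw d u (act g m) u' -> 0 < d u (act g m) ->
    half d u' u v -> half d u' u b -> False.
  move=> uu bu u0 h1 h2; have b1 := btwC H bu.
  have [_ k1] := btw_trans H b1 h1; have [_ k2] := btw_trans H b1 h2.
  move: bb k1 k2 (metric_triangle v u b); rewrite /btw (zhC H v (act g m)).
  rewrite (zhC H v u) (zhC H (act g m) u); lra.
have um : 0 < d (act g q) (act g m) by move: bm' em'; rewrite /btw; lra.
have um' : 0 < d (act g q') (act g m) by rewrite (zhC H (act g q')) -em'.
have gqq' := adjqC H gqq; have bm2 := btwC H bm'.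
case: (half_or H Geo sp QD gqq Qv) => hv; case: (half_or H Geo sp QD gqq Qb) => hb.
- by case: (bad _ _ gqq' bm2 um' hv hb).
- by have [? ?] := main _ _ gqq' bm2 hv hb; split.
- by have [? ?] := main _ _ gqq bm' hv hb; split.
- by case: (bad _ _ gqq bm' um hv hb).
Qed.



Lemma outer_pos : (0%:E < covolume T)%E -> exists u v : T, adjq d V u v.
Proof.
move=> cv; apply: contrapT => h; move: cv.
rewrite /covolume (_ : @edge_orbits R G T = set0) ?esum_set0 ?ltxx //.
rewrite -subset0 => o [e He _]; apply: h.
have [u [v ee]] := edge_exists_ends He; exists u, v; apply/adjq_edge.
by exists e.
Qed.

Lemma covolume_reps n (r : 'I_n -> T * T) : edge_reps d V (@act R G T) r ->
  covolume T = (\sum_(i < n) d (r i).1 (r i).2)%:E.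
Proof.
move=> rp.
pose seg i : set T := [set y | btw d (r i).1 y (r i).2].
pose O i : set (set T) := [set [set act g z | z in seg i] | g in [set: G]].
have ee i : edge_ends (seg i) (r i).1 (r i).2 := adjq_segment (er_adj rp i).
have len g i : edge_length (act g @` seg i) = d (r i).1 (r i).2.
  have [ec1 ec2] := edge_coord (ee i); have [e1 e2 _ _] := edge_endsV (ee i).
  rewrite /edge_length.
  apply/eqP; rewrite eq_le; apply/andP; split.
    apply: ge_sup => [|_ [[_ _] [[y /= sy <-] [z /= sz <-]] <-]].
      exists 0, (act g (r i).1, act g (r i).1); last by rewrite mdistxx.
      by split; exists (r i).1.
    rewrite /= (iaD A) ec2 //.
    have := ec1 _ sy; have := ec1 _ sz.
    have := mdist_ge0 (r i).1 y; have := mdist_ge0 (r i).1 z.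
    have := mdist_ge0 y (r i).2; have := mdist_ge0 z (r i).2.
    by move=> *; rewrite ler_norml; apply/andP; split; lra.
  apply: ub_le_sup.
    exists (d (r i).1 (r i).2) => _ [[_ _] [[y /= sy <-] [z /= sz <-]] <-].
    rewrite /= (iaD A) ec2 //.
    have := ec1 _ sy; have := ec1 _ sz.
    have := mdist_ge0 (r i).1 y; have := mdist_ge0 (r i).1 z.
    have := mdist_ge0 y (r i).2; have := mdist_ge0 z (r i).2.
    by move=> *; rewrite ler_norml; apply/andP; split; lra.
  exists (act g (r i).1, act g (r i).2); last by rewrite /= (iaD A).
  by split; [exists (r i).1|exists (r i).2].
have Oe i : sup (@edge_length R G T @` O i) = d (r i).1 (r i).2.
  rewrite (_ : _ @` _ = [set d (r i).1 (r i).2]) ?sup1 //.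
  apply/seteqP; split=> [_ [_ [g _ <-] <-]|_ ->]; first exact: len.
  by exists (act 1%g @` seg i); [exists 1%g|exact: len].
have Oi : injective O.
  move=> i j e; have : O j (act 1%g @` seg i) by rewrite -e; exists 1%g.
  case=> g _; rewrite !act_bij_segment !act1 => es; apply/esym.
  have hj := adjq_act A (@act_vertices R G T) g (er_adj rp j).
  apply: (er_uniq rp (g := g)).
  have ej := adjq_segment hj; have [_ n1 V1] := ej; have [_ _ V2] := ee i.
  have V12 : [set act g (r j).1; act g (r j).2] = [set (r i).1; (r i).2].
    by rewrite -V1 -V2 es.
  have : [set (r i).1; (r i).2] (act g (r j).1) by rewrite -V12; left.
  have : [set (r i).1; (r i).2] (act g (r j).2) by rewrite -V12; right.
  by case=> h1 [] h2; rewrite ?h1 ?h2; [case: n1; rewrite h1 h2|right|left|case: n1; rewrite h1 h2].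
have cover : @edge_orbits R G T = O @` setT.
  apply/seteqP; split=> [_ [e He <-]|_ [i _ <-]]; last first.
    by exists (seg i) => //; have [] := ee i.
  have [u [v eu]] := edge_exists_ends He.
  have uv : adjq d V u v by apply/adjq_edge; exists e.
  have [i [g h]] := er_cover rp uv; exists i => //.
  have es : e = act g @` seg i.
    rewrite (edge_segment eu) /seg act_bij_segment.
    case: h => -[-> ->] //; apply/seteqP; split=> y /=; exact: btwC.
  apply/seteqP; split=> [_ [h' _ <-]|_ [h' _ <-]].
    exists (h' * g^-1)%g => //; rewrite es.
    apply/seteqP; split=> [_ [_ [z sz <-] <-]|_ [z sz <-]].
      by exists z => //; rewrite actM (iaVl A).
    exists (act g z); last by rewrite actM (iaVl A).
    by exists z.
  exists (h' * g)%g => //; rewrite es.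
  apply/seteqP; split=> [_ [z sz <-]|_ [_ [z sz <-] <-]].
    by exists (act g z); [exists z|rewrite actM].
  by exists z => //; rewrite actM.
rewrite /covolume cover esum_image; last by move=> i j _ _ /Oi.
have fs : finite_set [set: 'I_n] by exact: finite_finset.
rewrite (esum_fset fs); last first.
  by move=> i _; rewrite Oe lee_fin mdist_ge0.
rewrite -sumEFin [RHS]bigfs ?index_enum_uniq //; last first.
  by move=> i _; rewrite mem_index_enum.
rewrite (_ : [set` _] = setT); last by apply/seteqP; split.
by apply: eq_fsbigr => i _; rewrite Oe.
Qed.

End InOuter.
End OuterTree.

(** * Invariance of vertices, covolume and stabilizers *)

Section OuterTransfer.
Variables (R : realType) (p k : nat) (Gi : 'I_p -> groupType) (G : groupType)
  (iota : forall i, {multiplicative Gi i -> G}) (x : 'I_k -> G).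
Hypothesis hG : is_free_product iota x.
Hypothesis hGi : forall i : 'I_p, exists a : Gi i, a <> 1%g.

Section Tree.
Variable T : gtree R G.
Local Notation d := (@mdist R T).
Local Notation V := (@vertices R T).
Let H := mdist_zh T.
Let Geo := mdist_geodesic (T := T).
Let A := act_isom T.
Let sp := @mdist_sep R G T.
Let VD := vertices_discrete T.

Definition branch_point (z : T) : Prop := exists a b c,
  [/\ [/\ 0 < d z a, 0 < d z b & 0 < d z c],
      btw d a z b, btw d b z c & btw d a z c].

Lemma neighbours_btw v u w : adjq d V v u -> adjq d V v w -> u <> w -> btw d u v w.
Proof.
move=> vu vw uw; have [Vv Vu nvu _] := vu; have [_ Vw nvw hw] := vw.
case: (half_or H Geo sp VD vu Vw) => // h.
by case: (hw u Vu h) => // e; case: nvu.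
Qed.

Lemma extend_to_vertex v y : V v -> exists y', V y' /\ btw d y' y v.
Proof.
move=> Vv; have [Vy|nVy] := pselect (V y).
  by exists y; split=> //; rewrite /btw mdistxx add0r.
have [_ _ _ h _] := smt_tree T; have [//|[e He ey]] := h y.
have [a [b ee]] := edge_exists_ends He.
have ab : adjq d V a b by apply/adjq_edge; exists e.
have [_ _ Va Vb] := edge_endsV ee.
have bty : btw d a y b by move: ey; rewrite (edge_segment ee).
case: (half_or H Geo sp VD ab Vv) => hv.
  by exists a; split=> //; have [] := btw_trans H bty hv.
by exists b; split=> //; have [] := btw_trans H (btwC H bty) hv.
Qed.

Hypothesis (free : trivial_edge_stabilizers T) (mini : minimal T).
Hypothesis edge_ex : exists u v, adjq d V u v.

(** A vertex without two neighbours is a leaf, and removing its orbit leaves a nonempty invariant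
    convex proper subset, against minimality. *)
Lemma two_neighbours v : V v -> exists u w, [/\ adjq d V v u, adjq d V v w & u <> w].
Proof.
move=> Vv; apply: contrapT => h.
pose S := [set z : T | forall g, z <> act g v].
have : S = setT.
  apply: mini.
  - have [u [w uw]] := edge_ex; have [m [bm em]] := midpoint_ex u w.
    exists m => g e; have [Vu Vw nuw hm] := uw.
    have Vm : V m by rewrite e; apply: act_vertices.
    case: (hm m Vm bm) => em'; subst m; apply: nuw; rewrite em' in bm em *.
      by apply/esym/sp; rewrite (zhC H) -em mdistxx.
    by apply: sp; rewrite em mdistxx.
  - apply: convex_connected => a b z Sa Sb bz g zg; apply: h.
    have bz' : btw d (act g^-1%g a) v (act g^-1%g b).
      by have := btw_act A g^-1%g bz; rewrite zg (iaVl A).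
    have na y : S y -> act g^-1%g y <> v.
      by move=> Sy e; apply: (Sy g); rewrite -e (iaVr A).
    have := na a Sa; have := na b Sb.
    move: (act g^-1%g a) (act g^-1%g b) bz' => a' b' bz' nb' na'.
    have [a2 [Va ba]] := extend_to_vertex a' Vv.
    have [b2 [Vb bb]] := extend_to_vertex b' Vv.
    have pa : 0 < d a' v by rewrite mdist_gt0; apply/eqP.
    have pb : 0 < d v b' by rewrite mdist_gt0; apply/eqP => e; apply: nb'.
    have [h1 h2] := btw_chain H ba bz' pa.
    have [_ h3] := btw_chain H h1 (btwC H bb) pb.
    have av : v <> a2 by move=> e; move: ba; rewrite /btw e mdistxx; have := mdist_ge0 a2 a'; rewrite -e; lra.
    have bv : v <> b2 by move=> e; move: bb; rewrite /btw e mdistxx; have := mdist_ge0 b2 b'; rewrite (zhC H b') -e; lra.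
    have [u [vu bu]] := first_stepq H sp VD Vv Va av.
    have [w [vw bw]] := first_stepq H sp VD Vv Vb bv.
    exists u, w; split=> // e; subst w.
    have := adjq_gt0 H sp vu; have := metric_triangle a2 u b2; move: h3 bu bw.
    by rewrite /btw (zhC H v a2) (zhC H u a2); lra.
  - by move=> g z Sz h' e; apply: (Sz (g^-1 * h')%g); rewrite actM -e (iaVl A).
by move=> e; have : S v by [rewrite e]; move=> /(_ 1%g); rewrite act1.
Qed.

Hypothesis nonred : forall v : T, ~ redundant v.

(** A vertex that is neither a branch point nor fixed by a nontrivial element has exactly two edges
    and would be redundant. So the vertex set is determined by the metric and the action. *)
Lemma vertex_intrinsic v : V v <-> (exists2 g, g <> 1%g & act g v = v) \/ branch_point v.
Proof.
split; last first.
  case=> [[g g1 gv]|[a [b [c [[pa pb pc] h1 h2 h3]]]]].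
    by apply: contrapT => nVv; apply: g1; apply: fix_nonvertex gv.
  exact: (branch_vertex pa pb pc).
move=> Vv; apply: contrapT => /not_orP[ns nb].
have stab1 g : act g v = v -> g = 1%g.
  by move=> gv; apply: contrapT => g1; apply: ns; exists g.
apply: (nonred (v := v)); split=> //; last first.
  move=> g /stab1 -> e _ _; apply/seteqP; split=> [_ [y ey <-]|y ey].
    by rewrite act1.
  by exists y => //; rewrite act1.
have [u [w [vu vw uw]]] := two_neighbours Vv.
pose seg (t : T) : set T := [set y | btw d v y t].
exists (seg u), (seg w); split.
  move=> e; apply: uw; have : seg w u by rewrite -e /seg /= /btw mdistxx addr0.
  have [_ Vu nvu _] := vu; have [_ _ nvw h] := vw.
  by move=> /(h u Vu)[e'|//]; case: nvu.
apply/seteqP; split=> [e [/= He ev]|e]; last first.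
  have gen t : adjq d V v t -> edges (seg t) /\ seg t v.
    move=> vt; have [He _ _] := adjq_segment vt; split=> //.
    by rewrite /seg /= /btw mdistxx add0r.
  by case=> ->; apply: gen.
have [a [b ee]] := edge_exists_ends He.
have [t [vt et]] : exists t, adjq d V v t /\ e = seg t.
  have [_ _ eV] := ee; have : [set a; b] v by rewrite -eV.
  rewrite /seg; case=> e1; rewrite e1.
    by exists b; split; [apply/adjq_edge; exists e|apply: edge_segment].
  exists a; split; first by apply/adjq_edge; exists e; apply: edge_endsC.
  by apply: edge_segment; apply: edge_endsC.
have [tu|/eqP tu] := eqVneq t u; first by left; rewrite et tu.
have [tw|/eqP tw] := eqVneq t w; first by right; rewrite et tw.
exfalso; apply: nb; exists u, w, t.
split; first by split; apply: (adjq_gt0 H sp); eassumption.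
- exact: neighbours_btw.
- by apply: neighbours_btw => // ?; apply: tw.
- by apply: neighbours_btw => // ?; apply: tu.
Qed.


End Tree.

Lemma outer_vertex (T : gtree R G) v : in_outer iota T -> (0%:E < covolume T)%E ->
  @vertices R T v <-> (exists2 g, g <> 1%g & act g v = v) \/ branch_point v.
Proof.
move=> [nr [m fr] _ _] /outer_pos cv; exact: vertex_intrinsic.
Qed.

Section EquivIsometric.
Variables T T' : gtree R G.
Hypotheses (HT : in_outer iota T) (HT' : in_outer iota T').
Hypothesis TT' : equiv_isometric T T'.

Lemma equiv_isometric_translation g : translation_length T g = translation_length T' g.
Proof.
have [f [fd fs fe]] := TT'; rewrite /translation_length; congr inf.
apply/seteqP; split=> [_ [y _ <-]|_ [y _ <-]].
  by exists (f y); rewrite // -fe fd.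
by have [z <-] := fs y; exists z; rewrite // -fe fd.
Qed.

(** A point of outer space is represented by a tree chosen in its class, so the covolume has to be
    invariant. Equivariant isometries are not assumed simplicial; they preserve vertices by
    [outer_vertex]. *)
Lemma equiv_isometric_covolume : (0%:E < covolume T)%E -> (0%:E < covolume T')%E ->
  covolume T' = covolume T.
Proof.
have [f [fd fs fe]] := TT' => cT cT'.
have sp' := @mdist_sep R G T'.
have fi u v : f u = f v -> u = v.
  by move=> e; apply: mdist_sep; rewrite -fd e mdistxx.
have fb u v w : btw (@mdist R T') (f u) (f v) (f w) <-> btw (@mdist R T) u v w.
  by rewrite /btw !fd.
have fV v : @vertices R T' (f v) <-> @vertices R T v.
  rewrite (outer_vertex _ HT cT) (outer_vertex _ HT' cT'); split.
    case=> [[g g1 gv]|[a [b [c [[pa pb pc] h1 h2 h3]]]]].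
      by left; exists g => //; apply: fi; rewrite fe.
    have [a' ea] := fs a; have [b' eb] := fs b; have [c' ec] := fs c; subst a b c.
    rewrite !fd in pa pb pc; right; exists a', b', c'.
    by split; [split| | |]; rewrite // -fb.
  case=> [[g g1 gv]|[a [b [c [[pa pb pc] h1 h2 h3]]]]].
    by left; exists g => //; rewrite -fe gv.
  right; exists (f a), (f b), (f c).
  by split; [rewrite !fd; split| | |]; rewrite ?fb.
have fadj u v : adjq (@mdist R T') (@vertices R T') (f u) (f v) <->
    adjq (@mdist R T) (@vertices R T) u v.
  split=> -[Vu Vv uv h]; split.
  - exact/fV.
  - exact/fV.
  - by move=> e; apply: uv; rewrite e.
  - by move=> w /fV Vw /fb bw; case: (h _ Vw bw) => /fi; [left|right].
  - exact/fV.
  - exact/fV.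
  - by move=> /fi.
  - move=> w'; have [w <-] := fs w'.
    by move=> /fV Vw /fb bw; case: (h _ Vw bw) => ->; [left|right].
have [n [r rp]] := outer_reps hG HT (vertices_discrete T) (fun _ => id) (@act_vertices R G T).
rewrite (covolume_reps rp).
pose r' i := (f (r i).1, f (r i).2).
have rp' : edge_reps (@mdist R T') (@vertices R T') (@act R G T') r'.
  split=> [i|u' v'|i j g] /=.
  - by apply/fadj; apply: (er_adj rp).
  - have [u <-] := fs u'; have [v <-] := fs v' => /fadj /(er_cover rp)[i [g h]].
    by exists i, g; rewrite -!fe; case: h => -[-> ->]; [left|right].
  - rewrite -!fe => h; apply: (er_uniq rp (g := g)).
    by case: h => -[/fi -> /fi ->]; [left|right].
rewrite (covolume_reps rp'); congr (_%:E); apply: eq_bigr => i _.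
by rewrite /= fd.
Qed.

End EquivIsometric.

Section Transfer.
Variables T0 T : gtree R G.
Hypothesis HT0 : in_outer iota T0.
Hypotheses (free : trivial_edge_stabilizers T) (mini : minimal T)
  (nonred : forall v : T, ~ redundant v).
Hypothesis same_elliptic : forall g, translation_length T g = 0 <->
  translation_length T0 g = 0.

Let ell2 (S : gtree R G) (fr : trivial_edge_stabilizers S) g h (y z : S) :
  act g y = y -> act h z = z -> g <> 1%g -> h <> 1%g ->
  translation_length S (g * h)%g = 0 -> y = z.
Proof.
move=> gy hz g1 h1 e; apply: contrapT => yz.
by have := elliptic_product fr gy hz g1 h1 yz; rewrite e ltxx.
Qed.

Let ell1 (S : gtree R G) g (y : S) : act g y = y -> translation_length S g = 0.
Proof. by move=> gy; apply/translation_length0; exists y. Qed.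

(* Three elements a, b, ab are elliptic iff they have a common fixed point, so
   stabilizers are determined by the set of elliptic elements. *)
Lemma stab_transfer (S S' : gtree R G) (y : S) (y' : S') g :
  trivial_edge_stabilizers S -> trivial_edge_stabilizers S' ->
  (forall g, translation_length S g = 0 <-> translation_length S' g = 0) ->
  g <> 1%g -> act g y = y -> act g y' = y' -> stab y `<=` stab y'.
Proof.
move=> fr fr' same g1 gy gy' h; rewrite /stab /= => hy.
have [->|/eqP h1] := eqVneq h 1%g; first by rewrite act1.
have [z hz] : exists z : S', act h z = z.
  by apply/translation_length0/same/(ell1 hy).
rewrite (ell2 (y := y') (z := z) fr' gy' hz g1 h1) //.
apply/same/(ell1 (y := y)); by rewrite actM hy.
Qed.

Let fr0 := outer_free HT0.

Lemma elliptic_vertex g : g <> 1%g -> translation_length T g = 0 ->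
  exists v : T, exists v0 : T0, [/\ act g v = v, act g v0 = v0 & stab v = stab v0].
Proof.
move=> g1 e; have [v gv] := (translation_length0 T g).1 e.
have [v0 gv0] := (translation_length0 T0 g).1 ((same_elliptic g).1 e).
exists v, v0; split=> //; apply/seteqP; split.
  exact: (stab_transfer free fr0 same_elliptic g1).
apply: (stab_transfer fr0 free _ g1) => // h; split=> h'; exact/same_elliptic.
Qed.

(** A nontrivial elliptic element fixes exactly one point, a vertex, in [T] and in [T0], and these
    two vertices have the same stabilizer. This matches the vertices with nontrivial stabilizer of
    the two trees, so (C2) and (C3) carry over. *)
Lemma outer_transfer : in_outer iota T.
Proof.
have [_ _ c2 c3] := HT0; split=> // [i|v Vv nc].
  have [v0 [Vv0 st u0]] := c2 i.
  have [a ha] := factor_nontrivial hG hGi i.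
  have [h eh] := st.
  have h1 : (iota i a ^ h)%g <> 1%g.
    move=> e; apply: ha; apply: (conjg_inj h); by rewrite e conj1g.
  have fx : act (iota i a ^ h)%g v0 = v0.
    by have : stab v0 (iota i a ^ h)%g by rewrite eh; exists a.
  have [v [w0 [fv fw0 sv]]] := elliptic_vertex h1 ((same_elliptic _).2 (ell1 fx)).
  have e0 : w0 = v0.
    apply: contrapT => ne; apply: h1; exact: (fix_unique fr0 fw0 fx).
  have Vv : @vertices R T v.
    by apply: contrapT => nV; apply: h1; apply: (fix_nonvertex free nV fv).
  exists v; split=> //; first by rewrite sv e0.
  move=> w Vw [h' ew]; exists (h'^-1 * h)%g.
  have fw : act (iota i a ^ h')%g w = w.
    by have : stab w (iota i a ^ h')%g by rewrite ew; exists a.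
  have fw' : act (iota i a ^ h)%g (act (h^-1 * h')%g w) = act (h^-1 * h')%g w.
    rewrite -[in LHS]actM -[in RHS](congr1 (act (h^-1 * h')%g) fw) -actM; congr act.
    by rewrite !conjgE !mulgA mulgK mulgK.
  have : act (h^-1 * h')%g w = v.
    apply: contrapT => ne; apply: h1; exact: (fix_unique free fw' fv).
  by move=> <-; rewrite -actM !mulgA mulgK mulVg act1.
apply/seteqP; split=> [g gv|_ ->]; last by rewrite /stab /= act1.
apply: contrapT => /= g1.
have [w [v0 [fw fv0 sv]]] := elliptic_vertex g1 (ell1 gv).
have ewv : w = v.
  apply: contrapT => ne; apply: g1; exact: (fix_unique free fw gv).
have Vv0 : @vertices R T0 v0.
  by apply: contrapT => nV; apply: g1; apply: (fix_nonvertex fr0 nV fv0).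
apply: g1; have : stab v0 g by [].
rewrite (c3 v0 Vv0) // => i; rewrite -sv ewv; exact: nc.
Qed.

End Transfer.
End OuterTransfer.

(** * Optimal Lipschitz maps *)

Section Gates.
Variables (R : realType) (X : Type) (D : X -> X -> R).
Hypotheses (H : zero_hyperbolic D) (Geo : geodesic D).
Hypothesis Sep : forall x y, D x y = 0 -> x = y.

(** The nearest point of [F] to [b], characterized by the fact that all geodesics from [b] to [F]
    pass through it. *)
Definition gate (F : set X) (b q : X) : Prop := F q /\ forall z, F z -> btw D b q z.

Lemma btw_prefix b x y q : btw D b q x -> 2 * D b q <= D b x + D b y - D x y ->
  btw D b q y.
Proof.
rewrite /btw => h1 h2.
have := gp_min H b q x y; have := zh_tri H q b y.
have := zhC H y b; have := zhC H q y; have := zh_ge0 H x y.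
by move=> *; lra.
Qed.

Lemma ball_gate (y b : X) (r : R) : 0 <= r ->
  exists q, gate [set z | D y z <= r] b q /\ D b q = Num.max 0 (D b y - r).
Proof.
move=> r0; have [h|h] := leP (D b y) r.
  exists b; rewrite (zh0 H) max_l ?subr_le0 //; split=> //; split=> [|z _].
    by rewrite /= (zhC H).
  by rewrite /btw (zh0 H) add0r.
have [|q [q1 q2]] := Geo (x := b) (y := y) (r := D b y - r).
  by apply/andP; split; lra.
exists q; rewrite q1 max_r; last by lra.
split=> //; split=> [|z /= hz].
  by rewrite /= (zhC H) q2; lra.
apply: (btw_prefix (x := y)); first by rewrite /btw q1 q2; lra.
by rewrite q1; have := zh_tri H z b y; rewrite (zhC H z y); lra.
Qed.

Variable h : X -> X.
Hypothesis hD : forall x y, D (h x) (h y) = D x y.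

Definition displaced (c : R) : set X := [set y | D y (h y) <= c].

Lemma displaced_convex c : convex_in D (displaced c).
Proof.
move=> x y w hx hy bw; rewrite /displaced /= in hx hy *.
have := zh_tri H y x (h y); have := zh_tri H x y (h x); have := bw; rewrite /btw.
have e1 := zhC H y x; have := hD x y; have := hD x w; have := hD w y.
have := zh_ge0 H x w; have := zh_ge0 H y w.
have := zhC H w y; have := zhC H (h x) x; have := zhC H (h y) x.
have := zhC H (h x) y; have := zhC H (h y) y.
have := zhC H (h w) x; have := zhC H (h w) y.
have bh : btw D (h x) (h w) (h y) by rewrite /btw !hD.
have := max_btw H x bh; have := max_btw H y bh; have := max_btw H (h w) bw.
by move: bw; rewrite /btw; move=> *; lra.
Qed.

(** Along the segment from [b] to [h b] the displacement first drops at twice the speed, so half of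
    its excess over [c] is the distance to the sublevel set. *)
Lemma displaced_gate c b z0 : displaced c z0 ->
  exists q, [/\ gate (displaced c) b q, D b q = Num.max 0 ((D b (h b) - c) / 2),
    btw D b q (h b) & btw D q (h q) (h b)].
Proof.
move=> hz0.
have [hb|hb] := leP (D b (h b)) c.
  exists b; rewrite (zh0 H) max_l; last by lra.
  by split; rewrite // /btw ?(zh0 H) ?addr0 ?add0r //; split=> // z _; rewrite /btw (zh0 H) add0r.
have c0 : 0 <= c by have := zh_ge0 H z0 (h z0); move: hz0; rewrite /displaced /=; lra.
have [|q [q1 q2]] := Geo (x := b) (y := h b) (r := (D b (h b) - c) / 2).
  by apply/andP; split; lra.
have [|p [p1 p2]] := Geo (x := h b) (y := b) (r := (D b (h b) - c) / 2).
  by rewrite (zhC H (h b)); apply/andP; split; lra.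
have bq : btw D b q (h b) by rewrite /btw q1 q2; lra.
have bp : btw D (h b) p b by rewrite /btw p1 p2; lra.
have gz z : displaced c z -> btw D b q z.
  rewrite /displaced /= => hz; apply: (btw_prefix bq).
  have := zh_tri H (h z) (h b) z; rewrite hD q1 (zhC H (h z) z).
  by lra.
have bpz : btw D (h b) p z0.
  apply: (btw_prefix bp); rewrite p1 (zhC H (h b) b).
  have := zh_tri H z0 (h b) (h z0); rewrite hD; move: hz0; rewrite /displaced /=; lra.
have hqp : h q = p.
  apply: Sep; apply: (btw_eq (x := h b) (y := z0) H) => //; last by rewrite hD q1 p1.
  apply: (btw_prefix (x := h z0)); first by rewrite /btw !hD; apply: gz.
  rewrite !hD q1; move: hz0; rewrite /displaced /= (zhC H z0).
  have := zh_tri H z0 b (h b); rewrite (zhC H z0 (h b)).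
  lra.
exists q; rewrite q1 max_r; last by lra.
have e : D q (h q) = c.
  rewrite hqp; have := btw_between H bq (btwC H bp).
  rewrite q1 (zhC H b p) p2 (zhC H (h b) b).
  have le : (D b (h b) - c) / 2 <= D b (h b) - (D b (h b) - c) / 2 by lra.
  move=> /(_ le).
  rewrite /btw q1 (zhC H b p) p2 (zhC H (h b) b); lra.
split=> //; last by rewrite /btw e q2 hD (zhC H q b) q1; lra.
by split=> //; rewrite /displaced /= e.
Qed.

End Gates.

Section Helly.
Variables (R : realType) (G : groupType) (X : Type) (D : X -> X -> R).
Hypotheses (H : zero_hyperbolic D) (Geo : geodesic D).
Hypothesis Sep : forall x y, D x y = 0 -> x = y.
Variable a : G -> X -> X.
Hypothesis A : isom_action D a.

(* For disjoint sets the axis of [h * g] runs through the bridge between them. *)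
Lemma displaced_meet g h (cg ch l : R) x yg yh :
  asym D a x (h * g)%g l -> l <= cg + ch ->
  displaced D (a g) cg yg -> displaced D (a h) ch yh ->
  exists2 z, displaced D (a g) cg z & displaced D (a h) ch z.
Proof.
move=> asl lc hg hh; apply: contrapT => nz.
have iD k : forall u v, D (a k u) (a k v) = D u v by move=> u v; apply: (iaD A).
have [q [[Fq gq] _ _ _]] := displaced_gate H Geo Sep (iD h) yg hh.
have [q' [[Fq' gq'] e' b1 b2]] := displaced_gate H Geo Sep (iD g) q hg.
have gq2 z : displaced D (a h) ch z -> btw D q' q z.
  move=> hz; have := gq _ hz; have := gq' _ hg.
  rewrite /btw; have := zhC H q' q; have := zhC H q yg; have := zhC H q' yg.
  have := zh_tri H q q' z; have := zh_tri H q' yg z; lra.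
have pos : 0 < D q q'.
  rewrite lt_neqAle (zh_ge0 H) andbT eq_sym; apply/eqP => /Sep e.
  by apply: nz; exists q' => //; rewrite -e.
have [r [[Fr gr] e3 b3 b4]] := displaced_gate H Geo Sep (iD h) q' hh.
have er : r = q.
  apply: Sep; have := gq2 _ Fr; have := gr _ Fq; rewrite /btw.
  by have := zh_ge0 H r q; have := zhC H q r; lra.
subst r => {hg hh gq gr}.
have maxE (t : R) : 0 < Num.max 0 t -> Num.max 0 t = t.
  by case: (leP 0 t) => // _; rewrite ltxx.
have dg : D q' (a g q') = cg.
  move: (pos) b1 b2; rewrite e' => /maxE e1; rewrite e1 in e'.
  by rewrite /btw (iaD A) e' (zhC H q' q) e'; lra.
have dh : D q (a h q) = ch.
  move: (pos) b3 b4; rewrite (zhC H q) e3 => /maxE e1; rewrite e1 in e3.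
  by rewrite /btw (iaD A) e3 (zhC H q q') e3; lra.
pose k := (h * g)%g.
have kE z : a k z = a h (a g z) by rewrite (iaM A).
have pk : 0 < D (a k q') (a k q) by rewrite iD (zhC H).
have b5 : btw D (a h q') (a k q') (a k q).
  by rewrite !kE; apply: (btw_act A).
have b6 : btw D q (a h q') (a k q).
  have b : btw D (a h q) (a h q') (a k q) by rewrite kE; apply: (btw_act A).
  by have [] := btw_chain H b4 b; rewrite ?iD.
have b7 : btw D (a k q') (a k q) (a k (a h q')) by apply: (btw_act A).
have [b8 _] := btw_chain H b5 b7 pk.
have p8 : 0 < D (a h q') (a k q).
  by rewrite b5; have := zh_ge0 H (a h q') (a k q'); lra.
have [b9 _] := btw_chain H b6 b8 p8.
have p9 : 0 < D (a k q) (a k (a h q')).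
  by rewrite iD b4 iD; have := zh_ge0 H q (a h q); lra.
have [_ b11] := btw_chain H b9 (btw_act A k b6) p9.
have pq : 0 < D q (a k q) by rewrite b6; have := zh_ge0 H q (a h q'); lra.
have asq : asym D a q k (D q (a k q)).
  by exists 0 => n; rewrite (axis_asym H A b11 pq) subrr normr0.
have := asym_uniq (asym_base H A q asl) asq.
by rewrite b6 b5 b4 !iD dh kE iD dg (zhC H q'); lra.
Qed.

End Helly.

Section CompleteHelly.
Variables (R : realType) (X : metricType R).
Local Notation d := (@mdist R X).
Hypotheses (H : zero_hyperbolic d).
Hypothesis complete : forall F : set_system X, ProperFilter F -> cauchy F -> exists z : X, F --> z.

Lemma vanishing_sequence : exists e : nat -> R, [/\ forall n, 0 < e n,
  forall n m, (n <= m)%N -> e m <= e n & forall r, 0 < r -> exists n, e n < r].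
Proof.
exists (fun n => n.+1%:R^-1); split=> [n|n m nm|r r0]; first by rewrite invr_gt0.
  by rewrite lef_pV2 ?posrE ?ltr0n // ler_nat.
exists (Num.bound r^-1).
have r1 : 0 < r^-1 by rewrite invr_gt0.
rewrite invf_plt ?posrE ?ltr0n //; apply: lt_trans (archi_boundP (ltW r1)) _.
by rewrite ltr_nat.
Qed.

Lemma cauchy_seq_limit (e : nat -> R) (s : nat -> X) :
  (forall r : R, 0 < r -> exists n, e n < r) ->
  (forall n m, (n <= m)%N -> d (s n) (s m) < e n) ->
  exists z, forall r : R, 0 < r -> exists N, forall n, (N <= n)%N -> d z (s n) < r.
Proof.
move=> small hs; have [z hz] : exists z : X, s @ \oo --> z.
  apply: complete; apply: cauchy_exP => r r0.
  have [N hN] := small r r0; exists (s N); exists N => // n Nn.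
  by rewrite /= ballEmdist /=; apply: lt_trans hN; apply: hs.
exists z => r r0.
have /metricType_numDomainType.cvgrPdist_lt /(_ r r0)[N _ hN] := hz.
by exists N => n Nn; apply: hN.
Qed.

(* The gates towards a base point lie on a single ray. *)
Lemma helly (I : Type) (F : I -> set X) (b : X) (q : I -> X) (M : R) :
  (forall i, gate d (F i) b (q i)) -> (forall i j, exists2 z, F i z & F j z) ->
  (forall i, d b (q i) <= M) -> (forall i, convex_in d (F i)) ->
  (forall i z, (forall e : R, 0 < e -> exists2 y, F i y & d z y < e) -> F i z) ->
  exists z, forall i, F i z.
Proof.
move=> hq meet hM hc hcl.
have [[i0 _]|nI] := pselect (exists i : I, True); last first.
  by exists b => i; case: nI; exists i.
have ray i j : d b (q i) <= d b (q j) -> btw d b (q i) (q j) /\ F i (q j).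
  move=> le; have [z zi zj] := meet i j; have [Fi gi] := hq i; have [Fj gj] := hq j.
  have bij := btw_between H (gi _ zi) (gj _ zj) le.
  have [_ b2] := btw_trans H bij (gj _ zj).
  by split=> //; apply: (hc i) b2.
have [e [e0 emono small]] := vanishing_sequence.
have [c leZ ex] : exists2 c : R, forall i, d b (q i) <= c &
    forall n, exists i, c - e n < d b (q i).
  have hZ : has_sup [set d b (q i) | i in [set: I]].
    by split; [exists (d b (q i0)); exists i0|exists M => _ [i _ <-]].
  exists (sup [set d b (q i) | i in [set: I]]) => [i|n].
    by apply: ub_le_sup; [case: hZ|exists i].
  have [_ [i _ <-] hi] := sup_adherent (e0 n) hZ.
  by exists i.
have [j hj] := choice ex.
have sym u v : d u v = d v u by exact: (zhC H).
have near n i : exists2 y, F i y & d (q (j n)) y < e n.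
  have [le|lt] := leP (d b (q i)) (d b (q (j n))).
    by exists (q (j n)); rewrite ?mdistxx //; have [] := ray _ _ le.
  have [bt _] := ray _ _ (ltW lt); exists (q i); first by have [] := hq i.
  by have := leZ i; have := hj n; move: bt; rewrite /btw; lra.
have [z hz] : exists z, forall r : R, 0 < r -> exists N, forall n, (N <= n)%N -> d z (q (j n)) < r.
  apply: (cauchy_seq_limit small) => n m nm.
  have := leZ (j n); have := leZ (j m); have := hj n; have := hj m; have := emono _ _ nm.
  by have [/ray[]|/ltW/ray[]] := leP (d b (q (j n))) (d b (q (j m))); rewrite /btw ?(sym (q (j m))) => *; lra.
exists z => i; apply: hcl => r r0.
have r2 : 0 < r / 2 by lra.
have [N hN] := hz _ r2; have [N2 hN2] := small _ r2.
pose n := maxn N N2.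
have [y yi dy] := near n i; exists y => //.
have := hN n (leq_maxl _ _); have := emono _ _ (leq_maxr N N2).
have := metric_triangle z (q (j n)) y; rewrite -/n; lra.
Qed.
End CompleteHelly.

Section Shift.
Variables (R : realType) (X : Type) (D : X -> X -> R).
Hypothesis H : zero_hyperbolic D.
Variable h : X -> X.
Hypothesis hD : forall x y, D (h x) (h y) = D x y.

(** An isometry that moves both ends of a long segment by at most [c] acts on the middle part as a
    translation along it, with one signed amount [t] for all points. Two such isometries therefore
    commute at a point far from the ends. *)
Lemma long_segment_shift p q c : D p (h p) <= c -> D q (h q) <= c -> c < D p q ->
  exists t, [/\ `|t| <= c & forall y, btw D p y q -> c < D p y -> c < D y q ->
    btw D p (h y) q /\ D p (h y) = D p y + t].
Proof.
move=> hp hq hL; exists (D p (h q) - D p q).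
have e4 := zh4 H p q (h p) (h q); have e5 := zh4 H p (h q) q (h p).
have e6 := zh4 H p (h p) q (h q).
have C1 := zhC H (h q) q; have C2 := zhC H (h p) q; have C3 := zhC H (h q) (h p).
have s0 : D p (h q) + D q (h p) = 2 * D p q.
  by have := hD p q; lra.
have t1 := zh_tri H q p (h q); have t2 := zh_tri H (h q) p q.
split=> [|y bt cy cq]; first by rewrite ler_norml; apply/andP; split; lra.
have bh : btw D (h p) (h y) (h q) by rewrite /btw !hD.
have m1 := max_btw H p bh; have m2 := max_btw H q bh.
have t3 := zh_tri H p (h p) (h y); have t4 := zh_tri H q (h q) (h y).
have t5 := zh_tri H (h y) p q; have t6 := zh_tri H (h y) p (h q).
have d1 := hD p y; have d2 := hD y q; have d3 := hD q y.
have C4 := zhC H (h y) p; have C5 := zhC H (h y) q; have C6 := zhC H (h p) p.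
have C7 := zhC H (h q) p; have C8 := zhC H y q.
move: bt; rewrite /btw => bt.
by split; lra.
Qed.

End Shift.

Section Outer.
Variables (R : realType) (p : nat) (Gi : 'I_p -> groupType) (G : groupType)
  (iota : forall i, {multiplicative Gi i -> G}).

(** If G were abelian and acted freely, the set of minimal displacement of a nontrivial element
    would be invariant, hence everything, and the tree would be a line. But a vertex with trivial
    stabilizer is a branch point. *)
Lemma nonabelian (T : gtree R G) : in_outer iota T ->
  (exists u v, adjq (@mdist R T) (@vertices R T) u v) ->
  (forall g (y : T), act g y = y -> g = 1%g) -> exists g h : G, (g * h)%g <> (h * g)%g.
Proof.
move=> HT ex nf; apply: contrapT => ab.
have H := mdist_zh T; have A := act_isom T; have fr := outer_free HT.
have [nr [mini _] _ _] := HT.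
have com (g h : G) : (g * h)%g = (h * g)%g.
  by apply: contrapT => n; apply: ab; exists g, h.
have [v [w vw]] := ex; have Vv : vertices v by case: vw.
have [[g g1 /nf //]|[a [b [c [[pa pb pc] ab_ bc ac]]]]] :=
  (vertex_intrinsic fr mini ex nr v).1 Vv.
have [[h h1]|G1] := pselect (exists h : G, h <> 1%g); last first.
  have : [set v] = setT.
    apply: (invariant_convex_full HT); first by exists v.
      by move=> _ _ z -> ->; rewrite /btw mdistxx => e; apply: mdist_sep; have := zhC H z v; have := zh_ge0 H v z; lra.
    move=> g z ->; suff -> : g = 1%g by rewrite act1.
    by apply: contrapT => n; apply: G1; exists g.
  by move=> e; have : [set v] a by [rewrite e]; move=> ea; move: pa; rewrite ea mdistxx ltxx.
have l0 : 0 < translation_length T h.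
  rewrite lt_neqAle translation_length_ge0 andbT eq_sym; apply/eqP.
  by move=> /translation_length0[y /nf].
have SA : displaced (@mdist R T) (act h) (translation_length T h) = setT.
  apply: (invariant_convex_full HT).
  - by have [m [e _]] := translation_lengthP T h; exists m; rewrite /displaced /= e.
  - by apply: displaced_convex => // y z; apply: act_isometry.
  - by move=> g z; rewrite /displaced /= -actM com actM act_isometry.
have dis (y : T) : mdist y (act h y) <= translation_length T h.
  by have : displaced (@mdist R T) (act h) (translation_length T h) y by rewrite SA.
have dis2 (y : T) : translation_length T h <= mdist y (act h y).
  exact: (asym_le H A y (translation_length_asym h y)).
have turn z u : mdist z v + mdist v u - mdist z u <= 0 -> btw (@mdist R T) z v u.
  by have := zh_tri H v z u; rewrite /btw; lra.
(* A third direction at [v], different from those of [h v] and [h^-1 v]: a point in it is displaced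
   by more than the translation length of [h]. One of [a], [b], [c] lies in such a direction. *)
suff [z [pz b1 b2]] : exists z, [/\ 0 < mdist v z, btw (@mdist R T) z v (act h v) &
    btw (@mdist R T) z v (act h^-1%g v)].
  have := btw_act A h (btwC H b2); rewrite (iaVr A) => b3.
  have [b4 _] := btw_chain H b1 b3 (lt_le_trans l0 (dis2 v)).
  have := dis z; have := dis2 v; have := zhC H z v; have := act_isometry h v z.
  by move: b4 b1 b3; rewrite /btw; have := zh_tri H (act h v) z (act h z); lra.
have two y : (btw (@mdist R T) a v y \/ btw (@mdist R T) b v y) /\
   (btw (@mdist R T) b v y \/ btw (@mdist R T) c v y) /\
   (btw (@mdist R T) a v y \/ btw (@mdist R T) c v y).
  have g1 := gp_min H v a y b; have g2 := gp_min H v b y c; have g3 := gp_min H v a y c.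
  have Ca := zhC H v a; have Cb := zhC H v b; have Cc := zhC H v c.
  have Ya := zhC H y a; have Yb := zhC H y b; have Yc := zhC H y c.
  move: ab_ bc ac; rewrite /btw => ab_ bc ac.
  by repeat split; [case: g1|case: g2|case: g3] => ?; [left|right|left|right|left|right]; apply: turn; lra.
have [a1 [b1 c1]] := two (act h v); have [a2 [b2 c2]] := two (act h^-1%g v).
have [|na] := pselect (btw (@mdist R T) a v (act h v) /\ btw (@mdist R T) a v (act h^-1%g v)).
  by case; exists a.
have [|nb] := pselect (btw (@mdist R T) b v (act h v) /\ btw (@mdist R T) b v (act h^-1%g v)).
  by case; exists b.
exists c; split=> //; tauto.
Qed.

End Outer.

Section Elliptic.
Variables (R : realType) (p : nat) (Gi : 'I_p -> groupType) (G : groupType)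
  (iota : forall i, {multiplicative Gi i -> G}).

(** A nontrivial elliptic element fixes a vertex, lies by (C3) in a conjugate of a factor, and by
    (C2) that factor fixes a vertex of the other tree. *)
Lemma elliptic_outer (T T' : gtree R G) g (y : T) :
  in_outer iota T -> in_outer iota T' -> act g y = y -> exists y' : T', act g y' = y'.
Proof.
move=> HT HT' gy; have [->|/eqP g1] := eqVneq g 1%g.
  by have [[v _] _ _ _ _] := smt_tree T'; exists v; rewrite act1.
have Vy : vertices y.
  by apply: contrapT => nV; apply: g1; apply: fix_nonvertex nV gy; apply: outer_free HT.
have [_ _ _ c3] := HT.
have [i [h e]] : exists i, conjugate_to_factor iota i (stab y).
  apply: contrapT => n; apply: g1; have : stab y g by [].
  by rewrite c3 // => i hi; apply: n; exists i.
have : stab y g by []. 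
rewrite e => -[a _ <-].
have [v [_ hv]] := factor_fixed HT' i; exists (act h^-1%g v).
by rewrite -actM conjgE !mulgA mulgK actM hv.
Qed.


End Elliptic.

Section LipschitzMap.
Variables (R : realType) (p : nat) (Gi : 'I_p -> groupType) (G : groupType)
  (iota : forall i, {multiplicative Gi i -> G}).
Variables A B : gtree R G.
Hypotheses (HA : in_outer iota A) (HB : in_outer iota B).
Hypothesis exA : exists u v, adjq (@mdist R A) (@vertices R A) u v.
Variable lam : R.
Hypothesis lam0 : 0 <= lam.
Hypothesis lip : forall g, translation_length B g <= lam * translation_length A g.

Let HdA := mdist_zh A.
Let HdB := mdist_zh B.
Let GeoB := mdist_geodesic (T := B).
Let SepB := @mdist_sep R G B.
Let IA := act_isom A.
Let IB := act_isom B.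
Local Notation dA := (@mdist R A).
Local Notation dB := (@mdist R B).

(** The constraint that the single element [g] puts on an image of [u]. A point satisfying it for
    all [g] is what an equivariant [lam]-Lipschitz map on the orbit of [u] needs. *)
Let C u g : set B := displaced dB (act g) (lam * dA u (act g u)).

Let Cconvex u g : convex_in dB (C u g).
Proof. by apply: displaced_convex => // y z; apply: act_isometry. Qed.

Let lenA u g : translation_length A g <= dA u (act g u).
Proof. exact: (asym_le HdA IA u (translation_length_asym g u)). Qed.

Let Cne u g : exists y, C u g y.
Proof.
have [m [e _]] := translation_lengthP B g; exists m; rewrite /C /displaced /= -e.
by apply: le_trans (lip g) _; apply: ler_wpM2l (lenA u g).
Qed.

Let Cmeet u g h : exists2 z, C u g z & C u h z.
Proof.
have [yg hg] := Cne u g; have [yh hh] := Cne u h.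
apply: (displaced_meet HdB GeoB SepB IB (translation_length_asym (h * g)%g yg)) hg hh.
rewrite -mulrDr; apply: le_trans (lip _) _; apply: ler_wpM2l => //.
apply: le_trans (lenA u _) _; rewrite actM.
by have := zh_tri HdA (act h u) u (act h (act g u)); rewrite act_isometry addrC.
Qed.

Let Cgate u g b : exists q, gate dB (C u g) b q.
Proof.
have [y hy] := Cne u g.
have [|q [hq _ _ _]] := @displaced_gate _ _ _ HdB GeoB SepB (act g) _ _ b _ hy.
  by move=> z w; apply: act_isometry.
by exists q.
Qed.

Let Cclosed u g z : (forall e : R, 0 < e -> exists2 y, C u g y & dB z y < e) -> C u g z.
Proof.
move=> h; rewrite /C /displaced /=; rewrite leNgt; apply/negP => lt.
have [|y yC dy] := h ((dB z (act g z) - lam * dA u (act g u)) / 2); first by lra.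
have := zh_tri HdB y z (act g z); have := zh_tri HdB (act g y) y (act g z).
have := act_isometry g y z; have := zhC HdB y z.
move: yC; rewrite /C /displaced /=; lra.
Qed.

Let completeB := (smt_metric B).2.

(** If a nontrivial [h] fixes [u], the fixed point of [h] is the only candidate. If the action is
    free, Helly applies once the gates are bounded: unbounded gates would run to infinity along a
    ray, and two noncommuting elements would both move its points by bounded amounts, so that they
    commute at some point, where freeness makes them equal up to order. *)
Lemma displaced_common u : (forall g : G, forall y : A, act g y = y -> g = 1%g) \/
  (exists2 h : G, h <> 1%g & act h u = u) -> exists y, forall g, C u g y.
Proof.
case=> [nf|[h h1 hu]]; last first.
  have fix_of z : C u h z -> act h z = z.
    rewrite /C /displaced /= hu mdistxx mulr0 => le; apply/esym/SepB.
    by apply/eqP; rewrite eq_le le mdist_ge0.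
  have [y hy] := Cne u h; exists y => g.
  have [z zg zh] := Cmeet u g h.
  suff -> : y = z by [].
  apply: contrapT => ne; apply: h1.
  exact: (fix_unique (outer_free HB) (fix_of _ hy) (fix_of _ zh)).
have nfB g (y : B) : act g y = y -> g = 1%g.
  by move=> /(elliptic_outer HB HA)[y' /nf].
have [b _] : exists b : B, True.
  by have [v _] := Cne u 1%g; exists v.
have [q hq] := choice (fun g => Cgate u g b).
have [M hM] : exists M, forall g, dB b (q g) <= M.
  apply: contrapT => nM.
  have far M : exists g, M < dB b (q g).
    apply: contrapT => n; apply: nM; exists M => g; rewrite leNgt; apply/negP => lt.
    by apply: n; exists g.
  have ray g h : dB b (q g) <= dB b (q h) -> btw dB b (q g) (q h) /\ C u g (q h).
    move=> le; have [z zi zj] := Cmeet u g h; have [Fi gi] := hq g; have [Fj gj] := hq h.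
    have bij := btw_between HdB (gi _ zi) (gj _ zj) le.
    have [_ b2] := btw_trans HdB bij (gj _ zj).
    by split=> //; apply: Cconvex b2.
  have key g h : (g * h)%g <> (h * g)%g -> dB b (q g) <= dB b (q h) -> False.
    move=> gh le; have [_ p0g] := ray _ _ le; have [p0h _] := hq h.
    move: p0g p0h; move e0 : (q h) => p0 p0g p0h.
    pose c := Num.max (lam * dA u (act g u)) (lam * dA u (act h u)).
    have cg : lam * dA u (act g u) <= c by rewrite /c le_max lexx.
    have ch : lam * dA u (act h u) <= c by rewrite /c le_max lexx orbT.
    have c0 : 0 <= c by apply: le_trans cg; apply: mulr_ge0 lam0 (mdist_ge0 _ _).
    move: (c) cg ch c0 => {}c cg ch c0.
    (* The margin 10 c + 10 keeps the midpoint of the segment more than [c] away from both ends,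
       even after a shift by up to [c]. *)
    have [f hf] := far (dB b p0 + 10 * c + 10).
    have hle : dB b (q h) <= dB b (q f) by rewrite e0; lra.
    have [bf fh] := ray _ _ hle; have [_ fg] := ray _ _ (le_trans le hle).
    move: bf; rewrite e0 /btw => bf.
    have L : 10 * c + 10 < dB p0 (q f) by lra.
    have sg := @long_segment_shift _ _ _ HdB (act g) (act_isometry g) p0 (q f) c
      (le_trans p0g cg) (le_trans fg cg).
    have sh := @long_segment_shift _ _ _ HdB (act h) (act_isometry h) p0 (q f) c
      (le_trans p0h ch) (le_trans fh ch).
    have [|tg [/ler_normlP[tg1 tg2] Sg]] := sg; first by lra.
    have [|th [/ler_normlP[th1 th2] Sh]] := sh; first by lra.
    have [|y [y1 y2]] := GeoB (x := p0) (y := q f) (r := dB p0 (q f) / 2).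
      by apply/andP; split; lra.
    have by0 : btw dB p0 y (q f) by rewrite /btw y1 y2; lra.
    have [||gb gd] := Sg _ by0; [lra|lra|].
    have [||hb hd] := Sh _ by0; [lra|lra|].
    have e1 := gb; have e2 := hb; rewrite /btw in e1 e2.
    have [||hgb hgd] := Sh _ gb; [lra|lra|].
    have [||ghb ghd] := Sg _ hb; [lra|lra|].
    have : act h (act g y) = act g (act h y).
      by apply: SepB; apply: (btw_eq HdB hgb ghb); rewrite hgd ghd gd hd; lra.
    rewrite -!actM => /(congr1 (act (h * g)^-1%g)); rewrite -!actM mulVg act1.
    move=> /esym /nfB e; apply: gh; apply: (mulgI (h * g)^-1%g).
    by rewrite e mulVg.
  have [g [h gh]] := nonabelian HA exA nf.
  have [le|/ltW le] := leP (dB b (q g)) (dB b (q h)); first exact: key gh le.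
  by apply: key le => /esym.
have [z hz] := helly HdB completeB hq (@Cmeet u) hM (@Cconvex u) (@Cclosed u).
by exists z.
Qed.

(** A partial equivariant map given by its graph; single-valuedness is the case of equal first
    components in the Lipschitz condition. *)
Let lipschitz_graph (Gam : set (A * B)) : Prop :=
  (forall g z, Gam z -> Gam (act g z.1, act g z.2)) /\
  (forall z w, Gam z -> Gam w -> dB z.2 w.2 <= lam * dA z.1 w.1).

Let extend_graph Gam u y : lipschitz_graph Gam -> (forall g, C u g y) ->
  (forall z, Gam z -> dB z.2 y <= lam * dA z.1 u) ->
  lipschitz_graph (Gam `|` [set (act g u, act g y) | g in [set: G]]).
Proof.
move=> [inv lp] hC hb.
have lp2 z g : Gam z -> dB z.2 (act g y) <= lam * dA z.1 (act g u).
  move=> Gz; have := hb _ (inv g^-1%g _ Gz); rewrite /= => h.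
  by rewrite -(iaD IB g^-1%g) -(iaD IA g^-1%g) (iaVl IA) (iaVl IB).
split=> [g z [Gz|[h _ <-]]|z w [Gz|[g _ <-]] [Gw|[h _ <-]]] /=.
- by left; apply: inv.
- by right; exists (g * h)%g => //; rewrite !actM.
- exact: lp.
- exact: lp2.
- by rewrite (zhC HdB) (zhC HdA); apply: lp2.
- have := hC (g^-1 * h)%g; rewrite /C /displaced /= !actM.
  by rewrite -(iaD IB g) -(iaD IA g) (iaVr IB) (iaVr IA).
Qed.

(** The image of a new point must lie in balls around the images already chosen and in all the sets
    [C u g]. These convex sets meet pairwise, so Helly gives a common point. *)
Let ball_common Gam u : lipschitz_graph Gam -> Gam !=set0 -> exists y,
  (forall g, C u g y) /\ forall z, Gam z -> dB z.2 y <= lam * dA z.1 u.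
Proof.
move=> [inv lp] [z0 G0].
pose F (i : {z | Gam z} + G) : set B :=
  match i with inl z => [set y | dB (sval z).2 y <= lam * dA (sval z).1 u] | inr g => C u g end.
have rad z : 0 <= lam * dA z u by apply: mulr_ge0 lam0 (mdist_ge0 _ _).
have /choice[q hq] : forall i, exists q, gate dB (F i) z0.2 q.
  case=> [z|g] /=; last exact: Cgate.
  by have [q [hq _]] := ball_gate HdB GeoB (sval z).2 z0.2 (rad (sval z).1); exists q.
have bc z g : Gam z -> exists2 y, dB z.2 y <= lam * dA z.1 u & C u g y.
  move=> Gz; have [yg hg] := Cne u g.
  have [|q0 [[Fq _] e _ _]] := @displaced_gate _ _ _ HdB GeoB SepB (act g) _ _ z.2 _ hg.
    by move=> z' w; apply: act_isometry.
  (* The image of [z.1] is displaced by [g] by at most lam times 2 d(z.1, u) + d(u, g u), so half of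
     its excess is at most the radius of the ball. *)
  exists q0 => //; rewrite e ge_max rad /=.
  have := lp _ _ Gz (inv g _ Gz); rewrite /= => h.
  have : lam * dA z.1 (act g z.1) <= lam * (2 * dA z.1 u + dA u (act g u)).
    apply: ler_wpM2l => //.
    have := zh_tri HdA u z.1 (act g z.1); have := zh_tri HdA (act g u) u (act g z.1).
    have := act_isometry g u z.1; have := zhC HdA u z.1; lra.
  move: (lam * dA z.1 u) (lam * dA u (act g u)) (mulrDr lam (2 * dA z.1 u) (dA u (act g u)))
    (mulrCA lam 2 (dA z.1 u)) => *.
  lra.
have meet i j : exists2 z, F i z & F j z.
  case: i j => [[z Gz]|g] [[w Gw]|h]; rewrite /F /=.
  - have le : dB z.2 w.2 <= lam * dA z.1 u + lam * dA w.1 u.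
      apply: le_trans (lp _ _ Gz Gw) _; rewrite -mulrDr; apply: ler_wpM2l => //.
      by have := zh_tri HdA u z.1 w.1; rewrite (zhC HdA w.1).
    have rz := rad z.1; have rw := rad w.1.
    have d0 := mdist_ge0 z.2 w.2.
    have [|y [y1 y2]] := GeoB (x := z.2) (y := w.2) (r := Num.min (lam * dA z.1 u) (dB z.2 w.2)).
      by rewrite le_min rz d0 ge_min lexx orbT.
    exists y; first by rewrite /= y1 ge_min lexx.
    rewrite /= (zhC HdB) y2; case: (leP (lam * dA z.1 u) (dB z.2 w.2)) => ?; lra.
  - exact: bc.
  - by have [y ? ?] := bc w g Gw; exists y.
  - exact: Cmeet.
have hM i : dB z0.2 (q i) <= lam * dA z0.1 u.
  have [y y0 yi] := meet (inl (exist _ z0 G0)) i; have [_ /(_ _ yi) b] := hq i.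
  by apply: le_trans y0; move: b; rewrite /= /btw => ->; have := mdist_ge0 (q i) y; lra.
have Fcl i z : (forall e : R, 0 < e -> exists2 y, F i y & dB z y < e) -> F i z.
  case: i => [[w Gw]|g]; last exact: Cclosed.
  move=> h; rewrite /F /= leNgt; apply/negP => lt.
  have [|y yC dy] := h (dB w.2 z - lam * dA w.1 u); first by lra.
  by have := zh_tri HdB y w.2 z; rewrite (zhC HdB y z); move: yC; rewrite /=; lra.
have Fcv i : convex_in dB (F i).
  case: i => [[w Gw]|g]; last exact: Cconvex.
  move=> a b c /= ha hb bt; rewrite (zhC HdB); have := max_btw HdB w.2 bt.
  have := zhC HdB w.2 a; have := zhC HdB w.2 b; have := mdist_ge0 a c; have := mdist_ge0 c b.
  have := zhC HdB b c; lra.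
have [y hy] := helly HdB completeB hq meet hM Fcv Fcl.
exists y; split=> [g|z Gz]; first exact: (hy (inr g)).
exact: (hy (inl (exist _ z Gz))).
Qed.

(** Zorn gives a maximal graph. It is nonempty by [displaced_common], applied to a point with
    nontrivial stabilizer if there is one and to any point otherwise, and everywhere defined by
    [ball_common]. *)
Lemma optimal_map : exists f : A -> B, (forall g u, f (act g u) = act g (f u)) /\
  forall u v, dB (f u) (f v) <= lam * dA u v.
Proof.
have [Gam [[inv lp] mx]] : exists Gam, lipschitz_graph Gam /\
    forall Gam', Gam `<` Gam' -> ~ lipschitz_graph Gam'.
  apply: Zorn_bigcup => F sF tF; split=> [g z [Y FY Yz]|z w [Y FY Yz] [Z FZ Zw]].
    by exists Y => //; have [inv _] := sF _ FY; apply: inv.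
  have [YZ|ZY] := tF _ _ FY FZ.
    by have [_ lp] := sF _ FZ; apply: lp => //; apply: YZ.
  by have [_ lp] := sF _ FY; apply: lp => //; apply: ZY.
have ext u y : (forall g, C u g y) -> (forall z, Gam z -> dB z.2 y <= lam * dA z.1 u) ->
    Gam (u, y).
  move=> h1 h2; apply: contrapT => nG.
  apply: (mx _ _ (extend_graph (conj inv lp) h1 h2)); split; first by left.
  by move=> /(_ (u, y)) h; apply: nG; apply: h; right; exists 1%g => //; rewrite !act1.
have ne : Gam !=set0.
  apply: contrapT => /set0P/negP/negPn/eqP G0.
  have [[u hu]|n] := pselect (exists u : A, exists2 h : G, h <> 1%g & act h u = u).
    have [y hy] := displaced_common (or_intror hu).
    by have := ext u y hy; rewrite G0 => h; have : set0 (u, y) by apply: h.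
  have [u _] := exA.
  have [|y hy] := @displaced_common u.
    by left=> g z gz; apply: contrapT => g1; apply: n; exists z, g.
  by have := ext u y hy; rewrite G0 => h; have : set0 (u, y) by apply: h.
have dom u : exists y, Gam (u, y).
  by have [y [h1 h2]] := ball_common u (conj inv lp) ne; exists y; apply: ext.
have [f hf] := choice dom.
exists f; split=> [g u|u v]; last exact: (lp (u, f u) (v, f v)).
apply: SepB; apply/eqP; rewrite eq_le mdist_ge0 andbT.
have := lp _ _ (hf (act g u)) (inv g _ (hf u)).
by rewrite /= mdistxx mulr0.
Qed.

End LipschitzMap.

(** * Trees from metrics *)

Lemma fcount_lt (I : choiceType) (P Q : pred I) i : finite_set [set j | Q j] ->
  (forall j, P j -> Q j) -> ~ P i -> Q i -> (fcount P < fcount Q)%N.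
Proof.
move=> fQ h nP Qi; rewrite -addn1 -(@fcount1 _ (fun j => j == i) i) ?eqxx //; last by move=> j /eqP.
rewrite -[leqRHS]addn0 -(fcount0 I); apply: fcount_leD => // [|j].
  by rewrite (_ : [set _ | _] = set0) //; apply/seteqP; split=> j.
case Pj : (P j); last by case: eqP => [->|_]; rewrite ?Qi.
by rewrite (h j Pj); case: eqP => [e|//]; case: nP; rewrite -e.
Qed.

Section TreeOfMetric.
Variables (R : realType) (X : metricType R) (V : set X).
Local Notation d := (@mdist R X).
Hypotheses (H : zero_hyperbolic d) (Geo : geodesic d) (VD : discrete d V).
Hypothesis Vne : V !=set0.
Hypothesis spanned : forall z, exists u v, [/\ V u, V v & btw d u z v].
Hypothesis complete : forall F : set_system X, ProperFilter F -> cauchy F ->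
  exists z : X, F --> z.

Let sep (u v : X) : d u v = 0 -> u = v.
Proof. by move/mdist_positivity. Qed.

Let seg (u v : X) : set X := [set y | btw d u y v].

Definition metric_edges : set (set X) :=
  [set e | exists u v, adjq d V u v /\ e = seg u v].
Local Notation E := metric_edges.

Let segC u v : seg u v = seg v u.
Proof. by apply/seteqP; split=> y; apply: btwC. Qed.

Let segl u v : seg u v u.
Proof. by rewrite /seg /= /btw mdistxx add0r. Qed.

Let segr u v : seg u v v.
Proof. by rewrite /seg /= /btw mdistxx addr0. Qed.

Let segV u v : adjq d V u v -> seg u v `&` V = [set u; v].
Proof.
move=> [Vu Vv uv h]; apply/seteqP; split=> [w [b Vw]|w]; first exact: h.
by case=> ->.
Qed.

Let edge_eq e u v : E e -> e `&` V = [set u; v] -> adjq d V u v /\ e = seg u v.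
Proof.
case=> [a [b [ab ->]]]; rewrite segV // => eV.
have ha : [set u; v] a by rewrite -eV; left.
have hb : [set u; v] b by rewrite -eV; right.
have nab : a <> b by case: ab.
case: ha nab ab {eV} => ->; case: hb => -> nab ab; first by case: nab.
- by split.
- by split; [apply: (adjqC H)|apply: segC].
- by case: nab.
Qed.

Let E_edges e : E e -> is_metric_edge V e.
Proof.
case=> [u [v [uv ->]]].
have ex t : exists z, 0 <= t <= d u v -> d u z = t /\ d z v = d u v - t.
  have [/Geo[z hz]|n] := pselect (0 <= t <= d u v); first by exists z.
  by exists u.
have [s hs] := choice ex.
have bs t : 0 <= t <= d u v -> btw d u (s t) v.
  by move=> /hs[e1 e2]; rewrite /btw e1 e2; lra.
have L := adjq_gt0 H sep uv.
have h0 : 0 <= (0 : R) <= d u v by rewrite lexx ltW.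
have h1 : 0 <= d u v <= d u v by rewrite ltW //=.
have s0 : s 0 = u by apply/esym/sep; have [] := hs _ h0.
have s1 : s (d u v) = v by apply: sep; have [_ ->] := hs _ h1; rewrite subrr.
exists (d u v), s; split=> //; last by rewrite s0 s1; apply: segV.
  apply/seteqP; split=> [y hy|_ [t ht <-]]; last by apply: bs; move: ht; rewrite /= in_itv.
  have hy2 : 0 <= d u y <= d u v.
    by move: hy; rewrite /seg /= /btw => ->; rewrite mdist_ge0 lerDl mdist_ge0.
  exists (d u y); first by rewrite /= in_itv.
  by apply: sep; apply: (btw_eq H (bs _ hy2) hy); have [] := hs _ hy2.
have key a b : 0 <= a <= d u v -> 0 <= b <= d u v -> a <= b -> d (s a) (s b) = b - a.
  move=> ha hb ab; have [ea _] := hs _ ha; have [eb _] := hs _ hb.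
  have := btw_between H (bs _ ha) (bs _ hb); rewrite ea eb => /(_ ab).
  by rewrite /btw ea eb; lra.
move=> a b ha hb; have [le|/ltW le] := leP a b.
  by rewrite key // distrC ger0_norm ?subr_ge0.
by rewrite metric_sym key // ger0_norm ?subr_ge0.
Qed.

Let adjE u v : Defs.adjacent V E u v <-> adjq d V u v.
Proof.
split=> [/asboolP[uv [e He eV]]|uv]; first by have [] := edge_eq He eV.
apply/asboolP; have [_ _ ne _] := uv; split=> //.
by exists (seg u v); [exists u, v|exact: segV].
Qed.

(** A simple edge path never turns back into the edge it came from, so it is locally geodesic and
    hence geodesic. Uniqueness of simple paths then follows by comparing first edges. *)
Let simple_path_half u a s : path (Defs.adjacent V E) u (a :: s) -> uniq [:: u, a & s] ->
  btw d u a (last a s).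
Proof.
elim: s u a => [|c s ih] u a; first by move=> *; apply: segr.
move=> /= /andP[/adjE ua hp] /andP[hu ha].
have /= := ih a c hp ha; case/andP: hp => /adjE ac _ h.
have uc : u <> c by move=> e; move: hu; rewrite e !inE eqxx !orbT.
have [_ Vc _ _] := ac; have [Vu Va _ hua] := ua.
have bac : btw d u a c.
  case: (half_or H Geo sep VD ac Vu) => [b|/(btwC H)//].
  by case: (hua c Vc (btwC H b)) => e; [case: uc|case: ac => _ _ []].
by have [] := btw_chain H bac h (adjq_gt0 H sep ac).
Qed.

Let simple_path_ex u v : V u -> V v -> exists s : seq X,
  [/\ path (Defs.adjacent V E) u s, last u s = v & uniq (u :: s)].
Proof.
move=> Vu Vv; suff [s [h1 h2 h3 _]] : exists s : seq X,
    [/\ path (Defs.adjacent V E) u s, last u s = v, uniq (u :: s) &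
      forall w, w \in u :: s -> btw d u w v] by exists s.
apply: (chain_indq H sep VD (x := u) (P := fun v => exists s : seq X,
    [/\ path (Defs.adjacent V E) u s, last u s = v, uniq (u :: s) &
      forall w, w \in u :: s -> btw d u w v])) => //.
  by exists [::]; split=> // w; rewrite inE => /eqP ->; apply: segl.
move=> q q' [s [h1 h2 h3 h4]] qq' b; exists (rcons s q'); split.
- by rewrite rcons_path h1 h2; apply/adjE.
- by rewrite last_rcons.
- rewrite -rcons_cons rcons_uniq h3 andbT; apply/negP => /h4 b2.
  have := adjq_gt0 H sep qq'; move: b b2; rewrite /btw (zhC H q' q); lra.
move=> w; rewrite -rcons_cons mem_rcons inE => /orP[/eqP ->|/h4 b2]; first exact: segr.
by have [] := btw_trans H b2 b.
Qed.

Let simple_path_uniq u v s t :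
  [/\ path (Defs.adjacent V E) u s, last u s = v & uniq (u :: s)] ->
  [/\ path (Defs.adjacent V E) u t, last u t = v & uniq (u :: t)] -> s = t.
Proof.
elim: s u t => [|a s ih] u [|b t] //= [h1 h2 h3] [h4 h5 h6].
- by move: h6; rewrite h2 -h5 mem_last.
- by move: h3; rewrite h5 -h2 mem_last.
have hs := simple_path_half h1 h3; have ht := simple_path_half h4 h6.
have [e|/eqP ne] := eqVneq a b; last first.
  move: h1 h4 => /andP[/adjE ua _] /andP[/adjE ub _].
  by have := half_disjoint_adj H ua ub ne hs; rewrite h2 -h5 => /(_ ht).
subst b; congr (_ :: _); apply: (ih a).
  by case/andP: h1 => _ h1; case/andP: h3.
by case/andP: h4 => _ h4; case/andP: h6.
Qed.

(* Vertices [u'], [w'] nearest to [x] and [y] on either side. *)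
Let edge_around u w x y : V u -> V w -> btw d u x w -> btw d u x y -> btw d x y w -> btw d u y w ->
  (forall v, V v -> btw d x v y -> v = x \/ v = y) -> (x = y -> ~ V x) ->
  exists e, [/\ E e, e x & e y].
Proof.
move=> Vu Vw buxw buxy bxyw buyw nov nxy.
have fin a b : finite_set [set z | V z /\ btw d a z b] by apply: disc_finite VD a b.
have [|u' [Vu' bu'] hu'] := @finite_argmin R _ [set z | V z /\ btw d u z x] (fun z => d z x) (fin u x).
  by exists u; split=> //; apply: segl.
have [|w' [Vw' bw'] hw'] := @finite_argmin R _ [set z | V z /\ btw d y z w] (fun z => d y z) (fin y w).
  by exists w; split=> //; apply: segr.
have [b1 b1'] := btw_trans H bu' buxw. 
have [b2 b2'] := btw_trans H bu' buxy.
have b3 : btw d u' y w' /\ btw d x y w'.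
  move: bw' bxyw b1' b2' buyw; rewrite /btw => *.
  have := zh_tri H y x w'; have := zh_tri H y u' w'; have := zh_tri H w' x w; have := zh_tri H w' u' w.
  by split; lra.
have b4 : btw d u' x w'.
  move: b3 b2'; rewrite /btw => -[]; lra.
exists (seg u' w'); split; [|exact: b4|by case: b3].
exists u', w'; split=> //; split=> //.
  move=> e; subst w'.
  have [xy|xy] := pselect (x = y).
    apply: (nxy xy); suff <- : u' = x by [].
    by apply: sep; move: b4; rewrite /btw mdistxx (zhC H x); have := mdist_ge0 u' x; lra.
  apply: xy; apply: sep; move: b4 b3; rewrite /btw mdistxx => ? [].
  have := mdist_ge0 u' x; have := zhC H x u'; have := mdist_ge0 y u'; have := mdist_ge0 u' y; have := mdist_ge0 x y; lra.
move=> v Vv bv; have [b3a b3b] := b3.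
have [bl|bl] := btw_split H x bv.
  left; have : d u' x <= d v x.
    apply: hu'; split=> //; move: bl bu'; rewrite /btw.
    have := zh_tri H u' u v; have := zh_tri H v u x; lra.
  move: bl; rewrite /btw => bl le; apply/esym/sep.
  have := mdist_ge0 u' v; lra.
have [bl2|bl2] := btw_split H y bl; last first.
  right; have : d y w' <= d y v.
    apply: hw'; split=> //; move: bl2 bw'; rewrite /btw.
    have := zh_tri H w' v w; have := zh_tri H v y w; lra.
  move: bl2; rewrite /btw => bl2 le; apply/sep.
  have := mdist_ge0 v w'; lra.
case: (nov v Vv bl2) => e; subst v; [left|right].
  apply/esym/sep/eqP; rewrite eq_le mdist_ge0 andbT -(mdistxx x).
  by apply: hu'; split=> //; apply: segr.
apply/esym/sep/eqP; rewrite (zhC H) eq_le mdist_ge0 andbT -(mdistxx y).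
by apply: hw'; split=> //; apply: segl.
Qed.

Let point_on_edge z : ~ V z -> exists2 e, E e & e z.
Proof.
move=> nV; have [u [v [Vu Vv b]]] := spanned z.
have [|e [He e1 _]] := @edge_around u v z z Vu Vv b (segr u z) (segl z v) b _ (fun _ => nV).
  move=> w Vw; rewrite /btw mdistxx => bw; left; apply/esym/sep.
  by have := mdist_ge0 z w; have := mdist_ge0 w z; lra.
by exists e.
Qed.

Let extend z y : exists u, V u /\ btw d u z y.
Proof.
have [u [v [Vu Vv b]]] := spanned z.
by have [h|/(btwC H) h] := btw_split H y b; [exists u|exists v].
Qed.

(** Induction on the number of vertices strictly between [a] and [b]. If there is none, both points
    lie on one edge; otherwise the string is cut at such a vertex. *)
Let string_attained a b : string_lengths E a b (d a b).
Proof.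
have fin x y : finite_set [set z | V z /\ btw d x z y] by apply: disc_finite VD x y.
pose I x y := fun z => `[< [/\ V z, btw d x z y, z <> x & z <> y] >].
have finI x y : finite_set [set z | I x y z].
  by apply: sub_finite_set (fin x y) => z /asboolP[].
have [n] := ubnP (fcount (I a b)); elim: n a b => // n ih a b hn.
have [->|/eqP ab] := eqVneq a b.
  by exists [::]; rewrite /= big_nil mdistxx.
have [[v [Vv bv va vb]]|nv] := pselect (exists v, [/\ V v, btw d a v b, v <> a & v <> b]).
  have lt x y : (forall z, I x y z -> I a b z) -> ~ I x y v -> (fcount (I x y) < n)%N.
    move=> h nI; apply: leq_trans (_ : fcount (I a b) <= n)%N; last by [].
    by apply: (fcount_lt (finI a b) h (i := v)) => //; apply/asboolP.
  have bp : 0 < d a v by rewrite mdist_gt0; apply/eqP => e; apply: va.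
  have [s1 [p1 l1 e1]] : string_lengths E a v (d a v).
    apply: ih; apply: lt => [z /asboolP[Vz bz za zv]|/asboolP[]//].
    apply/asboolP; split=> //; first by have [] := btw_trans H bz bv.
    move=> e; subst z; apply: zv; apply: sep; have := mdist_ge0 b v; move: bz bv; rewrite /btw (zhC H v b); lra.
  have [s2 [p2 l2 e2]] : string_lengths E v b (d v b).
    apply: ih; apply: lt => [z /asboolP[Vz bz zv zb]|/asboolP[]//].
    apply/asboolP; split=> //; first by have [] := btw_trans H (btwC H bz) (btwC H bv) => /(btwC H) + /(btwC H).
    move=> e; subst z; apply: zv; apply: sep; have := mdist_ge0 a v; move: bz bv; rewrite /btw (zhC H v a); lra.
  exists (s1 ++ s2); split.
  - by rewrite cat_path p1 l1.
  - by rewrite last_cat l1.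
  - by rewrite pairmap_cat big_cat /= l1 -e1 -e2.
have d0 : 0 < d a b by rewrite mdist_gt0; apply/eqP.
have [u [Vu bu]] := extend a b; have [w [Vw bw]] := extend b a.
have [bu2 bu3] := btw_chain H bu (btwC H bw) d0.
have [|e [He ea eb]] := @edge_around u w a b Vu Vw bu3 bu (btwC H bw) bu2 _ (fun e => False_ind _ (ab e)).
  move=> v Vv bv; apply: contrapT => /not_orP[n1 n2]; apply: nv; exists v.
  by split.
exists [:: b]; rewrite /= big_seq1 andbT; split=> //.
by apply/asboolP; exists e.
Qed.

Let string_ge a s : d a (last a s) <= \sum_(x <- pairmap d a s) x.
Proof.
elim: s a => [|b s ih] a /=; first by rewrite big_nil mdistxx.
rewrite big_cons; have := metric_triangle a b (last b s); have := ih b; lra.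
Qed.

(** Kept transparent, so that the points, the metric and the vertex set of the tree remain the given
    ones. *)
Definition tree_of_metric : simplicial_metric_tree R.
Proof.
apply: (@SimplicialMetricTree R X V E E_edges); split=> //.
- move=> e e' [u [v [uv ->]]] He'; rewrite segV // => /esym /(edge_eq He')[_ ->] //.
- move=> e e' [u [v [uv ->]]] [u' [v' [uv' ->]]] ne z [b b'].
  apply: contrapT => nV; apply: ne.
  have [Vu Vv nuv _] := uv; have [Vu' Vv' nuv' _] := uv'.
  have conv a c : convex_in d (half d a c) := half_convex H.
  have stuck a c : adjq d V a c -> btw d a z c -> half d a c z -> False.
    move=> ac bz hz; apply: nV; have [_ Vc _ _] := ac.
    suff -> : z = c by [].
    move: hz bz; rewrite /half /= /btw => h1 h2; apply: sep.
    by have := zhC H z c; have := mdist_ge0 z c; lra.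
  have := half_or H Geo sep VD uv' Vu; have := half_or H Geo sep VD uv' Vv => -[hv|hv] [hu|hu].
  - by case: (stuck _ _ uv' b'); apply: conv hu hv b.
  - have [e1 e2] := half_cross H sep uv' (adjqC H uv) hv hu.
    by rewrite e1 e2.
  - have [e1 e2] := half_cross H sep uv' uv hu hv.
    by rewrite e1 e2 segC.
  - by case: (stuck _ _ (adjqC H uv') (btwC H b')); apply: conv hu hv b.
- by move=> z; have [|/point_on_edge] := pselect (V z); [left|right].
- move=> u v Vu Vv; have [s hs] := simple_path_ex Vu Vv; exists s; split=> // t ht.
  exact: simple_path_uniq hs ht.
- move=> a b; apply/eqP; rewrite eq_le; apply/andP; split.
    apply: lb_le_inf; first by exists (d a b); apply: string_attained.
    by move=> _ [s [_ <- ->]]; apply: string_ge.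
  apply: ge_inf; last exact: string_attained.
  by exists 0 => _ [s [_ _ ->]]; apply: le_trans (string_ge a s); apply: mdist_ge0.
Defined.

End TreeOfMetric.

(** * The tree spanned by a zero-hyperbolic metric *)

Lemma min_cases (R : realType) (a b : R) :
  (Num.min a b = a /\ a <= b) \/ (Num.min a b = b /\ b <= a).
Proof. by have [h|/ltW h] := leP a b; [left|right]. Qed.

Section MetricQuotient.
Variables (R : realType) (Y : choiceType) (D : Y -> Y -> R).
Hypothesis H : zero_hyperbolic D.

(** Points at distance 0 share one chosen representative, which makes the metric quotient a subtype
    with an inherited choice structure. *)
Definition canon (x : Y) : Y := choose (fun y => `[< D x y = 0 >]) x.

Lemma canon0 x : D x (canon x) = 0.
Proof.
by apply/asboolP; apply: (@chooseP _ (fun y => `[< D x y = 0 >]) x); apply/asboolP/(zh0 H).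
Qed.

Lemma D0_eq x y z : D x y = 0 -> D x z = D y z.
Proof.
have := zh_tri H y x z; have := zh_tri H x y z; have := zhC H x y; lra.
Qed.

Lemma canon_eq x y : D x y = 0 -> canon x = canon y.
Proof.
move=> e; rewrite /canon (_ : (fun z => `[< D y z = 0 >]) = (fun z => `[< D x z = 0 >])).
  by apply: choose_id; apply/asboolP => //; apply: (zh0 H).
by apply/funext => z; rewrite (D0_eq _ e).
Qed.

(** The proof [h] is an argument so that the type determines the metric structure declared on it. *)
Definition mquot (h : zero_hyperbolic D) : Type := {x : Y | canon x == x}.
Local Notation X := (mquot H).

Lemma canonK x : canon (canon x) == canon x.
Proof. by rewrite -(canon_eq (canon0 x)). Qed.

Definition mproj (x : Y) : X := exist _ (canon x) (canonK x).

Definition qdist (x y : X) : R := D (sval x) (sval y).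

Lemma qdist_proj x y : qdist (mproj x) (mproj y) = D x y.
Proof.
by rewrite /qdist /= -(D0_eq _ (canon0 x)) (zhC H) -(D0_eq _ (canon0 y)) (zhC H).
Qed.

Lemma mproj_surj (x : X) : mproj (sval x) = x.
Proof. by apply: val_inj => /=; apply/eqP; case: x. Qed.

Lemma qdist_zh : zero_hyperbolic qdist.
Proof.
by split=> [x|x y|x y z t]; [apply: (zh0 H)|apply: (zhC H)|apply: (zh4 H)].
Qed.

Lemma qdist_sep x y : qdist x y = 0 -> x = y.
Proof.
move=> e; apply: val_inj => /=; have := canon_eq e.
by case: x {e} => x /= /eqP ->; case: y => y /= /eqP ->.
Qed.

HB.instance Definition _ := Choice.on X.
HB.instance Definition _ := isMetric.Build R X (zh0 qdist_zh) qdist_sep (zhC qdist_zh)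
  (zh_tri qdist_zh).

Lemma mquot_zh : zero_hyperbolic (@mdist R X).
Proof. exact: qdist_zh. Qed.

Lemma mdist_proj x y : mdist (mproj x) (mproj y) = D x y.
Proof. exact: qdist_proj. Qed.

End MetricQuotient.

(* The point at distance [r] from [b] on the segment from [b] to [p] is encoded as [(p, r)]. *)
Section Cone.
Variables (R : realType) (Q : choiceType) (D : Q -> Q -> R).
Hypothesis H : zero_hyperbolic D.
Variable b : Q.

Definition cone : Type := {x : Q * R | 0 <= x.2 <= D b x.1}.
HB.instance Definition _ := Choice.on cone.

Definition gp (p q : Q) : R := (D b p + D b q - D p q) / 2.
Definition cmeet (x y : cone) : R :=
  Num.min (gp (sval x).1 (sval y).1) (Num.min (sval x).2 (sval y).2).
Definition cdist (x y : cone) : R := (sval x).2 + (sval y).2 - 2 * cmeet x y.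

Lemma cone_zh : zero_hyperbolic cdist.
Proof.
have gpC p q : gp p q = gp q p by rewrite /gp (zhC H p q); lra.
have mC x y : cmeet x y = cmeet y x by rewrite /cmeet gpC (minC (sval x).2).
have mult x y z : Num.min (cmeet x y) (cmeet y z) <= cmeet x z.
  have h : Num.min (gp (sval x).1 (sval y).1) (gp (sval y).1 (sval z).1) <= gp (sval x).1 (sval z).1.
    have := gp_min H b (sval x).1 (sval y).1 (sval z).1.
    by rewrite /gp ge_min; case=> h; apply/orP; [left|right]; lra.
  have le3 (t u v w : R) : t <= u -> t <= v -> t <= w -> t <= Num.min u (Num.min v w).
    by move=> *; rewrite !le_min; apply/and3P.
  rewrite /cmeet; apply: le3.
  - by apply: le_trans h; rewrite le_min !ge_min !lexx !orbT.
  - by rewrite !ge_min lexx !orbT.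
  - by rewrite !ge_min lexx !orbT.
split=> [[[x r] hx]|x y|x y z t].
- rewrite /cdist /cmeet /gp /= (zh0 H) minxx min_r; move: hx => /= /andP[h1 h2]; lra.
- by rewrite /cdist mC; lra.
have := mult x z y; have := mult x t y; have := mult z x t; have := mult z y t.
rewrite /cdist (mC z x) (mC z y) (mC t y).
move: (cmeet x y) (cmeet x z) (cmeet x t) (cmeet y z) (cmeet y t) (cmeet z t)
  => c1 c2 c3 c4 c5 c6.
rewrite !ge_min => /orP h1 /orP h2 /orP h3 /orP h4.
have [h|h] := leP (c2 + c5) (c1 + c6); [by left; lra|right].
by case: h1 => ?; case: h2 => ?; case: h3 => ?; case: h4 => ?; lra.
Qed.

Lemma cone_geodesic : geodesic cdist.
Proof.
have half x y t : 0 <= t <= (sval x).2 - cmeet x y ->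
    exists z, cdist x z = t /\ cdist z y = cdist x y - t.
  move=> /andP[t0 t1]; set p := (sval x).1; set r := (sval x).2.
  have m0 : 0 <= r - t <= D b p.
    have hx := svalP x; rewrite /= -/p -/r in hx; have /andP[h1 h2] := hx.
    have hy := svalP y; move: hy => /andP[h3 h4].
    have : 0 <= cmeet x y.
      rewrite /cmeet /gp -/p -/r !le_min h1 h3 !andbT.
      have := zh_tri H b p (sval y).1; rewrite (zhC H p b); lra.
    by move: t1; rewrite -/r => *; apply/andP; split; lra.
  exists (exist _ (p, r - t) m0); rewrite /cdist /cmeet /=; split.
    rewrite /gp -/p -/r (zh0 H) (min_r (_ : r - t <= r)); last by lra.
    rewrite min_r; [lra|]; move: m0 => /andP[]; lra.
  move: t1; rewrite /cmeet /= -/p -/r; move: (gp p (sval y).1) (sval y).2 => g s.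
  have := min_cases g (Num.min r s); have := min_cases g (Num.min (r - t) s).
  have := min_cases r s; have := min_cases (r - t) s; lra.
move=> x y t /andP[t0 t1].
have [le|lt] := leP t ((sval x).2 - cmeet x y).
  by apply: half; rewrite t0.
have sym u v : cdist u v = cdist v u by apply: (zhC cone_zh).
have [|z [z1 z2]] := half y x (cdist x y - t).
  apply/andP; split; first by lra.
  move: lt; rewrite /cdist (_ : cmeet y x = cmeet x y); first by lra.
  by rewrite /cmeet (minC (sval y).2); congr Num.min; rewrite /gp (zhC H (sval y).1); lra.
by exists z; rewrite sym z2 (sym y x) (sym z) z1; split; lra.
Qed.

Definition cone_pt (q : Q) : cone.
Proof. by exists (q, D b q); rewrite /= lexx (zh_ge0 H). Defined.

Lemma cdist_pt p q : cdist (cone_pt p) (cone_pt q) = D p q.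
Proof.
rewrite /cdist /cmeet /gp /= min_l ?le_min; first by lra.
have := zh_tri H q b p; have := zh_tri H p b q; have := zhC H p q.
by move=> *; apply/andP; split; lra.
Qed.

Lemma cone_btw (x : cone) : btw cdist (cone_pt b) x (cone_pt (sval x).1).
Proof.
rewrite /btw cdist_pt; have /andP[] := svalP x.
set p := (sval x).1; set r := (sval x).2 => h1 h2.
rewrite /cdist /cmeet /gp /= -/p -/r !(zh0 H).
have := min_cases ((0 + D b p - D b p) / 2) (Num.min 0 r); have := min_cases 0 r.
have := min_cases ((D b p + D b p - 0) / 2) (Num.min r (D b p)); have := min_cases r (D b p); lra.
Qed.

End Cone.

Section Span.
Variables (R : realType) (Q : choiceType) (D : Q -> Q -> R).
Hypothesis H : zero_hyperbolic D.
Variable b : Q.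

Definition span : metricType R := Metric.clone R (mquot (cone_zh H b)) _.
Local Notation d := (@mdist R span).

Definition span_pt (q : Q) : span := mproj (cone_zh H b) (cone_pt H b q).

Lemma span_zh : zero_hyperbolic d.
Proof. exact: mquot_zh. Qed.

Lemma span_sep (x y : span) : d x y = 0 -> x = y.
Proof. exact: mdist_positivity. Qed.

Lemma span_geodesic : geodesic d.
Proof.
move=> x y t; rewrite -(mproj_surj x) -(mproj_surj y) mdist_proj => /(cone_geodesic H)[z [z1 z2]].
by exists (mproj (cone_zh H b) z); rewrite !mdist_proj.
Qed.

Lemma span_dist p q : d (span_pt p) (span_pt q) = D p q.
Proof. by rewrite mdist_proj cdist_pt. Qed.

Lemma span_btw (x : span) : exists p, btw d (span_pt b) x (span_pt p).
Proof.
have [y ->] : exists y, x = mproj (cone_zh H b) y by exists (sval x); rewrite mproj_surj.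
by exists (sval y).1; rewrite /btw !mdist_proj; apply: cone_btw.
Qed.

(** By [btw_split] the point [y] of [p,q] lies on [p,x] or on [x,q]. It follows that a point is
    determined by its distances to [Q], which is how equality and the group action on the span are
    handled. *)
Lemma dist_via (x y p q : span) : btw d p y q ->
  d x y = Num.max (d x p - d y p) (d x q - d y q).
Proof.
move=> bt; have S := span_zh.
have [h|h] := btw_split S x bt; rewrite /btw in h bt.
  rewrite max_l; have := zh_tri S y q x; have := zhC S y q; have := zhC S y p.
    have := zhC S x p; have := zhC S x y; have := zhC S q x; lra.
  have := zhC S x p; have := zhC S x y; have := zhC S q x; lra.
rewrite max_r; have := zh_tri S y p x; have := zhC S y q; have := zhC S y p.
  have := zhC S x p; have := zhC S x y; have := zhC S q x; lra.
have := zhC S x p; have := zhC S x y; have := zhC S q x; lra.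
Qed.

Lemma span_ext (x y : span) : (forall q, d x (span_pt q) = d y (span_pt q)) -> x = y.
Proof.
move=> h; have [p bp] := span_btw x; apply: span_sep.
rewrite metric_sym (dist_via y bp) !h !subrr maxxx //.
Qed.

Section Action.
Variables (G : groupType) (a : G -> Q -> Q).
Hypothesis A : isom_action D a.

(** For [x] on [b,p] the image is the point of the segment from [a g b] to [a g p] at the same
    distance from the first end; its distances to [Q] are then read off from [dist_via]. *)
Let lift_ex g (x : span) : exists y : span, forall q, d y (span_pt q) = d x (span_pt (a g^-1%g q)).
Proof.
have [p bp] := span_btw x.
have L : D (a g b) (a g p) = d (span_pt b) (span_pt p) by rewrite span_dist (iaD A).
have [|y [y1 y2]] := span_geodesic (x := span_pt (a g b)) (y := span_pt (a g p)) (r := d (span_pt b) x).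
  by rewrite span_dist L bp mdist_ge0 lerDl mdist_ge0.
have by' : btw d (span_pt (a g b)) y (span_pt (a g p)) by rewrite /btw y1 y2; lra.
exists y => q; rewrite metric_sym (dist_via _ by') [RHS]metric_sym (dist_via _ bp) !span_dist.
have e r : D (a g^-1%g q) r = D q (a g r) by rewrite (iaDV A).
have y3 : d y (span_pt (a g p)) = d x (span_pt p) by rewrite y2 span_dist L bp; lra.
by rewrite !e (metric_sym y (span_pt (a g b))) y1 y3 (metric_sym x (span_pt b)).
Qed.

Definition span_act g x := sval (cid (lift_ex g x)).

Lemma span_actE g x q : d (span_act g x) (span_pt q) = d x (span_pt (a g^-1%g q)).
Proof. by rewrite /span_act; case: cid. Qed.

Lemma span_act_pt g q : span_act g (span_pt q) = span_pt (a g q).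
Proof. by apply: span_ext => r; rewrite span_actE !span_dist (zhC H) (iaDV A) (zhC H). Qed.

Lemma span_isom : isom_action d span_act.
Proof.
split=> [x|g h x|g x y].
- by apply: span_ext => q; rewrite span_actE invg1 (ia1 A).
- by apply: span_ext => q; rewrite !span_actE invgM (iaM A).
have [p bp] := span_btw y.
have bp' : btw d (span_pt (a g b)) (span_act g y) (span_pt (a g p)).
  rewrite /btw (metric_sym (span_pt (a g b)) (span_act g y)) !span_actE !(iaVl A).
  by rewrite span_dist (iaD A) -span_dist bp (metric_sym y (span_pt b)).
by rewrite (dist_via _ bp') (dist_via _ bp) !span_actE !(iaVl A).
Qed.

End Action.

Section Discrete.
Variable eps : R.
Hypothesis eps0 : 0 < eps.
Hypothesis Dsep : forall p q, D p q = 0 \/ eps <= D p q.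
Hypothesis median : forall p q r, exists m, [/\ btw D p m q, btw D q m r & btw D p m r].

Definition span_vertices : set span := range span_pt.
Local Notation V := span_vertices.

Lemma span_vertices_sep (u v : span) : V u -> V v -> u = v \/ eps <= d u v.
Proof.
by move=> [p _ <-] [q _ <-]; rewrite span_dist; case: (Dsep p q) => h; [left; apply: span_sep; rewrite span_dist|right].
Qed.

Lemma span_extend (z y : span) : exists p, btw d (span_pt p) z y.
Proof.
have [p bp] := span_btw z.
by have [h|/(btwC span_zh) h] := btw_split span_zh y bp; [exists b|exists p].
Qed.

(** A branch point of the span is the median of three points of [Q], hence in [Q]. Local finiteness
    comes from the gap [eps] between distinct vertices. *)
Lemma span_discrete : discrete d V.
Proof.
have S := span_zh.
split=> [z x y c px py pc bxy byc bxc|x y].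
  have [p bp] := span_extend x z; have [q bq] := span_extend y z; have [r br] := span_extend c z.
  have far u v s t : btw d s u z -> btw d t v z -> 0 < d z u -> 0 < d z v -> btw d u z v -> btw d s z t.
    move=> h1 h2 zu zv h3; have uz : 0 < d u z by rewrite (zhC S).
    have [h4 _] := btw_chain S h1 h3 uz.
    by have [_] := btw_chain S h4 (btwC S h2) zv.
  have [m [m1 m2 m3]] := median p q r.
  exists m => //; apply: span_sep.
  have b1 := far _ _ _ _ bp bq px py bxy; have b2 := far _ _ _ _ bq br py pc byc.
  have b3 := far _ _ _ _ bp br px pc bxc.
  move: b1 b2 b3 m1 m2 m3; rewrite /btw -!span_dist.
  have e1 := zhC S (span_pt m) (span_pt q); have e2 := zhC S z (span_pt q).
  move=> b1 b2 b3 m1 m2 m3.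
  have em : d (span_pt p) z = d (span_pt p) (span_pt m) by lra.
  by rewrite (zhC S); apply: (btw_eq S (x := span_pt p) (y := span_pt q)).
(* The segment is cut into pieces of length [eps], each containing at most one vertex. *)
pose n z := Num.truncn (d x z / eps).
have ex m : exists z, forall w, V w -> btw d x w y -> n w = m -> w = z.
  have [[z [Vz bz ez]]|nz] := pselect (exists z, [/\ V z, btw d x z y & n z = m]); last first.
    by exists x => w Vw bw ew; case: nz; exists w.
  exists z => w Vw bw ew.
  have itv u : n u = m -> m%:R * eps <= d x u < m%:R * eps + eps.
    move=> eu; have := @truncn_itv R (d x u / eps); rewrite -/(n u) eu.
    rewrite divr_ge0 ?mdist_ge0 ?(ltW eps0) // => /(_ isT).
    by rewrite ler_pdivlMr // ltr_pdivrMr // -natr1 mulrDl mul1r.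
  have /andP[z1 z2] := itv _ ez; have /andP[w1 w2] := itv _ ew.
  case: (span_vertices_sep Vw Vz) => // le; exfalso.
  have [zw|/ltW zw] := leP (d x w) (d x z).
    have := btw_between S bw bz zw; rewrite /btw; lra.
  have := btw_between S bz bw zw; rewrite /btw; have := zhC S w z; lra.
have [h hh] := choice ex.
apply: (sub_finite_set (B := h @` `I_(n y).+1)); last exact/finite_image/finite_II.
move=> z [Vz bz]; exists (n z); last by apply/esym/hh.
rewrite /= ltnS truncn_le_nat; apply: le_lt_trans (truncnS_gt _).
by rewrite ler_pM2r ?invr_gt0 //; move: bz; rewrite /btw => ->; rewrite lerDl mdist_ge0.
Qed.

Lemma small_diameter (F : set_system span) : ProperFilter F -> cauchy F ->
  forall r : R, 0 < r -> exists S, F S /\ forall x y, S x -> S y -> d x y < r.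
Proof.
move=> FF /cauchy_ballP Fc r r0; have r2 : 0 < r / 2 by lra.
have [[A B] /= [FA FB] AB] := Fc _ r2.
exists (A `&` B); split; first exact: filterI.
move=> x y [Ax _] [Ay By].
have h1 : ball x (r / 2) y by apply: (AB (x, y)).
by move: h1; rewrite ballEmdist /=; lra.
Qed.

Lemma cvg_mdist (F : set_system span) (y : span) : Filter F ->
  (forall r : R, 0 < r -> exists S, F S /\ forall x, S x -> d y x < r) -> F --> y.
Proof.
move=> FF h A /nbhs_ballP[r /= r0 hA]; have [S [FS hS]] := h r r0.
by apply: filterS FS => x /hS lt; apply: hA; rewrite ballEmdist.
Qed.

(** A Cauchy filter that converges to no vertex contains a small set with no vertex between any two
    of its points. Such a set lies on a single segment, which reduces the claim to the completeness
    of the reals. *)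
Lemma span_complete (F : set_system span) : ProperFilter F -> cauchy F ->
  exists z : span, F --> z.
Proof.
move=> FF Fc; have S := span_zh; have small := small_diameter FF Fc.
have [[v [Vv hv]]|nv] := pselect (exists v, V v /\ forall r : R, 0 < r ->
    exists U, F U /\ forall x, U x -> d v x < r).
  by exists v; apply: cvg_mdist.
have e4 : 0 < eps / 4 by rewrite divr_gt0.
have [S0 [F0 h0]] := small _ e4.
have away v : V v -> exists r : R, 0 < r /\ forall U, F U -> exists2 x, U x & r <= d v x.
  move=> Vv; apply: contrapT => n; apply: nv; exists v; split=> // r r0.
  apply: contrapT => n2; apply: n; exists r; split=> // U FU.
  apply: contrapT => n3; apply: n2; exists U; split=> // x Ux; rewrite ltNge; apply/negP => le.
  by apply: n3; exists x.
(* a set of the filter with no vertex between any two of its points *)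
have [S1 [F1 h1 s1]] : exists S1, [/\ F S1, forall x y, S1 x -> S1 y -> d x y < eps / 4 &
    forall x y v, S1 x -> S1 y -> V v -> btw d x v y -> False].
  have [[v [Vv [x [Sx dx]]]]|n] := pselect (exists v, V v /\ exists x, S0 x /\ d x v < eps / 4).
    have [r [r0 hr]] := away v Vv.
    have r4 : 0 < r / 4 by lra.
    have [S1 [F1 h1]] := small _ r4.
    exists (S0 `&` S1); split; first exact: filterI.
      by move=> y z [Sy _] [Sz _]; apply: h0.
    move=> y z w [Sy S1y] [Sz S1z] Vw bw.
    have ew : w = v.
      case: (span_vertices_sep Vw Vv) => // le; exfalso.
      have := h0 _ _ Sy Sz; have := h0 _ _ Sx Sy; have := zh_tri S y w v; have := zh_tri S x y v.
      have := zhC S w y; have := zhC S x y; move: bw; rewrite /btw; have := mdist_ge0 w z; lra.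
    subst w; have [u S1u le] := hr _ F1.
    have := h1 _ _ S1y S1z; have := h1 _ _ S1y S1u; have := zh_tri S y v u.
    have := zhC S v y; move: bw; rewrite /btw; have := mdist_ge0 v z; lra.
  exists S0; split=> // y z w Sy Sz Vw bw; apply: n; exists w; split=> //; exists y; split=> //.
  by have := h0 _ _ Sy Sz; move: bw; rewrite /btw; have := mdist_ge0 w z; lra.
have [x0 Sx0] := filter_ex F1; have [p bp] := span_btw x0.
pose o := span_pt b; pose q := span_pt p; rewrite -/o -/q in bp.
have line y : S1 y -> btw d o y q.
  move=> Sy; apply: contrapT => ny.
  pose t := (d o q + d o y - d q y) / 2.
  have [|m [m1 m2]] := span_geodesic (x := o) (y := q) (r := t).
    have := zh_tri S o q y; have := zh_tri S q o y; have := zhC S o q; rewrite /t => *.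
    by apply/andP; split; lra.
  have bm : btw d o m q by rewrite /btw m1 m2; lra.
  have my := dist_via y bm; have xy := dist_via y bp.
  have Co := zhC S y o; have Cq := zhC S y q; have Cx := zhC S x0 o; have Cm := zhC S m o.
  have d0 := mdist_ge0 m y; have := zhC S m y => Cmy; have Cyx := zhC S y x0.
  have emy : d m y = d o y - t.
    rewrite Cmy my Co Cq Cm m1 m2 /t /Num.max; case: ifP => _; lra.
  have bom : btw d o m y by rewrite /btw m1 emy; lra.
  have bqm : btw d q m y by rewrite /btw (zhC S q m) m2 emy /t; lra.
  have xm : btw d x0 m y.
    have xm := dist_via x0 bm; have Cmx := zhC S m x0; have e1 := bp; rewrite /btw in e1.
    rewrite /btw emy xm -Cyx xy Co Cq Cx Cm m1 m2 /t.
    by rewrite /Num.max; do 2 case: ltP => ?; lra.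
  apply: (s1 x0 y m) => //.
  have [e|/eqP mo] := eqVneq m o; first by rewrite e; exists b.
  have [e|/eqP mq] := eqVneq m q; first by rewrite e; exists p.
  have [e|/eqP mny] := eqVneq m y; first by case: ny; rewrite -e.
  have gt u : m <> u -> 0 < d m u by move=> n; rewrite mdist_gt0; apply/eqP.
  by apply: (disc_branch span_discrete (gt _ mo) (gt _ mq) (gt _ mny)) => //.
have [c [c0 cq hc]] : exists c : R, [/\ 0 <= c, c <= d o q & forall r : R, 0 < r ->
    exists U, F U /\ forall x, U x -> `|d o x - c| < r].
  (* The limit position on the segment is the supremum of the eventual lower bounds of the distance
     to [o]. *)
  pose Z := [set t : R | exists U, F U /\ forall x, U x -> t <= d o x].
  have ub t : Z t -> t <= d o q.
    move=> [U [FU hU]]; have [x [Ux /line bx]] := filter_ex (filterI FU F1).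
    by apply: le_trans (hU _ Ux) _; rewrite bx lerDl mdist_ge0.
  have Z0 : Z 0 by exists S1; split=> // x _; apply: mdist_ge0.
  have hZ : has_sup Z by split; [exists 0|exists (d o q) => t /ub].
  exists (sup Z); split; first exact: (ub_le_sup hZ.2 Z0).
    by apply: ge_sup => //; exists 0.
  move=> r r0; have r3 : 0 < r / 3 by rewrite divr_gt0.
  have [U [FU hU]] := small _ r3; have [u Uu] := filter_ex FU.
  exists U; split=> // x Ux.
  have lip y z : d o y <= d o z + d y z by rewrite (metric_sym y); apply: metric_triangle.
  have le1 : d o u - r / 3 <= sup Z.
    apply: (ub_le_sup hZ.2); exists U; split=> // y Uy.
    by have := hU _ _ Uu Uy; have := lip u y; lra.
  have le2 : sup Z <= d o u + r / 3.
    apply: ge_sup => [|t [U' [FU' hU']]]; first by exists 0.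
    have [y [U'y Uy]] := filter_ex (filterI FU' FU).
    by have := hU' _ U'y; have := hU _ _ Uy Uu; have := lip y u; lra.
  have := hU _ _ Uu Ux; have := lip u x; have := lip x u; have := zhC S x u.
  by move=> *; rewrite ltr_norml; apply/andP; split; lra.
have [|z [z1 z2]] := span_geodesic (x := o) (y := q) (r := c); first by rewrite c0.
have bz : btw d o z q by rewrite /btw z1 z2; lra.
exists z; apply: cvg_mdist => r /hc[U [FU hU]]; exists (U `&` S1); split; first exact: filterI.
move=> x [/hU lt /line bx]; have [le|/ltW le] := leP (d o z) (d o x).
  have := btw_between S bz bx le; rewrite /btw z1 => e.
  by move: lt; rewrite e ger0_norm; [lra|rewrite addrAC subrr add0r mdist_ge0].
have := btw_between S bx bz le; rewrite /btw z1 => e.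
by move: lt; rewrite distrC e (zhC S z) ger0_norm; [lra|rewrite addrAC subrr add0r mdist_ge0].
Qed.

Definition span_tree : simplicial_metric_tree R :=
  tree_of_metric span_zh span_geodesic span_discrete
    (ex_intro _ (span_pt b) (ex_intro2 _ _ b I erefl))
    (fun z => let: ex_intro p bp := span_btw z in
      ex_intro _ (span_pt b) (ex_intro _ (span_pt p)
        (And3 (ex_intro2 _ _ b I erefl) (ex_intro2 _ _ p I erefl) bp)))
    span_complete.

Section SpanGTree.
Variables (G : groupType) (a : G -> Q -> Q).
Hypothesis A : isom_action D a.
Local Notation act_ := (span_act A).
Let SA := span_isom A.

Let act_V g v : V v -> V (act_ g v).
Proof. by move=> [q _ <-]; rewrite span_act_pt; exists (a g q). Qed.

Let act_E g e : metric_edges V e -> metric_edges V (act_ g @` e).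
Proof.
move=> [u [v [uv ->]]]; exists (act_ g u), (act_ g v).
have [Vu Vv nuv h] := uv; split; first split; try exact: act_V.
- by move=> /(congr1 (act_ g^-1%g)); rewrite !(iaVl SA).
- move=> w Vw bw; have := h _ (act_V g^-1%g Vw).
  have := btw_act SA g^-1%g bw; rewrite !(iaVl SA) => b1 /(_ b1)[] <-; [left|right]; exact/esym/(iaVr SA).
apply/seteqP; split=> [_ [y hy <-]|y hy]; first exact: (btw_act SA).
exists (act_ g^-1%g y); last exact: (iaVr SA).
by have := btw_act SA g^-1%g hy; rewrite !(iaVl SA).
Qed.

Definition span_gtree : gtree R G :=
  @GTree R G span_tree act_ (ia1 SA) (iaM SA) (iaD SA) act_V act_E.

End SpanGTree.
End Discrete.
End Span.

(** * The tree dual to nested half-spaces *)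

Lemma finite_minimal (I : choiceType) (Om : Type) (hs : I -> set Om) (S : set I) :
  finite_set S -> S !=set0 -> exists2 K, S K & forall L, S L -> hs L `<=` hs K -> hs K `<=` hs L.
Proof.
move=> fS S0.
pose low K := fcount (fun L => `[< S L /\ hs L `<=` hs K >]).
have fl K : finite_set [set L | `[< S L /\ hs L `<=` hs K >]].
  by apply: sub_finite_set fS => L /asboolP[].
have ex : exists m, `[< exists2 K, S K & low K = m >].
  by have [K SK] := S0; exists (low K); apply/asboolP; exists K.
case: (ex_minnP ex) => m /asboolP[K SK eK] mn.
exists K => // L SL LK; apply: contrapT => nKL.
have : (m <= low L)%N by apply: mn; apply/asboolP; exists L.
rewrite -eK leqNgt => /negP; apply.
apply: (fcount_lt (fl K) (i := K)).
- by move=> M /asboolP[SM ML]; apply/asboolP; split=> // z /ML /LK.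
- by move=> /asboolP[].
- by apply/asboolP; split.
Qed.

Section Pocset.
Variables (R : realType) (G : groupType) (Om : Type) (c : G -> Om -> Om).
Hypothesis c1 : forall z, c 1%g z = z.
Hypothesis cM : forall g h z, c (g * h)%g z = c g (c h z).
Variables (n : nat) (F : 'I_n -> set Om) (w : 'I_n -> R).
Hypothesis w0 : forall i, 0 < w i.

(** An oriented edge of the dual tree: the translate of the half-space with the given index by the
    group element, or its complement when the Boolean is false. It also serves as a name for its
    head, so vertices need no type of their own. *)
Definition oedge : Type := (G * 'I_n * bool)%type.
HB.instance Definition _ := Choice.on oedge.

Definition hs (e : oedge) : set Om := fun z =>
  if e.2 then F e.1.2 (c e.1.1^-1%g z) else ~ F e.1.2 (c e.1.1^-1%g z).
Definition opp (e : oedge) : oedge := (e.1, ~~ e.2).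
Definition emul (g : G) (e : oedge) : oedge := ((g * e.1.1)%g, e.1.2, e.2).

Hypothesis ne : forall e, hs e !=set0.
Hypothesis nest : forall e f, [\/ hs e `<=` hs f, hs e `<=` hs (opp f),
  hs (opp e) `<=` hs f | hs (opp e) `<=` hs (opp f)].
Hypothesis hs_inj : forall e f, hs e = hs f -> e = f.
Hypothesis fin : forall e f, finite_set [set K | hs e `<=` hs K /\ hs K `<=` hs f].

Lemma oppK e : opp (opp e) = e.
Proof. by case: e => e [|]. Qed.

Lemma hs_opp e z : hs (opp e) z <-> ~ hs e z.
Proof. by case: e => e [|] /=; rewrite /hs /=; split=> //; [move=> h h2; apply: h2|apply: contrapT]. Qed.

Lemma hs_emul g e z : hs (emul g e) z <-> hs e (c g^-1%g z).
Proof. by case: e => -[h i] [|]; rewrite /hs /= invgM cM. Qed.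

Lemma opp_emul g e : opp (emul g e) = emul g (opp e).
Proof. by []. Qed.

Lemma emulM g h e : emul (g * h)%g e = emul g (emul h e).
Proof. by rewrite /emul /= mulgA. Qed.

Lemma emul1 e : emul 1%g e = e.
Proof. by case: e => -[h i] b; rewrite /emul /= mul1g. Qed.

Lemma emul_sub g e f : hs e `<=` hs f -> hs (emul g e) `<=` hs (emul g f).
Proof. by move=> h z /hs_emul /h /hs_emul. Qed.

Lemma opp_sub e f : hs e `<=` hs f -> hs (opp f) `<=` hs (opp e).
Proof. by move=> h z /hs_opp nf; apply/hs_opp => /h. Qed.

Lemma hs_eq e f : hs e `<=` hs f -> hs f `<=` hs e -> e = f.
Proof. by move=> h1 h2; apply/hs_inj/seteqP. Qed.

Lemma no_disj e f : hs e `<=` hs f -> ~ hs e `<=` hs (opp f).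
Proof. by move=> h1 h2; have [z hz] := ne e; have /hs_opp := h2 _ hz; apply; apply: h1. Qed.

Lemma no_cover e f : hs e `<=` hs f -> ~ hs (opp e) `<=` hs f.
Proof. by move=> h1 h2; apply: (no_disj (opp_sub h1)); apply: opp_sub. Qed.

Lemma emul_inj g e : emul g e = e -> g = 1%g.
Proof. by case: e => -[h i] b [/(canRL (mulgK h))]; rewrite mulgV. Qed.

Lemma emul_opp g e : emul g e <> opp e.
Proof. by case: e => -[h i] [] []. Qed.

(* Whether the head of the oriented edge [e] lies on the side [K]. *)
Definition side (e K : oedge) : Prop :=
  hs e `<=` hs K \/ (hs (opp K) `<=` hs e /\ opp K <> e).

Lemma side_refl e : side e e. Proof. by left. Qed.

Lemma side_or e K : side e K \/ side e (opp K).
Proof.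
have [h|h|h|h] := nest e K.
- by left; left.
- by right; left.
- have [e1|ne1] := pselect (opp K = e); first by right; left; rewrite e1.
  by left; right; split=> //; rewrite -(oppK e); apply: opp_sub.
have [e1|ne1] := pselect (K = e); first by left; left; rewrite e1.
right; right; rewrite oppK; split=> //.
by rewrite -(oppK e) -(oppK K); apply: opp_sub.
Qed.

Lemma side_not e K : side e K -> ~ side e (opp K).
Proof.
case=> [h1|[h1 n1]] [h2|[]]; rewrite ?oppK.
- exact: no_disj h1 h2.
- by move=> h2 n2; apply: n2; apply: hs_eq.
- by apply: n1; apply: hs_eq.
- move=> h2 _; have := no_cover h2 h1; by [].
Qed.

Lemma side_opp e K : side e (opp K) <-> ~ side e K.
Proof.
split=> [h1 h2|h]; first exact: side_not h2 h1.
by case: (side_or e K).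
Qed.

Lemma side_mono e K L : hs K `<=` hs L -> side e K -> side e L.
Proof.
move=> KL [h|[h n']]; first by left; apply: subset_trans KL.
have [e1|ne1] := pselect (opp L = e); last first.
  by right; split=> //; apply: subset_trans h; apply: opp_sub.
by case: n'; apply: hs_eq => //; rewrite -e1; apply: opp_sub.
Qed.

Lemma side_emul g e K : side (emul g e) (emul g K) <-> side e K.
Proof.
suff h h' e' K' : side e' K' -> side (emul h' e') (emul h' K').
  split=> [/(h g^-1%g)|]; last exact: h.
  by rewrite -!emulM mulVg !emul1.
case=> [s|[s n']]; first by left; apply: emul_sub.
right; split; first exact: (emul_sub (e := opp K')).
by move=> /(congr1 (emul h'^-1%g)); rewrite opp_emul -!emulM mulVg !emul1.
Qed.

Definition sepE (e f : oedge) (i : 'I_n) (g : G) : bool :=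
  `[< side e (g, i, true) >] (+) `[< side f (g, i, true) >].

Lemma finite_side e f : finite_set [set K | side e K /\ side f (opp K)].
Proof.
pose S e f := [set K | hs e `<=` hs K /\ hs K `<=` hs f].
pose S' e f := [set K | S e f (opp K)].
have fS' a b : finite_set (S' a b).
  have -> : S' a b = opp @` S a b; last exact/finite_image/fin.
  apply/seteqP; split=> [K hK|_ [K hK <-]]; last by rewrite /S' /= oppK.
  by exists (opp K); rewrite ?oppK.
apply: (sub_finite_set (B := (S e (opp f) `|` S e f) `|` (S' f e `|` S' (opp f) e))).
  move=> K [[h1|[h1 _]] [h2|[h2 _]]]; rewrite ?oppK in h2.
  - by left; left; split=> //; rewrite -(oppK K); apply: opp_sub.
  - by left; right.
  - by right; left.
  - by right; right; split=> //; apply: opp_sub.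
by rewrite !finite_setU; do !split; apply: fin || apply: fS'.
Qed.

Lemma sepE_finite e f i : finite_set [set g | sepE e f i g].
Proof.
pose S := [set K | side e K /\ side f (opp K)] `|` [set K | side f K /\ side e (opp K)].
have fS : finite_set S by rewrite finite_setU; split; apply: finite_side.
apply: (sub_finite_set _ (finite_image (fun K : oedge => K.1.1) fS)) => g.
rewrite /= /sepE => h; exists (g, i, true) => //.
case: asboolP h => h1; case: asboolP => // h2 _; [left|right]; split=> //; exact/side_opp.
Qed.

Definition ddist (e f : oedge) : R := \sum_(i < n) w i * (fcount (sepE e f i))%:R.

Lemma ddist_le2 e1 f1 e2 f2 e3 f3 e4 f4 :
  (forall i g, (sepE e1 f1 i g + sepE e2 f2 i g <= sepE e3 f3 i g + sepE e4 f4 i g)%N) ->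
  ddist e1 f1 + ddist e2 f2 <= ddist e3 f3 + ddist e4 f4.
Proof.
move=> h; rewrite -!big_split; apply: ler_sum => i _ /=.
rewrite -!mulrDr ler_pM2l // -!natrD ler_nat.
by apply: fcount_leD => //; apply: sepE_finite.
Qed.

Lemma ddist0 e f : (forall K, side e K <-> side f K) -> ddist e f = 0.
Proof.
move=> h; apply: big1 => i _; rewrite (@eq_fcount _ _ (fun=> false)) ?fcount0 ?mulr0 // => g.
by rewrite /sepE (asbool_equiv_eq (h _)) addbb.
Qed.

Lemma ddist_gt0 e f K : side e K -> ~ side f K -> w K.1.2 <= ddist e f.
Proof.
move=> h1 h2; rewrite /ddist (bigD1 K.1.2) //= -[leLHS]addr0; apply: lerD; last first.
  by apply: sumr_ge0 => i _; apply: mulr_ge0 => //; apply: ltW.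
rewrite -[leLHS]mulr1 ler_pM2l // -[1]/(1%:R) ler_nat lt0n; apply/negP => /eqP.
move=> /(fcount_eq0 (sepE_finite e f K.1.2)) /(_ K.1.1); rewrite /sepE.
case: K h1 h2 => -[g i] [|] /= h1 h2; first by rewrite asboolT // asboolF.
rewrite asboolF; last by move=> /side_not; apply.
by rewrite asboolT //; apply: contrapT => h; apply: h2; apply/(side_opp f (g, i, true)).
Qed.

Lemma ddist_eq0 e f : ddist e f = 0 -> forall K, side e K <-> side f K.
Proof.
have half e' f' : ddist e' f' = 0 -> forall K, side e' K -> side f' K.
  move=> d0 K h1; apply: contrapT => h2; have := ddist_gt0 h1 h2.
  by rewrite d0 leNgt w0.
move=> d0 K; split; first exact: half.
move=> h1; apply: contrapT => h2; have : side f (opp K) by apply: half d0 _ _; apply/side_opp.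
by move/side_opp.
Qed.

Lemma ddistC e f : ddist e f = ddist f e.
Proof. by apply: eq_bigr => i _; congr (_ * _%:R); apply: eq_fcount => g; rewrite /sepE addbC. Qed.

Lemma no_crossing x y z t K L :
  side x K -> side z K -> ~ side y K -> ~ side t K ->
  side x L -> side t L -> ~ side y L -> ~ side z L -> False.
Proof.
move=> xK zK /side_opp yK /side_opp tK xL tL /side_opp yL /side_opp zL.
have [h|h|h|h] := nest K L.
- exact: side_not (side_mono h zK) zL.
- exact: side_not xL (side_mono h xK).
- exact: side_not (side_mono h yK) yL.
- exact: side_not tL (side_mono h tK).
Qed.

(** If the inequality failed for both pairings, one wall would separate x, z from y, t and another
    one x, t from y, z. Then all four quadrants of these two walls would be occupied, against
    nestedness. *)
Lemma ddist_zh : zero_hyperbolic ddist.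
Proof.
split=> [x|x y|x y z t]; [exact: ddist0|exact: ddistC|].
pose q (x y z t : oedge) := exists K, [/\ side x K, side y K, ~ side z K & ~ side t K].
have flip x' y' z' t' : q z' t' x' y' -> q x' y' z' t'.
  move=> [K [h1 h2 h3 h4]]; exists (opp K); split; try exact/side_opp; exact: side_not.
have key x' y' z' t' : ~ q x' z' y' t' -> ddist x' y' + ddist z' t' <= ddist x' z' + ddist y' t'.
  move=> nq; apply: ddist_le2 => i g; rewrite /sepE.
  have nq2 : ~ q y' t' x' z' by move=> /flip.
  case: (asboolP (side x' _)) => hx; case: (asboolP (side y' _)) => hy;
  case: (asboolP (side z' _)) => hz; case: (asboolP (side t' _)) => ht //=.
    by case: nq; exists (g, i, true).
  by case: nq2; exists (g, i, true).
have [q1|/key] := pselect (q x z y t); last by left.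
have [q2|/key h] := pselect (q x t y z); last first.
  by right; rewrite (ddistC z t).
exfalso; case: q1 q2 => K [h1 h2 h3 h4] [L [h5 h6 h7 h8]].
exact: (no_crossing (x := x) (y := y) (z := z) (t := t) (K := K) (L := L)).
Qed.

Lemma emul_isom : isom_action ddist emul.
Proof.
split=> [x|g h x|g x y]; [exact: emul1|exact: emulM|].
apply: eq_bigr => i _; congr (_ * _%:R).
rewrite -[in RHS](@fcount_bij _ _ _ (fun h => g^-1 * h)%g (fun h => g * h)%g); first last.
- exact: sepE_finite.
- by move=> h; rewrite mulKg.
- by move=> h; rewrite mulgA mulgV mul1g.
have tr z h : side (emul g z) (h, i, true) <-> side z ((g^-1 * h)%g, i, true).
  have -> : (h, i, true) = emul g ((g^-1 * h)%g, i, true) by rewrite /emul /= mulgA mulgV mul1g.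
  exact: side_emul.
by apply: eq_fcount => h; rewrite /sepE !(asbool_equiv_eq (tr _ _)).
Qed.

Lemma sep_unique e K : side e K -> ~ side (opp e) K -> K = e.
Proof.
move=> h1 /side_opp h2; move: h1 h2; rewrite /side oppK => -[h1|[h1 n1]] [h2|[h2 n2]].
- by apply: hs_eq => //; rewrite -(oppK K) -(oppK e); apply: opp_sub.
- by case: (no_disj (e := e) (f := e)) => //; apply: subset_trans h2.
- by case: (no_cover (e := K) (f := e)) => //; rewrite -(oppK K) -(oppK e); apply: opp_sub.
- by case: n1; apply/hs_eq => //; rewrite -[e]oppK; apply: opp_sub.
Qed.

Lemma ddist_edge e f : side f e -> ddist (opp e) f = w e.1.2 + ddist e f.
Proof.
move=> fe.
have cnt i : (fcount (sepE (opp e) f i) = (i == e.1.2) + fcount (sepE e f i))%N.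
  have same g : (g, i) <> e.1 -> sepE (opp e) f i g = sepE e f i g.
    move=> ge; rewrite /sepE; congr (_ (+) _); apply: asbool_equiv_eq.
    split=> h; apply: contrapT => h2; apply: ge.
      have hh := @sep_unique (opp e) (g, i, true) h; rewrite oppK in hh.
      by have /= := congr1 fst (hh h2).
    by have /(congr1 fst) := sep_unique h h2.
  have [ie|/eqP ie] := eqVneq i e.1.2; last first.
    rewrite add0n; apply: eq_fcount => g; apply: same => h; apply: ie.
    by rewrite -h.
  rewrite -[X in (X + _)%N](@fcount1 _ (fun g => g == e.1.1) e.1.1) ?eqxx //; last by move=> g /eqP.
  apply/esym; apply: fcountD; [|exact: sepE_finite|].
    by apply: (sub_finite_set (B := [set e.1.1])) => // g /eqP.
  move=> g; have [eg|/eqP eg] := eqVneq g e.1.1; last first.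
    by rewrite add0n same // => h; apply: eg; rewrite -h.
  rewrite /sepE; move: fe; rewrite (_ : (g, i, true) = (e.1, true)); last by rewrite eg ie; case: (e.1).
  case: (e) => e1 [] /= fe.
    by rewrite (asboolT (side_refl _)) (asboolT fe) asboolF // => /(@side_not (e1, false) (e1, true)); apply; apply: (side_refl (e1, false)).
  rewrite (asboolT (side_refl _)) (asboolF (side_not fe)) asboolF //.
  exact: (side_not (side_refl (e1, false))).
rewrite /ddist; under eq_bigr do rewrite cnt natrD mulrDr.
rewrite big_split /=; congr (_ + _).
by rewrite (bigD1 e.1.2) //= eqxx mulr1 big1 ?addr0 // => i /negPf ->; rewrite mulr0.
Qed.

(** Among the finitely many half-spaces containing exactly two of the three vertices, the head of a
    minimal one lies on the majority side of every wall, so it is the median. If there are none, the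
    three vertices are at distance 0. *)
Lemma median_ddist p q r : exists m, [/\ btw ddist p m q, btw ddist q m r & btw ddist p m r].
Proof.
have btwI x m y : (forall K, side x K -> side y K -> side m K) -> btw ddist x m y.
  move=> h; rewrite /btw /ddist -big_split; apply: eq_bigr => i _ /=.
  rewrite -mulrDr -natrD; congr (_ * _%:R); apply/esym.
  apply: fcountD; [exact: sepE_finite|exact: sepE_finite|move=> g].
  have h1 := h (g, i, true); have h2 := h (opp (g, i, true)); rewrite /sepE.
  case: (asboolP (side x _)) => hx; case: (asboolP (side m _)) => hm;
  case: (asboolP (side y _)) => hy //=; first by case: hm; apply: h1.
  by have /side_opp := h2 (proj2 (side_opp _ _) hx) (proj2 (side_opp _ _) hy).
pose S := [set K | [\/ [/\ side p K, side q K & ~ side r K],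
  [/\ side p K, side r K & ~ side q K] | [/\ side q K, side r K & ~ side p K]]].
have fS : finite_set S.
  apply: (sub_finite_set (B := [set K | side p K /\ side r (opp K)] `|`
    ([set K | side p K /\ side q (opp K)] `|` [set K | side q K /\ side p (opp K)]))).
    by move=> K [[h1 h2 /side_opp h3]|[h1 h2 /side_opp h3]|[h1 h2 /side_opp h3]];
      [left|right; left|right; right].
  by rewrite !finite_setU; do !split; apply: finite_side.
have [S0|nS] := pselect (S !=set0); last first.
  exists p; split; apply: btwI => // K h1 h2.
  by apply: contrapT => h3; apply: nS; exists K; constructor 3.
have [K SK hK] := finite_minimal hs fS S0.
exists K.
have maj L : S L \/ [/\ side p L, side q L & side r L] -> side K L.
  move=> hL; have [z zK zL] : exists2 z, side z K & side z L.
    case: SK => -[k1 k2 k3]; case: hL => [[[l1 l2 l3]|[l1 l2 l3]|[l1 l2 l3]]|[l1 l2 l3]];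
    first [by exists p|by exists q|by exists r].
  have [h|h|h|h] := nest K L.
  - by left.
  - by case: (side_not zL (side_mono h zK)).
  - right; split; first by rewrite -(oppK K); apply: opp_sub.
    by move=> e; case: (side_not zL); rewrite e.
  - have LK : hs L `<=` hs K by rewrite -(oppK L) -(oppK K); apply: opp_sub.
    left; case: hL => [hL|[l1 l2 l3]]; first exact: hK.
    by case: SK => -[k1 k2 k3]; case: k3; apply: side_mono LK _.
split; apply: btwI => L h1 h2; apply: maj.
- by have [h|h] := pselect (side r L); [right|left; constructor 1].
- by have [h|h] := pselect (side p L); [right|left; constructor 3].
- by have [h|h] := pselect (side q L); [right|left; constructor 2].
Qed.

Lemma ddist_sep : exists2 eps : R, 0 < eps & forall p q, ddist p q = 0 \/ eps <= ddist p q.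
Proof.
exists (\big[Num.min/1]_(i < n) w i).
  by apply: (big_ind (fun r : R => 0 < r)) => // r s r0 s0; rewrite lt_min r0.
move=> p q; have [h|/existsNP[K nK]] := pselect (forall K, side p K <-> side q K).
  by left; apply: ddist0.
right; have : w K.1.2 <= ddist p q.
  have [pK|npK] := pselect (side p K).
    by apply: (ddist_gt0 pK) => qK; apply: nK; split.
  have [qK|nqK] := pselect (side q K); last by case: nK; split.
  by rewrite ddistC; apply: (ddist_gt0 qK npK).
by apply: le_trans; apply: bigmin_le_cond.
Qed.

Section PocsetTree.
Variable b0 : oedge.

Definition pocset_tree : gtree R G :=
  span_gtree ddist_zh b0 (s2valP (cid2 ddist_sep)) (s2valP' (cid2 ddist_sep)) median_ddist emul_isom.

Local Notation T := pocset_tree.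
Local Notation d := (@mdist R T).
Local Notation V := (@vertices R T).

Definition pt (e : oedge) : T := span_pt ddist_zh b0 e.

Lemma d_pt e f : d (pt e) (pt f) = ddist e f.
Proof. exact: span_dist. Qed.

Lemma act_pt g e : act g (pt e) = pt (emul g e).
Proof. exact: span_act_pt. Qed.

Lemma V_pt e : V (pt e).
Proof. by exists e. Qed.

Lemma V_ptE v : V v -> exists e, v = pt e.
Proof. by case=> e _ <-; exists e. Qed.

Let TH := mdist_zh T.
Let TS := @mdist_sep R G T.
Let TD := vertices_discrete T.
Let TA := act_isom T.

Lemma pt_eq e f : pt e = pt f <-> (forall K, side e K <-> side f K).
Proof.
split=> [h|h]; first by apply: ddist_eq0; rewrite -d_pt h mdistxx.
by apply: TS; rewrite d_pt; apply: ddist0.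
Qed.

Lemma half_side e f : half d (pt (opp e)) (pt e) (pt f) <-> side f e.
Proof.
rewrite /half /= /btw !d_pt; have we : ddist (opp e) e = w e.1.2.
  by rewrite (ddist_edge (side_refl e)) (ddist0 (e := e)) ?addr0.
split=> [|fe]; last by rewrite (ddist_edge fe) we.
move=> h; apply: contrapT => /side_opp /ddist_edge; rewrite oppK /= => h2.
by have := w0 e.1.2; lra.
Qed.

Lemma pt_opp e : pt (opp e) <> pt e.
Proof.
move=> /pt_eq /(_ e)[_ /(_ (side_refl e))].
by have := side_not (side_refl (opp e)); rewrite oppK.
Qed.

Lemma edge_length_pt e : d (pt (opp e)) (pt e) = w e.1.2.
Proof. by rewrite d_pt (ddist_edge (side_refl e)) (ddist0 (e := e)) ?addr0. Qed.

Lemma adjq_pt e : adjq d V (pt (opp e)) (pt e).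
Proof.
split; [exact: V_pt|exact: V_pt|exact: pt_opp|].
move=> v /V_ptE[f ->] bf; have [h|h] := side_or f e.
  right; apply: TS; move/half_side: h; rewrite /half /= /btw.
  move: bf; rewrite /btw (zhC TH (pt e) (pt f)); lra.
left; apply: TS; move: h; rewrite -half_side oppK /half /= /btw.
by move: bf; rewrite /btw (zhC TH (pt f) (pt (opp e))) (zhC TH (pt e) (pt (opp e))) (zhC TH (pt e) (pt f)); lra.
Qed.

Lemma adjq_ptE u v : adjq d V u v -> exists e, u = pt (opp e) /\ v = pt e.
Proof.
move=> uv; have [/V_ptE[p ep] /V_ptE[q eq] nuv h] := uv; subst u v.
have [K [pK qK]] : exists K, ~ side p K /\ side q K.
  apply: contrapT => nex; apply: nuv; apply/pt_eq => K; split=> hK; apply: contrapT => nK.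
    by apply: nex; exists (opp K); split; [exact: side_not|exact/side_opp].
  by apply: nex; exists K.
move/side_opp: pK; rewrite -half_side oppK => hp; move: qK; rewrite -half_side => hq.
have Kp : 0 < d (pt (opp K)) (pt K) by rewrite edge_length_pt.
have [b1 b2] := btw_chain TH (btwC TH hp) hq Kp.
have nop := @pt_opp K.
exists K; case: (h _ (V_pt _) b1) (h _ (V_pt _) b2) => e1 [] e2; rewrite ?e1 ?e2 //.
- by case: nop; rewrite e1.
- exfalso; move: hp; rewrite -e1 /half /= /btw mdistxx; have := mdist_ge0 (pt K) (pt (opp K)).
  by move: Kp; rewrite (zhC TH (pt K)); lra.
- by case: nop; rewrite e1.
Qed.

Lemma pt_edge_eq e f : pt (opp e) = pt (opp f) -> pt e = pt f -> e = f.
Proof.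
move=> /pt_eq h1 /pt_eq h2; apply/esym; apply: sep_unique; first exact/(h2 f)/side_refl.
by move=> /(h1 f); have := side_not (side_refl (opp f)); rewrite oppK.
Qed.

Lemma pocset_free : trivial_edge_stabilizers T.
Proof.
move=> e He g ge; have [u [v ee]] := edge_exists_ends He.
have uv : adjq d V u v by apply/adjq_edge; exists e.
have [f [eu ev]] := adjq_ptE uv; subst u v.
have [_ _ eV] := ee.
have mem y : V y -> e y -> act g y = pt (opp f) \/ act g y = pt f.
  move=> Vy ey; have : (e `&` V) (act g y).
    by split; [rewrite -ge; exists y|apply: act_vertices].
  by rewrite eV.
have [m1 m2 _ _] := edge_endsV ee.
have nop := @pt_opp (emul g f).
case: (mem _ (V_pt _) m1) (mem _ (V_pt _) m2); rewrite !act_pt -opp_emul => e1 [] e2.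
- by case: nop; rewrite e1.
- by apply: (emul_inj (e := f)); apply: pt_edge_eq.
- by case: (@emul_opp g f); apply: pt_edge_eq; rewrite ?oppK.
- by case: nop; rewrite e1.
Qed.

Definition oedge_rep (i : 'I_n) : T * T := (pt (1%g, i, false), pt (1%g, i, true)).

Lemma pocset_reps : edge_reps d V (@act R G T) oedge_rep.
Proof.
have r1 i : (oedge_rep i).1 = pt (1%g, i, false) by [].
have r2 i : (oedge_rep i).2 = pt (1%g, i, true) by [].
split=> [i|u v|i j g]; rewrite ?r1 ?r2.
- exact: (adjq_pt (1%g, i, true)).
- move=> /adjq_ptE[[[g i] b] [-> ->]]; exists i, g; rewrite r1 r2 !act_pt /emul /= mulg1.
  by case: b; [left|right].
rewrite !act_pt /emul /= mulg1 => -[[e1 e2]|[e1 e2]].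
  by have [] := @pt_edge_eq (g, i, true) (1%g, j, true) e1 e2.
by have [] := @pt_edge_eq (g, i, true) (1%g, j, false) e1 e2.
Qed.

Lemma oedge_rep_length i : d (oedge_rep i).1 (oedge_rep i).2 = w i.
Proof. exact: (edge_length_pt (1%g, i, true)). Qed.

Lemma pocset_translation g e l : (exists C, forall m, `|ddist e (emul (g ^+ m) e) - m%:R * l| <= C) ->
  translation_length T g = l.
Proof.
move=> [C hC]; apply: (asym_uniq (translation_length_asym g (pt e))).
by exists C => m; rewrite act_pt d_pt.
Qed.

(* [om z] is thought of as an element of [G], located at its attracting end or fixed point. *)
Variable om : Om -> G.
Hypothesis om1 : forall z, om z <> 1%g.
Hypothesis star : forall z e, hs e z ->
  hs (emul (om z) e) `<=` hs e \/ hs (opp e) `<=` hs (emul (om z) e).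

Let spanned (z y : T) : exists f, btw d (pt f) z y.
Proof. exact: span_extend. Qed.

Lemma half_conv e : convex_in d (half d (pt (opp e)) (pt e)).
Proof. exact: half_convex. Qed.

Lemma not_half e z : ~ half d (pt (opp e)) (pt e) z ->
  exists f, ~ side f e /\ btw d (pt f) z (pt e).
Proof.
move=> nz; have [f bf] := spanned z (pt e); exists f; split=> // /half_side hf; apply: nz.
by apply: half_conv hf _ bf; apply/half_side/side_refl.
Qed.

(** An invariant convex set meeting both halves of every edge contains all vertices. If it missed a
    half [e], and so its translates, no translate could contain both the head of [e] and a vertex
    [f] beyond a point of the set. But for [k] in [e], either the translate by [om k] contains both,
    or those by negative powers of [om k] increase and infinitely many walls separate the two
    vertices. *)
Lemma pocset_minimal : minimal T.
Proof.
move=> S S0 /connected_convex cS inv.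
have inv' g z : S (act g z) -> S z by move=> /(inv g^-1%g); rewrite (iaVl TA).
have key e : exists2 z, S z & half d (pt (opp e)) (pt e) z.
  apply: contrapT => nz.
  have out z g : S z -> ~ half d (pt (opp (emul g e))) (pt (emul g e)) z.
    move=> Sz hz; apply: nz; exists (act g^-1%g z); first exact: inv.
    move: hz; rewrite -!act_pt opp_emul -act_pt => hz.
    by have := btw_act TA g^-1%g hz; rewrite !(iaVl TA).
  have out1 z : S z -> ~ half d (pt (opp e)) (pt e) z.
    by move=> /(@out _ 1%g); rewrite emul1.
  have [z Sz] := S0; have [k ek] := ne e.
  have [f [nf bf]] := not_half (out1 _ Sz).
  have esc g : side e (emul g e) -> ~ side f (emul g e).
    move=> h1 h2; apply: (out _ g Sz); move/half_side: h1; move/half_side: h2 => h2 h1.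
    exact: half_conv h2 h1 bf.
  case: (star ek) => h; last first.
    apply: (esc (om k)); last by apply: side_mono h _; apply/side_opp.
    right; split; last by move=> e1; case: (@emul_opp (om k) e); rewrite -[LHS]oppK e1.
    by rewrite -{2}(oppK e); apply: opp_sub.
  pose g := om k; rewrite -/g in h.
  have hm m : hs (emul (g ^+ m)%g e) `<=` hs e.
    elim: m => [|m ih]; first by rewrite expg0 emul1.
    by rewrite expgS emulM; apply: subset_trans h; apply: emul_sub.
  have gord m : (g ^+ m.+1)%g <> 1%g.
    move=> gm; apply: (@om1 k); rewrite -/g; apply: (emul_inj (e := e)); apply: hs_eq => //.
    by rewrite -{1}(emul1 e) -gm expgS emulM; apply: emul_sub.
  have inj m m' : (m < m')%N -> (g ^- m)%g <> (g ^- m')%g.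
    move=> lt /invg_inj; rewrite -(subnKC lt) addSnnS expgnDr => e1.
    by apply: (@gord (m' - m.+1)%N); apply: (mulgI (g ^+ m)%g); rewrite -e1 mulg1.
  have sepm m : sepE e f e.1.2 (g ^- m * e.1.1)%g.
    have s1 : side e (emul (g ^- m)%g e).
      left; rewrite -{1}(emul1 e) -(mulVg (g ^+ m)%g) emulM.
      by apply: emul_sub.
    have := esc _ s1; move: s1; rewrite /sepE /emul; case: (e) => -[g0 i] [] /= s1 s2.
      by rewrite asboolT // asboolF.
    rewrite asboolF; last by move=> /side_not; apply.
    by rewrite asboolT //; apply: contrapT => /(@side_opp f (g ^- m * g0, i, true)%g).
  have := @fcount_ge _ (sepE e f e.1.2) (fcount (sepE e f e.1.2)).+1
    (fun m => g ^- m * e.1.1)%g (sepE_finite _ _ _) (fun m _ => sepm m).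
  rewrite ltnn => /(_ _)/negP; case=> // m m' _ _ /mulIg e1.
  by case: (ltngtP m m') => // lt; [case: (inj _ _ lt)|case: (inj _ _ lt)].
have vert e : S (pt e).
  have [y Sy hy] := key e; have [y' Sy' hy'] := key (opp e); rewrite oppK in hy'.
  have p0 : 0 < d (pt (opp e)) (pt e) by rewrite edge_length_pt.
  by have [b1 _] := btw_chain TH (btwC TH hy') hy p0; apply: cS b1.
apply/seteqP; split=> // z _; have [f bf] := spanned z (pt b0).
exact: cS (vert f) (vert b0) bf.
Qed.

Lemma vertex_star e z : hs e z -> ~ side (emul (om z) e) (opp e).
Proof.
move=> ez; have inv : opp (emul (om z) e) <> e.
  by move=> e1; case: (@emul_opp (om z) e); rewrite -[LHS]oppK e1.
rewrite /side oppK; case: (star ez) => h [h1|[h1 h2]].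
- exact: no_disj h h1.
- by apply: h2; apply: hs_eq.
- by case: (@emul_opp (om z) e); apply: hs_eq.
- exact: no_cover h1 h.
Qed.

(** If [v] has only one incoming half-space [e] and one outgoing half-space [K], the inclusion of
    [K] in [e] is strict, so some [k] lies in [e] but not in [K]. Every vertex other than [v] lies
    beyond one of the two edges, which forces [om k] to fix [v]; redundancy would then make this
    nontrivial element fix an edge. *)
Lemma pocset_nonredundant v : ~ @redundant R G T v.
Proof.
move=> [Vv [E1 [E2 [E12 inc]]] fix_].
have [e ev] := V_ptE Vv; subst v.
have [He _ _] := adjq_segment (adjq_pt e).
have segT K : edges [set y | btw d (pt (opp K)) y (pt K)] by have [] := adjq_segment (adjq_pt K).
pose seg K : set T := [set y | btw d (pt (opp K)) y (pt K)].
have ve : seg e (pt e) by rewrite /seg /= /btw mdistxx addr0.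
have segV K u : V u -> seg K u -> u = pt (opp K) \/ u = pt K.
  by move=> Vu su; have [_ _ _ h] := adjq_pt K; apply: h.
have seg_inj K L : pt (opp K) = pt (opp L) -> seg K = seg L -> K = L.
  move=> e1 e2; have : seg K (pt L) by rewrite e2 /seg /= /btw mdistxx addr0.
  move=> /(segV _ _ (V_pt L))[e3|e3]; first by case: (@pt_opp L); rewrite -e1 e3.
  by apply: pt_edge_eq.
have orient E0 : edges E0 -> E0 (pt e) -> exists K, pt (opp K) = pt e /\ E0 = seg K.
  move=> He0 e0; have [u [v ee]] := edge_exists_ends He0.
  have uv : adjq d V u v by apply/adjq_edge; exists E0.
  have [L [eu ev]] := adjq_ptE uv; subst u v.
  have eL : E0 = seg L by apply: edge_segment.
  rewrite eL in e0; case: (segV _ _ (V_pt e) e0) => e1; first by exists L.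
  exists (opp L); rewrite oppK; split=> //; rewrite eL /seg oppK.
  by apply/seteqP; split=> y /(btwC TH).
have incE E0 : edges E0 -> E0 (pt e) -> E0 = E1 \/ E0 = E2.
  by move=> h1 h2; have : [set E1; E2] E0 by rewrite -inc.
have seg1 K : pt (opp K) = pt e -> seg K = E1 \/ seg K = E2.
  by move=> h; apply: incE; [exact: segT|rewrite -h /seg /= /btw mdistxx add0r].
have E0T E0 : E0 = E1 \/ E0 = E2 -> exists K, pt (opp K) = pt e /\ E0 = seg K.
  by move=> h; have [] : edges E0 /\ E0 (pt e); [have : [set E1; E2] E0 by []; rewrite -inc|apply: orient].
have [K [Ke vK incK]] : exists K, [/\ K <> opp e, pt (opp K) = pt e &
    forall L, pt (opp L) = pt e -> L = K \/ L = opp e].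
  have oe : pt (opp (opp e)) = pt e by rewrite oppK.
  have [K1 [v1 e1]] := E0T E1 (or_introl erefl); have [K2 [v2 e2]] := E0T E2 (or_intror erefl).
  have K12 : K1 <> K2 by move=> e3; apply: E12; rewrite e1 e2 e3.
  have two L : pt (opp L) = pt e -> L = K1 \/ L = K2.
    move=> vL; case: (seg1 _ vL) => e3; [left|right].
      by apply: seg_inj; [exact: etrans vL (esym v1)|rewrite e3 e1].
    by apply: seg_inj; [exact: etrans vL (esym v2)|rewrite e3 e2].
  case: (two _ oe) => e3.
    exists K2; rewrite e3; split=> //; first by move=> e4; apply: K12.
    by move=> L /two[]; [right|left].
  by exists K1; rewrite e3; split.
have sK L : side (opp K) L <-> side e L by move/pt_eq: vK.
have sides f : pt f <> pt e -> side f K \/ side f (opp e).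
  move=> fe; have ef : pt e <> pt f by move=> e1; apply: fe.
  have [q [eq bq]] := first_stepq TH TS TD Vv (V_pt f) ef.
  have [L [e1 e2]] := adjq_ptE eq; subst q; rewrite e1 in bq.
  move/half_side: bq => bq; case: (incK L (esym e1)) => e2; rewrite e2 in bq; by [left|right].
have [k ek Kk] : exists2 k, hs e k & ~ hs K k.
  have s1 : side (opp K) e by apply/sK/side_refl.
  have s2 : side e (opp K) by apply/sK/side_refl.
  move: s1 s2; rewrite /side oppK => -[h1|[h1 n1]] [h2|[h2 n2]].
  - by case: Ke; rewrite -(oppK K); congr opp; apply: hs_eq.
  - by case: (no_cover h2).
  - by case: (no_cover h2).
  apply: contrapT => nk; apply: n2; apply: hs_eq => // z ez.
  by apply: contrapT => nKz; apply: nk; exists z.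
have gv : act (om k) (pt e) = pt e.
  apply: contrapT; rewrite act_pt => /sides[].
    have nK : hs (opp K) k by apply/hs_opp.
    have := vertex_star nK; rewrite oppK => nv sv; apply: nv.
    have e1 : pt (emul (om k) (opp K)) = pt (emul (om k) e) by rewrite -!act_pt vK.
    by move/pt_eq: e1 => ->.
  exact: vertex_star.
have := fix_ _ gv _ (segT e) ve.
by move=> /(pocset_free (segT e)); apply: om1.
Qed.

End PocsetTree.
End Pocset.

(** * Walls and their stable ends *)

Section Hats.
Variables (G : groupType) (W : Type) (a : G -> W -> W).
Hypothesis a1 : forall x, a 1%g x = x.
Hypothesis aM : forall g h x, a (g * h)%g x = a g (a h x).
Variables (N : nat) (H : 'I_N -> set W).

Local Notation oedge := (oedge G N).
Local Notation ws := (hs a H).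

Definition sepb (x y : W) (e : oedge) : bool := `[< ws e x >] (+) `[< ws e y >].
Definition sepw (x y : W) (i : 'I_N) (g : G) : bool := sepb x y (g, i, true).

Hypothesis Hfin : forall x y i, finite_set [set g | sepw x y i g].
Hypothesis Hnest : forall e f, [\/ ws e `<=` ws f, ws e `<=` ws (opp f),
  ws (opp e) `<=` ws f | ws (opp e) `<=` ws (opp f)].
Hypothesis Hwit : forall i, exists x y, [/\ ~ H i x, H i y & forall g, sepw x y i g -> g = 1%g].

Lemma sepb_opp x y e : sepb x y (opp e) = sepb x y e.
Proof.
rewrite /sepb !(asbool_equiv_eq (hs_opp a H _ _)) !asbool_neg.
by case: `[< _ >]; case: `[< _ >].
Qed.

Lemma sepb_emul x y g e : sepb x y (emul g e) = sepb (a g^-1%g x) (a g^-1%g y) e.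
Proof. by rewrite /sepb !(asbool_equiv_eq (hs_emul aM H _ _ _)). Qed.

Lemma sepb_fin x y e : finite_set [set g | sepb x y (emul g e)].
Proof.
case: e => -[h i] b.
have -> : [set g | sepb x y (emul g (h, i, b))] =
    (fun g => g * h^-1)%g @` [set g | sepw x y i g].
  apply/seteqP; split=> [g hg|_ [g hg <-]] /=.
    exists (g * h)%g; last by rewrite mulgK.
    by move: hg; case: b => //=; rewrite -(sepb_opp _ _ (emul _ _)).
  by rewrite /emul /= mulgVK; case: b => //; rewrite -sepb_opp.
exact: finite_image.
Qed.

Lemma wall_witness e : exists x y, [/\ ~ ws e x, ws e y & forall g, sepb x y (emul g e) -> g = 1%g].
Proof.
case: e => -[h i] b; have [x [y [nx hy u]]] := Hwit i.
have sep g : sepb (a h x) (a h y) (emul g (h, i, b)) -> g = 1%g.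
  have -> : emul g (h, i, b) = emul h ((h^-1 * g * h)%g, i, b) by rewrite /emul /= !mulgA mulgV mul1g.
  rewrite sepb_emul -!aM mulVg !a1 => hs.
  have /u : sepw x y i (h^-1 * g * h)%g by move: hs; case: (b) => //; rewrite -sepb_opp.
  move=> hg; have -> : g = (h * (h^-1 * g * h) * h^-1)%g by rewrite !mulgA mulgV mul1g mulgK.
  by rewrite hg mulg1 mulgV.
case: b sep => sep; [exists (a h x), (a h y)|exists (a h y), (a h x)].
  by split=> //; rewrite /hs /= -aM mulVg a1.
have e1 z : a h^-1%g (a h z) = z by rewrite -aM mulVg a1.
split; [by rewrite /hs /= e1 => nn; apply: nn|by rewrite /hs /= e1|].
by move=> g hg; apply: sep; rewrite /sepb addbC.
Qed.

Lemma ws_ex e : exists x, ws e x.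
Proof. by have [x [y [_ h _]]] := wall_witness e; exists y. Qed.

Lemma ws_ex_opp e : exists x, ws (opp e) x.
Proof. by have [x [y [h _ _]]] := wall_witness e; exists x; apply/hs_opp. Qed.

Lemma ws_free g e : ws (emul g e) = ws e -> g = 1%g.
Proof.
move=> h; have [x [y [nx hy u]]] := wall_witness e; apply: u.
by rewrite /sepb h asboolF // asboolT.
Qed.

Lemma ws_noinv g e : ws (emul g e) <> ws (opp e).
Proof.
move=> h; have [x [y [nx hy u]]] := wall_witness e.
have g1 : g = 1%g.
  apply: u; rewrite /sepb h asboolT; last exact/hs_opp.
  by rewrite asboolF // => /hs_opp.
by move: (hy); rewrite -(emul1 e) -g1 h => /hs_opp; apply.
Qed.

(* For [g <> 1]: the fixed point or the attracting end of [g] lies on the side [e]. *)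
Definition hat (e : oedge) (g : G) : Prop :=
  ws (emul g e) `<=` ws e \/ ws (opp e) `<=` ws (emul g e).

Let nodisj e f : ws e `<=` ws f -> ws e `<=` ws (opp f) -> False.
Proof. by move=> h1 h2; have [x hx] := ws_ex e; have /hs_opp := h2 _ hx; apply; apply: h1. Qed.

Let osub e f : ws e `<=` ws f -> ws (opp f) `<=` ws (opp e).
Proof. exact: opp_sub. Qed.

(** Nestedness of [e] and its translate gives one of the two alternatives; both at once would make
    [g] stabilize or invert the wall or a half-space disjoint from itself, which the witnesses
    exclude. *)
Lemma hat_opp e g : g <> 1%g -> hat (opp e) g <-> ~ hat e g.
Proof.
move=> g1; rewrite /hat oppK -opp_emul; split.
  move=> h1 h2; case: h1 h2 => h1 [] h2.
  - apply: g1; apply: (@ws_free g e); apply/seteqP; split=> //.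
    by have := osub h1; rewrite !oppK.
  - by apply: (nodisj h1); have := osub h2; rewrite !oppK.
  - by apply: (@nodisj (emul g e) (emul g e)) => //; apply: subset_trans h1.
  - case: (@ws_noinv g e); apply/seteqP; split=> //.
    by have := osub h1; rewrite !oppK.
move=> h; have [k|k|k|k] := Hnest (emul g e) e.
- by case: h; left.
- by right; rewrite -{1}(oppK e); apply: osub.
- by case: h; right; rewrite -(oppK (emul g e)); apply: osub.
- by left; have := osub k; rewrite !oppK.
Qed.

Lemma hat_emul h e g : hat (emul h e) g <-> hat e (h^-1 * g * h)%g.
Proof.
have e1 : emul g (emul h e) = emul h (emul (h^-1 * g * h)%g e).
  by rewrite -!emulM !mulgA mulgV mul1g.
rewrite /hat e1 opp_emul; split=> -[k|k]; [left|right|left|right].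
- by have := emul_sub aM (g := h^-1%g) k; rewrite -!emulM !mulgA mulVg mul1g emul1.
- by have := emul_sub aM (g := h^-1%g) k; rewrite -!emulM !mulgA mulVg mul1g emul1.
- exact: emul_sub.
- exact: emul_sub.
Qed.

Lemma power_chain e g m : ws (emul g e) `<=` ws e -> ws (emul (g ^+ m)%g e) `<=` ws e.
Proof.
move=> h; elim: m => [|m ih]; first by rewrite expg0 emul1.
by rewrite expgS emulM; apply: subset_trans h; apply: emul_sub.
Qed.

Lemma power_inj e g : g <> 1%g -> ws (emul g e) `<=` ws e ->
  forall m m', (g ^+ m)%g = (g ^+ m')%g -> m = m'.
Proof.
move=> g1 h.
have gord m : (g ^+ m.+1)%g <> 1%g.
  move=> gm; apply: g1; apply: (@ws_free g e); apply/seteqP; split=> //.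
  by rewrite -{1}(emul1 e) -gm expgS emulM; apply: emul_sub => //; apply: power_chain.
have main m m' : (m < m')%N -> (g ^+ m)%g <> (g ^+ m')%g.
  move=> lt; rewrite -(subnKC lt) addSnnS expgnDr => e1.
  by apply: (@gord (m' - m.+1)%N); apply: (mulgI (g ^+ m)%g); rewrite -e1 mulg1.
by move=> m m' e1; case: (ltngtP m m') => // lt; [case: (main _ _ lt)|case: (main _ _ lt)].
Qed.

Lemma no_infinite_sep x y e (s : nat -> G) :
  (forall m m', s m = s m' -> m = m') -> (forall m, sepb x y (emul (s m) e)) -> False.
Proof.
move=> sinj hs; have := @fcount_ge _ (fun g => sepb x y (emul g e))
  (fcount (fun g => sepb x y (emul g e))).+1 s (sepb_fin _ _ _) (fun m _ => hs m).
by rewrite ltnn => /(_ _)/negP; case=> // m m' _ _ /sinj.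
Qed.

(** If the conclusion failed, the translates of [e] by negative powers of [g] would increase while
    those of [f] decrease, the former staying inside the latter. A point of [e] and a point outside
    [f] would be separated by infinitely many translates. *)
Lemma hat_mono e f g : ws e `<=` ws f -> g <> 1%g -> hat e g -> hat f g.
Proof.
move=> ef g1 [h|h]; last first.
  by right; apply: subset_trans (osub ef) (subset_trans h _); apply: emul_sub.
apply: contrapT => /(hat_opp f g1); rewrite /hat oppK -opp_emul => -[k|k]; last first.
  apply: (@nodisj (emul g e) (emul g f)); first exact: emul_sub.
  by apply: subset_trans k; apply: subset_trans ef.
have {}k : ws f `<=` ws (emul g f) by have := osub k; rewrite !oppK.
have [z [ez nz]] : exists z, ws e z /\ ~ ws (emul g e) z.
  apply: contrapT => n; apply: g1; apply: (@ws_free g e); apply/seteqP; split=> // z ez.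
  by apply: contrapT => nz; apply: n; exists z.
have [w nw] := ws_ex_opp f; move/hs_opp: nw => nw.
have up m : ws e `<=` ws (emul (g ^- m)%g e).
  have := emul_sub aM (g := (g ^- m)%g) (@power_chain e g m h).
  by rewrite -emulM mulVg emul1.
have dn m : ~ ws (emul (g ^- m)%g e) w.
  move=> h1; apply: nw; have : ws (emul (g ^- m)%g f) w by apply: emul_sub ef _ h1.
  have k' : ws (emul g^-1%g f) `<=` ws f.
    by have := emul_sub aM (g := g^-1%g) k; rewrite -emulM mulVg emul1.
  by rewrite -expVgn; apply: (@power_chain f g^-1%g m k').
apply: (@no_infinite_sep z w e (fun m => g ^- m)%g).
  by move=> m m' /invg_inj; apply: (power_inj g1 h).
by move=> m; rewrite /sepb asboolT ?asboolF //; apply: up.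
Qed.

(** Parallel walls: no fixed point or attracting end lies between them. They give the same edge of
    the realized tree. *)
Definition same_hat e f : Prop := forall k, k <> 1%g -> hat e k <-> hat f k.
Definition essential e : Prop :=
  (exists2 k, k <> 1%g & hat e k) /\ (exists2 k, k <> 1%g & ~ hat e k).

Lemma essential_opp e : essential e -> essential (opp e).
Proof.
move=> [[k k1 hk] [k' k1' hk']]; split; [exists k'|exists k] => //; first exact/hat_opp.
by move=> /hat_opp; apply.
Qed.

Lemma conj_neq1 (g k : G) : k <> 1%g -> (g^-1 * k * g)%g <> 1%g.
Proof.
move=> k1 e1; apply: k1; have -> : k = (g * (g^-1 * k * g) * g^-1)%g.
  by rewrite !mulgA mulgV mul1g mulgK.
by rewrite e1 mulg1 mulgV.
Qed.

Lemma hat_emul' g e k : hat (emul g e) (g * k * g^-1)%g <-> hat e k.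
Proof. by rewrite hat_emul !mulgA mulVg mul1g mulgVK. Qed.

Lemma essential_emul g e : essential e -> essential (emul g e).
Proof.
have c1 k : k <> 1%g -> (g * k * g^-1)%g <> 1%g.
  by move=> /(@conj_neq1 g^-1%g); rewrite invgK.
move=> [[k k1 hk] [k' k1' hk']]; split; [exists (g * k * g^-1)%g|exists (g * k' * g^-1)%g];
  by [exact: c1|rewrite hat_emul'].
Qed.

Lemma same_hat_emul g e f : same_hat e f -> same_hat (emul g e) (emul g f).
Proof. by move=> h k k1; rewrite !hat_emul; apply/h/conj_neq1. Qed.

Lemma same_hat_opp e f : same_hat e f -> same_hat (opp e) (opp f).
Proof. by move=> h k k1; rewrite !hat_opp // h. Qed.

Lemma same_hat_sub e f : essential e -> same_hat e f ->
  ws e `<=` ws f \/ ws f `<=` ws e.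
Proof.
move=> [[k k1 hk] [k' k1' hk']] h; have [m|m|m|m] := Hnest e f.
- by left.
- by have := hat_mono m k1 hk => /(hat_opp f k1); rewrite -h.
- have : hat (opp e) k' by apply/hat_opp.
  by move=> /(hat_mono m k1') /(h _ k1').
- by right; have := osub m; rewrite !oppK.
Qed.

Section Absorb.
Variables (e : oedge) (g : G).
Hypotheses (g1 : g <> 1%g) (h : ws (emul g e) `<=` ws e).

Lemma power_up m : ws e `<=` ws (emul (g ^- m)%g e).
Proof.
have := emul_sub aM (g := (g ^- m)%g) (@power_chain e g m h).
by rewrite -emulM mulVg emul1.
Qed.

(** A point outside all these increasing translates would be separated from a point of [e] by
    infinitely many of them. *)
Lemma absorb y : exists m, ws (emul (g ^- m)%g e) y.
Proof.
apply: contrapT => n; have [z ez] := ws_ex e.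
apply: (@no_infinite_sep z y e (fun m => g ^- m)%g).
  by move=> m m' /invg_inj; apply: (power_inj g1 h).
move=> m; rewrite /sepb asboolT; last exact: power_up.
by rewrite asboolF // => hy; apply: n; exists m.
Qed.

Lemma power_up_add m m' : ws (emul (g ^- m)%g e) `<=` ws (emul (g ^- (m + m'))%g e).
Proof.
rewrite addnC expgnDr invgM emulM; apply: emul_sub => //; exact: power_up.
Qed.

End Absorb.

(** * The degenerate case of a line of parallel walls *)

Section Line.
Variables (e : oedge) (g : G).
Hypotheses (ess : essential e) (g1 : g <> 1%g) (h : ws (emul g e) `<=` ws e)
  (sg : same_hat (emul g e) e).

Let sgm m : same_hat (emul (g ^+ m)%g e) e.
Proof.
elim: m => [|m ih]; first by rewrite expg0 emul1.
rewrite expgS emulM => k k1; rewrite -(sg k1); exact: same_hat_emul.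
Qed.

Let sgm' m : same_hat (emul (g ^- m)%g e) e.
Proof.
move=> k k1; have := @same_hat_emul (g ^- m)%g _ _ (@sgm m) k k1.
by rewrite -emulM mulVg emul1 => ->.
Qed.

Let gV1 : (g^-1)%g <> 1%g.
Proof. by move=> /(congr1 (fun z : G => z^-1)%g); rewrite invgK invg1. Qed.

Let oh : ws (emul g^-1%g (opp e)) `<=` ws (opp e).
Proof.
rewrite -opp_emul; apply: osub.
by have := @power_up e g h 1; rewrite expg1.
Qed.

(** Two points [y] and [y'] on different sides of [k e] lie in a translate [u] of [e] and in a
    translate [d] of its complement, both by powers of [g]. Hence [k e] or its complement lies
    inside [u], and likewise inside [d], and these have the hats of [e] and of its complement. *)
Lemma line_same k : same_hat (emul k e) e.
Proof.
have [y ky] := ws_ex (emul k e); have [y' ky'] := ws_ex_opp (emul k e).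
have [m hm] := absorb g1 h y; have [m' hm'] := absorb g1 h y'.
have [p hp] := absorb gV1 oh y; have [p' hp'] := absorb gV1 oh y'.
pose u := emul (g ^- (m + m'))%g e.
pose d := emul (g^-1 ^- (p + p'))%g (opp e).
have uy : ws u y by apply: (@power_up_add e g h m m').
have uy' : ws u y' by rewrite /u addnC; apply: (@power_up_add e g h m' m).
have dy : ws d y by apply: (@power_up_add (opp e) g^-1%g oh p p').
have dy' : ws d y' by rewrite /d addnC; apply: (@power_up_add (opp e) g^-1%g oh p' p).
have su : same_hat u e by apply: sgm'.
have sd : same_hat d (opp e).
  by rewrite /d expVgn invgK -opp_emul; apply/same_hat_opp/sgm.
have in_ c : ws c y -> ws c y' -> ws (emul k e) `<=` ws c \/ ws (opp (emul k e)) `<=` ws c.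
  move=> cy cy'; have [n|n|n|n] := Hnest (emul k e) c; [by left| |by right|].
    by have /hs_opp := n _ ky.
  by have /hs_opp := n _ ky'.
have hsub f c f' j : j <> 1%g -> ws f `<=` ws c -> same_hat c f' -> hat f j -> hat f' j.
  by move=> j1 fc cf' /(hat_mono fc j1) /cf'; apply.
have ek := essential_emul k ess.
case: (in_ u uy uy') => hu; case: (in_ d dy dy') => hd.
- have [[j j1 hj] _] := ek.
  by have := hsub _ _ _ _ j1 hd sd hj => /(hat_opp e j1); case; apply: hsub j1 hu su hj.
- move=> j j1; split; first exact: hsub hu su.
  move=> ej; apply: contrapT => nj; have : hat (opp (emul k e)) j by apply/hat_opp.
  by move=> /(hsub _ _ _ _ j1 hd sd) /(hat_opp e j1).
(* The reversed orientation. It would make the hat of [k e] the complement of that of [e], but [k]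
   belongs to both or to neither, being its own conjugate by [k]; for [k] = 1 any element does. *)
- exfalso; have [j [j1 hj nj]] : exists j, [/\ j <> 1%g, hat (emul k e) j <-> hat e j & True].
    have [k1|/eqP k1] := eqVneq k 1%g.
      by have [[j j1 _] _] := ess; exists j; rewrite k1 emul1.
    by exists k; split=> //; rewrite hat_emul mulVg mul1g.
  have [kj|kj] := pselect (hat (emul k e) j).
    have ej := hj.1 kj.
    by have := hsub _ _ _ _ j1 hd sd kj => /(hat_opp e j1).
  have : hat (opp (emul k e)) j by apply/hat_opp.
  by move=> /(hsub _ _ _ _ j1 hu su) /hj.
have [[j j1 hj] _] := essential_opp ek.
by have := hsub _ _ _ _ j1 hd sd hj => /(hat_opp e j1); case; apply: hsub j1 hu su hj.
Qed.

Lemma line_comparable k k' : ws (emul k e) `<=` ws (emul k' e) \/ ws (emul k' e) `<=` ws (emul k e).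
Proof.
apply: same_hat_sub; first exact: essential_emul.
by move=> j j1; rewrite (line_same k j1) (line_same k' j1).
Qed.

(* The group acts on the chain of translates as a discrete group of translations. *)
Lemma line_abelian (k k' : G) : (k * k')%g = (k' * k)%g.
Proof.
pose S : set G := [set j | [/\ j <> 1%g, ws (emul j e) `<=` ws e & ws (emul g e) `<=` ws (emul j e)]].
have fS : finite_set S.
  have [u hu] := ws_ex (emul g e); have [v hv] := ws_ex_opp e.
  apply: sub_finite_set (sepb_fin u v e) => j [_ j1 j2] /=.
  rewrite /sepb asboolT; last exact: j2.
  by rewrite asboolF // => /j1; apply/hs_opp.
have [k0 [k01 k0e k0g] k0max] := finite_minimal (fun j => ws (opp (emul j e))) fS (ex_intro _ g (And3 g1 h (@subset_refl _ _))).
have max j : j <> 1%g -> ws (emul j e) `<=` ws e -> ws (emul k0 e) `<=` ws (emul j e) -> j = k0.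
  move=> j1 je kj; have Sj : S j by split=> //; apply: subset_trans kj.
  have jk : ws (emul j e) `<=` ws (emul k0 e) by have := osub (k0max j Sj (osub kj)); rewrite !oppK.
  have : ws (emul (k0^-1 * j)%g e) = ws e.
    apply/seteqP; split.
      by have := emul_sub aM (g := k0^-1%g) jk; rewrite -!emulM mulVg emul1.
    by have := emul_sub aM (g := k0^-1%g) kj; rewrite -!emulM mulVg emul1.
  by move=> /ws_free /(congr1 (fun z => k0 * z)%g); rewrite mulgA mulgV mul1g mulg1.
have pos j : ws (emul j e) `<=` ws e -> exists m, j = (k0 ^+ m)%g.
  move=> je; have [m [hm hm1]] : exists m, ws (emul j e) `<=` ws (emul (k0 ^+ m)%g e) /\
      ~ ws (emul j e) `<=` ws (emul (k0 ^+ m.+1)%g e).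
    have kV1 : (k0^-1)%g <> 1%g by move=> /(congr1 (fun z : G => z^-1)%g); rewrite invgK invg1.
    have ok : ws (emul k0^-1%g (opp e)) `<=` ws (opp e).
      by rewrite -opp_emul; apply: osub; have := @power_up e k0 k0e 1; rewrite expg1.
    have [y jy] := ws_ex (emul j e); have [m hm] := absorb kV1 ok y.
    have nm : ~ ws (emul j e) `<=` ws (emul (k0 ^+ m)%g e).
      by move=> /(_ _ jy); apply/hs_opp; move: hm; rewrite expVgn invgK.
    elim: m nm {hm} => [|m ih] nm; first by case: nm; rewrite expg0 emul1.
    have [hm|/ih //] := pselect (ws (emul j e) `<=` ws (emul (k0 ^+ m)%g e)).
    by exists m.
  have {}hm1 : ws (emul (k0 ^+ m.+1)%g e) `<=` ws (emul j e).
    by case: (line_comparable j (k0 ^+ m.+1)%g).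
  have q1 : ws (emul (k0 ^- m * j)%g e) `<=` ws e.
    by have := emul_sub aM (g := (k0 ^- m)%g) hm; rewrite -!emulM mulVg emul1.
  have q2 : ws (emul k0 e) `<=` ws (emul (k0 ^- m * j)%g e).
    have := emul_sub aM (g := (k0 ^- m)%g) hm1; rewrite -!emulM expgSr !mulgA mulVg mul1g.
    by [].
  have jE : j = (k0 ^+ m * (k0 ^- m * j))%g by rewrite mulgA mulgV mul1g.
  have [q|/eqP q] := eqVneq (k0 ^- m * j)%g 1%g.
    by exists m; rewrite jE q mulg1.
  by exists m.+1; rewrite jE (max _ q q1 q2) expgSr.
have cyc j : exists m m', j = (k0 ^- m * k0 ^+ m')%g.
  have [y' jy'] := ws_ex_opp (emul j e); have [m hm] := absorb k01 k0e y'.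
  have jm : ws (emul j e) `<=` ws (emul (k0 ^- m)%g e).
    by case: (line_comparable j (k0 ^- m)%g) => // /(_ _ hm); move/hs_opp: jy'.
  have [|m' e'] := pos (k0 ^+ m * j)%g.
    by have := emul_sub aM (g := (k0 ^+ m)%g) jm; rewrite -!emulM mulgV emul1.
  by exists m, m'; rewrite -e' mulgA mulVg mul1g.
have [m [m' ->]] := cyc k; have [q [q' ->]] := cyc k'.
have C u v : commute (k0 ^+ u)%g (k0 ^+ v)%g by apply/commuteX2/commute_refl.
have CV u v : commute (k0 ^+ u)%g (k0 ^- v)%g by apply/commuteV/C.
have CVV u v : commute (k0 ^- u)%g (k0 ^- v)%g by apply/commuteV/commute_sym/CV.
have key u : commute (k0 ^- q * k0 ^+ q')%g (k0 ^+ u)%g by apply/commute_sym/commuteM; [apply: CV|apply: C].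
by apply: (commute_sym (commuteM (commuteV (key m)) (key m'))).
Qed.

End Line.

End Hats.

(** * Realization of wall systems in outer space *)

Lemma fcount_agree (I : choiceType) (P Q S S' : pred I) :
  finite_set [set i | P i] -> finite_set [set i | Q i] ->
  finite_set [set i | S i] -> finite_set [set i | S' i] ->
  (forall i, ~~ S i -> ~~ S' i -> P i = Q i) ->
  (fcount P <= fcount Q + (fcount S + fcount S'))%N.
Proof.
move=> fP fQ fS fS' h; pose U i := S i || S' i.
have fU : finite_set [set i | U i].
  apply: (sub_finite_set (B := [set i | S i] `|` [set i | S' i])); last by rewrite finite_setU.
  by move=> i /orP[]; [left|right].
apply: (@leq_trans (fcount Q + fcount U)).
  rewrite -[leqLHS]addn0 -(fcount0 I); apply: fcount_leD => // i; rewrite /U addn0.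
  have := h i; case: (S i) (S' i) (P i) (Q i) => [] [] [] [] // /(_ isT isT).
  by [].
rewrite leq_add2l -[leqLHS]addn0 -(fcount0 I); apply: fcount_leD => // i.
by rewrite /U; case: (S i) (S' i) => [] [].
Qed.

Lemma fcount_le1 (I : choiceType) (P : pred I) : (forall i j, P i -> P j -> i = j) ->
  (fcount P <= 1)%N.
Proof.
move=> h; have [[i Pi]|n] := pselect (exists i, P i).
  by rewrite (fcount1 Pi) // => j Pj; apply: h.
rewrite (@eq_fcount _ _ (fun=> false)) ?fcount0 // => i.
by apply/negP => Pi; apply: n; exists i.
Qed.

Section Realize.
Variables (R : realType) (p k : nat) (Gi : 'I_p -> groupType) (G : groupType)
  (iota : forall i, {multiplicative Gi i -> G}) (x : 'I_k -> G).
Hypothesis hG : is_free_product iota x.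
Hypothesis hGi : forall i : 'I_p, exists a : Gi i, a <> 1%g.
Variable T0 : gtree R G.
Hypothesis HT0 : in_outer iota T0.
Hypothesis edge0 : exists u v, adjq (@mdist R T0) (@vertices R T0) u v.

(** If all elements were elliptic, their fixed points would agree by [elliptic_product], and a
    global fixed point contradicts minimality in a tree with an edge. *)
Lemma hyperbolic_ex : exists g, translation_length T0 g <> 0.
Proof.
apply: contrapT => n.
have ell g : exists y : T0, act g y = y.
  by apply/translation_length0; apply: contrapT => h; apply: n; exists g.
have [u [v uv]] := edge0; have [_ _ nuv _] := uv.
have fr := outer_free HT0; have H := mdist_zh T0.
have [z hz] : exists z : T0, forall g, act g z = z.
  have [[g g1]|G1] := pselect (exists g : G, g <> 1%g); last first.
    exists u => g; suff -> : g = 1%g by rewrite act1.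
    by apply: contrapT => g1; apply: G1; exists g.
  have [z gz] := ell g; exists z => h.
  have [->|/eqP h1] := eqVneq h 1%g; first by rewrite act1.
  have [y hy] := ell h; suff -> : z = y by [].
  apply: contrapT => zy; have := elliptic_product fr gz hy g1 h1 zy.
  by have := (translation_length0 T0 (g * h)%g).2 (ell _) => ->; rewrite ltxx.
have : [set z] = setT.
  apply: (invariant_convex_full HT0); first by exists z.
    move=> a b y -> -> ; rewrite /btw mdistxx => e; apply: mdist_sep.
    by have := zhC H z y; have := mdist_ge0 z y; lra.
  by move=> g y ->; apply: hz.
move=> e; apply: nuv; have : [set z] u by rewrite e.
by have : [set z] v by [rewrite e]; move=> -> ->.
Qed.

Variables (W : Type) (base : W) (a : G -> W -> W).
Hypothesis a1 : forall x, a 1%g x = x.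
Hypothesis aM : forall g h x, a (g * h)%g x = a g (a h x).
Variables (N : nat) (H : 'I_N -> set W).
Local Notation ws := (hs a H).
Hypothesis Hfin : forall x y i, finite_set [set g | sepw a H x y i g].
Hypothesis Hnest : forall e f, [\/ ws e `<=` ws f, ws e `<=` ws (opp f),
  ws (opp e) `<=` ws f | ws (opp e) `<=` ws (opp f)].
Hypothesis Hwit : forall i, exists x y, [/\ ~ H i x, H i y & forall g, sepw a H x y i g -> g = 1%g].
Variable om : 'I_N -> R.
Hypothesis om0 : forall i, 0 < om i.

Definition wdist (x y : W) : R := \sum_(i < N) om i * (fcount (sepw a H x y i))%:R.

Variable l : G -> R.
Hypothesis hl : forall g x, exists C, forall m, `|wdist x (a (g ^+ m)%g x) - m%:R * l g| <= C.
Hypothesis ell : forall g, l g = 0 <-> translation_length T0 g = 0.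
Local Notation hat := (hat a H).
Local Notation same_hat := (same_hat a H).
Local Notation essential := (essential a H).

Let hatM := @hat_mono _ _ _ a1 aM _ _ Hfin Hnest Hwit.
Let hatO := @hat_opp _ _ _ a1 aM _ _ Hnest Hwit.
Let hatS := @same_hat_sub _ _ _ a1 aM _ _ Hfin Hnest Hwit.
Let hsO := hs_opp a H.
Let hsE := hs_emul aM H.
Let hatE := hat_emul aM H.
Let free := @ws_free _ _ _ a1 aM _ _ Hwit.

(** The first [m] translates of the wall by powers of [g] all separate [z] from [g^m z], so each
    step costs at least the weight of the wall. *)
Lemma chain_pos e g : g <> 1%g -> ws (emul g e) `<=` ws e -> 0 < l g.
Proof.
move=> g1 h.
have [z [ez nz]] : exists z, ws e z /\ ~ ws (emul g e) z.
  apply: contrapT => n; apply: g1; apply: (ws_free a1 aM Hwit (e := e)); apply/seteqP; split=> // z ez.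
  by apply: contrapT => nz; apply: n; exists z.
have [C hC] := hl g z; apply: (lt_le_trans (om0 e.1.2)).
apply: (@bounded_slope R _ _ C) => m.
have : m%:R * om e.1.2 <= wdist z (a (g ^+ m)%g z).
  rewrite /wdist (bigD1 e.1.2) //= -[leLHS]addr0; apply: lerD; last first.
    by apply: sumr_ge0 => i _; apply: mulr_ge0 => //; apply: ltW.
  rewrite mulrC ler_pM2l // ler_nat.
  apply: (@fcount_ge _ _ m (fun j => g ^+ j.+1 * e.1.1)%g); first exact: Hfin.
    move=> j jm; have : sepb a H z (a (g ^+ m)%g z) (emul (g ^+ j.+1)%g e).
      rewrite /sepb asboolF; last first.
        move=> h1; apply: nz; move: h1; rewrite expgS emulM.
        by apply: emul_sub => //; apply: (power_chain aM).
      rewrite asboolT //; apply/hsE; rewrite -aM -(subnKC jm) expgnDr mulgA mulVg mul1g.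
      by have /(hsE (g ^- (m - j.+1))%g e z) := power_up aM h (m - j.+1) ez; rewrite invgK.
    rewrite /sepw /emul; case: (e) => -[g0 i] [] //=.
    by rewrite -(sepb_opp _ _ _ _ (_, false)).
  move=> j j' _ _ /mulIg e1; apply: succn_inj.
  exact: (power_inj a1 aM Hwit g1 h) e1.
have := hC m; rewrite ler_norml => /andP[]; lra.
Qed.

Lemma same_hat_pos e g : essential e -> g <> 1%g -> same_hat (emul g e) e -> l g <> 0.
Proof.
move=> ee g1 sg; have [h|h] := hatS (essential_emul aM g ee) sg.
  by move=> e0; have := chain_pos g1 h; rewrite e0 ltxx.
have h' : ws (emul g (opp e)) `<=` ws (opp e) by rewrite -opp_emul; apply: opp_sub.
by move=> e0; have := chain_pos g1 h'; rewrite e0 ltxx.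
Qed.

(** Otherwise the translates of [e] form a line of parallel walls on which every nontrivial element
    has positive length. The action is then free and the group abelian, against [nonabelian]. *)
Lemma no_line e g : essential e -> same_hat (emul g e) e -> g = 1%g.
Proof.
move=> ee sg; apply: contrapT => g1.
have [j [j1 h sj]] : exists j, [/\ j <> 1%g, ws (emul j e) `<=` ws e & same_hat (emul j e) e].
  have [h|h] := hatS (essential_emul aM g ee) sg; first by exists g.
  exists g^-1%g; split.
  - by move=> /(congr1 (fun z : G => z^-1)%g); rewrite invgK invg1.
  - by have := emul_sub aM (g := g^-1%g) h; rewrite -emulM mulVg emul1.
  - move=> j j1; have := @same_hat_emul _ _ a aM N H g^-1%g _ _ sg j j1.
    by rewrite -emulM mulVg emul1 => ->.
have nf g' (y : T0) : act g' y = y -> g' = 1%g.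
  move=> gy; apply: contrapT => g1'.
  apply: (same_hat_pos ee g1' (line_same a1 aM Hfin Hnest Hwit ee j1 h sj g')).
  by apply/ell/translation_length0; exists y.
have [u [v]] := nonabelian HT0 edge0 nf; apply.
exact: (line_abelian a1 aM Hfin Hnest Hwit ee j1 h sj).
Qed.

Lemma no_inversion e g : essential e -> ~ same_hat (emul g e) (opp e).
Proof.
move=> ee sg; have [g1|/eqP g1] := eqVneq g 1%g.
  by have [[j j1 hj] _] := ee; have s := (sg j j1).1; rewrite g1 emul1 in s; have /(hatO e j1) := s hj; apply.
have := sg g g1; rewrite hatO // hatE mulVg mul1g; tauto.
Qed.

(** On the side whose hat is empty, distinct translates are disjoint, so at most one contains [y]
    and at most one contains [z]. Such walls contribute nothing to translation lengths. *)
Lemma inessential_bound i y z : ~ essential (1%g, i, true) -> (fcount (sepw a H y z i) <= 2)%N.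
Proof.
set e := (1%g, i, true).
have disj f : (forall g, g <> 1%g -> ~ hat f g) -> forall g g' y, ws (emul g f) y -> ws (emul g' f) y -> g = g'.
  move=> nf g g' u h1 h2; apply: contrapT => gg.
  have q1 : (g^-1 * g')%g <> 1%g.
    by move=> /(congr1 (fun j => g * j)%g); rewrite mulgA mulgV mul1g mulg1 => e1; apply: gg.
  have key j : j <> 1%g -> ws f `<=` ws (emul j f) \/ ws f `<=` ws (opp (emul j f)).
    move=> j1; have /(hatO f j1) := nf j j1; rewrite /hat oppK -opp_emul => -[h|h]; [left|by right].
    by have := opp_sub h; rewrite !oppK.
  have v1 : ws f (a g^-1%g u) by apply/hsE.
  have v2 : ws (emul (g^-1 * g')%g f) (a g^-1%g u).
    by apply/hsE; rewrite -aM invgM invgK mulgK; apply/hsE.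
  have [k1|k1] := key _ q1; last by have /hsO := k1 _ v1.
  have q2 : (g^-1 * g')^-1%g <> 1%g.
    by move=> /(congr1 (fun z : G => z^-1)%g); rewrite invgK invg1.
  have k1' : ws (emul (g^-1 * g')^-1%g f) `<=` ws f.
    by have := emul_sub aM (g := (g^-1 * g')^-1%g) k1; rewrite -emulM mulVg emul1.
  have [k2|k2] := key _ q2.
    by apply: q2; apply: (free (e := f)); apply/seteqP.
  have := emul_sub aM (g := (g^-1 * g')%g) k2; rewrite opp_emul -emulM mulgV emul1.
  by move=> /(_ _ v2) /hsO; apply.
have main f : (forall g, g <> 1%g -> ~ hat f g) -> (fcount (fun g => sepb a H y z (emul g f)) <= 2)%N.
  move=> nf; have d := disj f nf.
  pose P u g := `[< ws (emul g f) u >].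
  have P1 u : (fcount (P u) <= 1)%N by apply: fcount_le1 => g g' /asboolP h1 /asboolP; apply: d.
  have fP u : finite_set [set g | P u g].
    have [[g0 h0]|nn] := pselect (exists g, ws (emul g f) u).
      by apply: (sub_finite_set (B := [set g0])) => // g /asboolP h; apply: d h h0.
    by apply: (sub_finite_set (B := set0)) => // g /asboolP h; apply: nn; exists g.
  apply: (@leq_trans (fcount (P y) + fcount (P z))); last by rewrite -[2%N]/(1 + 1)%N leq_add.
  rewrite -[leqLHS]addn0 -(fcount0 G); apply: fcount_leD => // g.
  by rewrite /sepb /P; case: asboolP; case: asboolP.
have fe f : f = e \/ f = opp e -> fcount (sepw a H y z i) = fcount (fun g => sepb a H y z (emul g f)).
  by move=> hf; apply: eq_fcount => g; case: hf => ->; rewrite ?(sepb_opp a H y z) /emul /= ?mulg1 // -sepb_opp.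
move=> ness; have [[k0 k01 hk]|n1] := pselect (exists2 g, g <> 1%g & hat e g); last first.
  by rewrite (fe e); [apply: main => g g1 h; apply: n1; exists g|left].
rewrite (fe (opp e)); [apply: main => g g1 /(hatO e g1) h|by right].
by apply: ness; split; [exists k0|exists g].
Qed.

(** The ground set of the realized walls, under conjugation, with each half-space replaced by its
    hat. On it inessential walls become empty or full and parallel walls become equal. *)
Definition Om : Type := {g : G | g != 1%g}.
Definition conj_om (g : G) (z : Om) : Om.
Proof.
exists (g * sval z * g^-1)%g; apply/eqP.
by have := @conj_neq1 _ g^-1%g (sval z); rewrite invgK; apply; apply/eqP/(svalP z).
Defined.

Let conjM_om g h z : conj_om (g * h)%g z = conj_om g (conj_om h z).
Proof. by apply: val_inj; rewrite /= invgM !mulgA. Qed.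

(** Parallel up to translation and orientation: the relation whose classes of essential walls are
    the edge orbits of the realized tree. *)
Definition twin (i j : 'I_N) : Prop := exists g b, same_hat (1%g, i, true) (g, j, b).

Let twinP i j : twin i j -> exists g b, same_hat (1%g, j, true) (g, i, b).
Proof.
move=> [g [b h]]; exists g^-1%g, b => q q1; symmetry.
have := @same_hat_emul _ _ a aM N H g^-1%g _ _ h; rewrite /emul /= mulVg mulg1.
case: b h => h s; first exact: s.
have := same_hat_opp a1 aM Hnest Hwit s q1.
by [].
Qed.

Let twin_refl i : twin i i.
Proof. by exists 1%g, true => q q1. Qed.

Let twin_sym i j : twin i j -> twin j i.
Proof. exact: twinP. Qed.

Let twin_trans i j m : twin i j -> twin j m -> twin i m.
Proof.
move=> [g [b h]] [g' [b' h']].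
have s : same_hat (g, j, true) ((g * g')%g, m, b').
  by have := @same_hat_emul _ _ a aM N H g _ _ h'; rewrite /emul /= mulg1.
case: b h => h; [exists (g * g')%g, b'|exists (g * g')%g, (~~ b')] => q q1.
  by rewrite (h q q1) (s q q1).
by rewrite (h q q1); exact: (same_hat_opp a1 aM Hnest Hwit s q1).
Qed.

Section Reps.
Variables (n : nat) (rr : 'I_n -> 'I_N) (cl : 'I_N -> 'I_n).
Hypothesis rr_ess : forall j, essential (1%g, rr j, true).
Hypothesis rr_inj : forall i j, twin (rr i) (rr j) -> i = j.
Hypothesis cl_twin : forall i, essential (1%g, i, true) -> twin i (rr (cl i)).

Let F (j : 'I_n) : set Om := fun z => hat (1%g, rr j, true) (sval z).
Let ess i := `[< essential (1%g, i, true) >].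
(** Twins are pieces of one edge orbit of the realized tree, so their weights add up to its
    length. *)
Let w (j : 'I_n) : R := \sum_(i < N | ess i && (cl i == j)) om i.
Local Notation hsF := (hs conj_om F).
Let wl (e : oedge G n) : oedge G N := (e.1.1, rr e.1.2, e.2).

Let wl_ess e : essential (wl e).
Proof.
have h g i : essential (1%g, i, true) -> essential (g, i, true).
  by move=> /(essential_emul aM g); rewrite /emul /= mulg1.
case: e => -[g i] [] /=; first exact: h.
exact/(essential_opp a1 aM Hnest Hwit (e := (g, rr i, true)))/h.
Qed.

Let hsFE e z : hsF e z <-> hat (wl e) (sval z).
Proof.
have z1 : sval z <> 1%g by apply/eqP/(svalP z).
have h g i : F i (conj_om g^-1%g z) <-> hat (g, rr i, true) (sval z).
  rewrite /F /= invgK -hatE /emul /= mulg1 //.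
case: e => -[g i] [] /=; rewrite /hs /= h //.
by symmetry; apply: (hatO (g, rr i, true)).
Qed.

Let hsF_sub e f : ws (wl e) `<=` ws (wl f) -> hsF e `<=` hsF f.
Proof.
move=> h z /hsFE he; apply/hsFE; apply: hatM h _ he; exact/eqP/(svalP z).
Qed.

Let hsF_same e f : hsF e = hsF f -> same_hat (wl e) (wl f).
Proof.
move=> h q q1; have qq : q != 1%g by apply/eqP.
by rewrite -[q]/(sval (exist (fun g : G => g != 1%g) q qq)) -!hsFE h.
Qed.

Let w0 j : 0 < w j.
Proof.
rewrite /w (bigD1 (rr j)) /=; last first.
  apply/andP; split; first by apply/asboolP/rr_ess.
  by apply/eqP/esym/rr_inj/cl_twin/rr_ess.
by apply: ltr_pwDl => //; apply: sumr_ge0 => i _; apply: ltW.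
Qed.

Let F_ne e : hsF e !=set0.
Proof.
have [[q q1 hq] _] := wl_ess e; have qq : q != 1%g by apply/eqP.
by exists (exist _ q qq); apply/hsFE.
Qed.

Let F_nest e f : [\/ hsF e `<=` hsF f, hsF e `<=` hsF (opp f),
  hsF (opp e) `<=` hsF f | hsF (opp e) `<=` hsF (opp f)].
Proof.
by have [h|h|h|h] := Hnest (wl e) (wl f); [constructor 1|constructor 2|constructor 3|constructor 4];
  apply: hsF_sub.
Qed.

Let F_inj e f : hsF e = hsF f -> e = f.
Proof.
move=> /hsF_same; case: e => -[g i] b; case: f => -[h j] c; rewrite /wl /= => s.
have e1 : emul (h^-1 * g)%g (1%g, rr i, b) = emul h^-1%g (g, rr i, b).
  by rewrite /emul /= mulg1.
have s1 : same_hat (emul (h^-1 * g)%g (1%g, rr i, b)) (1%g, rr j, c).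
  by rewrite e1; have := @same_hat_emul _ _ a aM N H h^-1%g _ _ s; rewrite /emul /= mulVg.
have ij : i = j.
  apply: rr_inj; exists (g^-1 * h)%g, (b == c) => q q1.
  have s2 := @same_hat_emul _ _ a aM N H g^-1%g _ _ s; rewrite /emul /= mulVg in s2.
  have s3 := same_hat_opp a1 aM Hnest Hwit s2.
  by move: s2 s3; rewrite /opp /=; case: b {s e1 s1}; case: c => s2 s3; apply: s2 || apply: s3.
subst j; case: (eqVneq b c) => [bc|bc].
  subst c; have := no_line (wl_ess (1%g, i, b)) s1 => e2.
  have -> : g = (h * (h^-1 * g))%g by rewrite mulgA mulgV mul1g.
  by rewrite e2 mulg1.
have cb : (1%g, rr i, c) = opp (1%g, rr i, b) by rewrite /opp /=; move: bc; case: (b); case: (c).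
by rewrite cb in s1; case: (no_inversion (wl_ess (1%g, i, b)) s1).
Qed.

Let F_fin e f : finite_set [set K | hsF e `<=` hsF K /\ hsF K `<=` hsF f].
Proof.
have [y hy] := ws_ex a1 aM Hwit (wl e); have [z hz] := ws_ex_opp a1 aM Hwit (wl f).
pose S i b : set (oedge G n) := [set K | K.1.2 = i /\ K.2 = b /\ sepb a H y z (wl K)].
have fS i b : finite_set (S i b).
  have := sepb_fin Hfin y z (1%g, rr i, b); move=> /(finite_image (fun g => (g, i, b))).
  apply: sub_finite_set => -[[g j] c] [/= -> [-> h]]; exists g => //.
  by rewrite /= /emul /= mulg1.
apply: (sub_finite_set (B := [set e] `|` [set f] `|` \bigcup_(ib in [set: 'I_n * bool]) S ib.1 ib.2)).
  move=> K [h1 h2].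
  have [->|Ke] := pselect (K = e); first by left; left.
  have [->|Kf] := pselect (K = f); first by left; right.
  right; exists (K.1.2, K.2) => //; split=> //; split=> //.
  have sub e1 e2 : hsF e1 `<=` hsF e2 -> e1 <> e2 -> ws (wl e1) `<=` ws (wl e2).
    move=> s ne12; have [h|h|h|h] := Hnest (wl e1) (wl e2) => //.
    - have [q hq] := F_ne e1; have := hsF_sub (f := opp e2) h hq.
      by move=> /(hs_opp conj_om F); case; apply: s.
    - have [q /(hs_opp conj_om F) hq] := F_ne (opp e2); case: hq.
      have [hq|hq] := pselect (hsF e1 q); first exact: s.
      by apply: (hsF_sub (e := opp e1) h); apply/hs_opp.
    - have s' : hsF e2 `<=` hsF e1 by apply: hsF_sub; have := opp_sub h; rewrite !oppK.
      by case: ne12; apply: F_inj; apply/seteqP.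
  have b1 : ws (wl K) y by apply: (sub e K h1) hy => e1; apply: Ke.
  have b2 : ~ ws (wl K) z by move=> /(sub K f h2 Kf); apply/hsO.
  by rewrite /sepb asboolT // asboolF.
rewrite !finite_setU; split; first by split; apply: finite_set1.
by apply: bigcup_finite => // -[i b] _; apply: fS.
Qed.

Let F_star (z : Om) e : hsF e z ->
  hsF (emul (sval z) e) `<=` hsF e \/ hsF (opp e) `<=` hsF (emul (sval z) e).
Proof. by move=> /hsFE[h|h]; [left|right]; apply: hsF_sub. Qed.

Let om_neq1 (z : Om) : sval z <> 1%g.
Proof. exact/eqP/(svalP z). Qed.

Variable b0 : oedge G n.

Definition realization : gtree R G :=
  pocset_tree conjM_om w0 F_ne F_nest F_inj F_fin b0.

Let sideO e K : side conj_om F e (opp K) <-> ~ side conj_om F e K :=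
  side_opp F_ne F_nest F_inj e K.

(** An essential wall and its hat separate base point and translate alike, except for the walls
    between [y] and [z], the wall of [e] itself, and the translates of these by [g]. The number of
    exceptions does not depend on [g], so asymptotic lengths agree. *)
Let count_bound e y z i : ws (wl e) y -> ~ ws (wl e) z -> essential (1%g, i, true) ->
  exists M, forall g,
    (fcount (sepE conj_om F e (emul g e) (cl i)) <= fcount (sepw a H y (a g y) i) + M)%N /\
    (fcount (sepw a H y (a g y) i) <= fcount (sepE conj_om F e (emul g e) (cl i)) + M)%N.
Proof.
move=> hy hz hi; have [g0 [b sh]] := cl_twin hi.
pose K h : oedge G n := ((h * g0)%g, cl i, b).
have sK h : same_hat (h, i, true) (wl (K h)).
  by have := @same_hat_emul _ _ a aM N H h _ _ sh; rewrite /emul /= mulg1.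
pose Exc h := [|| sepw a H y z i h, K h == e | K h == opp e].
have fE : finite_set [set h | Exc h].
  apply: (sub_finite_set (B := [set h | sepw a H y z i h] `|` [set (e.1.1 * g0^-1)%g])).
    move=> h /or3P[h1|/eqP h1|/eqP h1]; [by left|right|right];
    by have := congr1 (fun u => u.1.1) h1 => /= <-; rewrite /= mulgK.
  by rewrite finite_setU; split; [apply: Hfin|apply: finite_set1].
(* A half-space containing a point on each side of [e] contains [e] or its complement, and in both
   cases the head of [e] lies on its side. *)
have half L u : L <> e -> L <> opp e -> same_hat u (wl L) ->
    ws u y -> ws u z -> side conj_om F e L.
  move=> Le Loe su uy uz.
  have sub e1 f1 (s1 : ws e1 `<=` ws f1) (q : Om) : hat e1 (sval q) -> hat f1 (sval q).
    by apply: hatM => //; apply: om_neq1.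
  have su' := same_hat_opp a1 aM Hnest Hwit su.
  have [s1|s1|s1|s1] := Hnest (wl e) u.
  - by left=> q /hsFE hq; apply/hsFE/su; [apply: om_neq1|apply: sub hq].
  - by have /hsO := s1 _ hy.
  - right; split; last by move=> e1; apply: Loe; rewrite -e1 oppK.
    move=> q /hsFE hq; apply/hsFE; apply: (sub (opp u)); last exact/su'.
    by have := opp_sub s1; rewrite !oppK.
  - by have /hsO := s1 z ((hsO _ _).2 hz).
have key h : ~~ Exc h -> (side conj_om F e (K h) <-> ws (h, i, true) y).
  rewrite /Exc !negb_or => /and3P[h1 /eqP h2 /eqP h3].
  have same : ws (h, i, true) y <-> ws (h, i, true) z.
    by move: h1; rewrite /sepw /sepb; case: asboolP; case: asboolP.
  split=> [hs|hs]; last by apply: (half (K h) (h, i, true)) => //; apply/same.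
  apply: contrapT => ny; apply: (proj1 (sideO e (K h))) hs.
  apply: (half (opp (K h)) (opp (h, i, true))).
  - by move=> e1; apply: h3; rewrite -e1 oppK.
  - by move=> e1; apply: h2; rewrite -(oppK (K h)) e1 oppK.
  - exact: (same_hat_opp a1 aM Hnest Hwit (sK h)).
  - exact/hsO.
  - by apply/hsO => /same.
have fE' g : finite_set [set h | Exc (g^-1 * h)%g].
  have -> : [set h | Exc (g^-1 * h)%g] = (fun h => g * h)%g @` [set h | Exc h].
    apply/seteqP; split=> [h hh|_ [h hh <-]] /=; last by rewrite mulgA mulVg mul1g.
    by exists (g^-1 * h)%g => //; rewrite mulgA mulgV mul1g.
  exact: finite_image.
have cE' g : fcount (fun h => Exc (g^-1 * h)%g) = fcount Exc.
  apply: (@fcount_bij _ _ Exc (fun h => g^-1 * h)%g (fun h => g * h)%g) => //.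
    by move=> h; rewrite mulgA mulgV mul1g.
  by move=> h; rewrite mulgA mulVg mul1g.
exists (fcount Exc + fcount Exc)%N => g; rewrite -{2 4}(cE' g).
pose P h := sepE conj_om F e (emul g e) (cl i) (h * g0)%g.
have fS : finite_set [set h | sepE conj_om F e (emul g e) (cl i) h].
  exact: (sepE_finite F_ne F_nest F_inj F_fin).
have cP : fcount P = fcount (sepE conj_om F e (emul g e) (cl i)).
  apply: (@fcount_bij _ _ _ (fun h => h * g0)%g (fun h => h * g0^-1)%g) => // h.
    by rewrite mulgK.
  by rewrite mulgVK.
have fP : finite_set [set h | P h].
  have -> : [set h | P h] = (fun h => h * g0^-1)%g @`
      [set h | sepE conj_om F e (emul g e) (cl i) h].
    apply/seteqP; split=> [h hh|_ [h hh <-]] /=; last by rewrite /P mulgVK.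
    by exists (h * g0)%g => //; rewrite mulgK.
  exact: finite_image.
rewrite -cP.
have agree h : ~~ Exc h -> ~~ Exc (g^-1 * h)%g -> P h = sepw a H y (a g y) i h.
  move=> h1 h2; have k1 := key _ h1; have k2 := key _ h2.
  have k3 : side conj_om F (emul g e) (K h) <-> ws (h, i, true) (a g y).
    have -> : K h = emul g (K (g^-1 * h)%g) by rewrite /K /emul /= !mulgA mulgV mul1g.
    have -> : (h, i, true) = emul g ((g^-1 * h)%g, i, true) by rewrite /emul /= !mulgA mulgV mul1g.
    by rewrite side_emul // k2 hsE -aM mulVg a1.
  rewrite /P /sepE /sepw /sepb -(asbool_equiv_eq k1) -(asbool_equiv_eq k3) /K.
  have so f g' : `[< side conj_om F f (g', cl i, false) >] = ~~ `[< side conj_om F f (g', cl i, true) >].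
    by rewrite -asbool_neg; apply: asbool_equiv_eq; exact: (sideO f (g', cl i, true)).
  by case: (b) => //; rewrite !so; case: `[< _ >]; case: `[< _ >].
have fQ : finite_set [set h | sepw a H y (a g y) i h] by apply: Hfin.
have fE2 := fE' g.
by split; apply: fcount_agree => // h h1 h2; rewrite agree.
Qed.

Let ddist_classes e f : ddist conj_om F w e f =
  \sum_(i < N | ess i) om i * (fcount (sepE conj_om F e f (cl i)))%:R.
Proof.
rewrite /ddist [RHS](partition_big cl predT) //=; apply: eq_bigr => j _.
by rewrite /w mulr_suml; apply: eq_bigr => i /andP[_ /eqP ->].
Qed.

Lemma realization_translation g : translation_length realization g = l g.
Proof.
pose e := b0.
have [y hy] := ws_ex a1 aM Hwit (wl e); have [z /hsO hz] := ws_ex_opp a1 aM Hwit (wl e).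
apply: (@pocset_translation R G Om conj_om conjM_om n F w w0 F_ne F_nest F_inj F_fin b0 g e).
have /choice[M hM] : forall i, exists M, essential (1%g, i, true) -> forall g,
    (fcount (sepE conj_om F e (emul g e) (cl i)) <= fcount (sepw a H y (a g y) i) + M)%N /\
    (fcount (sepw a H y (a g y) i) <= fcount (sepE conj_om F e (emul g e) (cl i)) + M)%N.
  move=> i; have [hi|hi] := pselect (essential (1%g, i, true)); last by exists 0%N.
  by have [M hM] := count_bound hy hz hi; exists M.
have [C hC] := hl g y.
exists (\sum_(i < N) om i * (M i + 2)%:R + C) => m.
pose S := \sum_(i < N | ess i) om i * (fcount (sepw a H y (a (g ^+ m)%g y) i))%:R.
have bnd i : 0 <= om i * (M i)%:R by apply: mulr_ge0 => //; apply: ltW.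
have b1 : `|ddist conj_om F w e (emul (g ^+ m)%g e) - S| <= \sum_(i < N | ess i) om i * (M i)%:R.
  rewrite ddist_classes /S -sumrB; apply: le_trans (ler_norm_sum _ _ _) _.
  apply: ler_sum => i /asboolP hi; rewrite -mulrBr normrM (gtr0_norm (om0 i)) ler_pM2l //.
  have [] := hM i hi (g ^+ m)%g; rewrite -(ler_nat R) natrD -(ler_nat R) natrD => h1 h2.
  by rewrite ler_norml; apply/andP; split; lra.
have b2 : `|S - wdist y (a (g ^+ m)%g y)| <= \sum_(i < N | ~~ ess i) om i * 2.
  rewrite /wdist (bigID ess) /= -/S opprD addrA subrr add0r normrN.
  apply: le_trans (ler_norm_sum _ _ _) _; apply: ler_sum => i /asboolPn hi.
  rewrite normrM (gtr0_norm (om0 i)) ler_pM2l // ger0_norm // ler_nat.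
  exact: inessential_bound.
have b3 : \sum_(i < N | ess i) om i * (M i)%:R + \sum_(i < N | ~~ ess i) om i * 2 <=
    \sum_(i < N) om i * (M i + 2)%:R.
  rewrite [leRHS](bigID ess) /=; apply: lerD; apply: ler_sum => i _; rewrite ler_pM2l //.
    by rewrite ler_nat leq_addr.
  by rewrite -[2]/(2%:R) ler_nat leq_addl.
have := hC m; move: b1 b2; rewrite !ler_norml => /andP[? ?] /andP[? ?] /andP[? ?].
by apply/andP; split; lra.
Qed.

Lemma realization_outer : in_outer iota realization.
Proof.
apply: (outer_transfer hG hGi HT0).
- exact: pocset_free.
- exact: (pocset_minimal om_neq1 F_star).
- by move=> v; apply: (pocset_nonredundant om_neq1 F_star).
- by move=> g; rewrite realization_translation.
Qed.

Lemma realization_covolume : covolume realization =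
  (\sum_(i < N | `[< essential (1%g, i, true) >]) om i)%:E.
Proof.
rewrite (covolume_reps (pocset_reps conjM_om w0 F_ne F_nest F_inj F_fin b0)).
congr (_%:E); rewrite [RHS](partition_big cl predT) //=.
by apply: eq_bigr => j _; rewrite oedge_rep_length.
Qed.

End Reps.

Lemma essential_ex : exists i, essential (1%g, i, true).
Proof.
apply: contrapT => n; have [g hg] := hyperbolic_ex; apply: hg; apply/ell.
have y := base; have [C hC] := hl g y.
have bnd m : wdist y (a (g ^+ m)%g y) <= \sum_(i < N) om i * 2.
  apply: ler_sum => i _; rewrite ler_pM2l // ler_nat; apply: inessential_bound.
  by move=> h; apply: n; exists i.
have wd m : 0 <= wdist y (a (g ^+ m)%g y).
  by apply: sumr_ge0 => i _; apply: mulr_ge0 => //; apply: ltW.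
apply/eqP; rewrite eq_le; apply/andP; split.
  apply: (@bounded_slope R _ _ (\sum_(i < N) om i * 2 + C)) => m.
  by have := bnd m; have := hC m; rewrite ler_norml mulr0 => /andP[]; lra.
apply: (@bounded_slope R _ _ C) => m.
by have := wd m; have := hC m; rewrite ler_norml mulr0 => /andP[]; lra.
Qed.

Theorem realize : exists T : gtree R G, [/\ in_outer iota T,
  forall g, translation_length T g = l g &
  covolume T = (\sum_(i < N | `[< essential (1%g, i, true) >]) om i)%:E].
Proof.
have [i0 hi0] := essential_ex.
have [r [rJ rcov rinj]] := reps_seq [seq i <- enum 'I_N | `[< essential (1%g, i, true) >]]
  twin_refl twin_sym twin_trans.
pose rr (j : 'I_(size r)) := tnth (in_tuple r) j.
have memJ i : (i \in [seq i <- enum 'I_N | `[< essential (1%g, i, true) >]]) =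
    `[< essential (1%g, i, true) >] by rewrite mem_filter mem_enum andbT.
have rr_ess j : essential (1%g, rr j, true).
  by apply/asboolP; rewrite -memJ; apply/rJ/mem_tnth.
have rr_inj i j : twin (rr i) (rr j) -> i = j.
  rewrite /rr !(tnth_nth i0) => /rinj e; apply/val_inj; exact: e.
have ex i : exists j, essential (1%g, i, true) -> twin i (rr j).
  have key i' : essential (1%g, i', true) -> exists j, twin i' (rr j).
    move=> /asboolP; rewrite -memJ => /rcov[y yr iy].
    have lt : (index y r < size r)%N by rewrite index_mem.
    by exists (Ordinal lt); rewrite /rr (tnth_nth i0) /= nth_index.
  have [j0 _] := key i0 hi0.
  have [/key[j hj]|hi] := pselect (essential (1%g, i, true)); first by exists j.
  by exists j0.
have [cl hcl] := choice ex.
exists (realization rr_ess rr_inj hcl (1%g, cl i0, true)); split.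
- exact: realization_outer.
- exact: realization_translation.
- exact: realization_covolume.
Qed.

End Realize.

(** * Interpolation of weights *)

Section WallSystems.
Variables (R : realType) (G : groupType) (W : choiceType) (base : W) (a : G -> W -> W).
Hypothesis a1 : forall x, a 1%g x = x.
Hypothesis aM : forall g h x, a (g * h)%g x = a g (a h x).

(** Repeated half-spaces are allowed, so that two overlapping systems can be listed side by side
    while weight moves from one to the other. *)
Record wall_sys N (H : 'I_N -> set W) : Prop := WallSys {
  sys_fin : forall x y i, finite_set [set g | sepw a H x y i g];
  sys_nest : forall e f, [\/ hs a H e `<=` hs a H f, hs a H e `<=` hs a H (opp f),
    hs a H (opp e) `<=` hs a H f | hs a H (opp e) `<=` hs a H (opp f)];
  sys_wit : forall i, exists x y, [/\ ~ H i x, H i y &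
    forall g, sepw a H x y i g -> g = 1%g] }.

Section One.
Variables (N : nat) (H : 'I_N -> set W) (om : 'I_N -> R).
Hypothesis S : wall_sys H.
Hypothesis om0 : forall i, 0 <= om i.
Local Notation wd := (wdist a H om).

Lemma wdist_act g x y : wd (a g x) (a g y) = wd x y.
Proof.
apply: eq_bigr => i _; congr (_ * _%:R).
rewrite -[in RHS](@fcount_bij _ _ _ (fun h => g^-1 * h)%g (fun h => g * h)%g); first last.
- exact: (sys_fin S).
- by move=> h; rewrite mulgA mulVg mul1g.
- by move=> h; rewrite mulgA mulgV mul1g.
apply: eq_fcount => h; rewrite /sepw.
have -> : (h, i, true) = emul g ((g^-1 * h)%g, i, true) by rewrite /emul /= mulgA mulgV mul1g.
by rewrite (sepb_emul aM) -!aM mulVg !a1.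
Qed.

Lemma wdist_zh : zero_hyperbolic wd.
Proof.
split=> [x|x y|x y z t].
- apply: big1 => i _; rewrite (@eq_fcount _ _ (fun=> false)) ?fcount0 ?mulr0 // => g.
  by rewrite /sepw /sepb addbb.
- by apply: eq_bigr => i _; congr (_ * _%:R); apply: eq_fcount => g; rewrite /sepw /sepb addbC.
pose q (x y z t : W) := exists K, [/\ hs a H K x, hs a H K y, ~ hs a H K z & ~ hs a H K t].
have flip x' y' z' t' : q z' t' x' y' -> q x' y' z' t'.
  by move=> [K [h1 h2 h3 h4]]; exists (opp K); split; rewrite ?hs_opp //; apply.
have key x' y' z' t' : ~ q x' z' y' t' -> wd x' y' + wd z' t' <= wd x' z' + wd y' t'.
  move=> nq; rewrite /wdist -!big_split; apply: ler_sum => i _ /=.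
  rewrite -!mulrDr; apply: ler_wpM2l => //; rewrite -!natrD ler_nat.
  apply: fcount_leD; [exact: (sys_fin S)|exact: (sys_fin S)|move=> g].
  have nq2 : ~ q y' t' x' z' by move=> /flip.
  rewrite /sepw /sepb.
  case: (asboolP (hs _ _ _ x')) => hx; case: (asboolP (hs _ _ _ y')) => hy;
  case: (asboolP (hs _ _ _ z')) => hz; case: (asboolP (hs _ _ _ t')) => ht //=.
    by case: nq; exists (g, i, true).
  by case: nq2; exists (g, i, true).
have [q1|/key] := pselect (q x z y t); last by left.
have wC u v : wd u v = wd v u.
  by apply: eq_bigr => i _; congr (_ * _%:R); apply: eq_fcount => g; rewrite /sepw /sepb addbC.
have [q2|/key h] := pselect (q x t y z); last by right; rewrite (wC z t).
exfalso; case: q1 q2 => K [h1 h2 h3 h4] [L [h5 h6 h7 h8]].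
have [s|s|s|s] := sys_nest S K L.
- by apply: h8; apply: s.
- by have /hs_opp := s _ h1.
- by apply: h7; apply: s; apply/hs_opp.
- by have /hs_opp := s t ((hs_opp a H K t).2 h4).
Qed.

Definition is_slope (l : G -> R) : Prop :=
  forall g x, exists C, forall m, `|wd x (a (g ^+ m)%g x) - m%:R * l g| <= C.

Lemma wdist_isom : isom_action wd a.
Proof. by split=> //; apply: wdist_act. Qed.

(* The translation lengths are read off the tree spanned by [W]. *)
Lemma slope_ex : exists l, is_slope l.
Proof.
suff /choice[l hl] : forall g, exists lg : R, forall x, exists C, forall m,
    `|wd x (a (g ^+ m)%g x) - m%:R * lg| <= C.
  by exists l => g x; apply: hl.
move=> g; have Hs := span_zh wdist_zh base.
have As := span_isom wdist_zh base wdist_isom.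
have [z hz] := translation_axis Hs As (@span_geodesic _ _ _ wdist_zh base)
  (span_pt wdist_zh base base) g.
pose lg := @mdist R (span wdist_zh base) z (span_act wdist_isom g z).
exists lg => x.
have az : asym (@mdist R (span wdist_zh base)) (span_act wdist_isom) z g lg.
  by exists 0 => m; rewrite hz subrr normr0.
have [C hC] := asym_base Hs As (span_pt wdist_zh base x) az.
by exists C => m; have := hC m; rewrite span_act_pt span_dist.
Qed.

End One.

Section Cat.
Variables (N M : nat) (H : 'I_N -> set W) (K : 'I_M -> set W).

Definition cat_fam (T : Type) (f : 'I_N -> T) (g : 'I_M -> T) (i : 'I_(N + M)) : T :=
  match fintype.split i with inl j => f j | inr j => g j end.

Lemma cat_faml (T : Type) (f : 'I_N -> T) (g : 'I_M -> T) i : cat_fam f g (lshift M i) = f i.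
Proof. by rewrite /cat_fam (unsplitK (inl i)). Qed.

Lemma cat_famr (T : Type) (f : 'I_N -> T) (g : 'I_M -> T) i : cat_fam f g (rshift N i) = g i.
Proof. by rewrite /cat_fam (unsplitK (inr i)). Qed.

Lemma sepw_eq N1 N2 (H1 : 'I_N1 -> set W) (H2 : 'I_N2 -> set W) i j :
  H1 i = H2 j -> forall x y, sepw a H1 x y i =1 sepw a H2 x y j.
Proof. by move=> e x y g; rewrite /sepw /sepb /hs /= e. Qed.

Lemma hs_eqfam N1 N2 (H1 : 'I_N1 -> set W) (H2 : 'I_N2 -> set W) i j g b :
  H1 i = H2 j -> hs a H1 (g, i, b) = hs a H2 (g, j, b).
Proof. by move=> e; rewrite /hs /= e. Qed.

Lemma essential_eqfam N1 N2 (H1 : 'I_N1 -> set W) (H2 : 'I_N2 -> set W) i j :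
  H1 i = H2 j -> essential a H1 (1%g, i, true) <-> essential a H2 (1%g, j, true).
Proof. by move=> e; rewrite /essential /hat /emul /opp /hs /= e. Qed.

Lemma wdist_cat (om : 'I_N -> R) (om' : 'I_M -> R) x y : wdist a (cat_fam H K) (cat_fam om om') x y =
  wdist a H om x y + wdist a K om' x y.
Proof.
rewrite /wdist big_split_ord /=; congr (_ + _); apply: eq_bigr => i _.
  rewrite cat_faml; congr (_ * _%:R); apply: eq_fcount; apply: sepw_eq; exact: cat_faml.
rewrite cat_famr; congr (_ * _%:R); apply: eq_fcount; apply: sepw_eq; exact: cat_famr.
Qed.

Definition essential_weight N1 (H1 : 'I_N1 -> set W) (om : 'I_N1 -> R) : R :=
  \sum_(i < N1 | `[< essential a H1 (1%g, i, true) >]) om i.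

Lemma essential_weight_cat (om : 'I_N -> R) (om' : 'I_M -> R) : essential_weight (cat_fam H K) (cat_fam om om') =
  essential_weight H om + essential_weight K om'.
Proof.
rewrite /essential_weight big_split_ord /=.
by congr (_ + _); apply: eq_big => i; rewrite ?cat_faml ?cat_famr //;
  apply: asbool_equiv_eq; apply: essential_eqfam; rewrite ?cat_faml ?cat_famr.
Qed.

Lemma wall_sys_cat : wall_sys H -> wall_sys K ->
  (forall e f, [\/ hs a H e `<=` hs a K f, hs a H e `<=` hs a K (opp f),
    hs a H (opp e) `<=` hs a K f | hs a H (opp e) `<=` hs a K (opp f)]) ->
  wall_sys (cat_fam H K).
Proof.
move=> SH SK HK; have KH e f : [\/ hs a K e `<=` hs a H f, hs a K e `<=` hs a H (opp f),
    hs a K (opp e) `<=` hs a H f | hs a K (opp e) `<=` hs a H (opp f)].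
  have [h|h|h|h] := HK f e.
  - by constructor 4 => z /hs_opp n; apply/hs_opp => /h.
  - by constructor 2 => z hz; apply/hs_opp => /h /hs_opp.
  - by constructor 3 => z /hs_opp n; apply: contrapT => m; apply/n/h/hs_opp.
  - by constructor 1 => z hz; apply: contrapT => m; have /hs_opp := h z ((hs_opp a H f z).2 m).
have caseL g i b : hs a (cat_fam H K) (g, lshift M i, b) = hs a H (g, i, b).
  by apply: hs_eqfam; rewrite cat_faml.
have caseR g i b : hs a (cat_fam H K) (g, rshift N i, b) = hs a K (g, i, b).
  by apply: hs_eqfam; rewrite cat_famr.
split.
- move=> x y i; case: (split_ordP i) => j ->.
    have -> : [set g | sepw a (cat_fam H K) x y (lshift M j) g] = [set g | sepw a H x y j g].
      by apply/seteqP; split=> g /=; rewrite (@sepw_eq _ _ (cat_fam H K) H _ j) // cat_faml.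
    exact: sys_fin SH _ _ _.
  have -> : [set g | sepw a (cat_fam H K) x y (rshift N j) g] = [set g | sepw a K x y j g].
    by apply/seteqP; split=> g /=; rewrite (@sepw_eq _ _ (cat_fam H K) K _ j) // cat_famr.
  exact: sys_fin SK _ _ _.
- move=> [[g i] b] [[h j] c]; case: (split_ordP i) => i' ->; case: (split_ordP j) => j' ->;
  rewrite /opp /= ?caseL ?caseR.
  + exact: (sys_nest SH (g, i', b) (h, j', c)).
  + exact: (HK (g, i', b) (h, j', c)).
  + exact: (KH (g, i', b) (h, j', c)).
  + exact: (sys_nest SK (g, i', b) (h, j', c)).
- move=> i; case: (split_ordP i) => j ->.
    have [x [y [h1 h2 u]]] := sys_wit SH j; exists x, y; rewrite cat_faml; split=> // g hg.
    by apply: u; rewrite -(@sepw_eq _ _ (cat_fam H K) H (lshift M j) j) // cat_faml.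
  have [x [y [h1 h2 u]]] := sys_wit SK j; exists x, y; rewrite cat_famr; split=> // g hg.
  by apply: u; rewrite -(@sepw_eq _ _ (cat_fam H K) K (rshift N j) j) // cat_famr.
Qed.

End Cat.

Lemma wall_sys_comp N M (H : 'I_N -> set W) (s : 'I_M -> 'I_N) : wall_sys H -> wall_sys (H \o s).
Proof.
move=> S; split.
- by move=> x y i; apply: sys_fin S x y (s i).
- move=> [[g i] b] [[h j] c]; exact: (sys_nest S (g, s i, b) (h, s j, c)).
- by move=> i; apply: sys_wit S (s i).
Qed.

End WallSystems.

Section Enum.
Variables (R : realType) (G : groupType) (W : choiceType) (a : G -> W -> W).
Variables (N : nat) (H : 'I_N -> set W) (om : 'I_N -> R) (P : pred 'I_N).
Hypothesis z0 : forall i, ~~ P i -> om i = 0.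
Let s (j : 'I_#|P|) : 'I_N := enum_val j.

Lemma wdist_enum : wdist a (H \o s) (om \o s) = wdist a H om.
Proof.
apply/funext => y; apply/funext => z.
rewrite /wdist [RHS](bigID P) /= [X in _ = _ + X]big1 ?addr0; last by move=> i /z0 ->; rewrite mul0r.
transitivity (\sum_(i in P) om i * (fcount (sepw a H y z i))%:R); last by [].
by apply/esym; rewrite big_enum_val; apply: eq_bigr.
Qed.

Lemma essential_weight_enum : essential_weight a (H \o s) (om \o s) = essential_weight a H om.
Proof.
rewrite /essential_weight [RHS]big_mkcond (bigID P) /= [X in _ = _ + X]big1 ?addr0; last first.
  by move=> i /z0 ->; case: ifP.
transitivity (\sum_(i in P) (if `[< essential a H (1%g, i, true) >] then om i else 0)); last by [].
by rewrite [RHS]big_enum_val [LHS]big_mkcond.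
Qed.

End Enum.

Section Realize0.
Variables (R : realType) (p k : nat) (Gi : 'I_p -> groupType) (G : groupType)
  (iota : forall i, {multiplicative Gi i -> G}) (x : 'I_k -> G).
Hypothesis hG : is_free_product iota x.
Hypothesis hGi : forall i : 'I_p, exists a : Gi i, a <> 1%g.
Variable T0 : gtree R G.
Hypothesis HT0 : in_outer iota T0.
Hypothesis edge0 : exists u v, adjq (@mdist R T0) (@vertices R T0) u v.
Variables (W : choiceType) (base : W) (a : G -> W -> W).
Hypothesis a1 : forall x, a 1%g x = x.
Hypothesis aM : forall g h x, a (g * h)%g x = a g (a h x).

(** Indices of weight 0 are dropped first, because the realization needs positive weights. *)
Lemma realize_state N (H : 'I_N -> set W) (om : 'I_N -> R) (l : G -> R) :
  wall_sys a H -> (forall i, 0 <= om i) -> is_slope a H om l ->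
  (forall g, l g = 0 <-> translation_length T0 g = 0) ->
  0 < essential_weight a H om /\ exists T : gtree R G, [/\ in_outer iota T,
    forall g, translation_length T g = l g & covolume T = (essential_weight a H om)%:E].
Proof.
move=> S om0 hl ell.
pose P := [pred i | 0 < om i].
pose s (j : 'I_#|P|) : 'I_N := enum_val j.
have S' := wall_sys_comp s S.
have omp j : 0 < om (s j) by have := enum_valP j.
have z0 i : ~~ P i -> om i = 0 by rewrite -leNgt => h; apply/eqP; rewrite eq_le h om0.
have hl' g y : exists C, forall m, `|wdist a (H \o s) (om \o s) y (a (g ^+ m)%g y) - m%:R * l g| <= C.
  by have [C hC] := hl g y; exists C => m; rewrite (wdist_enum a H z0).
have [i hi] := essential_ex HT0 edge0 base a1 aM (sys_nest S') (sys_wit S') omp hl' ell.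
split.
  rewrite -(essential_weight_enum a H z0) /essential_weight (bigD1 i) /=; last exact/asboolP.
  by apply: ltr_pwDl => //; apply: sumr_ge0 => j _; apply: ltW.
have [T [h1 h2 h3]] := realize hG hGi HT0 edge0 base a1 aM (sys_fin S') (sys_nest S') (sys_wit S') omp hl' ell.
by exists T; split=> //; rewrite h3 -(essential_weight_enum a H z0).
Qed.

End Realize0.


(** * Paths of realizable length functions *)

Section Conn.
Variables (R : realType) (p k : nat) (Gi : 'I_p -> groupType) (G : groupType)
  (iota : forall i, {multiplicative Gi i -> G}) (x : 'I_k -> G).

(* A path of length functions and covolumes realized, at every scale, by points of outer space. *)
Record conn (l0 : G -> R) (v0 : R) (l1 : G -> R) (v1 : R) : Prop := Conn {
  conn_path : exists (L : R -> G -> R) (V : R -> R),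
    [/\ [/\ forall g, continuous (fun t => L t g) & continuous V],
      L 0 = l0, V 0 = v0, L 1 = l1 & V 1 = v1] /\
    [/\ forall (s t : R) g, 0 <= s -> s <= t -> t <= 1 -> L t g <= L s g &
      forall t c : R, 0 <= t -> t <= 1 -> 0 < c -> 0 < V t /\ exists T : gtree R G,
        [/\ in_outer iota T, forall g, translation_length T g = c * L t g &
          covolume T = (c * V t)%:E]] }.

Definition clamp (t : R) : R := Num.max 0 (Num.min 1 t).

Lemma clamp_continuous : continuous clamp.
Proof.
move=> t; apply: continuous_max; first exact: cvg_cst.
by apply: continuous_min; [exact: cvg_cst|exact: cvg_id].
Qed.

Lemma clampE t : 0 <= t -> t <= 1 -> clamp t = t.
Proof. by move=> h1 h2; rewrite /clamp min_r // max_r. Qed.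

Lemma clamp0 t : t <= 0 -> clamp t = 0.
Proof. by move=> h; rewrite /clamp min_r ?max_l //; lra. Qed.

Lemma clamp1 t : 1 <= t -> clamp t = 1.
Proof. by move=> h; rewrite /clamp min_l // max_r. Qed.

Lemma conn_trans l0 v0 l1 v1 l2 v2 : conn l0 v0 l1 v1 -> conn l1 v1 l2 v2 -> conn l0 v0 l2 v2.
Proof.
move=> [[L [V [[[cL cV] L0 V0 L1 V1] [mL rL]]]]] [[L' [V' [[[cL' cV'] L0' V0' L1' V1'] [mL' rL']]]]].
split.
pose u (t : R) := clamp (2 * t); pose v (t : R) := clamp (2 * t - 1).
have cu : continuous u.
  move=> t; have c2 : {for t, continuous (fun t : R => 2 * t)} by apply: cvgM; [exact: cvg_cst|exact: cvg_id].
  exact: (continuous_comp c2 (@clamp_continuous _)).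
have cv : continuous v.
  move=> t; have c2 : {for t, continuous (fun t : R => 2 * t - 1)}.
    by apply: cvgB; [apply: cvgM; [exact: cvg_cst|exact: cvg_id]|exact: cvg_cst].
  exact: (continuous_comp c2 (@clamp_continuous _)).
(* The clamped parameter of the inactive half is constant, so subtracting the middle value glues the
   two paths by a single formula whose continuity needs no case distinction. *)
pose LL t g := L (u t) g + L' (v t) g - l1 g.
pose VV t := V (u t) + V' (v t) - v1.
have low t : t <= 1 / 2 -> v t = 0 by move=> h; apply: clamp0; lra.
have high t : 1 / 2 <= t -> u t = 1 by move=> h; apply: clamp1; lra.
have ulow t : 0 <= t -> t <= 1 / 2 -> u t = 2 * t by move=> *; apply: clampE; lra.
have vhigh t : 1 / 2 <= t -> t <= 1 -> v t = 2 * t - 1 by move=> *; apply: clampE; lra.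
have LLlow t : t <= 1 / 2 -> LL t = L (u t).
  by move=> h; apply/funext => g; rewrite /LL low // L0' addrK.
have LLhigh t : 1 / 2 <= t -> LL t = L' (v t).
  by move=> h; apply/funext => g; rewrite /LL high // L1 addrC addKr.
have VVlow t : t <= 1 / 2 -> VV t = V (u t) by move=> h; rewrite /VV low // V0' addrK.
have VVhigh t : 1 / 2 <= t -> VV t = V' (v t) by move=> h; rewrite /VV high // V1 addrC addKr.
have h0 : (0 : R) <= 1 / 2 by lra.
have h1 : (1 / 2 : R) <= 1 by lra.
exists LL, VV; split; split.
- split=> [g|] t.
    apply: cvgB; last exact: cvg_cst.
    by apply: cvgD; [exact: (continuous_comp (cu t) (cL g _))|exact: (continuous_comp (cv t) (cL' g _))].
  apply: cvgB; last exact: cvg_cst.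
  by apply: cvgD; [exact: (continuous_comp (cu t) (cV _))|exact: (continuous_comp (cv t) (cV' _))].
- by rewrite LLlow // ulow // mulr0.
- by rewrite VVlow // ulow // mulr0.
- by rewrite LLhigh // vhigh // -L1'; congr L'; lra.
- by rewrite VVhigh // vhigh // -V1'; congr V'; lra.
- move=> s t g s0 st t1; have [hs|hs] := leP s (1 / 2); have [ht|ht] := leP t (1 / 2).
  + by rewrite !LLlow // !ulow //; first apply: mL; lra.
  + have ht' := ltW ht; rewrite (LLlow s) // (LLhigh t) // ulow // vhigh //; apply: (@le_trans _ _ (l1 g)).
      by rewrite -L0'; apply: mL'; lra.
    by rewrite -L1; apply: mL; lra.
  + by have := lt_le_trans hs (le_trans st ht); rewrite ltxx.
  + by have hs' := ltW hs; have ht' := ltW ht; rewrite !LLhigh // !vhigh //; first apply: mL'; lra.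
move=> t c t0 t1 c0; have [ht|ht] := leP t (1 / 2).
  by rewrite LLlow // VVlow // ulow //; apply: rL => //; lra.
by have ht' := ltW ht; rewrite LLhigh // VVhigh // vhigh //; apply: rL' => //; lra.
Qed.

Hypothesis hG : is_free_product iota x.
Hypothesis hGi : forall i : 'I_p, exists a : Gi i, a <> 1%g.
Variable T0 : gtree R G.
Hypothesis HT0 : in_outer iota T0.
Hypothesis edge0 : exists u v, adjq (@mdist R T0) (@vertices R T0) u v.
Variables (W : choiceType) (base : W) (a : G -> W -> W).
Hypothesis a1 : forall x, a 1%g x = x.
Hypothesis aM : forall g h x, a (g * h)%g x = a g (a h x).

Lemma is_slope_scale N (H : 'I_N -> set W) (om : 'I_N -> R) l (c : R) :
  is_slope a H om l -> is_slope a H (fun i => c * om i) (fun g => c * l g).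
Proof.
move=> h g y; have [C hC] := h g y; exists (`|c| * C) => m.
have -> : wdist a H (fun i => c * om i) y (a (g ^+ m)%g y) = c * wdist a H om y (a (g ^+ m)%g y).
  by rewrite /wdist mulr_sumr; apply: eq_bigr => i _; rewrite mulrA.
rewrite mulrCA -mulrBr normrM; apply: ler_wpM2l => //; exact: hC.
Qed.

Lemma is_slope_cat N M (H : 'I_N -> set W) (K : 'I_M -> set W) (om : 'I_N -> R)
    (om' : 'I_M -> R) (l l' : G -> R) :
  is_slope a H om l -> is_slope a K om' l' ->
  is_slope a (cat_fam H K) (cat_fam om om') (fun g => l g + l' g).
Proof.
move=> h h' g y; have [C hC] := h g y; have [C' hC'] := h' g y; exists (C + C') => m.
have := hC m; have := hC' m; rewrite wdist_cat !ler_norml mulrDr => /andP[? ?] /andP[? ?].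
by apply/andP; split; lra.
Qed.

Lemma essential_weight_scale N (H : 'I_N -> set W) (om : 'I_N -> R) (c : R) :
  essential_weight a H (fun i => c * om i) = c * essential_weight a H om.
Proof. by rewrite /essential_weight mulr_sumr. Qed.

(** The two systems are listed in one family with weights (1-t) om and t om'. Joint nestedness makes
    all intermediate weights realizable, and lengths and essential weights are affine in t. *)
Lemma conn_interpolation N M (H : 'I_N -> set W) (K : 'I_M -> set W) (om : 'I_N -> R)
    (om' : 'I_M -> R) (l l' : G -> R) :
  wall_sys a (cat_fam H K) -> (forall i, 0 <= om i) -> (forall i, 0 <= om' i) ->
  is_slope a H om l -> is_slope a K om' l' ->
  (forall g, 0 <= l' g) -> (forall g, l' g <= l g) ->
  (forall g, l g = 0 <-> translation_length T0 g = 0) ->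
  (forall g, l' g = 0 <-> translation_length T0 g = 0) ->
  conn l (essential_weight a H om) l' (essential_weight a K om').
Proof.
move=> S om0 om0' hl hl' l0 ll ell ell'; split.
exists (fun t g => (1 - t) * l g + t * l' g),
  (fun t => (1 - t) * essential_weight a H om + t * essential_weight a K om').
have aff (u v : R) : continuous (fun t : R => (1 - t) * u + t * v).
  move=> t; apply: cvgD; apply: cvgM; [|exact: cvg_cst|exact: cvg_id|exact: cvg_cst].
  by apply: cvgB; [exact: cvg_cst|exact: cvg_id].
split; split.
- by split=> [g|]; apply: aff.
- by apply/funext => g; rewrite subr0 mul1r mul0r addr0.
- by rewrite subr0 mul1r mul0r addr0.
- by apply/funext => g; rewrite subrr mul1r mul0r add0r.
- by rewrite subrr mul1r mul0r add0r.
- move=> s t g s0 st t1; rewrite -subr_ge0.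
  have -> : (1 - s) * l g + s * l' g - ((1 - t) * l g + t * l' g) = (t - s) * (l g - l' g) by ring.
  by apply: mulr_ge0; rewrite subr_ge0.
move=> t c t0 t1 c0.
pose omt d := cat_fam (fun i => (d * (1 - t)) * om i) (fun j => (d * t) * om' j).
have omt0 d i : 0 < d -> 0 <= omt d i.
  move=> d0; rewrite /omt /cat_fam; case: fintype.split => j; apply: mulr_ge0 => //;
  by apply: mulr_ge0; lra.
have slope d : is_slope a (cat_fam H K) (omt d) (fun g => d * ((1 - t) * l g + t * l' g)).
  have := is_slope_cat (is_slope_scale (d * (1 - t)) hl) (is_slope_scale (d * t) hl').
  rewrite (_ : (fun g => _ + _) = (fun g => d * ((1 - t) * l g + t * l' g))) //.
  by apply/funext => g; ring.
have ellt d g : 0 < d -> d * ((1 - t) * l g + t * l' g) = 0 <-> translation_length T0 g = 0.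
  move=> d0; split=> [|h]; last by rewrite (ell g).2 // (ell' g).2 // !mulr0 addr0 mulr0.
  move/eqP; rewrite mulf_eq0 gt_eqF //= => /eqP h; apply/ell'; apply/eqP.
  rewrite eq_le l0 andbT; have := ll g; have := l0 g; have := h.
  have := mulr_ge0 t0 (l0 g); have t1' : 0 <= 1 - t by lra.
  have := mulr_ge0 t1' (le_trans (l0 g) (ll g)).
  have := mulr_ge0 t1' (l0 g); move=> h1 h2 h3 h4 h5 h6.
  have : (1 - t) * l' g <= (1 - t) * l g by apply: ler_wpM2l.
  rewrite mulrBl mul1r; lra.
have ew d : essential_weight a (cat_fam H K) (omt d) =
    d * ((1 - t) * essential_weight a H om + t * essential_weight a K om').
  by rewrite essential_weight_cat !essential_weight_scale; ring.
split.
  have [] := realize_state hG hGi HT0 edge0 base a1 aM S (fun i => omt0 1 i ltr01) (slope 1) (fun g => ellt 1 g ltr01).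
  by rewrite ew mul1r.
have [_ [T hT]] := realize_state hG hGi HT0 edge0 base a1 aM S (fun i => omt0 c i c0) (slope c) (fun g => ellt c g c0).
by exists T; rewrite -ew.
Qed.

End Conn.

(** * Folding *)

Section Nested.
Variable W : Type.
Implicit Types A B : set W.

Definition nested A B := [\/ A `<=` B, A `<=` ~` B, ~` A `<=` B | ~` A `<=` ~` B].

Lemma nestedCl A B : nested A B -> nested (~` A) B.
Proof. by case=> h; [constructor 3|constructor 4|constructor 1|constructor 2]; rewrite ?setCK. Qed.

Lemma nestedC A B : nested A B -> nested B A.
Proof.
case=> h.
- by constructor 4 => z nb /h.
- by constructor 2 => z hb /h.
- by constructor 3 => z nb; apply: contrapT => /h.
- by constructor 1 => z hb; apply: contrapT => /h.
Qed.

Lemma nestedCr A B : nested A B -> nested A (~` B).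
Proof. by move=> /nestedC /nestedCl /nestedC. Qed.

Lemma nested_refl A : nested A A.
Proof. by constructor 1. Qed.

Lemma nested_quadrants A B x y z t : nested A B ->
  A x -> B x -> A y -> ~ B y -> ~ A z -> B z -> ~ A t -> ~ B t -> False.
Proof. by move=> [] h ax bx ay nby naz bz nat nbt; [apply: nby|case: (h x)|apply: nbt|case: (h z)]; auto. Qed.

Lemma nested_part (U V K : set W) : nested U K -> K `<=` V ->
  [\/ nested U V, U `<=` ~` K | K `<=` U].
Proof.
case=> h KV.
- by constructor 1; constructor 1; apply: subset_trans KV.
- by constructor 2.
- by constructor 1; constructor 3; apply: subset_trans KV.
- by constructor 3 => z kz; apply: contrapT => /h.
Qed.

(** Unless the unions are nested for a simple reason, each piece lies inside the other union or is
    disjoint from it; the mixed configurations force a piece of one union to equal a piece of the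
    other. *)
Lemma nested_union (J1 J2 K1 K2 : set W) : J1 <> K1 -> J2 <> K1 -> J1 <> K2 -> J2 <> K2 ->
  nested (J1 `|` J2) K1 -> nested (J1 `|` J2) K2 -> nested (K1 `|` K2) J1 -> nested (K1 `|` K2) J2 ->
  nested (J1 `|` J2) (K1 `|` K2).
Proof.
have crossed A1 A2 B1 B2 : B1 `<=` A1 `|` A2 -> A1 `|` A2 `<=` ~` B2 ->
    A1 `<=` B1 `|` B2 -> B1 `|` B2 `<=` ~` A2 -> A1 = B1.
  move=> h1 h2 h3 h4; apply/seteqP; split=> z hz.
    by case: (h3 z hz) => // /(h2 z (or_introl hz)).
  by case: (h1 z hz) => // /(h4 z (or_introl hz)).
move=> n1 n2 n3 n4 N1 N2 M1 M2.
set U := J1 `|` J2 in N1 N2 *; set V := K1 `|` K2 in M1 M2 *.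
have UC : J2 `|` J1 = U by rewrite setUC.
have VC : K2 `|` K1 = V by rewrite setUC.
have [//|a1|a1] := nested_part N1 (@subsetUl _ K1 K2);
have [//|a2|a2] := nested_part N2 (@subsetUr _ K1 K2).
- by constructor 2 => z uz [/(a1 z uz)|/(a2 z uz)].
- have [/nestedC//|b1|b1] := nested_part M1 (@subsetUl _ J1 J2);
  have [/nestedC//|b2|b2] := nested_part M2 (@subsetUr _ J1 J2).
  + by constructor 2 => z [/(contraPnot (b1 z))|/(contraPnot (b2 z))].
  + by case: n4; apply: (crossed J2 J1 K2 K1); rewrite ?UC ?VC.
  + by case: n3; apply: (crossed J1 J2 K2 K1); rewrite ?UC ?VC.
  + by constructor 1 => z [/b1|/b2].
- have [/nestedC//|b1|b1] := nested_part M1 (@subsetUl _ J1 J2);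
  have [/nestedC//|b2|b2] := nested_part M2 (@subsetUr _ J1 J2).
  + by constructor 2 => z [/(contraPnot (b1 z))|/(contraPnot (b2 z))].
  + by case: n2; apply: (crossed J2 J1 K1 K2); rewrite ?UC ?VC.
  + by case: n1; apply: (crossed J1 J2 K1 K2); rewrite ?UC ?VC.
  + by constructor 1 => z [/b1|/b2].
- by apply: nestedC; constructor 1 => z [/a1|/a2].
Qed.

End Nested.

Section Fold.
Variables (G : groupType) (W : choiceType) (base : W) (a : G -> W -> W).
Hypothesis a1 : forall x, a 1%g x = x.
Hypothesis aM : forall g h x, a (g * h)%g x = a g (a h x).
Variables (M : nat) (P : 'I_M -> set W).
Hypothesis Pnest : forall e f, nested (hs a P e) (hs a P f).
Variable N : nat.
Implicit Types (H : 'I_N -> set W) (act : {set 'I_N}) (lab : 'I_N -> 'I_M).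

Definition ind (A : set W) (z : W) : int := `[< A z >]%:R.

(* Up to additive constants, the indicator of [P m] is the sum of those of the active half-spaces
   labelled [m]; an inactive index merely repeats an active half-space. *)
Record fold_state lab H act : Prop := FoldState {
  fs_fin : forall x y i, finite_set [set g | sepw a H x y i g];
  fs_nest : forall e f, nested (hs a H e) (hs a H f);
  fs_dup : forall i, exists2 j, j \in act & H i = H j;
  fs_wit : forall i, i \in act -> exists x y, [/\ ~ H i x, H i y &
    forall e, e.1.2 \in act -> sepb a H x y e -> e.1 = (1%g, i)];
  fs_lab : forall m x y, \sum_(i in act | lab i == m) (ind (H i) x - ind (H i) y) =
    ind (P m) x - ind (P m) y }.

Lemma indT A z : A z -> ind A z = 1.
Proof. by move=> h; rewrite /ind asboolT. Qed.

Lemma indF A z : ~ A z -> ind A z = 0.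
Proof. by move=> h; rewrite /ind asboolF. Qed.

Lemma ind_ge0 A z : 0 <= ind A z <= 1.
Proof. by rewrite /ind; case: `[< _ >]. Qed.

Lemma ind_inj A z B t : ind A z = ind B t -> A z <-> B t.
Proof. by rewrite /ind; case: asboolP => h1; case: asboolP => h2. Qed.

Lemma hs_oppE K (H : 'I_K -> set W) e : hs a H (opp e) = ~` hs a H e.
Proof. by apply/seteqP; split=> z /= /hs_opp. Qed.

Lemma sepbP K (H : 'I_K -> set W) x y e : reflect (hs a H e x <-> hs a H e y) (~~ sepb a H x y e).
Proof.
rewrite /sepb; apply: (iffP idP) => [|[h1 h2]].
  by case: asboolP => h1; case: asboolP => h2.
by case: asboolP => h3; case: asboolP => h4 //; exfalso; auto.
Qed.

Lemma sepb_true K (H : 'I_K -> set W) x y g i b : sepb a H x y (g, i, b) = sepb a H x y (g, i, true).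
Proof. by case: b => //; rewrite -sepb_opp. Qed.

Lemma hs1 K (H : 'I_K -> set W) i : hs a H (1%g, i, true) = H i.
Proof. by apply/funext => z; rewrite /hs /= invg1 a1. Qed.

Section State.
Variables (lab : 'I_N -> 'I_M) (H : 'I_N -> set W) (act : {set 'I_N}).
Hypothesis S : fold_state lab H act.
Local Notation ws := (hs a H).

Lemma fold_wall_sys : wall_sys a H.
Proof.
split; first exact: fs_fin S.
  move=> e f; rewrite !hs_oppE; exact: fs_nest S e f.
move=> i; have [j ja e] := fs_dup S i; have [x [y [h1 h2 u]]] := fs_wit S ja.
exists x, y; rewrite e; split=> // g hg.
have := u (g, j, true) ja; rewrite (_ : sepb _ _ _ _ _ = true) => [/(_ isT)[]//|].
by move: hg; rewrite /sepw /sepb /hs /= e.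
Qed.

(** The edge of the half-space seen on the ground set: [z] inside and [o] outside, with no other
    active wall between them. Thus [o] marks the outer endpoint of the edge. *)
Definition outer_pt i b (z o : W) : Prop := [/\ ws (1%g, i, b) z, ~ ws (1%g, i, b) o &
  forall e, e.1.2 \in act -> sepb a H z o e -> e.1 = (1%g, i)].

Lemma outer_pt_ex i b : i \in act -> exists z o, outer_pt i b z o.
Proof.
move=> ia; have [x [y [h1 h2 u]]] := fs_wit S ia.
case: b; [exists y, x|exists x, y]; split.
- by rewrite hs1.
- by rewrite hs1.
- by move=> e ea; rewrite /sepb addbC; apply: u.
- by apply/(hs_opp a H (1%g, i, true)); rewrite hs1.
- by move/(hs_opp a H (1%g, i, true)); rewrite hs1; apply.
- exact: u.
Qed.

Lemma outer_unsep i b z o e : outer_pt i b z o -> e.1.2 \in act -> e.1 <> (1%g, i) ->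
  ws e z <-> ws e o.
Proof. by move=> [_ _ u] ea ne; apply/sepbP/negP => /(u _ ea). Qed.

Lemma lab_translate g m x y : \sum_(i in act | lab i == m)
   (ind (ws (g, i, true)) x - ind (ws (g, i, true)) y) =
  ind (hs a P (g, m, true)) x - ind (hs a P (g, m, true)) y.
Proof. by rewrite /ind /hs /= -[RHS](fs_lab S). Qed.

Lemma outer_lab_neq i b z o g m : outer_pt i b z o -> (g, m) <> (1%g, lab i) ->
  hs a P (g, m, true) z <-> hs a P (g, m, true) o.
Proof.
move=> ho ne; apply: ind_inj; apply/eqP; rewrite -subr_eq0 -lab_translate; apply/eqP.
apply: big1 => j /andP[ja /eqP jm]; have := @outer_unsep i b z o (g, j, true) ho ja.
case; first by move=> [e1 e2]; apply: ne; rewrite -jm e1 e2.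
move=> h1 h2; apply/eqP; rewrite subr_eq0; apply/eqP; congr (_%:R : int).
by congr (nat_of_bool _); apply: asbool_equiv_eq.
Qed.

Lemma outer_lab i b z o : i \in act -> outer_pt i b z o ->
  hs a P (1%g, lab i, b) z /\ ~ hs a P (1%g, lab i, b) o.
Proof.
move=> ia ho; have := lab_translate 1%g (lab i) z o.
rewrite (bigD1 i) ?ia ?eqxx //= big1 ?addr0; last first.
  move=> j /andP[/andP[ja _] ji]; have := @outer_unsep i b z o (1%g, j, true) ho ja.
  case; first by move=> [e1]; move/eqP: ji.
  move=> h1 h2; apply/eqP; rewrite subr_eq0; apply/eqP; congr (_%:R : int).
  by congr (nat_of_bool _); apply: asbool_equiv_eq.
have [h1 h2 _] := ho; case: b h1 h2 {ho} => h1 h2.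
  rewrite indT // indF // subr0; rewrite /ind; case: asboolP => h3; case: asboolP => h4 //.
move/(hs_opp a H (1%g, i, true)): h1 => h1; have {}h2 : ws (1%g, i, true) o.
  by apply: contrapT => /(hs_opp a H (1%g, i, true)).
rewrite indF // indT //; rewrite /ind; case: asboolP => h3; case: asboolP => h4 // _.
by split; [apply/(hs_opp a P (1%g, lab i, true))|move/(hs_opp a P (1%g, lab i, true))].
Qed.

(** In the target both outer points go to the outer end of the edge with the common label. Another
    target wall separating them would separate the inner points too, and so cross the wall of that
    edge. *)
Lemma pinch_unsep i j b z1 o1 z2 o2 : i \in act -> j \in act -> lab i = lab j ->
  outer_pt i b z1 o1 -> outer_pt j b z2 o2 ->
  forall g m, hs a P (g, m, true) o1 <-> hs a P (g, m, true) o2.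
Proof.
move=> ia ja ij h1 h2 g m; have [p1 q1] := outer_lab ia h1; have [p2 q2] := outer_lab ja h2.
have [e|ne] := pselect ((g, m) = (1%g, lab i)).
  case: e => -> ->; rewrite -ij in p2 q2; case: b h1 h2 p1 q1 p2 q2 => h1 h2 p1 q1 p2 q2; first by split.
  move: q1 q2; rewrite !(hs_opp a P (1%g, lab i, true)) => q1 q2.
  by split=> _; apply: contrapT.
have s1 := outer_lab_neq h1 ne; rewrite ij in ne; have s2 := outer_lab_neq h2 ne.
rewrite -ij in p2 q2.
have N1 := Pnest (1%g, lab i, b) (g, m, true).
split=> h; apply: contrapT => h'.
  apply: (nested_quadrants N1 p1 (s1.2 h) p2 _ q1 h q2 h').
  by move/s2.1.
apply: (nested_quadrants N1 p2 (s2.2 h) p1 _ q2 h q1 h').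
by move/s1.1.
Qed.

Definition wall_count x y := (\sum_(i in act) fcount (sepw a H x y i))%N.

Lemma wall_count_act g x y : wall_count (a g x) (a g y) = wall_count x y.
Proof.
apply: eq_bigr => i _.
rewrite -[RHS](@fcount_bij _ _ _ (fun h => g^-1 * h)%g (fun h => g * h)%g); first last.
- exact: (fs_fin S).
- by move=> h; rewrite mulgA mulVg mul1g.
- by move=> h; rewrite mulgA mulgV mul1g.
apply: eq_fcount => h; rewrite /sepw.
have -> : (h, i, true) = emul g ((g^-1 * h)%g, i, true) by rewrite /emul /= mulgA mulgV mul1g.
by rewrite (sepb_emul aM) -!aM mulVg !a1.
Qed.

Lemma wall_count_lt x y x' y' i : i \in act ->
  (forall e, e.1.2 \in act -> sepb a H x' y' e -> sepb a H x y e) ->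
  sepb a H x y (1%g, i, true) -> ~ sepb a H x' y' (1%g, i, true) ->
  (wall_count x' y' < wall_count x y)%N.
Proof.
move=> ia h s n; rewrite /wall_count (bigD1 i) //= [X in (_ < X)%N](bigD1 i) //=.
rewrite -addSn; apply: leq_add.
  by apply: (fcount_lt (fs_fin S _ _ _) _ n s) => g; apply: (h (g, i, true)).
apply: leq_sum => j /andP[ja _]; apply: fcount_le; first exact: (fs_fin S).
by move=> g; apply: (h (g, j, true)).
Qed.

(** Two opposed half-spaces with the same label. When no active wall separates the outer points, the
    two edges share their outer endpoint and can be folded together. *)
Record pinch i j b z1 o1 z2 o2 : Prop := Pinch {
  pinch_act : [/\ i \in act, j \in act, i <> j & lab i = lab j];
  pinch_out1 : outer_pt i b z1 o1;
  pinch_out2 : outer_pt j b z2 o2;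
  pinch_disj : forall x, ws (1%g, i, b) x -> ~ ws (1%g, j, b) x }.

(* The two sides of a wall separating the outer points carry, by the count of labels, an
   oppositely oriented wall of the same label, which gives a closer pair. *)
Lemma pinch_closer i j b z1 o1 z2 o2 : pinch i j b z1 o1 z2 o2 ->
  (exists2 e, e.1.2 \in act & sepb a H o1 o2 e) ->
  exists i' j' b' z1' o1' z2' o2', pinch i' j' b' z1' o1' z2' o2' /\
    (wall_count o1' o2' < wall_count o1 o2)%N.
Proof.
move=> [[ia ja ij lij] h1 h2 dis] [[[g k] c] /= ka]; rewrite sepb_true => ks.
pose p1 := a g^-1%g o1; pose p2 := a g^-1%g o2.
have wp i0 b0 z : ws (g, i0, b0) z = ws (1%g, i0, b0) (a g^-1%g z).
  by rewrite /hs /= invg1 a1.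
have [k1 [k2 [ka1 ka2 lk hk]]] : exists k1 k2, [/\ k1 \in act, k2 \in act, lab k1 = lab k2 &
    [/\ H k1 p1, ~ H k1 p2, H k2 p2 & ~ H k2 p1]].
  have lz : \sum_(i0 in act | lab i0 == lab k)
     (ind (ws (g, i0, true)) o1 - ind (ws (g, i0, true)) o2) = 0.
    rewrite lab_translate; apply/eqP; rewrite subr_eq0; apply/eqP; congr (_%:R : int).
    by congr (nat_of_bool _); apply: asbool_equiv_eq; apply: (pinch_unsep ia ja lij h1 h2).
  have ex (d : int) : (d = 1 \/ d = -1) -> ind (H k) p1 - ind (H k) p2 = d ->
      exists2 k', k' \in act /\ lab k' = lab k & ind (H k') p1 - ind (H k') p2 = - d.
    move=> dd hd; apply: contrapT => nk; move: lz; rewrite (bigD1 k) ?ka ?eqxx //=.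
    have -> : ind (ws (g, k, true)) o1 - ind (ws (g, k, true)) o2 = d.
      by rewrite -hd /ind !wp !hs1.
    have : 0 <= d * \sum_(i0 < N | (i0 \in act) && (lab i0 == lab k) && (i0 != k))
        (ind (ws (g, i0, true)) o1 - ind (ws (g, i0, true)) o2).
      rewrite mulr_sumr; apply: sumr_ge0 => i0 /andP[/andP[ia0 /eqP l0] _].
      have : ind (H i0) p1 - ind (H i0) p2 <> - d by move=> e; apply: nk; exists i0.
      rewrite /ind !wp !hs1 -/p1 -/p2; case: `[< _ >]; case: `[< _ >]; case: dd => -> //=.
    by move: (\sum_(i0 < N | _) _) => s; case: dd => ->; lia.
  move: ks; rewrite /sepb !wp !hs1 -/p1 -/p2.
  case: asboolP => q1; case: asboolP => q2 // _.
    have [|k' [ka' lk'] e] := ex 1 (or_introl erefl); first by rewrite indT // indF.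
    exists k, k'; split=> //; split=> //; move: e; rewrite /ind; case: asboolP => //;
    by case: asboolP.
  have [|k' [ka' lk'] e] := ex (-1) (or_intror erefl); first by rewrite indF // indT.
  exists k', k; split=> //; split=> //; move: e; rewrite /ind; case: asboolP => //;
  by case: asboolP.
case: hk => q1 q2 q3 q4.
have [l1 [l2 [b' [la1 la2 ll [r1 r2 dis']]]]] : exists l1 l2 b', [/\ l1 \in act, l2 \in act, lab l1 = lab l2 &
    [/\ ws (1%g, l1, b') p1, ws (1%g, l2, b') p2 & forall x, ws (1%g, l1, b') x -> ~ ws (1%g, l2, b') x]].
  have := fs_nest S (1%g, k1, true) (1%g, k2, true); rewrite !hs1; case=> h.
  - by case: q4; apply: h.
  - by exists k1, k2, true; rewrite !hs1; split=> //; split=> // x /h.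
  - exists k2, k1, false; split=> //; rewrite !(hs_oppE H (1%g, _, true)) !hs1.
    by split=> // x nx; apply; apply: contrapT => /h.
  - by case: q2; apply: contrapT => /h.
have [z1' [ o1' H1]] := outer_pt_ex b' la1; have [z2' [ o2' H2]] := outer_pt_ex b' la2.
have l12 : l1 <> l2 by move=> e; apply: (dis' p1); rewrite -?e.
exists l1, l2, b', z1', o1', z2', o2'; split; first by split.
have l12' : (1%g, l2) <> (1%g, l1) :> G * 'I_N by case=> e; apply: l12.
have l21' : (1%g, l1) <> (1%g, l2) :> G * 'I_N by case.
have [u1 v1 _] := H1; have [u2 v2 _] := H2.
have v2' : ~ ws (1%g, l1, b') o2'.
  by move/(outer_unsep (e := (1%g, l1, b')) H2 la1 l21').2 => /dis'.
have v1' : ~ ws (1%g, l2, b') o1'.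
  by move/(outer_unsep (e := (1%g, l2, b')) H1 la2 l12').2 => h; apply: (dis' z1').
rewrite -(wall_count_act g^-1%g o1 o2) -/p1 -/p2.
apply: (wall_count_lt la1).
(* A wall separating the new outer points is nested with both new half-spaces, and comparing
   quadrants shows that it separates [p1] from [p2] as well. *)
- move=> e ea.
  have E i0 z : ws (1%g, i0, false) z <-> ~ ws (1%g, i0, true) z := hs_opp a H (1%g, i0, true) z.
  have one f : f.1.2 \in act -> ws f o1' -> ~ ws f o2' -> ws f p1 /\ ~ ws f p2.
    move=> fa f1 f2.
    have ne1 : f.1 <> (1%g, l1).
      case: f fa f1 f2 => -[h i0] b0 /= _ f1 f2 [eh e0]; move: f1 f2 v1 v2'; rewrite eh e0.
      by case: b0; case: (b'); rewrite ?E; tauto.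
    have ne2 : f.1 <> (1%g, l2).
      case: f fa f1 f2 {ne1} => -[h i0] b0 /= _ f1 f2 [eh e0]; move: f1 f2 v1' v2; rewrite eh e0.
      by case: b0; case: (b'); rewrite ?E; tauto.
    have f3 := (outer_unsep H1 fa ne1).2 f1.
    have f4 : ~ ws f z2' by move/(outer_unsep H2 fa ne2).1.
    split.
      apply: contrapT => f5.
      exact: (nested_quadrants (fs_nest S f (1%g, l1, b')) f3 u1 f1 v1 f5 r1 f2 v2').
    move=> f5.
    exact: (nested_quadrants (fs_nest S f (1%g, l2, b')) f5 r2 f1 v1' f4 u2 f2 v2).
  rewrite /sepb; case: asboolP => e1; case: asboolP => e2 // _.
    by have [h3 h4] := one e ea e1 e2; rewrite asboolT // asboolF.
  have [||h3 h4] := one (opp e) ea; [by apply/hs_opp|by move/hs_opp|].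
  by rewrite asboolF ?asboolT //; [apply: contrapT => /hs_opp|apply/hs_opp].
- rewrite -(sepb_true H p1 p2 1%g l1 b') /sepb asboolT // asboolF //.
  by move=> h; apply: (dis' p2).
- by rewrite -(sepb_true H o1' o2' 1%g l1 b') /sepb !asboolF.
Qed.

Lemma pinch_tight i j b z1 o1 z2 o2 : pinch i j b z1 o1 z2 o2 ->
  exists i' j' b' z1' o1' z2' o2', pinch i' j' b' z1' o1' z2' o2' /\
    forall e, e.1.2 \in act -> ws e o1' <-> ws e o2'.
Proof.
have [n] := ubnP (wall_count o1 o2); elim: n => // n ih in i j b z1 o1 z2 o2 * => hn hp.
have [ex|nx] := pselect (exists2 e, e.1.2 \in act & sepb a H o1 o2 e).
  have [i' [j' [b' [z1' [ o1' [z2' [ o2' [hp' hlt]]]]]]]] := pinch_closer hp ex.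
  by apply: (ih _ _ _ _ _ _ _ _ hp'); apply: leq_trans hlt _.
exists i, j, b, z1, o1, z2, o2; split=> // e ea; apply/sepbP/negP => h; apply: nx.
by exists e.
Qed.

(** Opposed half-spaces give a pinch at once. For nested ones the indicators of the label class
    would jump by at least 2 between [y] and [x'], while that of the label jumps by at most 1; so a
    third half-space of the class jumps back there, and it is opposed to the smaller one. *)
Lemma pinch_ex i j : i \in act -> j \in act -> i <> j -> lab i = lab j ->
  exists i' j' b' z1' o1' z2' o2', pinch i' j' b' z1' o1' z2' o2'.
Proof.
have mk k1 k2 : k1 \in act -> k2 \in act -> k1 <> k2 -> lab k1 = lab k2 ->
    H k1 `<=` ~` H k2 \/ ~` H k1 `<=` H k2 ->
    exists i' j' b' z1' o1' z2' o2', pinch i' j' b' z1' o1' z2' o2'.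
  move=> ka1 ka2 k12 lk h.
  have [b' dis'] : exists b', forall x, ws (1%g, k1, b') x -> ~ ws (1%g, k2, b') x.
    case: h => h; [exists true|exists false] => z.
      by rewrite !hs1 => /h.
    rewrite !(hs_oppE H (1%g, _, true)) !hs1 => n1; apply; exact: h.
  have [z1' [ o1' H1]] := outer_pt_ex b' ka1; have [z2' [ o2' H2]] := outer_pt_ex b' ka2.
  by exists k1, k2, b', z1', o1', z2', o2'.
have sub k1 k2 : k1 \in act -> k2 \in act -> k1 <> k2 -> lab k1 = lab k2 ->
    H k1 `<=` H k2 -> exists i' j' b' z1' o1' z2' o2', pinch i' j' b' z1' o1' z2' o2'.
  move=> ka1 ka2 k12 lk sk.
  have [x [y [hx hy ux]]] := fs_wit S ka1; have [x' [y' [hx' hy' ux']]] := fs_wit S ka2.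
  have h2y : H k2 y by apply: sk.
  have h1x' : ~ H k1 x' by move/sk.
  have [k3 [ka3 lk3 h3y h3x']] : exists k3, [/\ k3 \in act, lab k3 = lab k1, ~ H k3 y & H k3 x'].
    apply: contrapT => nk.
    have := fs_lab S (lab k1) y x'.
    rewrite (bigD1 k1) ?ka1 ?eqxx //= (bigD1 k2) ?ka2 ?lk ?eqxx //=; last first.
      by apply/eqP => e; apply: k12.
    rewrite (indT hy) (indF h1x') (indT h2y) (indF hx').
    have : 0 <= \sum_(i0 < N | (i0 \in act) && (lab i0 == lab k2) && (i0 != k1) && (i0 != k2))
        (ind (H i0) y - ind (H i0) x').
      apply: sumr_ge0 => i0 /andP[/andP[/andP[ia0 /eqP l0] _] _]; rewrite /ind.
      case: asboolP => d1; case: asboolP => d2 //.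
      by exfalso; apply: nk; exists i0; rewrite lk.
    have := ind_ge0 (P (lab k2)) y; have := ind_ge0 (P (lab k2)) x'.
    by move: (\sum_(i0 < N | _) _) => s; move: (ind _ _) (ind _ _); lia.
  apply: (mk k1 k3) => //; first by move=> e; apply: h3y; rewrite -e.
  have := fs_nest S (1%g, k1, true) (1%g, k3, true); rewrite !hs1; case=> h.
  - by case: h3y; apply: h.
  - by left.
  - by right.
  - by case: (h x').
move=> ia ja ij lij; have := fs_nest S (1%g, i, true) (1%g, j, true); rewrite !hs1; case=> h.
- exact: (sub i j).
- by apply: (mk i j) => //; left.
- by apply: (mk i j) => //; right.
- apply: (sub j i) => //; first by move=> e; apply: ij.
  by move=> z hz; apply: contrapT => /h.
Qed.

Section Merge.
Variables (i j : 'I_N) (b : bool) (z1 o1 z2 o2 : W).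
Hypothesis hp : pinch i j b z1 o1 z2 o2.
Hypothesis tight : forall e, e.1.2 \in act -> ws e o1 <-> ws e o2.

Definition joined (g : G) : set W := ws (g, i, b) `|` ws (g, j, b).
Definition kept (k : 'I_N) := [&& k \in act, k != i & k != j].
(** Every index that is not kept carries the union, so [j] and inactive indices become copies of
    [i]. For [b] false the opposed sides are complements, so the complement of their union is
    recorded and the label keeps its orientation. *)
Definition merged (k : 'I_N) : set W :=
  if kept k then H k else if b then joined 1%g else ~` joined 1%g.

Local Notation ws' := (hs a merged).

Lemma ws_pre g e : ws (emul g e) = a g^-1%g @^-1` ws e.
Proof. by apply/seteqP; split=> z; [exact: (hs_emul aM H g e z).1|exact: (hs_emul aM H g e z).2]. Qed.

Lemma joined_pre g h : joined (g * h)%g = a g^-1%g @^-1` joined h.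
Proof.
rewrite /joined -[(_, i, b)]/(emul g (h, i, b)) -[((g * h)%g, j, b)]/(emul g (h, j, b)).
by rewrite !ws_pre.
Qed.

Lemma nested_pre g A B : nested A B -> nested (a g @^-1` A) (a g @^-1` B).
Proof. by case=> h; [constructor 1|constructor 2|constructor 3|constructor 4] => z /h. Qed.

Lemma kept_hs g k c : kept k -> ws' (g, k, c) = ws (g, k, c).
Proof. by move=> h; apply: hs_eqfam; rewrite /merged h. Qed.

Lemma lost_hs g k c : ~~ kept k -> ws' (g, k, c) = if c == b then joined g else ~` joined g.
Proof.
move=> h; have E : (if b then joined g else ~` joined g) = ws' (g, k, true).
  apply/funext => z; rewrite /hs /= /merged (negbTE h).
  have -> : joined g = a g^-1%g @^-1` joined 1%g by rewrite -joined_pre mulg1.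
  by case: b.
have E' : ws' (g, k, false) = ~` ws' (g, k, true) by rewrite -hs_oppE.
by case: c; case: (b) E E' => //= <- // ->; rewrite setCK.
Qed.

Lemma merged_hs f : (exists e, ws' f = ws e) \/ (exists g, ws' f = joined g \/ ws' f = ~` joined g).
Proof.
case: f => -[g k] c; have [h|h] := boolP (kept k); first by left; exists (g, k, c); rewrite kept_hs.
by right; exists g; rewrite lost_hs //; case: eqP => _; [left|right].
Qed.

Lemma outer_eq i0 z o e : outer_pt i0 b z o -> e.1.2 \in act -> ws (1%g, i0, b) = ws e ->
  e.1 = (1%g, i0).
Proof. by move=> [h1 h2 u] ea E; apply: u => //; rewrite /sepb -E asboolT // asboolF. Qed.

(** By tightness a wall other than the two pieces has both outer points, and hence both edges, on
    one side. The half-space on that side contains both pieces, or covers everything together with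
    one of them. *)
Lemma joined1_nested e : e.1.2 \in act -> nested (joined 1%g) (ws e).
Proof.
move=> ea; have [[ia ja ij lij] h1 h2 dis] := hp.
have J1 : ws (1%g, i, b) `<=` joined 1%g by move=> ? ?; left.
have J2 : ws (1%g, j, b) `<=` joined 1%g by move=> ? ?; right.
have self k : ws (1%g, k, b) `<=` joined 1%g -> e.1 = (1%g, k) -> nested (joined 1%g) (ws e).
  case: e ea => -[g k'] c /= _ Jk [-> ->]; have [->|nc] := eqVneq c b.
    by apply: nestedC; constructor 1.
  have -> : (1%g, k, c) = opp (1%g, k, b) :> oedge G N by congr pair; case: (b) nc; case: c.
  by rewrite hs_oppE; apply/nestedCr/nestedC; constructor 1.
have [/(self i J1)//|n1] := pselect (e.1 = (1%g, i)).
have [/(self j J2)//|n2] := pselect (e.1 = (1%g, j)).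
have main f : f.1.2 \in act -> f.1 <> (1%g, i) -> f.1 <> (1%g, j) -> ws f o1 -> nested (joined 1%g) (ws f).
  move=> fa m1 m2 f1; have f2 := (tight fa).1 f1.
  have f3 := (outer_unsep h1 fa m1).2 f1; have f4 := (outer_unsep h2 fa m2).2 f2.
  have [p1 q1 _] := h1; have [p2 q2 _] := h2.
  have one k z o : ws (1%g, k, b) z -> ~ ws (1%g, k, b) o -> ws f z -> ws f o ->
      ws (1%g, k, b) `<=` joined 1%g -> nested (joined 1%g) (ws f) \/ ws (1%g, k, b) `<=` ws f.
    move=> r1 r2 r3 r4 Jk; case: (fs_nest S f (1%g, k, b)) => h.
    - by case: r2; apply: h.
    - by case: (h z).
    - by left; apply: nestedC; constructor 3; apply: subset_trans Jk.
    - by right=> y hy; apply: contrapT => /h.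
  have [//|s1] := one i z1 o1 p1 q1 f3 f1 J1.
  have [//|s2] := one j z2 o2 p2 q2 f4 f2 J2.
  by constructor 1 => y [/s1|/s2].
have [e1|e1] := pselect (ws e o1); first exact: main.
rewrite -[ws e]setCK -hs_oppE; apply: nestedCr; apply: main => //; exact/hs_opp.
Qed.

Lemma joined_nested_ws g e : nested (joined g) (ws e).
Proof.
have -> : ws e = a g^-1%g @^-1` ws (emul g^-1%g e) by rewrite -ws_pre -emulM mulgV emul1.
have -> : joined g = a g^-1%g @^-1` joined 1%g by rewrite -joined_pre mulg1.
apply: nested_pre; case: e => -[h k] c; have [k' ka' ek] := fs_dup S k.
by rewrite /emul /= (hs_eqfam a _ _ ek); apply: joined1_nested.
Qed.

Lemma joined_nested g h : nested (joined g) (joined h).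
Proof.
suff main g' : nested (joined 1%g) (joined g').
  have -> : joined h = a g^-1%g @^-1` joined (g^-1 * h)%g by rewrite -joined_pre mulgA mulgV mul1g.
  have -> : joined g = a g^-1%g @^-1` joined 1%g by rewrite -joined_pre mulg1.
  exact: nested_pre.
have [->|/eqP ng] := eqVneq g' 1%g; first exact: nested_refl.
have [[ia ja ij lij] h1 h2 dis] := hp.
apply: nested_union; try exact: joined_nested_ws.
- by move/(outer_eq h1 (e := (g', i, b)) ia) => [].
- by move/(outer_eq h2 (e := (g', i, b)) ia) => [].
- by move/(outer_eq h1 (e := (g', j, b)) ja) => [].
- by move/(outer_eq h2 (e := (g', j, b)) ja) => [].
Qed.

Lemma lost_sep g k c x y : ~~ kept k -> sepb a merged x y (g, k, c) ->
  sepb a H x y (g, i, true) \/ sepb a H x y (g, j, true).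
Proof.
move=> hk hs; apply: contrapT => n.
have /sepbP n1 : ~~ sepb a H x y (g, i, b) by rewrite sepb_true; apply/negP => ?; apply: n; left.
have /sepbP n2 : ~~ sepb a H x y (g, j, b) by rewrite sepb_true; apply/negP => ?; apply: n; right.
move/negP: hs; apply; apply/negP/sepbP; rewrite lost_hs //.
by case: (c == b); rewrite /joined /= /setU /setC /=; tauto.
Qed.

Lemma lost_i : ~~ kept i. Proof. by rewrite /kept eqxx andbF. Qed.

Lemma kept_sep x y g k c : kept k -> sepb a merged x y (g, k, c) = sepb a H x y (g, k, c).
Proof. by move=> h; rewrite /sepb kept_hs. Qed.

Lemma keptP k : k \in act :\ j -> k = i \/ kept k.
Proof.
rewrite !inE => /andP[kj ka]; have [|ki] := eqVneq k i; [left|right] => //.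
by rewrite /kept ka ki kj.
Qed.

(** The correction for [b] false is the additive constant because of which labels are compared
    through differences of indicators. *)
Lemma ind_merged z : ind (merged i) z = ind (H i) z + ind (H j) z - (~~ b)%:R.
Proof.
have [_ _ _ dis] := hp; rewrite /merged (negbTE lost_i) /joined.
have E i0 y : ws (1%g, i0, false) y <-> ~ ws (1%g, i0, true) y := hs_opp a H (1%g, i0, true) y.
move: (dis z); case: b; rewrite ?E ?hs1 => d.
  rewrite /ind; case: (asboolP (H i z)) => p1; case: (asboolP (H j z)) => p2; first by case: d.
  - by rewrite asboolT //; left.
  - by rewrite asboolT //; right.
  - by rewrite asboolF // => -[].
have -> : ind (~` (ws (1%g, i, false) `|` ws (1%g, j, false))) z = ind (H i `&` H j) z.
  congr (_%:R : int); congr (nat_of_bool _); apply: asbool_equiv_eq.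
  rewrite /setC /setU /setI /= !E !hs1; split=> [n|[? ?] []//].
  by split; apply: contrapT => m; apply: n; [left|right].
rewrite /ind; case: (asboolP (H i z)) => p1; case: (asboolP (H j z)) => p2.
- by rewrite asboolT.
- by rewrite asboolF // => -[].
- by rewrite asboolF // => -[].
- by case: d.
Qed.

Lemma merged_state : fold_state lab merged (act :\ j).
Proof.
have [[ia ja ij lij] h1 h2 dis] := hp.
have ij' : i != j by apply/eqP.
split.
- move=> x y k; have [h|h] := boolP (kept k).
    rewrite (_ : mkset _ = [set g | sepw a H x y k g]); first exact: fs_fin S _ _ _.
    by apply/seteqP; split=> g; rewrite /= /sepw kept_sep.
  apply: (@sub_finite_set _ _ ([set g | sepw a H x y i g] `|` [set g | sepw a H x y j g])).
    by move=> g /= /(lost_sep h).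
  by rewrite finite_setU; split; apply: fs_fin S _ _ _.
- move=> e f; have [[e' ->]|[g he]] := merged_hs e; have [[f' ->]|[h hf]] := merged_hs f.
  + exact: fs_nest S _ _.
  + apply: nestedC; case: hf => ->; [|apply: nestedCl]; exact: joined_nested_ws.
  + case: he => ->; [|apply: nestedCl]; exact: joined_nested_ws.
  + case: he => ->; case: hf => ->; [|apply: nestedCr|apply: nestedCl|apply/nestedCl/nestedCr];
    exact: joined_nested.
- move=> k; have [h|h] := boolP (kept k).
    by exists k => //; move: h; rewrite /kept !inE => /and3P[-> _ ->].
  by exists i; rewrite ?inE ?ij' //= /merged (negbTE h) (negbTE lost_i).
- move=> k /keptP[->|hk].
    have [p1 q1 u1] := h1.
    have zJ : joined 1%g z1 by left.
    have oJ : ~ joined 1%g o1.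
      case=> // q; apply: (dis z1) => //; apply: (outer_unsep (e := (1%g, j, b)) h1 ja _).2 => //.
      by case=> e; apply: ij.
    have sep e : e.1.2 \in act :\ j -> sepb a merged z1 o1 e -> e.1 = (1%g, i).
      case: e => -[g k'] c /= /keptP[->|hk'] hs.
        have [/(u1 (g, i, true) ia)//|/(u1 (g, j, true) ja)[_ e]] := lost_sep lost_i hs.
        by case: ij.
      by move: hs; rewrite kept_sep //; apply: u1; move: hk' => /and3P[].
    have mi : merged i = if b then joined 1%g else ~` joined 1%g by rewrite /merged (negbTE lost_i).
    rewrite mi; case: {mi}(b) => /=; [exists o1, z1|exists z1, o1]; split=> //.
      by move=> e ea; rewrite /sepb addbC; apply: sep.
  have [x [y [hx hy u]]] := fs_wit S (i := k) (andP hk).1.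
  have [ka ki kj] := and3P hk.
  exists x, y; split; [by rewrite /merged hk|by rewrite /merged hk|].
  case=> -[g k'] c /= /keptP[->|hk'] hs.
    have [/(u (g, i, true) ia)[_ e]|/(u (g, j, true) ja)[_ e]] := lost_sep lost_i hs.
      by rewrite e eqxx in ki.
    by rewrite e eqxx in kj.
  by move: hs; rewrite kept_sep //; apply: u; move: hk' => /and3P[].
move=> m x y; rewrite -(fs_lab S).
have [<-|nm] := eqVneq (lab i) m.
  rewrite [RHS](bigD1 i) ?ia ?eqxx //= [X in _ = _ + X](bigD1 j) ?ja ?lij ?eqxx //=; last by rewrite eq_sym.
  rewrite [LHS](bigD1 i) ?inE ?ij' ?ia ?lij ?eqxx //= !ind_merged addrA; congr (_ + _).
    by move: (ind _ _) (ind _ _) (ind _ _) (ind _ _) => *; lia.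
  apply: eq_big => k; first by rewrite !inE; case: (k \in act) (k == i) (k == j) (lab k == lab j) => -[] [] [].
  by rewrite !inE => /andP[/andP[/andP[kj ka] _] ki]; rewrite /merged /kept ka ki kj.
apply: eq_big => k.
  by rewrite !inE; have [->|//] := eqVneq k j; rewrite -lij (negbTE nm) !andbF.
rewrite !inE => /andP[/andP[kj ka] /eqP km]; rewrite /merged /kept ka kj.
by have [e|//] := eqVneq k i; move: nm; rewrite -e km eqxx.
Qed.

Lemma merged_cat : wall_sys a (cat_fam H merged).
Proof.
apply: (wall_sys_cat fold_wall_sys).
  have S' := merged_state; split; first exact: fs_fin S'.
    by move=> e f; rewrite !hs_oppE; apply: fs_nest S' e f.
  move=> k; have [l la e] := fs_dup S' k; have [x [y [h1 h2 u]]] := fs_wit S' la.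
  exists x, y; rewrite e; split=> // g hg.
  have := u (g, l, true) la; rewrite (_ : sepb _ _ _ _ _ = true) => [/(_ isT)[]//|].
  by move: hg; rewrite /sepw /sepb /hs /= e.
move=> e f; rewrite !hs_oppE -/(nested _ _).
have [[f' ->]|[h hf]] := merged_hs f; first exact: fs_nest S _ _.
apply: nestedC; case: hf => ->; [|apply: nestedCl]; exact: joined_nested_ws.
Qed.

(** The union separates two points only if one of its pieces does, so folding increases no
    distance. *)
Lemma merged_wdist (R : realType) (w : 'I_M -> R) x y : (forall m, 0 <= w m) ->
  wdist a merged (fun k => if k \in act :\ j then w (lab k) else 0) x y <=
  wdist a H (fun k => if k \in act then w (lab k) else 0) x y.
Proof.
move=> w0; have [[ia ja ij lij] h1 h2 dis] := hp.
have ji : j != i by apply/eqP => e; apply: ij.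
rewrite /wdist (bigD1 i) //= [leRHS](bigD1 i) //= (bigD1 j) //= [X in _ <= _ + X](bigD1 j) //=.
rewrite !inE eqxx /= mul0r add0r eq_sym ji ia ja -lij addrA; apply: lerD.
  rewrite -mulrDr ler_wpM2l // -natrD ler_nat.
  rewrite -[leqLHS]addn0 -(fcount0 G); apply: fcount_leD; try exact: fs_fin S _ _ _.
  move=> g; rewrite addn0 /sepw; case: (boolP (sepb a merged x y (g, i, true))) => // hs.
  by have [->|->] := lost_sep lost_i hs; rewrite ?addn1.
apply: ler_sum => k /andP[ki kj]; rewrite !inE kj /=; case: (boolP (k \in act)) => ka; last by rewrite !mul0r.
rewrite ler_wpM2l // ler_nat; apply: fcount_le; first exact: fs_fin S _ _ _.
by move=> g; rewrite /sepw kept_sep // /kept ka ki kj.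
Qed.

End Merge.

End State.

Lemma fold_step lab H act i j : fold_state lab H act -> i \in act -> j \in act -> i <> j -> lab i = lab j ->
  exists H' (act' : {set 'I_N}), [/\ fold_state lab H' act', (#|act'| < #|act|)%N, wall_sys a (cat_fam H H') &
    forall (R : realType) (w : 'I_M -> R) x y, (forall m, 0 <= w m) ->
     wdist a H' (fun k => if k \in act' then w (lab k) else 0) x y <=
     wdist a H (fun k => if k \in act then w (lab k) else 0) x y].
Proof.
move=> S ia ja ij lij; have [i0 [j0 [b0 [z [t [z' [t' hp]]]]]]] := pinch_ex S ia ja ij lij.
have [i1 [j1 [b [z1 [u1 [z2 [u2 [hp' tight]]]]]]]] := pinch_tight S hp.
exists (merged H act i1 j1 b), (act :\ j1)%SET; split.
- exact: (merged_state S hp' tight).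
- by have [[_ ja1 _ _] _ _ _] := hp'; rewrite [X in (_ < X)%N](cardsD1 j1) ja1.
- exact: (merged_cat S hp' tight).
- by move=> R w x y; apply: (merged_wdist S hp').
Qed.

Hypothesis Pex : forall m, exists x y, P m x /\ ~ P m y.

(** With one active half-space per label, its indicator differs from that of [P m] by a constant,
    and the constant is 0 because [P m] is neither empty nor full. *)
Lemma fold_end lab H act : fold_state lab H act -> (forall i j, i \in act -> j \in act -> lab i = lab j -> i = j) ->
  exists s : 'I_M -> 'I_N, [/\ forall m, s m \in act, forall m, lab (s m) = m & forall m, H (s m) = P m].
Proof.
move=> S inj; suff /choice[s hs] : forall m, exists i, [/\ i \in act, lab i = m & H i = P m].
  by exists s; split=> m; have [] := hs m.
move=> m; have one i x y : i \in act -> lab i = m -> ind (H i) x - ind (H i) y = ind (P m) x - ind (P m) y.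
  move=> ia im; rewrite -(fs_lab S) (bigD1 i) ?ia ?im ?eqxx //= big1 ?addr0 // => j /andP[/andP[ja /eqP jm]].
  by rewrite (inj j i) ?eqxx // jm.
have [x [y [px py]]] := Pex m.
have [[i [ia im]]|n] := pselect (exists i, i \in act /\ lab i = m); last first.
  have := fs_lab S m x y; rewrite indT // indF // big1 // => i /andP[ia /eqP im].
  by case: n; exists i.
exists i; split=> //; have := one i x y ia im; rewrite (indT px) (indF py) => e.
have hx : H i x by apply: contrapT => h; move: e; rewrite (indF h) /ind; case: `[< _ >].
apply/seteqP; split=> z hz; apply: contrapT => h; have := one i x z ia im; rewrite (indT hx) (indT px).
  by rewrite (indT hz) (indF h).
by rewrite (indT hz) (indF h).
Qed.

End Fold.

(** * The path of folds *)

Section FoldConn.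
Variables (R : realType) (p k : nat) (Gi : 'I_p -> groupType) (G : groupType)
  (iota : forall i, {multiplicative Gi i -> G}) (x : 'I_k -> G).
Hypothesis hG : is_free_product iota x.
Hypothesis hGi : forall i : 'I_p, exists a : Gi i, a <> 1%g.
Variable T0 : gtree R G.
Hypothesis HT0 : in_outer iota T0.
Hypothesis edge0 : exists u v, adjq (@mdist R T0) (@vertices R T0) u v.
Variables (W : choiceType) (base : W) (a : G -> W -> W).
Hypothesis a1 : forall x, a 1%g x = x.
Hypothesis aM : forall g h x, a (g * h)%g x = a g (a h x).
Variables (M : nat) (P : 'I_M -> set W) (w : 'I_M -> R).
Hypothesis Pnest : forall e f, nested (hs a P e) (hs a P f).
Hypothesis Pex : forall m, exists x y, P m x /\ ~ P m y.
Hypothesis w0 : forall m, 0 <= w m.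
Variables (lP l0 : G -> R).
Hypothesis hlP : is_slope a P w lP.
Hypothesis lP0 : forall g, 0 <= lP g.
Hypothesis ellP : forall g, lP g = 0 <-> translation_length T0 g = 0.
Hypothesis ell0 : forall g, l0 g = 0 <-> translation_length T0 g = 0.

Lemma slope_le N N' (H : 'I_N -> set W) (H' : 'I_N' -> set W) om om' (l l' : G -> R) :
  is_slope a H om l -> is_slope a H' om' l' -> (forall y z, wdist a H' om' y z <= wdist a H om y z) ->
  forall g, l' g <= l g.
Proof.
move=> h h' le g; have [C hC] := h g base; have [C' hC'] := h' g base.
apply: (@bounded_slope R _ _ (C + C')) => m.
by have := hC m; have := hC' m; have := le base (a (g ^+ m)%g base);
  rewrite !ler_norml => ? /andP[? ?] /andP[? ?]; lra.
Qed.

Lemma fcount_has (I J : choiceType) (A : pred I) (Q : I -> pred J) (r : seq I) :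
  (forall i, finite_set [set j | Q i j]) ->
  (fcount (fun j => has (fun i => A i && Q i j) r) <= \sum_(i <- r | A i) fcount (Q i))%N /\
  finite_set [set j | has (fun i => A i && Q i j) r].
Proof.
move=> f; elim: r => [|i r [ih1 ih2]] /=.
  by rewrite big_nil fcount0; split=> //; apply: (sub_finite_set (B := set0)).
have fi : finite_set [set j | A i && Q i j].
  by apply: sub_finite_set (f i) => j /= /andP[].
split; last first.
  apply: (sub_finite_set (B := [set j | A i && Q i j] `|` [set j | has (fun i => A i && Q i j) r])).
    by move=> j /= /orP.
  by rewrite finite_setU.
rewrite big_cons; apply: (@leq_trans (fcount (fun j => A i && Q i j) + fcount (fun j => has (fun i => A i && Q i j) r))).
  rewrite -[leqLHS]addn0 -(fcount0 J); apply: fcount_leD => // j.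
  by rewrite addn0; case: (A i && Q i j) => //=; case: (has _ _).
case: (A i) => /=; first by rewrite leq_add2l.
by rewrite fcount0 add0n.
Qed.

(** A target wall separating [y] and [z] makes the sum of indicator differences nonzero, so the same
    translate of some active half-space with its label separates them too. *)
Lemma labels_wdist_le N (H : 'I_N -> set W) (act : {set 'I_N}) lab y z : fold_state a P lab H act ->
  wdist a P w y z <= wdist a H (fun i => if i \in act then w (lab i) else 0) y z.
Proof.
move=> S; rewrite /wdist [leRHS](bigID [pred i | i \in act]) /= [X in _ <= _ + X]big1 ?addr0; last first.
  by move=> i /negbTE ->; rewrite mul0r.
rewrite [leRHS](partition_big lab predT) //=; apply: ler_sum => m _.
rewrite (eq_bigr (fun i => w m * (fcount (sepw a H y z i))%:R)); last first.
  by move=> i /andP[-> /eqP ->].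
rewrite -mulr_sumr ler_wpM2l // -natr_sum ler_nat.
have [le fin] := @fcount_has _ _ (fun i => (i \in act) && (lab i == m)) (sepw a H y z)
  (index_enum 'I_N) (fs_fin S y z).
apply: leq_trans le; apply: fcount_le fin _ => g /= hs; apply/negPn/negP => /hasPn n.
move/negP: hs; apply; apply/negP/sepbP; apply: ind_inj; apply/eqP; rewrite -subr_eq0 -(lab_translate S).
apply/eqP; apply: big1 => i /andP[ia im]; have := n i (mem_index_enum i).
rewrite ia im /= => /sepbP h; apply/eqP; rewrite subr_eq0; apply/eqP; congr (_%:R : int).
by congr (nat_of_bool _); apply: asbool_equiv_eq.
Qed.

(** Induction on the number of active half-spaces, each fold being an interpolation. Once labels are
    distinct, the active half-spaces are those of the target, and a last interpolation moves the
    weights to the target family. *)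
Lemma fold_conn N (H : 'I_N -> set W) (act : {set 'I_N}) lab l :
  let om := fun i => if i \in act then w (lab i) else 0 in
  fold_state a P lab H act -> is_slope a H om l -> (forall g, l g <= l0 g) ->
  conn iota l (essential_weight a H om) lP (essential_weight a P w).
Proof.
have [n] := ubnP #|act|; elim: n => // n ih in H act l * => hn om S hl ll0.
have om_ge0 (act' : {set 'I_N}) k0 : 0 <= (if k0 \in act' then w (lab k0) else 0) by case: ifP.
(* All lengths on the way stay between [lP] and [l0], which vanish on the same elements, so the set
   of elliptic elements never changes. *)
have sand H' (act' : {set 'I_N}) l' : fold_state a P lab H' act' ->
    is_slope a H' (fun i => if i \in act' then w (lab i) else 0) l' -> (forall g, l' g <= l0 g) ->
    (forall g, lP g <= l' g) /\ (forall g, l' g = 0 <-> translation_length T0 g = 0).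
  move=> S' hl' ll'; have lPl := slope_le hl' hlP (fun y z => labels_wdist_le y z S').
  split=> // g; split=> e.
    by apply/ellP/eqP; rewrite eq_le lP0 andbT -e.
  by apply/eqP; rewrite eq_le -{1}((ell0 g).2 e) ll' (le_trans (lP0 g)).
have [lPl ell] := sand _ _ _ S hl ll0.
have [[i [j [ia ja ij lij]]]|nij] := pselect (exists i j, [/\ i \in act, j \in act, i <> j & lab i = lab j]).
  have [H' [act' [S' lt C dec]]] := fold_step a1 aM Pnest S ia ja ij lij.
  have W' : wall_sys a H' := fold_wall_sys S'.
  have [l' hl'] := slope_ex base a1 aM W' (om_ge0 act').
  have ll' := slope_le hl hl' (fun y z => dec R w y z w0).
  have ll0' g : l' g <= l0 g := le_trans (ll' g) (ll0 g).
  have [lPl' ell'] := sand _ _ _ S' hl' ll0'.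
  apply: conn_trans (ih H' act' l' (leq_trans lt hn) S' hl' ll0').
  apply: (conn_interpolation hG hGi HT0 edge0 base a1 aM C) => // g; [exact: om_ge0|exact: (le_trans (lP0 g) (lPl' g))].
have [s [s1 s2 s3]] := fold_end Pex S (fun i j ia ja e => contrapT (fun ne => nij (ex_intro _ i (ex_intro _ j (And4 ia ja ne e))))).
have C : wall_sys a (cat_fam H P).
  have -> : cat_fam H P = H \o cat_fam id s.
    by apply/funext => i; case: (split_ordP i) => j ->; rewrite /= ?cat_faml ?cat_famr.
  exact: (wall_sys_comp _ (fold_wall_sys S)).
by apply: (conn_interpolation hG hGi HT0 edge0 base a1 aM C) => // g; exact: om_ge0.
Qed.

End FoldConn.

(** * Walls of a subdivided tree *)

Section Subdivision.
Variables (R : realType) (p k : nat) (Gi : 'I_p -> groupType) (G : groupType)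
  (iota : forall i, {multiplicative Gi i -> G}) (x : 'I_k -> G).
Variable T : gtree R G.
Hypothesis HT : in_outer iota T.
Local Notation d := (@mdist R T).
Local Notation V := (@vertices R T).
Let H := mdist_zh T.
Let Geo := mdist_geodesic (T := T).
Let A := act_isom T.
Let sp := @mdist_sep R G T.
Let VD := vertices_discrete T.

Lemma vertex_inv g z : V z -> V (act g z).
Proof. exact: act_vertices. Qed.

Lemma point_edge (z : T) : V z \/ exists u v, adjq d V u v /\ btw d u z v.
Proof.
have [_ _ _ h _] := smt_tree T; have [|[e Ee ez]] := h z; first by left.
right; have [u [v uv]] := edge_exists_ends Ee; exists u, v; split.
  by apply/adjq_edge; exists e.
by move: ez; rewrite (edge_segment uv).
Qed.

Lemma edge_meet u v u' v' z : adjq d V u v -> adjq d V u' v' -> btw d u z v -> btw d u' z v' ->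
  ~ V z -> (u = u' /\ v = v') \/ (u = v' /\ v = u').
Proof.
move=> a1 a2 b1 b2 nz; have [E1 n1 h1] := adjq_segment a1; have [E2 n2 h2] := adjq_segment a2.
have [_ _ dis _ _] := smt_tree T.
have e12 : [set y | btw d u y v] = [set y | btw d u' y v'].
  by apply: contrapT => ne; apply: nz; apply: (dis _ _ E1 E2 ne).
move: h2; rewrite -e12 h1 => e.
have : [set u'; v'] u by rewrite -e; left.
have : [set u'; v'] v by rewrite -e; right.
by move=> /= [] ev [] eu; [case: n1; rewrite eu ev|right|left|case: n1; rewrite eu ev].
Qed.

Section Fixed.
Variable Q : set T.
Hypotheses (QD : discrete d Q) (VQ : V `<=` Q) (Qinv : forall g z, Q z -> Q (act g z)).
Let free := adjq_free (outer_free HT) VQ.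

(** Otherwise the points none of whose translates lies in the half form an invariant convex proper
    subset, against minimality. *)
Lemma half_translate u v (Y : set T) : adjq d Q u v -> Y !=set0 ->
  (forall g z, Y z -> Y (act g z)) -> exists2 z, Y z & half d u v z.
Proof.
move=> uv [y0 Yy0] Yinv; apply: contrapT => n.
pose S := [set z | forall g, ~ half d u v (act g z)].
have : S = setT.
  apply: (invariant_convex_full HT).
  - by exists y0 => g h; apply: n; exists (act g y0) => //; apply: Yinv.
  - move=> y z w Sy Sz yz g h.
    have h2 := btw_act A g yz.
    case: (btw_split H u h2) => h3.
      by apply: (Sy g); have [] := btw_trans H h (btwC H h3).
    by apply: (Sz g); have [] := btw_trans H h h3.
  - by move=> g z Sz h; rewrite -actM; apply: Sz.
by move=> e; have : S v by [rewrite e]; move/(_ 1%g); rewrite act1; apply; apply: half_r.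
Qed.

Lemma half_flip u v z : adjq d Q u v -> Q z -> ~ half d u v z <-> half d v u z.
Proof.
move=> uv Qz; split; first by have [|] := half_or H Geo sp QD uv Qz.
by move=> h h'; apply: (half_not H sp uv h' h).
Qed.

(* A translate of the edge itself lies in the half. *)
Lemma half_shift u v : adjq d Q u v -> exists2 g, g <> 1%g &
  (forall z, half d v u z -> ~ half d (act g u) (act g v) z) \/
  (forall z, half d v u z -> ~ half d (act g v) (act g u) z).
Proof.
move=> uv; have [_ [g _ <-] hg] := half_translate (Y := [set act g u | g in [set: G]]) uv
  (ex_intro _ _ (ex_intro2 _ _ 1%g I erefl)) (fun g z => fun '(ex_intro2 h _ e) =>
    ex_intro2 _ _ (g * h)%g I (etrans (actM _ _ _) (congr1 (act g) e))).
have [Qu Qv nuv _] := uv; have guv := adjq_act A Qinv g uv.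
have ng : g <> 1%g.
  move=> e; move: hg; rewrite e act1 => h.
  by apply: (half_not H sp (adjqC H uv) (half_r H v u)).
exists g => //.
have hg' : half d u v (act g v).
  apply: contrapT => /(half_flip uv (Qinv g Qv)) h.
  have [e1 e2] := half_cross H sp uv guv hg h.
  by apply: ng; apply: (free uv); right.
have [h|h|h|h] := half_nested H Geo sp QD uv guv.
- by case: (h _ hg'); apply: half_r.
- by case: (h _ hg); apply: half_r.
- by left.
- by right.
Qed.

(** The midpoint of the small edge is no vertex, so it lies inside an edge of the tree, whose ends
    are on opposite sides of the small edge. *)
Lemma sub_edge u v : adjq d Q u v -> exists s t, [/\ adjq d V s t, btw d s u t, btw d s v t & btw d s u v].
Proof.
move=> uv; have [Qu Qv nuv h] := uv; have uv0 := adjq_gt0 H sp uv.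
have [m [um em]] := midpoint_ex u v.
have nm : ~ V m.
  move=> /VQ Qm; case: (h m Qm um) => e; move: em um; rewrite e /btw ?(zh0 H) => em;
  by rewrite -?em; move: uv0; have := zhC H u v; lra.
have [//|[s [t [st smt]]]] := point_edge m.
have [Vs Vt _ _] := st.
have main s' t' : adjq d V s' t' -> btw d s' m t' -> half d u v t' -> half d v u s' ->
    exists s t, [/\ adjq d V s t, btw d s u t, btw d s v t & btw d s u v].
  move=> st' smt' h1 h2; exists s', t'.
  by have [h3 h4] := btw_chain H (btwC H h2) h1 uv0; split=> //; apply: btwC.
have same s' t' : btw d s' m t' -> half d u v t' -> half d u v s' -> False.
  rewrite /half /btw /= => b h1 h2; have := zh_tri H v m s'; have := zh_tri H v m t'.
  have := zh_tri H m u s'; have := zh_tri H m u t'.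
  have := zh_tri H v t' s'; move: b um h1 h2; rewrite /btw.
  have := zhC H s' m; have := zhC H s' v; have := zhC H t' v; have := zhC H s' t'.
  have := zhC H m u; lra.
have [h1|h1] := half_or H Geo sp QD uv (VQ Vs);
have [h2|h2] := half_or H Geo sp QD uv (VQ Vt).
- by case: (same s t).
- by apply: (main t s) => //; [exact: adjqC|exact: btwC].
- exact: (main s t).
- exfalso; have um' : btw d v m u by apply: btwC.
  move: smt h1 h2 um' em; rewrite /half /btw /= => b h1 h2 um' em.
  have := zh_tri H u m s; have := zh_tri H u m t; have := zh_tri H m v s; have := zh_tri H m v t.
  have := zh_tri H u t s; have := zhC H s m; have := zhC H s u; have := zhC H t u; have := zhC H s t.
  have := zhC H m u; have := zhC H m v; have := zhC H u v; lra.
Qed.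

Variables (n : nat) (r : 'I_n -> T * T).
Hypothesis RP : edge_reps d Q (@act R G T) r.

(** Writing the length of each original edge as a sum over small edges gives the small lengths with
    multiplicities. Each multiplicity is 1: the midpoint of a small representative has exactly one
    translate in exactly one original representative. *)
Lemma reps_covolume : is_free_product iota x -> covolume T = (\sum_(i < n) d (r i).1 (r i).2)%:E.
Proof.
move=> hG; have [m [s SP]] := outer_reps hG HT VD (fun z h => h) vertex_inv.
rewrite (covolume_reps SP); congr (_%:E).
have freeV := adjq_free (outer_free HT) (fun z (h : V z) => h).
have Qs j : Q (s j).1 /\ Q (s j).2 by have [h1 h2 _ _] := er_adj SP j; split; apply: VQ.
pose c i j := fcount (sepr d (@act R G T) r i (s j).1 (s j).2).
have fin j := (dist_count H Geo sp QD A Qinv free RP (Qs j).1 (Qs j).2).1.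
rewrite (eq_bigr (fun j => \sum_(i < n) d (r i).1 (r i).2 * (c i j)%:R)); last first.
  by move=> j _; rewrite (dist_count H Geo sp QD A Qinv free RP (Qs j).1 (Qs j).2).2.
rewrite exchange_big /=; apply: eq_bigr => i _; rewrite -mulr_sumr -natr_sum.
suff -> : (\sum_(j < m) c i j = 1)%N by rewrite mulr1.
have ri := er_adj RP i; have ri0 := adjq_gt0 H sp ri.
have [mid [mb me]] := midpoint_ex (r i).1 (r i).2.
have nmid g : ~ V (act g mid).
  move=> /(vertex_inv g^-1%g); rewrite -actM mulVg act1 => /VQ Qm.
  have [_ _ _ h] := ri; case: (h mid Qm mb) => e; move: me mb; rewrite e /btw ?(zh0 H) => e1;
  by rewrite -?e1; move: ri0; have := zhC H (r i).1 (r i).2; lra.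
have inside j g : sepr d (@act R G T) r i (s j).1 (s j).2 g -> btw d (s j).1 (act g mid) (s j).2.
  have gri := adjq_act A Qinv g ri; have gm := btw_act A g mb.
  have gri0 := adjq_gt0 H sp gri; have [Q1 Q2] := Qs j.
  rewrite /sepr /sepq; case: asboolP => h1; case: asboolP => h2 // _.
    move/(half_flip gri Q2) in h2; have [h3 h4] := btw_chain H (btwC H h2) h1 gri0.
    by apply: btwC => //; apply: (segment_convex H) h4 h3 gm.
  move/(half_flip gri Q1) in h1; have [h3 h4] := btw_chain H (btwC H h1) h2 gri0.
  exact: (segment_convex H) h4 h3 gm.
have [j0 [g0 hg0]] : exists j g, sepr d (@act R G T) r i (s j).1 (s j).2 g.
  have [y [z [yz h1 h2 h3]]] := sub_edge ri.
  have h4 := (btw_trans H h3 h2).2.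
  have hz : half d (r i).1 (r i).2 z by [].
  have [Vy Vz _ _] := yz.
  have hy : ~ half d (r i).1 (r i).2 y by apply/(half_flip ri (VQ Vy)); apply: btwC.
  have [j [g hg]] := er_cover SP yz; exists j, g^-1%g.
  rewrite /sepr /sepq !(asbool_equiv_eq (half_act A _ _ _ _)) invgK.
  by case: hg => -[e1 e2]; rewrite -e1 -e2 (asboolT hz) (asboolF hy).
have uni j g : sepr d (@act R G T) r i (s j).1 (s j).2 g -> j = j0 /\ g = g0.
  move=> hg; have b1 := btw_act A (g0 * g^-1)%g (inside j g hg); have b0 := inside j0 g0 hg0.
  rewrite -actM mulgVK in b1.
  have e1 := adjq_act A vertex_inv (g0 * g^-1)%g (er_adj SP j).
  have em := edge_meet e1 (er_adj SP j0) b1 b0 (nmid g0).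
  have [|-> e] := er_inj A freeV SP (i := j) (j := j0) (g := (g0 * g^-1)%g) (h := 1%g).
    by rewrite !act1.
  by split=> //; rewrite -[g0]mulg1 -(mulVg g) mulgA e mul1g.
rewrite (bigD1 j0) //= [X in (_ + X)%N]big1 ?addn0.
  by apply: (fcount1 hg0) => g /uni[].
move=> j /eqP nj; rewrite /c (@eq_fcount _ _ (fun=> false)) ?fcount0 // => g.
by apply/negP => /uni[].
Qed.

Section Pull.
Variables (W : choiceType) (a : G -> W -> W) (phi : W -> T).
Hypothesis a1 : forall y, a 1%g y = y.
Hypothesis aM : forall g h y, a (g * h)%g y = a g (a h y).
Hypothesis phiA : forall g y, phi (a g y) = act g (phi y).
Hypothesis phiQ : forall y, Q (phi y).

(** Used with the inclusion for the source tree and with the piecewise affine map for the target, so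
    that both wall systems live on one ground set. *)
Definition pull (i : 'I_n) : set W := [set y | half d (r i).1 (r i).2 (phi y)].
Let src (e : oedge G n) := act e.1.1 (if e.2 then (r e.1.2).1 else (r e.1.2).2).
Let tgt (e : oedge G n) := act e.1.1 (if e.2 then (r e.1.2).2 else (r e.1.2).1).

Lemma pull_adj e : adjq d Q (src e) (tgt e).
Proof.
have h := er_adj RP e.1.2; apply: adjq_act A Qinv _ _ _ _; rewrite /=; case: e.2 => //.
exact: adjqC.
Qed.

Lemma hs_pull e y : hs a pull e y <-> half d (src e) (tgt e) (phi y).
Proof.
case: e => -[g i] [] /=; rewrite /hs /pull /src /tgt /= (half_act A) -phiA; first by split.
exact: half_flip (er_adj RP i) (phiQ _).
Qed.

Lemma pull_sep y z i g : sepw a pull y z i g = sepr d (@act R G T) r i (phi y) (phi z) g.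
Proof. by rewrite /sepw /sepb /sepr /sepq !(asbool_equiv_eq (hs_pull (g, i, true) _)). Qed.

Let cnt y z := dist_count H Geo sp QD A Qinv free RP (phiQ y) (phiQ z).

Lemma pull_fin y z i : finite_set [set g | sepw a pull y z i g].
Proof.
rewrite (_ : mkset _ = [set g | sepr d (@act R G T) r i (phi y) (phi z) g]); first exact: (cnt y z).1.
by apply/seteqP; split=> g /=; rewrite pull_sep.
Qed.

Lemma pull_nest e f : nested (hs a pull e) (hs a pull f).
Proof.
have E c y : (~` hs a pull c) y <-> half d (tgt c) (src c) (phi y).
  by rewrite -(half_flip (pull_adj c) (phiQ y)) -hs_pull.
have [h|h|h|h] := half_nested H Geo sp QD (pull_adj e) (pull_adj f).
- by constructor 2 => y /hs_pull hy; move/hs_pull => h2; apply: (h _ hy).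
- by constructor 1 => y /hs_pull hy; apply: contrapT => /E; apply: h.
- by constructor 4 => y /E hy; move/hs_pull => h2; apply: (h _ hy).
- by constructor 3 => y /E hy; apply: contrapT => /E; apply: h.
Qed.

Lemma pull_wdist y z : wdist a pull (fun i => d (r i).1 (r i).2) y z = d (phi y) (phi z).
Proof.
rewrite (cnt y z).2; apply: eq_bigr => i _; congr (_ * _%:R); apply: eq_fcount => g.
exact: pull_sep.
Qed.

Lemma pull_slope : is_slope a pull (fun i => d (r i).1 (r i).2) (translation_length T).
Proof.
move=> g y; have [C hC] := translation_length_asym g (phi y).
by exists C => m; rewrite pull_wdist phiA.
Qed.

Hypothesis hits : forall i, exists y z, phi y = (r i).1 /\ phi z = (r i).2.

Lemma pull_wit i : exists y z, [/\ phi y = (r i).1, phi z = (r i).2, ~ pull i y, pull i z &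
  forall e, sepb a pull y z e -> e.1 = (1%g, i)].
Proof.
have ri := er_adj RP i; have [y [z [ey ez]]] := hits i; exists y, z; split=> //.
- rewrite /pull /= ey; move=> h; apply: (half_not H sp (adjqC H ri) (half_r H _ _)); exact: h.
- by rewrite /pull /= ez; apply: half_r.
case=> -[g j] b; rewrite sepb_true -/(sepw a pull y z j g) pull_sep ey ez /sepr => h.
have [|-> ->] := er_inj A free RP (i := j) (j := i) (g := g) (h := 1%g); last by [].
by rewrite !act1; case: ((sepq_adj H Geo sp QD (adjq_act A Qinv g (er_adj RP j)) ri).1 h) => -[-> ->]; [left|right].
Qed.

Lemma pull_sys : wall_sys a pull.
Proof.
split; first exact: pull_fin.
  by move=> e f; rewrite !hs_oppE; apply: pull_nest.
move=> i; have [y [z [_ _ h1 h2 u]]] := pull_wit i; exists y, z; split=> // g hg.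
by have [] := u (g, i, true) hg.
Qed.

Lemma pull_hat e : exists2 g, g <> 1%g & hat a pull e g.
Proof.
have [g ng h] := half_shift (pull_adj e).
have E c z : hs a pull (emul c e) z <-> half d (act c (src e)) (act c (tgt e)) (phi z).
  by rewrite hs_pull /src /tgt /= !actM.
exists g => //; case: h => h; [left|right] => z.
  move/E => h1; apply/hs_pull; apply: contrapT => /(half_flip (pull_adj e) (phiQ z)) h2.
  exact: (h _ h2).
move=> /hs_opp; rewrite hs_pull => /(half_flip (pull_adj e) (phiQ z)) h1; apply/E; apply: contrapT.
by move/(half_flip (adjq_act A Qinv g (pull_adj e)) (phiQ z)); apply: h.
Qed.

(** Both sides have nonempty hats, so no weight is lost in the realization and the essential weight
    is the covolume of the tree. *)
Lemma pull_essential e : essential a pull e.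
Proof.
split; first exact: pull_hat.
have [g ng hg] := pull_hat (opp e); exists g => //; move: hg.
by rewrite (hat_opp a1 aM (sys_nest pull_sys) (sys_wit pull_sys) e ng).
Qed.

Lemma pull_weight (om : 'I_n -> R) : essential_weight a pull om = \sum_(i < n) om i.
Proof. by apply: eq_bigl => i; apply/asboolP/pull_essential. Qed.

End Pull.

End Fixed.

Lemma discrete_union (Y : set T) : (exists v, V v) ->
  (forall u v, adjq d V u v -> finite_set [set z | Y z /\ btw d u z v]) -> discrete d (V `|` Y).
Proof.
move=> [v0 Vv0] fin; split.
  by move=> y b c e *; left; apply: (branch_vertex (a := b) (b := c) (c := e)).
move=> y z; rewrite (_ : mkset _ = [set w | V w /\ btw d y w z] `|` [set w | Y w /\ btw d y w z]); last first.
  by apply/seteqP; split=> w /=; rewrite /setU /=; tauto.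
rewrite finite_setU; split; first exact: finite_vertices_btw.
have fromv v : V v -> finite_set [set w | Y w /\ btw d v0 w v].
  move=> Vv; apply: (@chain_indq _ _ _ H sp _ VD v0 (fun v => finite_set [set w | Y w /\ btw d v0 w v])) => //.
    apply: (sub_finite_set (B := [set v0])) => // w [_ h]; apply: sp.
    have h0 := zh_ge0 H v0 w; move: h; rewrite /btw (zh0 H) (zhC H w) => h; lra.
  move=> q q' fq qq' _; apply: (sub_finite_set (B := [set w | Y w /\ btw d v0 w q] `|` [set w | Y w /\ btw d q w q'])).
    by move=> w /= [Yw hw]; case: (btw_split H q hw) => ?; [left|right].
  by rewrite finite_setU; split=> //; apply: fin.
have fromany z' : finite_set [set w | Y w /\ btw d v0 w z'].
  have [v [Vv hv]] := extend_to_vertex z' Vv0.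
  apply: sub_finite_set (fromv v Vv) => w /= [Yw hw]; split=> //.
  by have [] := btw_trans H hw (btwC H hv).
apply: (sub_finite_set (B := [set w | Y w /\ btw d v0 w y] `|` [set w | Y w /\ btw d v0 w z])).
  move=> w /= [Yw hw]; case: (btw_split H v0 hw) => h; [left|right] => //.
  by split=> //; apply: btwC.
by rewrite finite_setU.
Qed.

End Subdivision.

(** * The affine map and its folding path *)

Lemma reps_modify (R : realType) (X : choiceType) (D : X -> X -> R) (Q : set X) (G : groupType)
    (a : G -> X -> X) n (r : 'I_n -> X * X) (h : 'I_n -> G) (b : 'I_n -> bool) :
  zero_hyperbolic D -> isom_action D a -> (forall g z, Q z -> Q (a g z)) -> edge_reps D Q a r ->
  edge_reps D Q a (fun i => if b i then (a (h i) (r i).2, a (h i) (r i).1)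
    else (a (h i) (r i).1, a (h i) (r i).2)).
Proof.
move=> H A Qinv RP; split.
- move=> i; have := adjq_act A Qinv (h i) (er_adj RP i).
  by case: (b i) => //=; apply: adjqC.
- move=> u v uv; have [i [g hg]] := er_cover RP uv; exists i, (g * (h i)^-1)%g.
  case: (b i); rewrite /= -!(iaM A) !mulgVK //; tauto.
move=> i j g hg; apply: (er_uniq RP (i := i) (j := j) (g := ((h j)^-1 * g * h i)%g)).
have E y z : a g (a (h i) y) = a (h j) z -> a ((h j)^-1 * g * h i)%g y = z.
  by rewrite -(iaM A) => e; rewrite -mulgA (iaM A) e -(iaM A) mulVg (ia1 A).
by move: hg; case: (b i); case: (b j) => /= -[] [/E -> /E ->]; auto.
Qed.

Section AffineExtension.
Variables (R : realType) (p k : nat) (Gi : 'I_p -> groupType) (G : groupType)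
  (iota : forall i, {multiplicative Gi i -> G}) (x : 'I_k -> G).
Hypothesis hG : is_free_product iota x.
Variables A B : gtree R G.
Hypotheses (HA : in_outer iota A) (HB : in_outer iota B).
Local Notation dA := (@mdist R A).
Local Notation dB := (@mdist R B).
Local Notation VA := (@vertices R A).
Local Notation VB := (@vertices R B).
Hypothesis edgeA : exists u v, adjq dA VA u v.
Hypothesis edgeB : exists u v, adjq dB VB u v.
Variable f : A -> B.
Hypothesis f_act : forall g u, f (act g u) = act g (f u).
Variable lam : R.
Hypothesis lam0 : 0 < lam.
Hypothesis f_lip : forall u v, dB (f u) (f v) <= lam * dA u v.
Let ZA := mdist_zh A.
Let ZB := mdist_zh B.
Let GA := mdist_geodesic (T := A).
Let GB := mdist_geodesic (T := B).
Let SA := @mdist_sep R G A.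
Let SB := @mdist_sep R G B.
Let IA := act_isom A.
Let IB := act_isom B.
Let DA := vertices_discrete A.

(** [y] divides the image segment in the ratio in which [z] divides the edge, with denominators
    cleared so that collapsed edges are included. *)
Definition stretched (u v z : A) (y : B) : Prop :=
  btw dB (f u) y (f v) /\ dB (f u) y * dA u v = dA u z * dB (f u) (f v).

Lemma stretchedC u v z y : btw dA u z v -> stretched u v z y -> stretched v u z y.
Proof.
rewrite /btw => h [h1 h2]; split; first exact: btwC.
have e1 : dB (f v) y = dB (f u) (f v) - dB (f u) y by rewrite h1 (zhC ZB (f v)); lra.
have e2 : dA v z = dA u v - dA u z by rewrite h (zhC ZA v); lra.
by rewrite e1 e2 (zhC ZA v) (zhC ZB (f v)) mulrBl h2; lra.
Qed.

Lemma stretched_ex u v z : adjq dA VA u v -> btw dA u z v -> exists y, stretched u v z y.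
Proof.
move=> uv h; have L := adjq_gt0 ZA SA uv.
have r0 : 0 <= dA u z / dA u v * dB (f u) (f v) <= dB (f u) (f v).
  apply/andP; split; first by rewrite !mulr_ge0 ?invr_ge0 // zh_ge0.
  rewrite ler_piMl ?(zh_ge0 ZB) // ler_pdivrMr // mul1r h; have := zh_ge0 ZA z v; lra.
have [y [h1 h2]] := GB r0; exists y; split; first by rewrite /btw h1 h2; lra.
by rewrite h1; field; rewrite gt_eqF.
Qed.

Lemma stretched_uniq u v z y y' : adjq dA VA u v -> stretched u v z y -> stretched u v z y' -> y = y'.
Proof.
move=> uv [h1 h2] [h3 h4]; have L := adjq_gt0 ZA SA uv.
apply/SB/(btw_eq ZB h1 h3); apply: (mulIf (lt0r_neq0 L)); by rewrite h2 h4.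
Qed.

Lemma stretched_end u v z y : adjq dA VA u v -> btw dA u z v -> VA z -> stretched u v z y -> y = f z.
Proof.
move=> uv h Vz st; have L := adjq_gt0 ZA SA uv; have [_ _ _ hv] := uv.
apply: (stretched_uniq uv st); case: (hv z Vz h) => ->; split.
- exact: btw_xx.
- by rewrite (zh0 ZA) (zh0 ZB) !mul0r.
- exact: btw_yy.
- by rewrite mulrC.
Qed.

Definition extension_rel z y : Prop := exists u v, [/\ adjq dA VA u v, btw dA u z v & stretched u v z y].

Lemma extension_rel_edge u v z y : adjq dA VA u v -> btw dA u z v -> extension_rel z y -> stretched u v z y.
Proof.
move=> uv h [u' [v' [uv' h' st]]].
have [Vz|nz] := pselect (VA z).
  have [y0 st0] := stretched_ex uv h.
  by rewrite (stretched_end uv' h' Vz st) -(stretched_end uv h Vz st0).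
have [[e1 e2]|[e1 e2]] := edge_meet uv uv' h h' nz; rewrite e1 e2 //.
exact: stretchedC.
Qed.

Lemma edge_through (z : A) : exists u v, adjq dA VA u v /\ btw dA u z v.
Proof.
have [Vz|//] := point_edge z; have [u [v [Vu Vv nuv _]]] := edgeA.
have [w Vw nw] : exists2 w, VA w & z <> w.
  by have [e|ne] := pselect (z = u); [exists v; rewrite ?e|exists u].
have [q [zq _]] := first_stepq ZA SA DA Vz Vw nw.
by exists z, q; split=> //; apply: btw_xx.
Qed.

Lemma extension_ex z : exists y, extension_rel z y.
Proof.
have [u [v [uv h]]] := edge_through z; have [y hy] := stretched_ex uv h.
by exists y, u, v.
Qed.

(** Only the values of [f] at vertices are kept: affine interpolation is constant or injective on
    each edge, which [f] itself need not be. *)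
Definition ext (z : A) : B := projT1 (cid (extension_ex z)).

Lemma ext_edge u v z : adjq dA VA u v -> btw dA u z v -> stretched u v z (ext z).
Proof. by move=> uv h; apply: (extension_rel_edge uv h); apply: (projT2 (cid (extension_ex z))). Qed.

Lemma ext_vertex z : VA z -> ext z = f z.
Proof.
by move=> Vz; have [u [v [uv h]]] := edge_through z; apply: (stretched_end uv h Vz); apply: ext_edge.
Qed.

Lemma ext_act g z : ext (act g z) = act g (ext z).
Proof.
have [u [v [uv h]]] := edge_through z; have [h1 h2] := ext_edge uv h.
have uv' := adjq_act IA (@vertex_inv _ _ A) g uv; have h' := btw_act IA g h.
apply: (stretched_uniq uv' (ext_edge uv' h')); split; rewrite !f_act; first exact: btw_act.
by rewrite !act_isometry.
Qed.

Lemma ext_affine u v z z' : adjq dA VA u v -> btw dA u z v -> btw dA u z' v ->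
  dB (ext z) (ext z') * dA u v = dA z z' * dB (f u) (f v).
Proof.
move=> uv; wlog le : z z' / dA u z <= dA u z'.
  move=> wl h h'; have [le|/ltW le] := leP (dA u z) (dA u z'); first exact: wl.
  by rewrite (zhC ZB) (zhC ZA z); apply: wl.
move=> h h'; have L := adjq_gt0 ZA SA uv.
have [h1 h2] := ext_edge uv h; have [h3 h4] := ext_edge uv h'.
have leB : dB (f u) (ext z) <= dB (f u) (ext z').
  rewrite -(ler_pM2r L) h2 h4; apply: ler_wpM2r => //; exact: zh_ge0.
have b1 := btw_between ZA h h' le; have b2 := btw_between ZB h1 h3 leB.
have -> : dB (ext z) (ext z') = dB (f u) (ext z') - dB (f u) (ext z) by rewrite b2; lra.
have -> : dA z z' = dA u z' - dA u z by rewrite b1; lra.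
by rewrite !mulrBl h2 h4.
Qed.

Lemma ext_lip u v z z' : adjq dA VA u v -> btw dA u z v -> btw dA u z' v ->
  dB (ext z) (ext z') <= lam * dA z z'.
Proof.
move=> uv h h'; have L := adjq_gt0 ZA SA uv; rewrite -(ler_pM2r L) (ext_affine uv h h').
rewrite mulrAC mulrC; apply: ler_wpM2r; [exact: zh_ge0|exact: f_lip].
Qed.

Lemma ext_onto u v y : adjq dA VA u v -> f u <> f v -> btw dB (f u) y (f v) ->
  exists2 z, btw dA u z v & ext z = y.
Proof.
move=> uv nf hy; have L := adjq_gt0 ZA SA uv; have L' := D_gt0 ZB SB nf.
have r0 : 0 <= dB (f u) y / dB (f u) (f v) * dA u v <= dA u v.
  apply/andP; split; first by rewrite !mulr_ge0 ?invr_ge0 // zh_ge0.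
  rewrite ler_piMl ?(zh_ge0 ZA) // ler_pdivrMr // mul1r hy; have := zh_ge0 ZB y (f v); lra.
have [z [h1 h2]] := GA r0; have hz : btw dA u z v by rewrite /btw h1 h2; lra.
exists z => //; apply: (stretched_uniq uv (ext_edge uv hz)); split=> //.
by rewrite h1; field; rewrite gt_eqF.
Qed.

Lemma ext_inj u v z z' : adjq dA VA u v -> f u <> f v -> btw dA u z v -> btw dA u z' v ->
  ext z = ext z' -> z = z'.
Proof.
move=> uv nf h h' e; have := ext_affine uv h h'; rewrite e (zh0 ZB) mul0r => /esym/eqP.
by rewrite mulf_eq0 (gt_eqF (D_gt0 ZB SB nf)) orbF => /eqP /SA.
Qed.

Lemma ext_collapsed u v z : adjq dA VA u v -> f u = f v -> btw dA u z v -> ext z = f u.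
Proof.
move=> uv e h; have [h1 _] := ext_edge uv h; apply/esym/SB; move: h1; rewrite /btw e (zh0 ZB).
have := zh_ge0 ZB (f v) (ext z); rewrite (zhC ZB (ext z)); lra.
Qed.

(** The target is subdivided at images of vertices, and the source at preimages of all vertices so
    obtained. Collapsed edges receive no new points, since a preimage there would be a whole
    edge. *)
Definition QB : set B := VB `|` [set f v | v in VA].
Definition QA : set A := VA `|` [set z | exists u v, [/\ adjq dA VA u v, btw dA u z v, f u <> f v & QB (ext z)]].

Lemma QB_inv g y : QB y -> QB (act g y).
Proof.
case=> [Vy|[v Vv <-]]; [left; exact: act_vertices|right; exists (act g v); last exact: f_act].
exact: act_vertices.
Qed.

Lemma QA_inv g z : QA z -> QA (act g z).
Proof.
case=> [Vz|[u [v [uv h nf Qz]]]]; [left; exact: act_vertices|right; exists (act g u), (act g v)].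
split; [exact: adjq_act IA (@vertex_inv _ _ A) _ _ _ uv|exact: btw_act| |by rewrite ext_act; apply: QB_inv].
by rewrite !f_act => e; apply: nf; apply: (a_inj IB e).
Qed.

Lemma ext_QB z : QA z -> QB (ext z).
Proof. by case=> [Vz|[u [v [_ _ _]]]//]; right; exists z => //; rewrite ext_vertex. Qed.

Lemma QB_discrete : discrete dB QB.
Proof.
have [v0 [_ [V0 _ _ _]]] := edgeB.
apply: discrete_union; first by exists v0.
have [n [r RP]] := outer_reps hG HA DA (fun z h => h) (@vertex_inv _ _ A).
have orbits v : VA v -> exists (i : 'I_n) (b : bool) g, v = act g (if b then (r i).1 else (r i).2).
  move=> Vv; have [u1 [v1 [Vu Vw nuv _]]] := edgeA.
  have [w Vw' nw] : exists2 w, VA w & v <> w.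
    by have [e|ne] := pselect (v = u1); [exists v1; rewrite ?e|exists u1].
  have [q [vq _]] := first_stepq ZA SA DA Vv Vw' nw.
  have [i [g [[e _]|[e _]]]] := er_cover RP vq; first by exists i, true, g.
  by exists i, false, g.
move=> u v uv.
pose y0 (s : 'I_n * bool) := f (if s.2 then (r s.1).1 else (r s.1).2).
(* Up to translation there are finitely many images of vertices, and an edge with trivial stabilizer
   contains at most one translate of a point that is not a vertex. *)
have : forall s, exists c, forall g, ~ VB (act g (y0 s)) -> btw dB u (act g (y0 s)) v -> act g (y0 s) = c.
  move=> s; have [[g [ng bg]]|n0] := pselect (exists g, ~ VB (act g (y0 s)) /\ btw dB u (act g (y0 s)) v); last first.
    by exists u => g ng bg; case: n0; exists g.
  exists (act g (y0 s)) => g' ng' bg'.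
  have bg2 := btw_act IB (g' * g^-1)%g bg; rewrite -actM mulgVK in bg2.
  have uv2 := adjq_act IB (@vertex_inv _ _ B) (g' * g^-1)%g uv.
  have e1 : (g' * g^-1)%g = 1%g.
    apply: (adjq_free (outer_free HB) (fun z h => h) uv); exact: edge_meet uv2 uv bg2 bg' ng'.
  by rewrite -[g']mulg1 -(mulVg g) mulgA e1 mul1g.
move/choice => [c hc].
apply: (sub_finite_set (B := [set w | VB w /\ btw dB u w v] `|` c @` setT)).
  move=> w [[t Vt <-] bw]; have [Vw|nw] := pselect (VB (f t)); first by left.
  have [i [b [g e]]] := orbits t Vt; right; exists (i, b) => //.
  by have := hc (i, b) g; rewrite /y0 /= -f_act -e => ->.
rewrite finite_setU; split; first exact: finite_vertices_btw.
exact: finite_image.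
Qed.

Lemma QA_discrete : discrete dA QA.
Proof.
have [v0 [_ [V0 _ _ _]]] := edgeA.
apply: discrete_union; first by exists v0.
move=> u v uv; have [e|nf] := pselect (f u = f v).
  apply: (sub_finite_set (B := [set w | VA w /\ btw dA u w v])); last exact: finite_vertices_btw.
  move=> z [[u' [v' [uv' h' nf _]]] h]; split=> //; apply: contrapT => nz.
  by have [[e1 e2]|[e1 e2]] := edge_meet uv uv' h h' nz; apply: nf; rewrite -e1 -e2.
have : forall y, exists c, forall z, btw dA u z v -> ext z = y -> z = c.
  move=> y; have [[z [hz ez]]|n0] := pselect (exists z, btw dA u z v /\ ext z = y); last first.
    by exists u => z hz ez; case: n0; exists z.
  by exists z => z' hz' ez'; apply: (ext_inj uv nf hz' hz); rewrite ez.
move/choice => [c hc].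
apply: (sub_finite_set (B := c @` [set y | QB y /\ btw dB (f u) y (f v)])).
  move=> z [[u' [v' [_ _ _ Qz]]] h]; exists (ext z); last by apply/esym/hc.
  by split=> //; have [] := ext_edge uv h.
by apply: finite_image; apply: disc_finite QB_discrete _ _.
Qed.

Lemma QA_V : VA `<=` QA. Proof. by move=> z h; left. Qed.
Lemma QB_V : VB `<=` QB. Proof. by move=> z h; left. Qed.

(** A small edge lies in one original edge, where the map is constant or injective. In the second
    case a point of [QB] strictly between the images would have a preimage in [QA] inside the small
    edge. *)
Lemma QA_edge u v : adjq dA QA u v -> dB (ext u) (ext v) <= lam * dA u v /\
  (ext u = ext v \/ adjq dB QB (ext u) (ext v)).
Proof.
move=> uv; have [s [t [st su tv suv]]] := sub_edge QA_discrete QA_V uv.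
split; first exact: ext_lip st su tv.
have [e|nf] := pselect (f s = f t); [left|right].
  by rewrite (ext_collapsed st e su) (ext_collapsed st e tv).
have [Qu Qv nuv huv] := uv.
split; [exact: ext_QB|exact: ext_QB| |].
  by move=> e; apply: nuv; apply: (ext_inj st nf su tv e).
move=> w Qw bw; have [b1 _] := ext_edge st su; have [b2 _] := ext_edge st tv.
have bw' : btw dB (f s) w (f t) := segment_convex ZB b1 b2 bw.
have [z hz ez] := ext_onto st nf bw'.
have [||e|e] := huv z; [by right; exists s, t; rewrite ez| |by left; rewrite -ez e|by right; rewrite -ez e].
have L := adjq_gt0 ZA SA st; have L' := D_gt0 ZB SB nf.
apply: (mulIf (lt0r_neq0 L')); rewrite mulrDl -!(ext_affine st) // -mulrDl.
by congr (_ * _); rewrite ez; apply: bw.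
Qed.

Hypothesis hGi : forall i : 'I_p, exists a : Gi i, a <> 1%g.

(** The common ground set of both wall systems. *)
Definition subdivided : choiceType := {z : A | `[< QA z >]}.
Local Notation W := subdivided.
Definition sub_pt z (Qz : QA z) : W := exist _ z (asboolT Qz).
Lemma sub_Q (w : W) : QA (val w). Proof. exact: asboolW (valP w). Qed.
Definition sub_act g (w : W) : W := sub_pt (QA_inv g (sub_Q w)).

Lemma sub_act1 w : sub_act 1%g w = w.
Proof. by apply: val_inj; rewrite /= act1. Qed.

Lemma sub_actM g h w : sub_act (g * h)%g w = sub_act g (sub_act h w).
Proof. by apply: val_inj; rewrite /= actM. Qed.

Definition sub_ext (w : W) : B := ext (val w).

Lemma sub_extA g w : sub_ext (sub_act g w) = act g (sub_ext w).
Proof. exact: ext_act. Qed.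

Lemma sub_extQ w : QB (sub_ext w).
Proof. by apply: ext_QB; apply: sub_Q. Qed.

Let freeA := adjq_free (outer_free HA) QA_V.
Let freeB := adjq_free (outer_free HB) QB_V.

(** The image of the subdivided source is invariant, so it meets both halves of the edge; an edge
    path between preimages of the two halves has a step that is mapped onto the edge. *)
Lemma ext_hits u v : adjq dB QB u v -> exists y z : W, sub_ext y = u /\ sub_ext z = v.
Proof.
move=> uv.
have [z0 Qz0] : exists z0, QA z0 by have [z0 [_ [V0 _ _ _]]] := edgeA; exists z0; left.
have Y0 : [set ext z | z in QA] !=set0 by exists (ext z0), z0.
have Yinv g y : [set ext z | z in QA] y -> [set ext z | z in QA] (act g y).
  by move=> [z Qz <-]; exists (act g z); [apply: QA_inv|rewrite ext_act].
have [_ [z Qz <-] hz] := half_translate HB uv Y0 Yinv.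
have [_ [z' Qz' <-] hz'] := half_translate HB (adjqC ZB uv) Y0 Yinv.
apply: contrapT => n.
apply: (half_not ZB SB uv hz).
apply: (chain_indq ZA SA QA_discrete (x := z') (P := fun w => half dB v u (ext w))) Qz => // q q' hq qq' _.
apply: contrapT => hq'; apply: n.
have [Qq Qq' _ _] := qq'.
have {}hq' : half dB u v (ext q') by have [|//] := half_or ZB GB SB QB_discrete uv (ext_QB Qq').
have [_ [e|adj]] := QA_edge qq'.
  by case: (half_not ZB SB uv hq'); rewrite -e.
have [e1 e2] := half_cross ZB SB uv (adjqC ZB adj) hq' hq.
by exists (sub_pt Qq), (sub_pt Qq'); rewrite /sub_ext /= e1 e2.
Qed.

(* Edge representatives of the subdivided tree, each one collapsed or mapped exactly onto
   a representative in the target. *)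
Lemma compatible_reps M (b : 'I_M -> B * B) : edge_reps dB QB (@act R G B) b ->
  exists n (r : 'I_n -> A * A), edge_reps dA QA (@act R G A) r /\
    forall i, ext (r i).1 = ext (r i).2 \/ exists m, ext (r i).1 = (b m).1 /\ ext (r i).2 = (b m).2.
Proof.
move=> BP; have [n [r RP]] := outer_reps hG HA QA_discrete QA_V QA_inv.
suff : forall i, exists gb : G * bool, let r' := if gb.2 then (act gb.1 (r i).2, act gb.1 (r i).1)
    else (act gb.1 (r i).1, act gb.1 (r i).2) in
    ext r'.1 = ext r'.2 \/ exists m, ext r'.1 = (b m).1 /\ ext r'.2 = (b m).2.
  move=> /choice[gb hgb]; exists n; eexists; split.
    exact: (reps_modify (fun i => (gb i).1) (fun i => (gb i).2) ZA IA QA_inv RP).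
  by move=> i; apply: hgb.
move=> i; have [_ [e|adj]] := QA_edge (er_adj RP i); first by exists (1%g, false); left; rewrite /= !act1.
have [m [g [[e1 e2]|[e1 e2]]]] := er_cover BP adj; [exists (g^-1%g, false)|exists (g^-1%g, true)];
right; exists m; rewrite /= !ext_act e1 e2 -!actM mulVg !act1; split=> //.
Qed.

Section Labels.
Variables (M n : nat) (b : 'I_M -> B * B) (r : 'I_n -> A * A) (N : nat) (s : 'I_N -> 'I_n) (lab : 'I_N -> 'I_M).
Hypothesis BP : edge_reps dB QB (@act R G B) b.
Hypothesis RP : edge_reps dA QA (@act R G A) r.
Hypothesis s_inj : injective s.
Hypothesis s_lab : forall j, ext (r (s j)).1 = (b (lab j)).1 /\ ext (r (s j)).2 = (b (lab j)).2.
Hypothesis s_onto : forall i, ext (r i).1 = ext (r i).2 \/ exists j, i = s j.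
Let HH := pull r (fun w : W => val w).
Let PP := pull b sub_ext.

Let hitsA i : exists y z : W, val y = (r i).1 /\ val z = (r i).2.
Proof. by have [Q1 Q2 _ _] := er_adj RP i; exists (sub_pt Q1), (sub_pt Q2). Qed.

(** A small edge is a translate of one representative. If it is collapsed, or its label or group
    element is a different one, both sides vanish; otherwise exactly one term jumps, in the same
    direction as [PP m]. *)
Lemma label_step m (y z : W) : adjq dA QA (val y) (val z) ->
  \sum_(j | lab j == m) (ind (HH (s j)) y - ind (HH (s j)) z) = ind (PP m) y - ind (PP m) z.
Proof.
have anti i g : forall y z : W, val y = act g (r i).1 -> val z = act g (r i).2 ->
    \sum_(j | lab j == m) (ind (HH (s j)) y - ind (HH (s j)) z) = ind (PP m) y - ind (PP m) z.
  move=> {}y {}z ey ez.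
  have adjyz : adjq dA QA (val y) (val z) by rewrite ey ez; apply: adjq_act IA QA_inv _ _ _ (er_adj RP i).
  have zero (K : set W) : (K y <-> K z) -> ind K y - ind K z = 0.
    by move=> h; rewrite /ind (asbool_equiv_eq h) subrr.
  have off j : ~ (s j = i /\ g = 1%g) -> ind (HH (s j)) y - ind (HH (s j)) z = 0.
    move=> nji; apply: zero; apply: contrapT => nh; apply: nji.
    have hsep : sepq dA (r (s j)).1 (r (s j)).2 (val y) (val z).
      rewrite /sepq; move: nh; rewrite /HH /pull /=; case: asboolP => h1; case: asboolP => h2 // nh; exfalso; apply: nh; tauto.
    have := (sepq_adj ZA GA SA QA_discrete (er_adj RP (s j)) adjyz).1 hsep; rewrite ey ez => h.
    have [|-> ->] := er_inj IA freeA RP (i := i) (j := s j) (g := g) (h := 1%g); last by [].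
    by rewrite !act1.
  have [e|[j0 ij]] := s_onto i.
    rewrite [LHS]big1; last first.
      move=> j _; apply: off => -[ji _]; have [e1 e2] := s_lab j.
      have [_ _ + _] := er_adj BP (lab j); apply; rewrite -e1 -e2 ji; exact: e.
    by rewrite zero // /PP /pull /sub_ext /= ey ez !ext_act e.
  have [l1 l2] := s_lab j0; rewrite -ij in l1 l2.
  have Fy : sub_ext y = act g (b (lab j0)).1 by rewrite /sub_ext ey ext_act l1.
  have Fz : sub_ext z = act g (b (lab j0)).2 by rewrite /sub_ext ez ext_act l2.
  have adjB : adjq dB QB (sub_ext y) (sub_ext z).
    by rewrite Fy Fz; apply: adjq_act IB QB_inv _ _ _ (er_adj BP (lab j0)).
  have offB : ~ (lab j0 = m /\ g = 1%g) -> ind (PP m) y - ind (PP m) z = 0.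
    move=> nm; apply: zero; apply: contrapT => nh; apply: nm.
    have hsep : sepq dB (b m).1 (b m).2 (sub_ext y) (sub_ext z).
      rewrite /sepq; move: nh; rewrite /PP /pull /=; case: asboolP => h1; case: asboolP => h2 // nh; exfalso; apply: nh; tauto.
    have := (sepq_adj ZB GB SB QB_discrete (er_adj BP m) adjB).1 hsep; rewrite Fy Fz => h.
    have [|-> ->] := er_inj IB freeB BP (i := lab j0) (j := m) (g := g) (h := 1%g); last by [].
    by rewrite !act1.
  have [[em eg]|nm] := pselect (lab j0 = m /\ g = 1%g); last first.
    rewrite offB // big1 // => j /eqP jm; apply: off => -[ji g1]; apply: nm; split=> //.
    by rewrite -jm; congr lab; apply: s_inj; rewrite ji.
  rewrite (bigD1 j0) ?em ?eqxx //= big1 ?addr0; last first.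
    move=> j /andP[_ /eqP jj]; apply: off => -[ji _]; apply: jj; apply: s_inj; rewrite ji; exact: ij.
  have e1 : HH (s j0) y <-> PP m y.
    rewrite /HH /PP /pull /= Fy ey eg !act1 -ij em; split=> h; exfalso.
      exact: (half_not ZA SA (adjqC ZA (er_adj RP i)) (half_r ZA _ _)) h.
    exact: (half_not ZB SB (adjqC ZB (er_adj BP m)) (half_r ZB _ _)) h.
  have e2 : HH (s j0) z <-> PP m z.
    by rewrite /HH /PP /pull /= Fz ez eg !act1 -ij em; split=> h; apply: half_r.
  by rewrite /ind (asbool_equiv_eq e1) (asbool_equiv_eq e2).
move=> yz; have [i [g [[e1 e2]|[e1 e2]]]] := er_cover RP yz; first exact: anti e1 e2.
have := anti i g z y e2 e1; move=> h; apply: oppr_inj; rewrite opprB -h -sumrN.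
by apply: eq_bigr => j _; rewrite opprB.
Qed.

Lemma label_sum m y z :
  \sum_(j | lab j == m) (ind (HH (s j)) y - ind (HH (s j)) z) = ind (PP m) y - ind (PP m) z.
Proof.
pose P t := forall w : W, val w = t -> \sum_(j | lab j == m) (ind (HH (s j)) y - ind (HH (s j)) w) = ind (PP m) y - ind (PP m) w.
suff : P (val z) by apply.
apply: (chain_indq ZA SA QA_discrete (x := val y) (P := P)); last exact: sub_Q.
- exact: sub_Q.
- by move=> w /val_inj ->; rewrite subrr big1 // => j _; rewrite subrr.
move=> q q' hq qq' _ w ew; have [Qq _ _ _] := qq'.
have h1 := hq (sub_pt Qq) erefl; have h2 := @label_step m (sub_pt Qq) w; rewrite /= ew in h2.
have {}h2 := h2 qq'; rewrite !sumrB in h1 h2 *; move: h1 h2.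
by move: (\sum_(j | _) _) (\sum_(j | _) _) (\sum_(j | _) _) => *; lia.
Qed.

Lemma label_state : fold_state sub_act PP lab (HH \o s) [set: 'I_N]%SET.
Proof.
have S := pull_sys HA QA_discrete QA_V QA_inv RP (a := sub_act) (fun g y => erefl) sub_Q hitsA.
split.
- by move=> y z i; exact: (sys_fin S y z (s i)).
- move=> [[g i] c] [[h j] c']; exact: (pull_nest QA_discrete QA_inv RP (a := sub_act) (fun g y => erefl) sub_Q (g, s i, c) (h, s j, c')).
- by move=> i; exists i; rewrite ?inE.
- move=> i _; have [y [z [_ _ h1 h2 u]]] := pull_wit HA QA_discrete QA_V QA_inv RP (a := sub_act) (fun g y => erefl) sub_Q hitsA (s i).
  exists y, z; split=> // -[[g j] c] _ hs; have [-> /s_inj ->] // := u (g, s j, c) hs.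
move=> m y z; rewrite -label_sum; apply: eq_bigl => j; by rewrite inE.
Qed.

End Labels.

(** On the first leg the weight of a wall shrinks from [lam] times the length of its edge to the
    length of the image, which is 0 for collapsed edges; the second leg folds the surviving
    walls. *)
Theorem stretch_conn (cA cB : R) : covolume A = cA%:E -> covolume B = cB%:E ->
  conn iota (fun g => lam * translation_length A g) (lam * cA) (translation_length B) cB.
Proof.
move=> covA covB.
have [M [b BP]] := outer_reps hG HB QB_discrete QB_V QB_inv.
have [n [r [RP comp]]] := compatible_reps BP.
have [v0 [_ [V0 _ _ _]]] := edgeA.
pose base := sub_pt (QA_V V0).
pose P := [pred i | ext (r i).1 != ext (r i).2].
pose s (j : 'I_#|P|) : 'I_n := enum_val j.
have s_inj : injective s by exact: enum_val_inj.
have /choice[lab hlab] : forall j, exists m, ext (r (s j)).1 = (b m).1 /\ ext (r (s j)).2 = (b m).2.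
  by move=> j; have [e|//] := comp (s j); have /eqP := enum_valP j.
have s_onto i : ext (r i).1 = ext (r i).2 \/ exists j, i = s j.
  have [e|ne] := eqVneq (ext (r i).1) (ext (r i).2); [left|right] => //.
  have iP : i \in P by [].
  by exists (enum_rank_in iP i); rewrite /s enum_rankK_in.
pose HH := pull r (fun w : W => val w); pose PP := pull b sub_ext.
pose omA i := lam * dA (r i).1 (r i).2; pose om1 i := dB (ext (r i).1) (ext (r i).2).
pose w m := dB (b m).1 (b m).2.
have omA0 i : 0 <= omA i by apply: mulr_ge0; [exact: ltW|exact: zh_ge0].
have om10 i : 0 <= om1 i by exact: zh_ge0.
have w0 m : 0 <= w m by exact: zh_ge0.
have hitsA i : exists y z : W, val y = (r i).1 /\ val z = (r i).2.
  by have [Q1 Q2 _ _] := er_adj RP i; exists (sub_pt Q1), (sub_pt Q2).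
have hitsB m : exists y z : W, sub_ext y = (b m).1 /\ sub_ext z = (b m).2 := ext_hits (er_adj BP m).
have valA g (y : W) : val (sub_act g y) = act g (val y) by [].
have S := pull_sys HA QA_discrete QA_V QA_inv RP valA sub_Q hitsA.
have slA : is_slope sub_act HH omA (fun g => lam * translation_length A g).
  exact: is_slope_scale lam (pull_slope HA QA_discrete QA_V QA_inv RP valA sub_Q).
have slB : is_slope sub_act PP w (translation_length B).
  exact: (pull_slope HB QB_discrete QB_V QB_inv BP sub_extA sub_extQ).
have [l1 sl1] := slope_ex base sub_act1 sub_actM S om10.
have z0 i : ~~ P i -> om1 i = 0 by rewrite negbK => /eqP e; rewrite /om1 e (zh0 ZB).
have omE : om1 \o s = fun j => if j \in [set: 'I_#|P|]%SET then w (lab j) else 0.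
  by apply/funext => j; rewrite inE /=; have [e1 e2] := hlab j; rewrite /om1 e1 e2.
have st := label_state BP RP s_inj hlab s_onto.
have sl1' : is_slope sub_act (HH \o s) (fun j => if j \in [set: 'I_#|P|]%SET then w (lab j) else 0) l1.
  by rewrite -omE => g y; have [C hC] := sl1 g y; exists C => m; rewrite (wdist_enum sub_act HH z0).
have om1A y z : wdist sub_act HH om1 y z <= wdist sub_act HH omA y z.
  by apply: ler_sum => i _; apply: ler_wpM2r => //; have [] := QA_edge (er_adj RP i).
have l1A := slope_le base slA sl1 om1A.
have Bl1 := slope_le base sl1' slB (fun y z => labels_wdist_le w0 y z st).
have ell g : translation_length B g = 0 <-> translation_length A g = 0.
  rewrite !translation_length0; split=> -[y hy]; [exact: elliptic_outer HB HA hy|exact: elliptic_outer HA HB hy].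
have ellA g : lam * translation_length A g = 0 <-> translation_length A g = 0.
  by split=> [/eqP|->]; rewrite ?mulr0 // mulf_eq0 gt_eqF //= => /eqP.
have l10 g : 0 <= l1 g := le_trans (translation_length_ge0 B g) (Bl1 g).
have ell1 g : l1 g = 0 <-> translation_length A g = 0.
  split=> e; first by apply/ell/eqP; rewrite eq_le translation_length_ge0 andbT -e Bl1.
  by apply/eqP; rewrite eq_le l10 andbT -((ellA g).2 e) l1A.
(* The shrinking leg changes weights only, so the same system is listed twice. *)
have C : wall_sys sub_act (cat_fam HH HH).
  have -> : cat_fam HH HH = HH \o cat_fam id id.
    by apply/funext => i; case: (split_ordP i) => j ->; rewrite /= ?cat_faml ?cat_famr.
  exact: wall_sys_comp S.
have c1 := conn_interpolation hG hGi HA edgeA base sub_act1 sub_actM C omA0 om10 slA sl1 l10 l1A ellA ell1.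
have Pex m : exists y z, PP m y /\ ~ PP m z.
  have [y [z [_ _ h1 h2 _]]] := pull_wit HB QB_discrete QB_V QB_inv BP sub_extA sub_extQ hitsB m.
  by exists z, y.
have Pnest := pull_nest QB_discrete QB_inv BP sub_extA sub_extQ.
have c2 := fold_conn hG hGi HA edgeA base sub_act1 sub_actM Pnest Pex w0 slB
  (translation_length_ge0 B) ell ellA st sl1' l1A.
have eA : lam * cA = essential_weight sub_act HH omA.
  rewrite (pull_weight HA QA_discrete QA_V QA_inv RP sub_act1 sub_actM valA sub_Q hitsA) -mulr_sumr.
  by move: covA; rewrite (reps_covolume HA QA_discrete QA_V QA_inv RP hG) => -[->].
have eB : cB = essential_weight sub_act PP w.
  rewrite (pull_weight HB QB_discrete QB_V QB_inv BP sub_act1 sub_actM sub_extA sub_extQ hitsB).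
  by move: covB; rewrite (reps_covolume HB QB_discrete QB_V QB_inv BP hG) => -[->].
rewrite eA eB; apply: conn_trans c1 _.
by rewrite -(essential_weight_enum sub_act HH z0) -/s omE.
Qed.

End AffineExtension.

(** * Geodesics *)

Section Comparison.
Variables (R : realType) (p k : nat) (Gi : 'I_p -> groupType) (G : groupType)
  (iota : forall i, {multiplicative Gi i -> G}) (x : 'I_k -> G).
Hypothesis hG : is_free_product iota x.

Lemma elliptic_iff (A B : gtree R G) g : in_outer iota A -> in_outer iota B ->
  translation_length A g = 0 <-> translation_length B g = 0.
Proof.
by move=> HA HB; rewrite !translation_length0; split=> -[y hy];
  [exact: elliptic_outer HA HB hy|exact: elliptic_outer HB HA hy].
Qed.

Lemma covolume_gt0 (T : gtree R G) : in_outer iota T ->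
  (exists u v, adjq (@mdist R T) (@vertices R T) u v) -> (0%:E < covolume T)%E.
Proof.
move=> HT [u [v uv]]; have H := mdist_zh T.
have [n [r RP]] := outer_reps hG HT (vertices_discrete T) (fun z h => h) (@vertex_inv _ _ T).
rewrite (covolume_reps RP); have [i _] := er_cover RP uv.
pose c j : R := mdist (r j).1 (r j).2.
have c0 j : 0 < c j := adjq_gt0 H (@mdist_sep R G T) (er_adj RP j).
rewrite -[X in (_ < X%:E)%E]/(\sum_(j < n) c j) lte_fin (bigD1 i) //=.
by apply: ltr_pwDl => //; apply: sumr_ge0 => j _; apply: ltW.
Qed.

Lemma edge_of_distinct (T : gtree R G) (u v : T) : u <> v ->
  exists s t, adjq (@mdist R T) (@vertices R T) s t.
Proof.
move=> nuv; have H := mdist_zh T.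
have [Vu|[s [t [st _]]]] := point_edge u; last by exists s, t.
have [Vv|[s [t [st _]]]] := point_edge v; last by exists s, t.
by have [q [uq _]] := first_stepq H (@mdist_sep R G T) (vertices_discrete T) Vu Vv nuv; exists u, q.
Qed.

Variables A B : gtree R G.
Hypotheses (HA : in_outer iota A) (HB : in_outer iota B).
Hypothesis edgeA : exists u v, adjq (@mdist R A) (@vertices R A) u v.
Local Notation dA := (@mdist R A).
Local Notation dB := (@mdist R B).

(** Each orbit representative is sent to a point fixed by its stabilizer, which exists because a
    nontrivial point stabilizer of one tree also fixes a point of the other. *)
Lemma equivariant_map : exists f : A -> B, forall g u, f (act g u) = act g (f u).
Proof.
have [a0 _] := edgeA; have [b0 _] : exists b : B, True.
  by have [[b _] _ _ _ _] := smt_tree B; exists b.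
pose rho (v : A) := xget a0 [set w | exists g, v = act g w].
have rhoP v : exists g, v = act g (rho v).
  by apply: (@xgetPex _ a0 [set w | exists g, v = act g w]); exists v, 1%g; rewrite act1.
have rho_act g v : rho (act g v) = rho v.
  congr xget; apply/seteqP; split=> w /= [h e].
    by exists (g^-1 * h)%g; rewrite actM -e -actM mulVg act1.
  by exists (g * h)%g; rewrite actM -e.
have /choice[y hy] : forall w : A, exists y : B, forall g, act g w = w -> act g y = y.
  move=> w; have [[g g1 gw]|n] := pselect (exists2 g, g <> 1%g & act g w = w); last first.
    exists b0 => g gw; have [->|/eqP g1] := eqVneq g 1%g; first by rewrite act1.
    by case: n; exists g.
  have [y gy] := elliptic_outer HA HB gw; exists y => h hw.
  exact: (stab_transfer (outer_free HA) (outer_free HB) (fun g0 => elliptic_iff g0 HA HB) g1 gw gy hw).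
have [h hh] := choice rhoP.
exists (fun v => act (h v) (y (rho v))) => g v; rewrite rho_act -actM.
have e : act ((g * h v)^-1 * h (act g v))%g (y (rho v)) = y (rho v).
  apply: hy; rewrite actM -[X in act _ (act _ X)](rho_act g) -hh.
  by rewrite {2}(hh v) -actM -actM -mulgA mulVg act1.
by rewrite -[in RHS]e -actM mulgA mulgV mul1g.
Qed.

(** An equivariant map is Lipschitz on vertices because there are finitely many edge orbits. This
    crude constant makes [Lambda_R] finite, which the construction of the optimal map
    presupposes. *)
Lemma length_bound : exists K, forall g, translation_length B g <= K * translation_length A g.
Proof.
have [f f_act] := equivariant_map.
have ZA := mdist_zh A; have ZB := mdist_zh B; have DA := vertices_discrete A.
have SA := @mdist_sep R G A.
have [n [r RP]] := outer_reps hG HA DA (fun z h => h) (@vertex_inv _ _ A).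
have r0 i : 0 < (dA (r i).1 (r i).2 : R) := adjq_gt0 ZA SA (er_adj RP i).
pose K : R := \sum_(i < n) dB (f (r i).1) (f (r i).2) / dA (r i).1 (r i).2.
have K0 : 0 <= K by apply: sumr_ge0 => i _; rewrite divr_ge0 ?zh_ge0.
have Ki i : dB (f (r i).1) (f (r i).2) <= K * dA (r i).1 (r i).2.
  rewrite -ler_pdivrMr // /K (bigD1 i) //= lerDl; apply: sumr_ge0 => j _.
  by rewrite divr_ge0 ?zh_ge0.
have step q q' : adjq dA (@vertices R A) q q' -> dB (f q) (f q') <= K * dA q q'.
  move=> /(er_cover RP)[i [g [[-> ->]|[-> ->]]]]; rewrite !f_act !act_isometry //.
  by rewrite (zhC ZB) (zhC ZA).
have [v [_ [Vv _ _ _]]] := edgeA.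
have lip w : vertices w -> dB (f v) (f w) <= K * dA v w.
  move=> Vw; apply: (chain_indq ZA SA DA (x := v) (P := fun w => dB (f v) (f w) <= K * dA v w)) Vw => //.
    by rewrite (zh0 ZB) (zh0 ZA) mulr0.
  move=> q q' hq qq' b; apply: le_trans (zh_tri ZB (f q) _ _) _.
  by rewrite b mulrDr; apply: lerD => //; apply: step.
exists K => g; have [C hC] := translation_length_asym g v; have [C' hC'] := translation_length_asym g (f v).
apply: (@bounded_slope R _ _ (K * C + C')) => m.
have := lip _ (act_vertices (g ^+ m)%g Vv); rewrite f_act.
have := hC m; have := hC' m; rewrite !ler_norml => /andP[h1 _] /andP[_ h2] h3.
have h4 : K * (dA v (act (g ^+ m)%g v) - m%:R * translation_length A g) <= K * C by apply: ler_wpM2l.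
by rewrite mulrBr in h4; rewrite mulrCA; lra.
Qed.

End Comparison.

Section Points.
Variables (R : realType) (p k : nat) (Gi : 'I_p -> groupType) (G : groupType)
  (iota : forall i, {multiplicative Gi i -> G}) (x : 'I_k -> G).
Hypothesis hG : is_free_product iota x.

Definition outer_point (T : gtree R G) (HT : in_outer iota T) : outer_space R iota :=
  OuterSpace (ex_intro _ T (conj HT erefl)).

Lemma rep_outer (X : outer_space R iota) : in_outer iota (rep X).
Proof. by have [] := projT2 (cid (iso_classP X)). Qed.

Lemma equiv_isometric_rep (T : gtree R G) (HT : in_outer iota T) :
  equiv_isometric T (rep (outer_point HT)).
Proof.
have [_ e] := projT2 (cid (iso_classP (outer_point HT))).
have /= -> := e; exists id; split=> // y; by exists y.
Qed.

Lemma outer_point_length (T : gtree R G) (HT : in_outer iota T) :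
  outer_length (outer_point HT) = translation_length T.
Proof. by apply/funext => g; apply/esym/equiv_isometric_translation/equiv_isometric_rep. Qed.

Lemma outer_point_covolume (T : gtree R G) (HT : in_outer iota T) :
  (0%:E < covolume T)%E -> covolume (rep (outer_point HT)) = covolume T.
Proof.
move=> T0; apply: (equiv_isometric_covolume hG HT (rep_outer _) (equiv_isometric_rep HT)) => //.
apply: (covolume_gt0 hG (rep_outer _)); have [u [v [_ _ nuv _]]] := outer_pos T0.
have [f [fD _ _]] := equiv_isometric_rep HT.
apply: (@edge_of_distinct _ _ _ (f u) (f v)) => e; apply: nuv.
by apply: (@mdist_sep R G T); rewrite -fD e (zh0 (mdist_zh _)).
Qed.

Lemma projective_edge (X : outer_space R iota) : in_projective_outer_space X ->
  exists u v, adjq (@mdist R (rep X)) (@vertices R (rep X)) u v.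
Proof. by move=> h; apply: outer_pos; rewrite h lte_fin. Qed.

(** Ellipticity is the same in all trees of outer space, so one representative decides a property
    that quantifies over all of them. *)
Lemma HypP (X : outer_space R iota) g : Hyp R iota g <-> 0 < outer_length X g.
Proof.
have nz : (translation_length (rep X) g <> 0) <-> 0 < outer_length X g.
  rewrite lt_neqAle translation_length_ge0 andbT eq_sym; split=> [/eqP//|/eqP//].
rewrite -nz; split=> [h /translation_length0[y]|n T HT y gy]; first exact: (h _ (rep_outer X)).
by apply/n/(elliptic_iff g (rep_outer X) HT)/translation_length0; exists y.
Qed.

End Points.

Section Stretch.
Variables (R : realType) (p k : nat) (Gi : 'I_p -> groupType) (G : groupType)
  (iota : forall i, {multiplicative Gi i -> G}) (x : 'I_k -> G).
Hypothesis hG : is_free_product iota x.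
Variables A B : outer_space R iota.
Hypotheses (hA : in_projective_outer_space A) (hB : in_projective_outer_space B).
Local Notation lA := (outer_length A).
Local Notation lB := (outer_length B).

Lemma Hyp_nonempty : exists g, Hyp R iota g.
Proof.
have [g hg] := hyperbolic_ex (rep_outer A) (projective_edge hA).
exists g; apply/(HypP A); rewrite lt_neqAle translation_length_ge0 andbT eq_sym; exact/eqP.
Qed.

(** The inequality passes from hyperbolic to all elements because elliptic ones have length 0 in
    both trees. *)
Lemma Lambda_fin : exists lam : R, [/\ 0 < lam, Lambda_R A B = lam%:E,
  forall g, lB g <= lam * lA g &
  forall c, (forall g, lB g <= c * lA g) -> lam <= c].
Proof.
have [K hK] := length_bound hG (rep_outer A) (rep_outer B) (projective_edge hA).
have [g0 h0] := Hyp_nonempty; have a0 := (HypP A g0).1 h0; have b0 := (HypP B g0).1 h0.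
have le g : Hyp R iota g -> ((lB g / lA g)%:E <= Lambda_R A B)%E.
  by move=> h; apply: ereal_sup_ubound; exists g.
have ub c : (forall g, lB g <= c * lA g) -> (Lambda_R A B <= c%:E)%E.
  move=> h; apply: ge_ereal_sup => _ [g hg <-]; rewrite lee_fin ler_pdivrMr ?h //.
  exact: (HypP A g).1.
have leK := ub K hK; have le0 := le g0 h0.
case E : (Lambda_R A B) le ub leK le0 => [lam| |] //= le ub _ le0.
exists lam; split=> //.
- by move: le0; rewrite lee_fin; apply: lt_le_trans; rewrite divr_gt0.
- move=> g; have [hg|ng] := pselect (Hyp R iota g).
    by have := le g hg; rewrite lee_fin ler_pdivrMr //; apply/(HypP A g).1.
  have z (X : outer_space R iota) : outer_length X g = 0.
    apply/eqP; rewrite eq_le translation_length_ge0 andbT leNgt; apply/negP => h.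
    by apply: ng; apply/(HypP X).
  by rewrite !z mulr0.
Qed.

End Stretch.

Lemma ptws_continuous (R : realType) (G : Type) (h : R -> {ptws G -> R}) :
  (forall g, continuous (fun t => h t g)) -> continuous h.
Proof.
move=> hc t; apply/cvg_sup => g; exact: (@continuous_comp_initial _ _ _ (fun F => F g) h (hc g)).
Qed.

Theorem theorem7p7 (R : realType) (p k : nat) (Gi : 'I_p -> groupType)
    (G : groupType) (iota : forall i : 'I_p, {multiplicative Gi i -> G})
    (x : 'I_k -> G) (hG : is_free_product iota x)
    (hGi : forall i : 'I_p, exists a : Gi i, a <> 1%g)
    (A B : outer_space R iota)
    (hA : in_projective_outer_space A) (hB : in_projective_outer_space B) :
  exists gamma : R -> outer_space R iota,
    [/\ is_d_R_geodesic gamma, gamma 0 = A & gamma 1 = B].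
Proof.
have [lam [lam0 _ lip least]] := Lambda_fin hG B hA.
pose lA := translation_length (rep A); pose lB := translation_length (rep B).
have edgeA := projective_edge hA; have edgeB := projective_edge hB.
have [f [f_act f_lip]] := optimal_map (rep_outer A) (rep_outer B) edgeA (ltW lam0) lip.
have [[L [V [[[cL cV] L0 V0 L1 V1] [mL real]]]]] :=
  stretch_conn hG (rep_outer A) (rep_outer B) edgeA edgeB f_act lam0 f_lip hGi hA hB.
rewrite mulr1 in V0.
have Vpos t : 0 <= t -> t <= 1 -> 0 < V t by move=> t0 t1; have [] := real t 1 t0 t1 ltr01.
(* Each intermediate tree is rescaled by the inverse of its covolume; outside [0,1] the value [A] is
   a placeholder. *)
have /choice[pt hpt] : forall t, exists X : outer_space R iota, 0 <= t <= 1 ->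
    in_projective_outer_space X /\ forall g, outer_length X g = L t g / V t.
  move=> t; have [/andP[t0 t1]|nt] := pselect (0 <= t <= 1); last by exists A => /nt.
  have Vt := Vpos t t0 t1.
  have Vt' : 0 < (V t)^-1 by rewrite invr_gt0.
  have [_ [T [HT lT cT]]] := real t (V t)^-1 t0 t1 Vt'.
  have cT1 : covolume T = 1%E by rewrite cT mulVf ?gt_eqF.
  exists (outer_point HT) => _; split.
    by rewrite /in_projective_outer_space (outer_point_covolume hG) cT1 ?lte_fin.
  by move=> g; rewrite outer_point_length lT mulrC.
(* The chosen points at 0 and 1 have the lengths of [A] and [B], but equality in [outer_space] is
   not deduced from lengths, so the ends are set by hand. *)
pose gamma t := if t == 0 then A else if t == 1 then B else pt t.
have hg t : 0 <= t <= 1 -> in_projective_outer_space (gamma t) /\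
    forall g, outer_length (gamma t) g = L t g / V t.
  move=> ht; rewrite /gamma; have [->|t0] := eqVneq t 0.
    by split=> // g; rewrite L0 V0 mulrAC divff ?mul1r // gt_eqF.
  have [->|t1] := eqVneq t 1; last exact: hpt.
  by split=> // g; rewrite L1 V1 divr1.
have dist r t : 0 <= r -> r <= t -> t <= 1 -> d_R (gamma r) (gamma t) = (ln (V r) - ln (V t))%:E.
  move=> r0 rt t1; have r1 := le_trans rt t1; have t0 := le_trans r0 rt.
  have [pr lr] := hg r (introT andP (conj r0 r1)); have [pt' lt] := hg t (introT andP (conj t0 t1)).
  have Vr := Vpos r r0 r1; have Vt := Vpos t t0 t1.
  have [mu [mu0 E lipm leastm]] := Lambda_fin hG (gamma t) pr.
  have mE : mu = V r / V t.
    apply/eqP; rewrite eq_le; apply/andP; split.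
      apply: leastm => g; rewrite lr lt.
      have -> : V r / V t * (L r g / V r) = L r g / V t by field; rewrite !gt_eqF.
      by rewrite ler_pM2r ?invr_gt0 //; apply: mL.
    (* Comparing [A] with [B] through the times [r] and [t] bounds all ratios by [lam] times
       [mu * V t / V r]; optimality of [lam] forces this factor to be at least 1. *)
    have : lam <= mu * V t / V r * lam.
      apply: least => g; have h1 : lB g <= L t g by have := mL t 1 g t0 t1 (lexx 1); rewrite L1.
      have h2 : L r g <= lam * lA g by have := mL 0 r g (lexx 0) r0 r1; rewrite L0.
      have h3 : L t g <= mu * V t / V r * L r g.
        have := lipm g; rewrite lr lt ler_pdivrMr //.
        by have -> : mu * (L r g / V r) * V t = mu * V t / V r * L r g by ring.
      apply: (le_trans h1 (le_trans h3 _)); rewrite -[leRHS]mulrA; apply: ler_wpM2l => //.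
      by rewrite divr_ge0 ?mulr_ge0 ?ltW.
    by rewrite -{1}[lam]mul1r ler_pM2r // ler_pdivlMr // mul1r ler_pdivrMr.
  by rewrite /d_R E lne_EFin // mE ln_div // posrE.
exists gamma; split; [split|by rewrite /gamma eqxx|].
(* Clamping the parameter extends the path of length functions continuously to the whole line
   without changing it on [0,1]. *)
- pose h (t : R) : {ptws G -> R} := fun g => L (clamp t) g / V (clamp t).
  have c01 (t : R) : 0 <= clamp t /\ clamp t <= 1.
    by rewrite /clamp le_max lexx ge_max ler01 ge_min lexx.
  apply: (@subspace_eq_continuous _ _ _ h).
    move=> t; rewrite inE /= in_itv /= => ht; have /andP[t0 t1] := ht.
    by apply/funext => g; rewrite /h clampE //; apply/esym; apply: (hg t ht).2.
  apply: continuous_subspaceT; apply: ptws_continuous => g t.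
  have cl := @clamp_continuous R t.
  apply: cvgM; first exact: (continuous_comp cl (cL g _)).
  apply: cvgV; last exact: (continuous_comp cl (cV _)).
  by rewrite gt_eqF //; apply: Vpos; have [] := c01 t.
- by move=> t /hg[].
- move=> r s t r0 rs st t1; have s0 := le_trans r0 rs; have s1 := le_trans st t1.
  by rewrite !dist ?(le_trans rs st) // -EFinD; congr (_%:E); ring.
- by rewrite /gamma oner_eq0 eqxx.
Qed.
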